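(* For $n\ge0$, the functions $g^{(n)}$ defined in the context are elements of $V\cap SK_{n+1}$. (1) For $n\ge1$ we have $$\mathscr{Z}^{\circledast_+n}(x)=\sum_{k=0}^nc^{[n]}_k\,g^{(k)}(x),$$ where for $1\le k\le n$ $$c^{[n]}_k=(-1)^{n-1}(\Delta\mathscr{Z})^{n-k}\frac{(k-1)!}{(n-1)!}\,s(n,k),$$ and for $k=0$, $c^{[0]}_0=1$ and $$c^{[n]}_0=(\Delta\mathscr{Z})^n\left\{\frac1{2^n}+\frac{(-1)^{n+1}}{n!}\sum_{m=1}^{n+1}\frac{s(n+1,m)}{m}\right\},\qquad n\ge1.$$ (2) For $n\ge0$, the inverse transformation is $$g^{(n)}(x)=\sum_{k=0}^nC^{[n]}_k\,\mathscr{Z}^{\circledast_+k}(x),$$ where for $1\le k\le n$ $$C^{[n]}_k=(-1)^{k-1}(\Delta\mathscr{Z})^{n-k}\frac{(k-1)!}{(n-1)!}\,S(n,k)=\frac{(-1)^{k-1}}{(n-1)!}(\Delta\mathscr{Z})^{n-k}\sum_{t=0}^{k-1}(-1)^t(k-t)^{n-1}\binom{k-1}{t},$$ and $$C^{[n]}_0=\frac{(\Delta\mathscr{Z})^n}{n!}\,2B_n(1-2^{n-1}),\qquad n\ge0.$$ Moreover, the sequence of normalized polynomials $p_n(x)=\sum_{k=1}^n(-1)^{k-1}\frac{(k-1)!}{(n-1)!}S(n,k)\,x^k$, $n\ge1$ (i.e. $\sum_{k=1}^nC^{[n]}_kx^k$ with $\Delta\mathscr{Z}$ replaced by $1$), has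 the generating function $$\sum_{n=1}^\infty p_n(x)\,y^{n-1}=\frac{x\exp(y)}{1-x+x\exp(y)}.$$
   Context: Fix $\tau\in\mathbb{C}$ with $\operatorname{Im}(\tau)>0$ and let $\Lambda=\mathbb{Z}+\tau\mathbb{Z}$. For a meromorphic function $f$ on $\mathbb{C}$ of period $1$ put $\Delta f(x)=f(x+\tau)-f(x)$. $SK_k$ is the set of meromorphic functions $f$ on $\mathbb{C}$ of period $1$, with all poles in $\Lambda$, such that $\Delta^kf=0$; $SK=\bigcup_{k\ge0}SK_k$. $V$ is the set of $f\in SK$ having at most simple poles. $\mathscr{Z}(x)=\zeta(x)-e_2x$, where $\zeta$ is the Weierstrass zeta function of $\Lambda$ and $e_2=\zeta(x+1)-\zeta(x)$ (a constant). Then $\mathscr{Z}\in SK$ and $\Delta\mathscr{Z}=-2\pi i$ is constant. Convolution: for meromorphic $1$-periodic functions $f,g$ on $\mathbb{C}$ with poles only in $\Lambda$, and for $0<\operatorname{Im}(x)<2\operatorname{Im}(\tau)$, define $(f\circledast_+ g)(x)=\oint_{\operatorname{Im}(z)=\operatorname{Im}(x)/2}f(x-z)g(z)\,dz$, where the integral runs over one real period, i.e. over $z=t+\tfrac{i}{2}\operatorname{Im}(x)$, $t\in[0,1]$. This has a unique analytic continuation to a meromorphic function on $\mathbb{C}$ of period $1$, also denoted $f\circledast_+ g$. On $SK$ this product is commutative and associative with values in $SK$. $f^{\circledast_+n}$ is the $n$-fold product, with the conventions $f^{\circledast_+0}=1$ and $f^{\circledast_+1}=f$. The functions $g^{(n)}$,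 $n\ge0$, are defined by the expansion in $y$ near $0$ of the Eisenstein–Kronecker function: $F(x,y)=\frac{\vartheta'(0)\,\vartheta(x+y)}{\vartheta(x)\,\vartheta(y)}=\frac1y\sum_{n\ge0}g^{(n)}(x)\,y^n$, where $\vartheta(x)=\sum_{n\in\mathbb{Z}}(-1)^ne^{\pi i\tau(n+1/2)^2}e^{2\pi i(n+1/2)x}$ is the odd Jacobi theta function (its normalization does not affect $F$). $s(n,k)$ are the signed Stirling numbers of the first kind, $x(x-1)\cdots(x-n+1)=\sum_ks(n,k)x^k$; $S(n,k)$ are the Stirling numbers of the second kind; $B_0=1$ and $B_n$ for $n\ge2$ is the $n$th Bernoulli number (the value of $B_1$ is immaterial, its coefficient being $0$). *)

(* Defs.v *)
From Stdlib Require Import Reals ZArith Arith Lia Lra ClassicalEpsilon.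
From Coquelicot Require Import Coquelicot.
Open Scope R_scope.
Open Scope C_scope.

Definition Cexp (z : C) : C :=
  ((exp (Re z) * cos (Im z))%R, (exp (Re z) * sin (Im z))%R).

(* Sum of a series of complex numbers; total, meaningful when it converges. *)
Definition CSeries (a : nat -> C) : C :=
  (Series (fun n => Re (a n)), Series (fun n => Im (a n))).

(* Sum over Z, grouping the indices k and -k-1.  All two-sided series below
   converge absolutely, so the grouping is immaterial. *)
Definition ZSeries (a : Z -> C) : C :=
  CSeries (fun k => a (Z.of_nat k) + a (- Z.of_nat k - 1)%Z).

(* A meromorphic function is represented by a total function C -> C whose
   values on a discrete closed set (poles, removable singularities) carry no
   information; equality of meromorphic functions is [mero_eq]. *)

Definition mero_eq (f g : C -> C) : Prop :=
  forall a : C, exists r : posreal, forall z : C,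
    0 < Cmod (z - a) < r -> f z = g z.

(* f has a Laurent expansion with terms of degree >= -m around a, that is,
   f has at a a pole of order at most m (no pole when m = 0). *)
Definition pole_order_le (m : nat) (f : C -> C) (a : C) : Prop :=
  exists (c : nat -> C) (r : posreal), forall z : C,
    0 < Cmod (z - a) < r ->
    @is_pseries C_AbsRing C_NormedModule c (z - a) ((z - a) ^ m * f z).

Definition meromorphic (f : C -> C) : Prop :=
  forall a : C, exists m : nat, pole_order_le m f a.

Definition period1 (f : C -> C) : Prop := mero_eq (fun x => f (x + 1)) f.

(* The value of an (essentially) constant meromorphic function. *)
Definition const_value (f : C -> C) : C :=
  epsilon (inhabits (RtoC 0)) (fun c => mero_eq f (fun _ => c)).

Definition in_lattice (tau x : C) : Prop :=
  exists m n : Z, x = RtoC (IZR m) + RtoC (IZR n) * tau.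

Definition Delta (tau : C) (f : C -> C) : C -> C :=
  fun x => f (x + tau) - f x.

Definition SK_ (tau : C) (k : nat) (f : C -> C) : Prop :=
  meromorphic f /\ period1 f /\
  (forall a : C, ~ in_lattice tau a -> pole_order_le 0 f a) /\
  mero_eq (Nat.iter k (Delta tau) f) (fun _ => 0).

Definition SK (tau : C) (f : C -> C) : Prop := exists k : nat, SK_ tau k f.

Definition V (tau : C) (f : C -> C) : Prop :=
  SK tau f /\ forall a : C, pole_order_le 1 f a.

Definition zeta (tau x : C) : C :=
  / x + ZSeries (fun n => ZSeries (fun m =>
    if (Z.eqb m 0 && Z.eqb n 0)%bool then 0
    else let w := RtoC (IZR m) + RtoC (IZR n) * tau in
         / (x - w) + / w + x / w ^ 2)).

Definition e2 (tau : C) : C :=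
  const_value (fun x => zeta tau (x + 1) - zeta tau x).

Definition Zfun (tau x : C) : C := zeta tau x - e2 tau * x.

Definition DeltaZ (tau : C) : C := const_value (Delta tau (Zfun tau)).

Definition conv_integral (f g : C -> C) (x : C) : C :=
  RInt (V := C_R_CompleteNormedModule)
    (fun t : R => let z : C := (t, (Im x / 2)%R) in f (x - z) * g z) 0 1.

Definition is_conv (tau : C) (f g h : C -> C) : Prop :=
  meromorphic h /\ period1 h /\
  forall x : C, (0 < Im x < 2 * Im tau)%R -> h x = conv_integral f g x.

(* The meromorphic continuation, unique up to [mero_eq]. *)
Definition conv (tau : C) (f g : C -> C) : C -> C :=
  epsilon (inhabits (fun _ => RtoC 0)) (is_conv tau f g).

Fixpoint conv_pow (tau : C) (f : C -> C) (n : nat) : C -> C :=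
  match n with
  | O => fun _ => 1
  | S O => f
  | S m => conv tau f (conv_pow tau f m)
  end.

Definition theta (tau x : C) : C :=
  ZSeries (fun n =>
    let nu := RtoC (IZR n + / 2)%R in
    RtoC (powerRZ (-1) n) * Cexp (RtoC PI * Ci * tau * nu ^ 2)
    * Cexp (2 * RtoC PI * Ci * nu * x)).

Definition EK (tau x y : C) : C :=
  C_derive (theta tau) 0 * theta tau (x + y) / (theta tau x * theta tau y).

Definition is_EK_expansion (tau x : C) (a : nat -> C) : Prop :=
  exists r : posreal, forall y : C, 0 < Cmod y < r ->
    exists s : C,
      @is_pseries C_AbsRing C_NormedModule a y s /\ EK tau x y = / y * s.

(* Meaningful for x outside the lattice. *)
Definition g (tau : C) (n : nat) (x : C) : C :=
  epsilon (inhabits (fun _ : nat => RtoC 0)) (is_EK_expansion tau x) n.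

Fixpoint falling (x : R) (n : nat) : R :=
  match n with
  | O => 1
  | S m => falling x m * (x - INR m)
  end.

Fixpoint stirling1 (n k : nat) : Z :=
  match n, k with
  | O, O => 1
  | O, S _ => 0
  | S m, O => - Z.of_nat m * stirling1 m O
  | S m, S j => stirling1 m j - Z.of_nat m * stirling1 m k
  end%Z.

Fixpoint stirling2 (n k : nat) : nat :=
  match n, k with
  | O, O => 1
  | O, S _ => 0
  | S m, O => 0
  | S m, S j => stirling2 m j + k * stirling2 m k
  end%nat.

Lemma stirling1_big (n : nat) : forall k, (n < k)%nat -> stirling1 n k = 0%Z.
Proof.
induction n as [|n IH]; intros [|k] Hk; try lia; [reflexivity|].
cbn [stirling1]; rewrite !IH by lia; ring.
Qed.

Lemma stirling2_big (n : nat) : forall k, (n < k)%nat -> stirling2 n k = 0%nat.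
Proof.
induction n as [|n IH]; intros [|k] Hk; try lia; [reflexivity|].
cbn [stirling2]; rewrite !IH by lia; lia.
Qed.

Lemma sum_f_R0_shift (u : nat -> R) (n : nat) :
  sum_f_R0 u (S n) = (u O + sum_f_R0 (fun k => u (S k)) n)%R.
Proof.
induction n as [|n IH]; [reflexivity|].
rewrite tech5, IH, tech5; ring.
Qed.

Lemma falling_stirling1 (x : R) (n : nat) :
  falling x n = sum_f_R0 (fun k => IZR (stirling1 n k) * x ^ k)%R n.
Proof.
induction n as [|n IH]; [simpl; ring|].
rewrite sum_f_R0_shift; cbn [falling]; rewrite IH.
rewrite (sum_eq (fun k => IZR (stirling1 (S n) (S k)) * x ^ S k)%R
  (fun k => IZR (stirling1 n k) * x ^ k * x -
  (IZR (stirling1 n (S k)) * x ^ S k * INR n))%R).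
2: { intros k _; change (stirling1 (S n) (S k))
       with (stirling1 n k - Z.of_nat n * stirling1 n (S k))%Z.
     rewrite minus_IZR, mult_IZR, <- INR_IZR_INZ; simpl; ring. }
rewrite minus_sum, <- !scal_sum.
assert (H := sum_f_R0_shift (fun k => IZR (stirling1 n k) * x ^ k)%R n).
rewrite tech5, (stirling1_big n (S n)) in H by lia.
assert (E : sum_f_R0 (fun k => IZR (stirling1 n (S k)) * x ^ S k)%R n =
  (sum_f_R0 (fun k => IZR (stirling1 n k) * x ^ k) n
   - IZR (stirling1 n 0))%R).
{ simpl (x ^ 0)%R in H; lra. }
rewrite E; change (stirling1 (S n) 0) with (- Z.of_nat n * stirling1 n 0)%Z.
rewrite mult_IZR, opp_IZR, <- INR_IZR_INZ; simpl; ring.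
Qed.

Lemma pow_stirling2 (x : R) (n : nat) :
  (x ^ n)%R = sum_f_R0 (fun k => INR (stirling2 n k) * falling x k)%R n.
Proof.
induction n as [|n IH]; [simpl; ring|].
rewrite sum_f_R0_shift.
change (x ^ S n)%R with (x * x ^ n)%R; rewrite IH.
rewrite (sum_eq (fun k => INR (stirling2 (S n) (S k)) * falling x (S k))%R
  (fun k => INR (stirling2 n k) * falling x k * (x - INR k) +
  (INR (S k) * INR (stirling2 n (S k)) * falling x (S k)))%R).
2: { intros k _; change (stirling2 (S n) (S k))
       with (stirling2 n k + S k * stirling2 n (S k))%nat.
     rewrite plus_INR, mult_INR; cbn [falling]; ring. }
rewrite sum_plus.
assert (H := sum_f_R0_shift
  (fun k => INR k * INR (stirling2 n k) * falling x k)%R n).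
rewrite tech5, (stirling2_big n (S n)) in H by lia.
simpl (INR 0) in H; rewrite Rmult_0_r in H.
replace (sum_f_R0 (fun k => INR (S k) * INR (stirling2 n (S k))
  * falling x (S k))%R n)
  with (sum_f_R0 (fun k => INR k * INR (stirling2 n k) * falling x k)%R n)
  by lra.
rewrite <- sum_plus, scal_sum; simpl (stirling2 (S n) 0); simpl (INR 0).
rewrite Rmult_0_l, Rplus_0_l; apply sum_eq; intros k _; ring.
Qed.

(* [bernoulli_upto n k] is the k-th Bernoulli number for k <= n. *)
Fixpoint bernoulli_upto (n : nat) : nat -> R :=
  match n with
  | O => fun _ => 1
  | S m => fun k =>
      if Nat.leb k m then bernoulli_upto m k
      else - / INR (m + 2)
           * sum_f_R0 (fun j => Binomial.C (m + 2) j * bernoulli_upto m j) m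
  end%R.

Definition bernoulli (n : nat) : R := bernoulli_upto n n.

Lemma bernoulli_upto_eq (n k : nat) :
  (k <= n)%nat -> bernoulli_upto n k = bernoulli k.
Proof.
induction n as [|n IH]; intros Hk; [now replace k with O by lia|].
destruct (Nat.eq_dec k (S n)) as [->|Hne]; [reflexivity|].
simpl; rewrite (proj2 (Nat.leb_le k n)) by lia; apply IH; lia.
Qed.

Lemma bernoulli_rec (n : nat) : (1 <= n)%nat ->
  sum_f_R0 (fun k => Binomial.C (n + 1) k * bernoulli k)%R n = 0%R.
Proof.
destruct n as [|n]; [lia|]; intros _.
rewrite tech5; replace (S n + 1)%nat with (n + 2)%nat by lia.
replace (bernoulli (S n)) with (- / INR (n + 2) *
  sum_f_R0 (fun j => Binomial.C (n + 2) j * bernoulli j) n)%R.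
2: { unfold bernoulli at 2; cbn [bernoulli_upto].
     rewrite (proj2 (Nat.leb_gt (S n) n)) by lia.
     f_equal; apply sum_eq; intros j Hj; now rewrite bernoulli_upto_eq. }
replace (Binomial.C (n + 2) (S n)) with (INR (n + 2)).
{ field; apply not_0_INR; lia. }
unfold Binomial.C; replace (n + 2 - S n)%nat with 1%nat by lia.
replace (n + 2)%nat with (S (S n)) by lia.
rewrite (fact_simpl (S n)), mult_INR; simpl (INR (fact 1)); field.
apply INR_fact_neq_0.
Qed.

(* In the transition coefficients, D stands for Delta Z. *)

Definition coef_c (D : C) (n k : nat) : C :=
  match k, n with
  | O, O => 1
  | O, S _ =>
      D ^ n * RtoC (/ 2 ^ n + (-1) ^ (n + 1) / INR (fact n)
        * sum_n_m (fun m => IZR (stirling1 (n + 1) m) / INR m) 1 (n + 1))%R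
  | S _, _ =>
      RtoC ((-1) ^ (n - 1))%R * D ^ (n - k)
      * RtoC (INR (fact (k - 1)) / INR (fact (n - 1))
              * IZR (stirling1 n k))%R
  end.

Definition coef_C (D : C) (n k : nat) : C :=
  match k with
  | O =>
      D ^ n / RtoC (INR (fact n))
      * RtoC (2 * bernoulli n * (1 - powerRZ 2 (Z.of_nat n - 1)))%R
  | S _ =>
      RtoC ((-1) ^ (k - 1))%R * D ^ (n - k)
      * RtoC (INR (fact (k - 1)) / INR (fact (n - 1))
              * INR (stirling2 n k))%R
  end.

Definition poly_p (n : nat) (x : C) : C :=
  sum_n_m (fun k =>
    RtoC ((-1) ^ (k - 1) * (INR (fact (k - 1)) / INR (fact (n - 1)))
          * INR (stirling2 n k))%R * x ^ k) 1 n.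

(* Main.v *)
Require Import Defs.
From Stdlib Require Import Reals ZArith Lia Lra List Permutation ClassicalEpsilon.
From mathcomp Require Import ssreflect.
From Coquelicot Require Import Coquelicot.
Import ListNotations.
Set Bullet Behavior "None".
Open Scope R_scope.
Open Scope C_scope.

(** Write [q(x) = exp (2 pi i x)] (below [qexp]).  The proof rests on one
    observation: in the strip [0 < Im x < Im tau] a function of period 1 is a
    Fourier series, and the convolution of two such functions is the series whose
    coefficients are the products of the coefficients ([conv_fourier]).  Both
    [Zfun tau] and the functions [g tau n] have explicit Fourier coefficients, and
    the transition formulas hold coefficient by coefficient.

    To find the coefficients, let [kap x = 1 / (1 - q(x))] and let [lam n] be
    [kap (x + n tau)] minus its limit at [n -> +oo] for [n >= 0].  For weights [c]
    the Lambert series [Lam c x = sum_n c n * lam n x] are meromorphic with at most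
    simple poles, all in the lattice.  Kronecker's formula ([kronecker_strip])
    identifies [EK tau x y] with [D0 * (kap y + Lam (n |-> q(n y)) x)], where
    [D0 = - 2 pi i].  It is proved by multiplying Laurent series: [theta * kap] is
    entire with coefficients the partial sums of those of theta, and the
    quasi-periodicity of theta turns the product of the series of [theta (x + y)]
    with a suitable series in [y] into [theta x] times the Lambert series.  The
    remaining constant is read off at [x = 0], and the nonvanishing of theta off the
    lattice is a consequence of the formula itself.
    Expanding in [y] gives [g tau n] as the Lambert series [ghat tau n] with weights
    [(2 pi i n)^j / j!], [j = n - 1] ([g_ghat]); this yields periodicity, the poles
    and, by comparing coefficients of [y] in [EK (x + tau) y = exp (D0 y) EK x y],
    the vanishing of iterated differences ([g_SK], [g_V]).

    The Weierstrass zeta function is summed by rows of the lattice.  Each row is a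
    difference of cotangents, by the partial fraction expansion obtained from
    Herglotz's trick ([cotangent_partial_fractions]), and the rows add up to
    [ghat tau 1 x] plus a linear term, which [e2] removes.  So [Zfun tau] is
    [g tau 1] ([Zfun_ghat]) and [DeltaZ tau = D0].

    Expanding every [kap] as a geometric series, the [m]-th Fourier coefficient of
    [g tau n] for [m <> 0] is [D0^n * p_n(u)] with [u = kap (m tau)]
    ([ghat_fourier]), because the generating function of the [p_n] is exactly
    [1 / (1 - Q exp (- y))] at [x = 1 / (1 - Q)] ([poly_gf], [poly_geom_pos]); the
    zeroth coefficient is a multiple of a Bernoulli number.  As [p_1(u) = u], the [n]-fold
    convolution power of [Zfun tau] has the coefficient [(D0 u)^n], and the formula
    for it says that [u^n] is the stated combination of [p_1(u), ..., p_n(u)].  That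
    is the inversion of Stirling numbers, together with an identity between
    Bernoulli and Stirling numbers at [m = 0] ([fourier_coef_pow]).  For [n >= 2]
    the coefficients decay fast enough for the convolution integral to be analytic
    for [0 < Im x < 2 Im tau]; the identity theorem and gluing show that the
    combination of the [g tau k] is the continuation that defines [conv]
    ([conv_continuation]).  Inverting the triangular system of coefficients
    ([rcoef_C_rcoef_c]) gives the second transition formula. *)

(** * Unconditional sums over arbitrary index types *)

Definition csum {I : Type} (a : I -> C) (l : list I) : C :=
  fold_right (fun i s => a i + s) 0 l.

Definition rsum {I : Type} (b : I -> R) (l : list I) : R :=
  fold_right (fun i s => (b i + s)%R) 0%R l.

(** Convergence along the net of finite sets of indices.  Unlike convergence of
    a series it does not see the order of the indices, so that reindexing and
    exchange of summations become statements about finite sets. *)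
Definition has_sum {I : Type} (a : I -> C) (s : C) : Prop :=
  forall eps : R, (0 < eps)%R -> exists l0 : list I,
    forall l, NoDup l -> incl l0 l -> (Cmod (csum a l - s) < eps)%R.

(** Absolute summability, with a bound that passes through estimates without
    the value of the sum. *)
Definition bsum {I : Type} (b : I -> R) (M : R) : Prop :=
  (forall i, (0 <= b i)%R) /\ forall l, NoDup l -> (rsum b l <= M)%R.

Lemma eq_dec_any {I : Type} (x y : I) : {x = y} + {x <> y}.
Proof. exact (excluded_middle_informative (x = y)). Qed.

Lemma csum_perm {I} (a : I -> C) l l' : Permutation l l' -> csum a l = csum a l'.
Proof. elim => //= [x m m' _ ->|x y m|m1 m2 m3 _ -> _ ->] //; ring. Qed.

Lemma rsum_perm {I} (a : I -> R) l l' : Permutation l l' -> rsum a l = rsum a l'.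
Proof. elim => //= [x m m' _ ->|x y m|m1 m2 m3 _ -> _ ->] //; ring. Qed.

Lemma csum_app {I} (a : I -> C) l l' : csum a (l ++ l') = csum a l + csum a l'.
Proof. elim: l => /= [|x l ->]; ring. Qed.

Lemma rsum_app {I} (a : I -> R) l l' : rsum a (l ++ l') = (rsum a l + rsum a l')%R.
Proof. elim: l => /= [|x l ->]; ring. Qed.

Lemma csum_ext {I} (a b : I -> C) l :
  (forall i, In i l -> a i = b i) -> csum a l = csum b l.
Proof.
elim: l => //= x l IH H; rewrite H; last by left.
by rewrite IH // => i Hi; apply: H; right.
Qed.

Lemma rsum_le {I} (a b : I -> R) l :
  (forall i, In i l -> (a i <= b i)%R) -> (rsum a l <= rsum b l)%R.
Proof.
elim: l => /= [|x l IH] H; first lra.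
have := H x (or_introl eq_refl).
have : (rsum a l <= rsum b l)%R by apply: IH => i Hi; apply: H; right.
lra.
Qed.

Lemma csum_map {I J} (f : I -> J) (a : J -> C) l : csum a (map f l) = csum (fun i => a (f i)) l.
Proof. by elim: l => //= x l ->. Qed.

Lemma rsum_map {I J} (f : I -> J) (a : J -> R) l : rsum a (map f l) = rsum (fun i => a (f i)) l.
Proof. by elim: l => //= x l ->. Qed.

Lemma Cmod_csum {I} (a : I -> C) l : (Cmod (csum a l) <= rsum (fun i => Cmod (a i)) l)%R.
Proof.
elim: l => /= [|x l IH]; first by rewrite Cmod_0; lra.
have := Cmod_triangle (a x) (csum a l); lra.
Qed.

Lemma csum_flat_map {I J} (a : I * J -> C) (K : I -> list J) L :
  csum a (flat_map (fun i => map (fun j => (i, j)) (K i)) L)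
  = csum (fun i => csum (fun j => a (i, j)) (K i)) L.
Proof. elim: L => //= x L IH; by rewrite csum_app csum_map IH. Qed.

Lemma split_incl {I} (l0 l : list I) : NoDup l0 -> NoDup l -> incl l0 l ->
  exists l1, NoDup l1 /\ Permutation l (l0 ++ l1).
Proof.
elim: l0 l => [|x l0 IH] l H0 H Hi; first by exists l.
have Hx : In x l by apply: Hi; left.
case: (in_split _ _ Hx) => u [v Ev]; subst l.
have Hp := Permutation_middle u v x.
have Huv : NoDup (x :: u ++ v) by apply: Permutation_NoDup H; apply: Permutation_sym.
inversion_clear Huv as [|? ? Hnx Huv']; inversion_clear H0 as [|? ? Hx0 Hl0].
case: (IH (u ++ v)) => //.
  move=> y Hy.
  have : In y (x :: u ++ v).
    apply: (Permutation_in _ (Permutation_sym Hp)); apply: Hi; by right.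
  case => // E; by subst y.
move=> l1 [N1 P1]; exists l1; split => //.
apply: Permutation_trans (Permutation_sym Hp) _ => /=; by apply: perm_skip.
Qed.

Lemma rsum_incl {I} (b : I -> R) l0 l : (forall i, (0 <= b i)%R) ->
  NoDup l0 -> NoDup l -> incl l0 l -> (rsum b l0 <= rsum b l)%R.
Proof.
move=> Hb H0 H Hi; case: (split_incl _ _ H0 H Hi) => l1 [_ Hp].
rewrite (rsum_perm _ _ _ Hp) rsum_app.
have : (0 <= rsum b l1)%R.
  elim: l1 {Hp} => /= [|x l1 IH]; first lra.
  have := Hb x; lra.
lra.
Qed.

Lemma join_list {I} (l1 l2 : list I) :
  exists l, NoDup l /\ incl l1 l /\ incl l2 l.
Proof.
exists (nodup eq_dec_any (l1 ++ l2)); split; first exact: NoDup_nodup.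
by split => x Hx; apply/nodup_In/in_or_app; [left|right].
Qed.

Lemma has_sum_unique {I} (a : I -> C) s s' : has_sum a s -> has_sum a s' -> s = s'.
Proof.
move=> H H'; case: (Req_dec (Cmod (s - s')) 0) => [E|E].
  have := Cmod_eq_0 _ E => E2.
  by replace s with (s - s' + s'); [rewrite E2|]; ring.
have P : (0 < Cmod (s - s') / 2)%R by have := Cmod_ge_0 (s - s'); lra.
case: (H _ P) => l0 H0; case: (H' _ P) => l1 H1.
case: (join_list l0 l1) => l [Hn [Hl0 Hl1]].
have A0 := H0 l Hn Hl0; have A1 := H1 l Hn Hl1.
have := Cmod_triangle (- (csum a l - s)) (csum a l - s').
rewrite Cmod_opp; replace (- (csum a l - s) + (csum a l - s')) with (s - s') by ring.
lra.
Qed.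

Lemma has_sum_ext {I} (a b : I -> C) s : (forall i, a i = b i) -> has_sum a s -> has_sum b s.
Proof.
move=> E H eps He; case: (H eps He) => l0 H0; exists l0 => l Hn Hi.
rewrite -(csum_ext a b) //; exact: H0.
Qed.

Lemma has_sum_plus {I} (a b : I -> C) s t :
  has_sum a s -> has_sum b t -> has_sum (fun i => a i + b i) (s + t).
Proof.
move=> Ha Hb eps He.
have P : (0 < eps / 2)%R by lra.
case: (Ha _ P) => l0 H0; case: (Hb _ P) => l1 H1.
exists (l0 ++ l1) => l Hn Hi.
have A0 := H0 l Hn (fun x Hx => Hi x (in_or_app _ _ _ (or_introl Hx))).
have A1 := H1 l Hn (fun x Hx => Hi x (in_or_app _ _ _ (or_intror Hx))).
have E : csum (fun i => a i + b i) l = csum a l + csum b l.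
  elim: l {Hn Hi A0 A1} => /= [|x l ->]; ring.
rewrite E; have := Cmod_triangle (csum a l - s) (csum b l - t).
replace (csum a l - s + (csum b l - t)) with (csum a l + csum b l - (s + t)) by ring.
lra.
Qed.

Lemma has_sum_scal {I} (k : C) (a : I -> C) s :
  has_sum a s -> has_sum (fun i => k * a i) (k * s).
Proof.
move=> Ha eps He.
have Hk := Cmod_ge_0 k.
have P : (0 < eps / (Cmod k + 1))%R by apply: Rdiv_lt_0_compat; lra.
case: (Ha _ P) => l0 H0; exists l0 => l Hn Hi.
have E : csum (fun i => k * a i) l = k * csum a l.
  elim: l {Hn Hi} => /= [|x l ->]; ring.
rewrite E; replace (k * csum a l - k * s) with (k * (csum a l - s)) by ring.
rewrite Cmod_mult.
have A := H0 l Hn Hi; have B := Cmod_ge_0 (csum a l - s).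
apply: Rle_lt_trans (_ : ((Cmod k + 1) * Cmod (csum a l - s) < _)%R).
  nra.
apply: Rlt_le_trans (_ : (_ < (Cmod k + 1) * (eps / (Cmod k + 1)))%R) _.
  apply: Rmult_lt_compat_l; lra.
right; field; lra.
Qed.

Lemma has_sum_scal_r {I} (k : C) (a : I -> C) s :
  has_sum a s -> has_sum (fun i => a i * k) (s * k).
Proof.
move=> H; rewrite Cmult_comm; apply: has_sum_ext (has_sum_scal k _ _ H) => i; ring.
Qed.

Lemma has_sum_opp {I} (a : I -> C) s : has_sum a s -> has_sum (fun i => - a i) (- s).
Proof.
move=> H; replace (- s) with (-1 * s) by ring.
apply: has_sum_ext (has_sum_scal _ _ _ H) => i; ring.
Qed.

Lemma has_sum_minus {I} (a b : I -> C) s t :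
  has_sum a s -> has_sum b t -> has_sum (fun i => a i - b i) (s - t).
Proof. move=> Ha Hb; exact: (has_sum_plus _ _ _ _ Ha (has_sum_opp _ _ Hb)). Qed.

Lemma has_sum_zero {I} : has_sum (fun _ : I => 0) 0.
Proof.
move=> eps He; exists nil => l _ _.
have -> : csum (fun _ : I => 0) l = 0 by elim: l => //= x l ->; ring.
by replace (0 - 0) with (RtoC 0) by ring; rewrite Cmod_0.
Qed.

Lemma has_sum_single {I} (i0 : I) (a : I -> C) :
  (forall i, i <> i0 -> a i = 0) -> has_sum a (a i0).
Proof.
move=> H eps He; exists [i0] => l Hn Hi.
have Hs : NoDup [i0] by constructor => //; constructor.
case: (split_incl _ _ Hs Hn Hi) => l1 [_ Hp].
have : ~ In i0 l1.
  have := Permutation_NoDup Hp Hn => /=; by inversion_clear 1.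
rewrite (csum_perm _ _ _ Hp) /= => Hni.
have -> : csum a l1 = 0.
  rewrite (csum_ext a (fun _ => 0)).
    by elim: (l1) => //= x l' ->; ring.
  move=> i Hi1; apply: H => E; by subst i.
replace (a i0 + 0 - a i0) with (RtoC 0) by ring; by rewrite Cmod_0.
Qed.

Lemma has_sum_bound {I} (a : I -> C) (b : I -> R) s M :
  (forall i, (Cmod (a i) <= b i)%R) -> bsum b M -> has_sum a s -> (Cmod s <= M)%R.
Proof.
move=> Hab [Hb HM] H; apply: Rnot_lt_le => Hlt.
have P : (0 < Cmod s - M)%R by lra.
case: (H _ P) => l0 H0; case: (join_list l0 nil) => l [Hn [Hi _]].
have A := H0 l Hn Hi; have B := HM l Hn; have D := Cmod_csum a l.
have E : (rsum (fun i => Cmod (a i)) l <= rsum b l)%R by apply: rsum_le.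
have := Cmod_triangle (csum a l) (- (csum a l - s)).
rewrite Cmod_opp; replace (csum a l + - (csum a l - s)) with s by ring.
lra.
Qed.

Lemma bsum_le {I} (b c : I -> R) M :
  (forall i, (0 <= b i <= c i)%R) -> bsum c M -> bsum b M.
Proof.
move=> H [_ HM]; split => [i|l Hl]; first by case: (H i).
apply: Rle_trans (HM l Hl); apply: rsum_le => i _; by case: (H i).
Qed.

Lemma bsum_mono {I} (b : I -> R) M M' : (M <= M')%R -> bsum b M -> bsum b M'.
Proof. move=> H [Hb HM]; split => // l /HM; lra. Qed.

Lemma bsum_ge0 {I} (b : I -> R) M : bsum b M -> (0 <= M)%R.
Proof. by case=> _ /(_ nil (NoDup_nil _)). Qed.

Lemma bsum_term {I} (b : I -> R) M i : bsum b M -> (b i <= M)%R.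
Proof.
move=> [Hb HM].
have := HM [i] ltac:(constructor => //; constructor) => /=; lra.
Qed.

Lemma bsum_scal {I} (k : R) (b : I -> R) M : (0 <= k)%R ->
  bsum b M -> bsum (fun i => (k * b i)%R) (k * M).
Proof.
move=> Hk [Hb HM]; split => [i|l Hl]; first by apply: Rmult_le_pos.
have -> : rsum (fun i => (k * b i)%R) l = (k * rsum b l)%R.
  elim: l {Hl} => /= [|x l ->]; ring.
apply: Rmult_le_compat_l => //; exact: HM.
Qed.

Lemma bsum_plus {I} (b c : I -> R) M N :
  bsum b M -> bsum c N -> bsum (fun i => (b i + c i)%R) (M + N).
Proof.
move=> [Hb HM] [Hc HN]; split => [i|l Hl]; first by have := Hb i; have := Hc i; lra.
have -> : rsum (fun i => (b i + c i)%R) l = (rsum b l + rsum c l)%R.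
  elim: l {Hl} => /= [|x l ->]; ring.
have := HM l Hl; have := HN l Hl; lra.
Qed.

Lemma bsum_inj {I J} (f : I -> J) (b : J -> R) M :
  (forall x y, f x = f y -> x = y) -> bsum b M -> bsum (fun i => b (f i)) M.
Proof.
move=> Hf [Hb HM]; split => // l Hl; rewrite -rsum_map; apply: HM.
exact: FinFun.Injective_map_NoDup Hl.
Qed.

(** Sort the pairs of a finite list by their first components. *)
Lemma bsum_pairs {I J} (b : I * J -> R) (N : I -> R) M :
  (forall i, bsum (fun j => b (i, j)) (N i)) -> bsum N M -> bsum b M.
Proof.
move=> Hrow [HN HM]; split => [[i j]|l Hl]; first by case: (Hrow i).
suff G : forall L, forall l, NoDup l -> (forall p, In p l -> In (fst p) L) ->
    (rsum b l <= rsum N L)%R.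
  set L := nodup eq_dec_any (map fst l).
  apply: Rle_trans (G L l Hl _) (HM L (NoDup_nodup _ _)).
  move=> p Hp; apply/nodup_In; exact: in_map.
move=> {l Hl}; elim => [|i L IH] l Hl Hin.
  have -> : l = nil by case: l Hl Hin => // p l _ /(_ p (or_introl eq_refl)).
  simpl; lra.
set t := fun p : I * J => match eq_dec_any (fst p) i with left _ => true | right _ => false end.
have Hs : (rsum b l = rsum b (filter t l) + rsum b (filter (fun p => negb (t p)) l))%R.
  elim: (l) => /= [|p l' ->]; first ring.
  case: (t p) => /=; ring.
rewrite Hs /=; apply: Rplus_le_compat.
  have E : filter t l = map (fun j => (i, j)) (map snd (filter t l)).
    have : forall p, In p (filter t l) -> fst p = i.
      by move=> p /filter_In [_]; rewrite /t; case: eq_dec_any.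
    elim: (filter t l) => //= [[i' j]] m IHm Hm; rewrite -IHm.
      by rewrite -(Hm (i', j)) //; left.
    by move=> p Hp; apply: Hm; right.
  rewrite E rsum_map; apply: (proj2 (Hrow i)).
  have : NoDup (filter t l) by apply: NoDup_filter.
  rewrite {1}E; exact: NoDup_map_inv.
apply: IH; first exact: NoDup_filter.
move=> p /filter_In [Hp]; rewrite /t; case: eq_dec_any => // Hne _.
by case: (Hin p Hp) => // E; case: Hne.
Qed.

Lemma bsum_prod {I J} (b : I -> R) (c : J -> R) M N :
  bsum b M -> bsum c N -> bsum (fun p => (b (fst p) * c (snd p))%R) (M * N).
Proof.
move=> Hb Hc; apply: (bsum_pairs _ (fun i => (b i * N)%R)).
  move=> i /=; apply: bsum_scal => //; by case: Hb.
rewrite Rmult_comm; apply: bsum_le (bsum_scal N _ _ (bsum_ge0 _ _ Hc) Hb) => i.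
have := bsum_ge0 _ _ Hc; have := proj1 Hb i; nra.
Qed.

(** An unconditional sum of nonnegative reals is the supremum of its finite
    partial sums; the general case follows by writing a complex family as a
    combination of nonnegative ones. *)
Lemma has_sum_nonneg {I} (b : I -> R) M : bsum b M -> exists s, has_sum (fun i => RtoC (b i)) s.
Proof.
move=> [Hb HM].
case: (completeness (fun x => exists l, NoDup l /\ x = rsum b l)).
- exists M => x [l [Hl ->]]; exact: HM.
- exists 0%R, nil; split => //; constructor.
- move=> S [HS1 HS2]; exists (RtoC S) => eps He.
  have [l0 [Hn0 Hl0]] : exists l0, NoDup l0 /\ (S - eps < rsum b l0)%R.
    apply: NNPP => Hno.
    have : (S <= S - eps)%R; last lra.
    apply: HS2 => x [l [Hl ->]]; apply: Rnot_lt_le => Hlt.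
    by apply: Hno; exists l.
  exists l0 => l Hn Hi.
  have -> : csum (fun i => RtoC (b i)) l = RtoC (rsum b l).
    elim: l {Hn Hi} => //= x l ->; by rewrite RtoC_plus.
  rewrite -RtoC_minus Cmod_R.
  have A := rsum_incl b l0 l Hb Hn0 Hn Hi.
  have B : (rsum b l <= S)%R by apply: HS1; exists l.
  rewrite Rabs_left1; lra.
Qed.

Lemma has_sum_exists {I} (a : I -> C) (b : I -> R) M :
  (forall i, (Cmod (a i) <= b i)%R) -> bsum b M -> exists s, has_sum a s.
Proof.
move=> Hab HM.
have Hre : forall i, (Rabs (Re (a i)) <= b i)%R.
  move=> i; exact: Rle_trans (re_le_Cmod _) (Hab i).
have Him : forall i, (Rabs (Im (a i)) <= b i)%R.
  move=> i; apply: Rle_trans (Hab i); apply: Rle_trans (Rmax_Cmod _).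
  exact: Rmax_r.
have [s0 H0] := has_sum_nonneg _ _ HM.
have HM2 := bsum_plus _ _ _ _ HM HM.
have [s1 H1] : exists s, has_sum (fun i => RtoC (b i + Re (a i))) s.
  apply: has_sum_nonneg; apply: bsum_le HM2 => i.
  have := Hre i; have := Rle_abs (Re (a i)); have := Rle_abs (- Re (a i)).
  rewrite Rabs_Ropp; lra.
have [s2 H2] : exists s, has_sum (fun i => RtoC (b i + Im (a i))) s.
  apply: has_sum_nonneg; apply: bsum_le HM2 => i.
  have := Him i; have := Rle_abs (Im (a i)); have := Rle_abs (- Im (a i)).
  rewrite Rabs_Ropp; lra.
exists ((s1 - s0) + Ci * (s2 - s0)).
have H3 := has_sum_plus _ _ _ _ (has_sum_minus _ _ _ _ H1 H0)
  (has_sum_scal Ci _ _ (has_sum_minus _ _ _ _ H2 H0)).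
apply: has_sum_ext H3 => i.
by case: (a i) => x y; apply: injective_projections => /=; ring.
Qed.

(** Over a large finite set of rows, replace each row sum by a finite partial
    sum, sharing the error evenly among the rows; together these are one large
    partial sum of [a]. *)
Lemma has_sum_pairs {I J} (a : I * J -> C) (r : I -> C) s :
  has_sum a s -> (forall i, has_sum (fun j => a (i, j)) (r i)) -> has_sum r s.
Proof.
move=> Ha Hr eps He.
case: (Ha (eps / 2)%R ltac:(lra)) => l0 H0.
exists (map fst l0) => L HL Hi.
set d := (eps / 2 / (INR (length L) + 1))%R.
have Hlen := pos_INR (length L).
have Hd : (0 < d)%R by apply: Rdiv_lt_0_compat; lra.
have HK : forall i, exists K : list J, NoDup K /\ (forall j, In (i, j) l0 -> In j K) /\
    (Cmod (csum (fun j => a (i, j)) K - r i) < d)%R.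
  move=> i; case: (Hr i d Hd) => K0 HK0.
  case: (join_list K0 (map snd l0)) => K [Hn [Hi1 Hi2]]; exists K; split => //.
  split; last exact: HK0.
  move=> j Hj; apply: Hi2; exact: (in_map snd _ _ Hj).
have [K HKK] : exists K : I -> list J, forall i, NoDup (K i) /\
    (forall j, In (i, j) l0 -> In j (K i)) /\
    (Cmod (csum (fun j => a (i, j)) (K i) - r i) < d)%R.
  exists (fun i => proj1_sig (constructive_indefinite_description _ (HK i))) => i.
  exact: proj2_sig (constructive_indefinite_description _ (HK i)).
set l := flat_map (fun i => map (fun j => (i, j)) (K i)) L.
have Hl : NoDup l.
  rewrite /l; elim: L HL {Hi d Hlen Hd HK HKK l} (fun i => proj1 (HKK i)) => [|i L IH] HL HKn /=.
    constructor.
  inversion_clear HL as [|? ? Hni HL'].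
  apply: NoDup_app; last first.
  - move=> p /in_map_iff [j [<- _]] /in_flat_map [i' [Hi' /in_map_iff [j' [E _]]]].
    by case: E => E _; subst i'.
  - exact: IH.
  - apply: FinFun.Injective_map_NoDup (HKn i).
    by move=> j j' [].
have Hil : incl l0 l.
  move=> [i j] Hij; apply/in_flat_map; exists i; split.
    apply: Hi; exact: (in_map fst _ _ Hij).
  apply/in_map_iff; exists j; split => //; by apply: (proj1 (proj2 (HKK i))).
have A := H0 l Hl Hil; move: A; rewrite /l csum_flat_map => A.
have B : forall L', (Cmod (csum r L' - csum (fun i => csum (fun j => a (i, j)) (K i)) L')
    <= INR (length L') * d)%R.
  elim => [|i L' IH].
    by rewrite /= Rmult_0_l; replace (0 - 0) with (RtoC 0) by ring; rewrite Cmod_0; lra.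
  have -> : INR (length (i :: L')) = (INR (length L') + 1)%R by rewrite -S_INR.
  simpl csum.
  have := Cmod_triangle (- (csum (fun j => a (i, j)) (K i) - r i))
   (csum r L' - csum (fun i => csum (fun j => a (i, j)) (K i)) L').
  rewrite Cmod_opp; have := proj2 (proj2 (HKK i)).
  set u := csum _ (K i); set v := csum _ L'; set w := csum _ L'.
  replace (r i + v - (u + w)) with (- (u - r i) + (v - w)) by ring.
  move: IH; fold v w; lra.
have E : (INR (length L) * d <= eps / 2)%R.
  apply: Rle_trans (_ : ((INR (length L) + 1) * d <= _)%R); first nra.
  right; rewrite /d; field; lra.
have F := B L; set w := csum (fun i => csum _ (K i)) L in A F.
have := Cmod_triangle (csum r L - w) (w - s).
replace (csum r L - w + (w - s)) with (csum r L - s) by ring.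
lra.
Qed.

Lemma has_sum_reindex {I J} (f : I -> J) (g : J -> I) (a : J -> C) s :
  (forall i, g (f i) = i) -> (forall j, f (g j) = j) ->
  has_sum (fun i => a (f i)) s -> has_sum a s.
Proof.
move=> gf fg H eps He; case: (H eps He) => l0 H0; exists (map f l0) => l Hn Hi.
have -> : l = map f (map g l).
  rewrite map_map -{1}(map_id l); apply: map_ext => j; by rewrite fg.
rewrite csum_map; apply: H0.
  apply: FinFun.Injective_map_NoDup Hn => x y E; by rewrite -(fg x) -(fg y) E.
move=> i Hi0; rewrite -(gf i); apply: in_map; apply: Hi; exact: in_map.
Qed.

Lemma has_sum_swap {I J} (a : I -> J -> C) s :
  has_sum (fun p => a (fst p) (snd p)) s -> has_sum (fun p : J * I => a (snd p) (fst p)) s.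
Proof.
move=> H; apply: (has_sum_reindex (fun p : I * J => (snd p, fst p))
  (fun p : J * I => (snd p, fst p))); [by case|by case|exact: H].
Qed.

Lemma has_sum_prod {I J} (a : I -> C) (c : J -> C) s t M N :
  bsum (fun i => Cmod (a i)) M -> bsum (fun j => Cmod (c j)) N ->
  has_sum a s -> has_sum c t -> has_sum (fun p => a (fst p) * c (snd p)) (s * t).
Proof.
move=> HM HN Ha Hc.
have [u Hu] := has_sum_exists (fun p : I * J => a (fst p) * c (snd p)) _ _
  ltac:(move=> p /=; rewrite Cmod_mult; exact: Rle_refl) (bsum_prod _ _ _ _ HM HN).
have H1 := has_sum_pairs _ (fun i => a i * t) _ Hu (fun i => has_sum_scal (a i) _ _ Hc).
by rewrite -(has_sum_unique _ _ _ H1 (has_sum_scal_r t _ _ Ha)).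
Qed.

Lemma has_sum_union {I J} (a : I + J -> C) s t :
  has_sum (fun i => a (inl i)) s -> has_sum (fun j => a (inr j)) t -> has_sum a (s + t).
Proof.
move=> Ha Hb eps He.
case: (Ha (eps / 2)%R ltac:(lra)) => l0 H0; case: (Hb (eps / 2)%R ltac:(lra)) => l1 H1.
exists (map inl l0 ++ map inr l1) => l Hn Hi.
pose fl := flat_map (fun p : I + J => match p with inl i => [i] | inr _ => [] end).
pose fr := flat_map (fun p : I + J => match p with inl _ => [] | inr j => [j] end).
have Efl : forall i m, In i (fl m) <-> In (inl i) m.
  move=> i m; rewrite in_flat_map; split.
    by move=> [[k|k] [Hk]] //= [<-|[]].
  by move=> Hk; exists (inl i); split => //; left.
have Efr : forall i m, In i (fr m) <-> In (inr i) m.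
  move=> i m; rewrite in_flat_map; split.
    by move=> [[k|k] [Hk]] //= [<-|[]].
  by move=> Hk; exists (inr i); split => //; left.
have E : csum a l = csum (fun i => a (inl i)) (fl l) + csum (fun j => a (inr j)) (fr l).
  elim: (l) => [|[i|j] m IH] /=; [ring|rewrite IH; ring|rewrite IH; ring].
have Nl : NoDup (fl l).
  elim: (l) Hn => [|[i|j] m IH] Hn /=; inversion_clear Hn; [constructor| |exact: IH].
  constructor; last exact: IH.
  by rewrite -/(fl m) Efl.
have Nr : NoDup (fr l).
  elim: (l) Hn => [|[i|j] m IH] Hn /=; inversion_clear Hn; [constructor|exact: IH|].
  constructor; last exact: IH.
  by rewrite -/(fr m) Efr.
have A0 : (Cmod (csum (fun i => a (inl i)) (fl l) - s) < eps / 2)%R.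
  apply: H0 => // i Hi0; apply/Efl/Hi/in_or_app; left; exact: in_map.
have A1 : (Cmod (csum (fun j => a (inr j)) (fr l) - t) < eps / 2)%R.
  apply: H1 => // i Hi0; apply/Efr/Hi/in_or_app; right; exact: in_map.
rewrite E; set u := csum _ (fl l) in A0 *; set v := csum _ (fr l) in A1 *.
have := Cmod_triangle (u - s) (v - t).
replace (u - s + (v - t)) with (u + v - (s + t)) by ring.
lra.
Qed.

Lemma bsum_union {I J} (b : I + J -> R) M N :
  bsum (fun i => b (inl i)) M -> bsum (fun j => b (inr j)) N -> bsum b (M + N).
Proof.
move=> [Hb HM] [Hc HN]; split => [[i|j]|l Hl] //.
pose fl := flat_map (fun p : I + J => match p with inl i => [i] | inr _ => [] end).
pose fr := flat_map (fun p : I + J => match p with inl _ => [] | inr j => [j] end).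
have E : rsum b l = (rsum (fun i => b (inl i)) (fl l) + rsum (fun j => b (inr j)) (fr l))%R.
  elim: (l) => [|[i|j] m IH] /=; [ring|rewrite IH; ring|rewrite IH; ring].
rewrite E; apply: Rplus_le_compat; [apply: HM|apply: HN].
- elim: (l) Hl => [|[i|j] m IH] Hn /=; inversion_clear Hn; [constructor| |exact: IH].
  constructor; last exact: IH.
  by move=> /in_flat_map [[k|k] [Hk]] //= [Ek|[]]; subst k.
- elim: (l) Hl => [|[i|j] m IH] Hn /=; inversion_clear Hn; [constructor|exact: IH|].
  constructor; last exact: IH.
  by move=> /in_flat_map [[k|k] [Hk]] //= [Ek|[]]; subst k.
Qed.

Lemma choice_fun {A B} (P : A -> B -> Prop) :
  (forall x, exists y, P x y) -> exists f, forall x, P x (f x).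
Proof.
move=> H; exists (fun x => proj1_sig (constructive_indefinite_description _ (H x))) => x.
exact: proj2_sig.
Qed.

(** In a finite set of rows each row sum is approximated by a finite partial
    sum; together these form one partial sum of the whole family. *)
Lemma bsum_rows {I J} (a : I -> J -> C) (c : I -> C) M :
  bsum (fun p => Cmod (a (fst p) (snd p))) M -> (forall i, has_sum (a i) (c i)) ->
  bsum (fun i => Cmod (c i)) M.
Proof.
move=> [_ HM] Hc; split => [i|l Hl]; first exact: Cmod_ge_0.
have key : forall l, NoDup l -> forall eps, (0 < eps)%R -> exists L, NoDup L /\
    (forall p, In p L -> In (fst p) l) /\
    (rsum (fun i => Cmod (c i)) l <= rsum (fun p => Cmod (a (fst p) (snd p))) L + eps)%R.
  elim => [|i l' IH] Hn eps He.
    exists nil; split; first constructor; split => //=; lra.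
  move/NoDup_cons_iff: Hn => [Hi Hn].
  have He2 : (0 < eps / 2)%R by lra.
  have [L [HL [HLl HLs]]] := IH Hn _ He2.
  have [l0 H0] := Hc i _ He2.
  have [l1 [Hn1 [Hi1 _]]] := join_list l0 l0.
  exists (map (fun j => (i, j)) l1 ++ L); split.
    apply: NoDup_app => //.
      by apply: FinFun.Injective_map_NoDup (Hn1) => x y [->].
    move=> p Hp HpL; move: Hp (HLl _ HpL) => /in_map_iff [j [<- _]]; exact: Hi.
  split.
    move=> p Hp; case: (in_app_or _ _ _ Hp) => Hp'; last by right; exact: HLl.
    by move: Hp' => /in_map_iff [j [<- _]]; left.
  rewrite rsum_app rsum_map /=.
  have H1 := H0 l1 Hn1 Hi1; have H2 := Cmod_csum (a i) l1.
  have H3 := Cmod_triangle (c i - csum (a i) l1) (csum (a i) l1).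
  replace (c i - csum (a i) l1 + csum (a i) l1) with (c i) in H3 by ring.
  have H4 : Cmod (c i - csum (a i) l1) = Cmod (csum (a i) l1 - c i).
    rewrite -Cmod_opp; congr Cmod; ring.
  lra.
apply: Rnot_lt_le => Hlt.
have [L [HL [_ HLs]]] := key l Hl ((rsum (fun i => Cmod (c i)) l - M) / 2)%R ltac:(lra).
have := HM L HL; lra.
Qed.

Lemma has_sum_csum {I J} (a : J -> I -> C) (s : J -> C) l :
  (forall j, In j l -> has_sum (a j) (s j)) ->
  has_sum (fun i => csum (fun j => a j i) l) (csum s l).
Proof.
elim: l => [|j l IH] H /=; first exact: has_sum_zero.
apply: has_sum_plus; first by apply: H; left.
by apply: IH => k Hk; apply: H; right.
Qed.

Lemma has_sum_fin {I} (a : I -> C) l : NoDup l -> (forall i, ~ In i l -> a i = 0) ->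
  has_sum a (csum a l).
Proof.
move=> Hl H eps He; exists l => l' Hn Hi.
case: (split_incl _ _ Hl Hn Hi) => l1 [Hn1 Hp].
have Hd : forall i, In i l1 -> ~ In i l.
  move=> i Hi1 Hi0; have := Permutation_NoDup Hp Hn.
  move=> /NoDup_app_remove_l; case: (in_split _ _ Hi1) => u [v E].
  have N := Permutation_NoDup Hp Hn; rewrite E in N.
  move=> _; apply: (NoDup_remove_2 _ _ _ ltac:(rewrite app_assoc in N; exact: N)).
  apply/in_or_app; left; apply/in_or_app; by left.
rewrite (csum_perm _ _ _ Hp) csum_app (csum_ext a (fun _ => 0) l1); last by move=> i /Hd /H.
have -> : csum (fun _ : I => 0) l1 = 0 by elim: (l1) => //= x m ->; ring.
replace (csum a l + 0 - csum a l) with (RtoC 0) by ring; by rewrite Cmod_0.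
Qed.

(** * Sums over the natural numbers and over the integers *)

Lemma incl_seq (l : list nat) : exists N, forall n, (N <= n)%nat -> incl l (seq 0 n).
Proof.
elim: l => [|x l [N HN]]; first by exists 0%nat => n _ y.
exists (max N (S x)) => n Hn y [<-|Hy]; first by apply/in_seq; lia.
apply: HN => //; lia.
Qed.

Lemma csum_seq (a : nat -> C) n : csum a (seq 0 (S n)) = sum_n a n.
Proof.
elim: n => [|n IH]; first by rewrite sum_O /=; ring.
rewrite sum_Sn -IH seq_S csum_app /= /plus /=; ring.
Qed.

Lemma has_sum_is_series (a : nat -> C) s :
  has_sum a s -> @is_series C_AbsRing C_NormedModule a s.
Proof.
move=> H; apply/filterlim_locally_ball_norm => eps.
case: (H eps (cond_pos eps)) => l0 H0; case: (incl_seq l0) => N HN.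
exists N => n Hn; rewrite /ball_norm /norm /minus /plus /opp /=.
rewrite -csum_seq; apply: H0; first exact: seq_NoDup.
apply: HN; lia.
Qed.

Lemma bsum_nat (b : nat -> R) M : (forall n, (0 <= b n)%R) ->
  (forall n, (rsum b (seq 0 n) <= M)%R) -> bsum b M.
Proof.
move=> Hb H; split => // l Hl; case: (incl_seq l) => N HN.
apply: Rle_trans (H N); apply: rsum_incl => //; first exact: seq_NoDup.
exact: HN.
Qed.

Lemma has_sum_shift (a : nat -> C) s : has_sum (fun n => a (S n)) s -> has_sum a (a 0%nat + s).
Proof.
move=> H; pose f (p : unit + nat) := match p with inl _ => 0%nat | inr n => S n end.
pose g n := match n with O => inl tt | S m => inr m end.
apply: (has_sum_reindex f g); [by case=> [[]|n]|by case|].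
apply: (has_sum_union (fun p => a (f p))) => //=.
by apply: (has_sum_single tt (fun _ => a 0%nat)) => -[].
Qed.

Lemma bsum_shift (b : nat -> R) M : bsum b M -> bsum (fun n => b (S n)) M.
Proof. apply: bsum_inj => x y []; done. Qed.

Lemma bsum_geom (x : R) : (0 <= x < 1)%R -> bsum (fun n => (x ^ n)%R) (/ (1 - x)).
Proof.
move=> Hx; apply: bsum_nat => [n|n]; first by apply: pow_le; lra.
have -> : rsum (fun k => (x ^ k)%R) (seq 0 n) = ((1 - x ^ n) / (1 - x))%R.
  elim: n => [|n IH]; first by rewrite /=; field; lra.
  rewrite seq_S rsum_app IH /=; field; lra.
have : (0 <= x ^ n)%R by apply: pow_le; lra.
move=> H; rewrite /Rdiv -{2}(Rmult_1_l (/ (1 - x))).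
apply: Rmult_le_compat_r; last lra.
left; apply: Rinv_0_lt_compat; lra.
Qed.

Lemma has_sum_geom (x : C) : (Cmod x < 1)%R -> has_sum (fun n : nat => x ^ n) (/ (1 - x)).
Proof.
move=> Hx.
have [s Hs] : exists s, has_sum (fun n : nat => x ^ n) s.
  apply: (has_sum_exists _ (fun n => (Cmod x ^ n)%R)) => [n|].
    rewrite Cmod_pow; lra.
  apply: bsum_geom; have := Cmod_ge_0 x; lra.
have H1 : has_sum (fun n : nat => x ^ n) (1 + x * s).
  apply: (has_sum_shift (fun n => x ^ n)); exact: (has_sum_ext _ _ _ _ (has_sum_scal x _ _ Hs)).
have E := has_sum_unique _ _ _ Hs H1.
have Hn : 1 - x <> 0.
  move=> E0; have Ex : x = 1 by replace x with (1 - (1 - x)) by ring; rewrite E0; ring.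
  by rewrite Ex Cmod_1 in Hx; lra.
suff -> : / (1 - x) = s by [].
have : s * (1 - x) = 1.
  have -> : s * (1 - x) = s - x * s by ring.
  have -> : s - x * s = (1 + x * s) - x * s by rewrite -E.
  ring.
move=> E2; have -> : / (1 - x) = s * (1 - x) * / (1 - x) by rewrite E2; ring.
by field.
Qed.

(** The grouping of indices in [ZSeries]. *)
Definition Zof (p : nat + nat) : Z :=
  match p with inl k => Z.of_nat k | inr k => (- Z.of_nat k - 1)%Z end.

Definition ofZ (n : Z) : nat + nat :=
  if (0 <=? n)%Z then inl (Z.to_nat n) else inr (Z.to_nat (- n - 1)).

Lemma ZofK p : ofZ (Zof p) = p.
Proof.
case: p => k; rewrite /Zof /ofZ.
  by rewrite (proj2 (Z.leb_le _ _)) ?Nat2Z.id //; lia.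
rewrite (proj2 (Z.leb_gt _ _)); last lia.
congr inr; lia.
Qed.

Lemma ofZK n : Zof (ofZ n) = n.
Proof. rewrite /ofZ; case: Z.leb_spec => H /=; lia. Qed.

Lemma has_sum_Z (a : Z -> C) s t : has_sum (fun k => a (Z.of_nat k)) s ->
  has_sum (fun k => a (- Z.of_nat k - 1)%Z) t -> has_sum a (s + t).
Proof.
move=> Hs Ht; apply: (has_sum_reindex Zof ofZ); [exact: ZofK|exact: ofZK|].
exact: (has_sum_union (fun p => a (Zof p))).
Qed.

Lemma bsum_Z (b : Z -> R) M N : bsum (fun k => b (Z.of_nat k)) M ->
  bsum (fun k => b (- Z.of_nat k - 1)%Z) N -> bsum b (M + N).
Proof.
move=> HM HN.
have := bsum_inj ofZ (fun p => b (Zof p)) (M + N) _ (bsum_union _ _ _ HM HN).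
move=> H; apply: bsum_le (H _) => [i|x y E].
  rewrite ofZK; split; last lra.
  rewrite -(ofZK i); case: (ofZ i) => k; [exact: (proj1 HM)|exact: (proj1 HN)].
by rewrite -(ofZK x) E ofZK.
Qed.

Lemma has_sum_Z_halves (a : Z -> C) (b : Z -> R) M s :
  (forall n, (Cmod (a n) <= b n)%R) -> bsum b M -> has_sum a s ->
  exists u v, has_sum (fun k => a (Z.of_nat k)) u /\
    has_sum (fun k => a (- Z.of_nat k - 1)%Z) v /\ s = u + v.
Proof.
move=> Hab HM Hs.
have [u Hu] : exists u, has_sum (fun k => a (Z.of_nat k)) u.
  apply: (has_sum_exists _ (fun k => b (Z.of_nat k)) M) => // .
  apply: (bsum_inj Z.of_nat) => // x y; lia.
have [v Hv] : exists u, has_sum (fun k => a (- Z.of_nat k - 1)%Z) u.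
  apply: (has_sum_exists _ (fun k => b (- Z.of_nat k - 1)%Z) M) => // .
  apply: (bsum_inj (fun k => (- Z.of_nat k - 1)%Z)) => // x y; lia.
exists u, v; do 2 split => //.
exact: has_sum_unique Hs (has_sum_Z _ _ _ Hu Hv).
Qed.

Lemma has_sum_Zshift (a : Z -> C) (d : Z) s : has_sum a s -> has_sum (fun n => a (n + d)%Z) s.
Proof.
move=> H; apply: (has_sum_reindex (fun n => (n - d)%Z) (fun n => (n + d)%Z)).
- move=> n; lia.
- move=> n; lia.
apply: has_sum_ext H => n; congr a; lia.
Qed.

Lemma has_sum_Zopp (a : Z -> C) s : has_sum a s -> has_sum (fun n => a (- n)%Z) s.
Proof.
move=> H; apply: (has_sum_reindex Z.opp Z.opp); try exact: Z.opp_involutive.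
apply: has_sum_ext H => n; congr a; lia.
Qed.

Lemma bsum_geomZ (x : R) : (0 <= x < 1)%R ->
  bsum (fun n => (x ^ Z.abs_nat n)%R) (2 / (1 - x)).
Proof.
move=> Hx; have G := bsum_geom x Hx.
replace (2 / (1 - x))%R with (/ (1 - x) + / (1 - x))%R by (field; lra).
apply: bsum_Z.
  apply: bsum_le G => k; rewrite Zabs2Nat.id; split; last lra.
  apply: pow_le; lra.
apply: bsum_le (bsum_shift _ _ G) => k.
replace (Z.abs_nat (- Z.of_nat k - 1)) with (S k) by lia.
split; last lra.
apply: pow_le; lra.
Qed.

Lemma is_series_C_parts (a : nat -> C) s :
  @is_series C_AbsRing C_NormedModule a s -> CSeries a = s.
Proof.
move=> H; have HR : forall eps : posreal, exists N, forall n, (N <= n)%nat ->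
    (Cmod (sum_n a n - s) < eps)%R.
  move=> eps; exact: (proj1 (filterlim_locally_ball_norm _ _) H eps).
have Ere : forall n, Re (sum_n a n) = sum_n (fun k => Re (a k)) n.
  elim=> [|n IH]; first by rewrite !sum_O.
  by rewrite !sum_Sn -IH.
have Eim : forall n, Im (sum_n a n) = sum_n (fun k => Im (a k)) n.
  elim=> [|n IH]; first by rewrite !sum_O.
  by rewrite !sum_Sn -IH.
rewrite /CSeries; case: s HR {H} => x y HR; congr pair; apply: is_series_unique.
  apply/filterlim_locally_ball_norm => eps; case: (HR eps) => N HN.
  exists N => n Hn; rewrite /ball_norm /norm /minus /plus /opp /= /abs /= -Ere.
  apply: Rle_lt_trans (HN n Hn); exact: (re_le_Cmod (sum_n a n - (x, y))).
apply/filterlim_locally_ball_norm => eps; case: (HR eps) => N HN.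
exists N => n Hn; rewrite /ball_norm /norm /minus /plus /opp /= /abs /= -Eim.
apply: Rle_lt_trans (HN n Hn); apply: Rle_trans (Rmax_Cmod _).
exact: (Rmax_r _ (Rabs (Im (sum_n a n - (x, y))))).
Qed.

Lemma has_sum_ZSeries (a : Z -> C) (b : Z -> R) M s :
  (forall n, (Cmod (a n) <= b n)%R) -> bsum b M -> has_sum a s -> ZSeries a = s.
Proof.
move=> Hab HM Hs.
have [u [v [Hu [Hv ->]]]] := has_sum_Z_halves _ _ _ _ Hab HM Hs.
apply: is_series_C_parts; apply: has_sum_is_series; exact: has_sum_plus.
Qed.

Lemma bsum_unshift (b : nat -> R) M : (0 <= b 0%nat)%R -> bsum (fun n => b (S n)) M ->
  bsum b (b 0%nat + M).
Proof.
move=> H0 HM.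
pose f (p : unit + nat) := match p with inl _ => 0%nat | inr n => S n end.
pose g n := match n with O => inl tt | S m => inr m end.
have H1 : bsum (fun _ : unit => b 0%nat) (b 0%nat).
  split => // -[|[] [|[] l]] //= H; try lra.
  by inversion_clear H as [|? ? H1 _]; case: H1; left.
have := bsum_inj g (fun p => b (f p)) _ _ (bsum_union (fun p => b (f p)) _ _ H1 HM).
move=> H; apply: bsum_le (H _) => [[|n]|[|n] [|m]] //=; try lra.
  split; last lra; exact: (proj1 HM).
by move=> [->].
Qed.

Lemma has_sum_unshift (a : nat -> C) s : has_sum a s -> has_sum (fun n => a (S n)) (s - a 0%nat).
Proof.
move=> H eps He; case: (H eps He) => l0 H0; exists (map Nat.pred l0) => l Hn Hi.
have -> : csum (fun n => a (S n)) l - (s - a 0%nat) = csum a (0%nat :: map S l) - s.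
  rewrite /= csum_map; ring.
apply: H0.
  constructor; last by apply: FinFun.Injective_map_NoDup Hn => x y; lia.
  by move=> /in_map_iff [x [Hx _]].
move=> [|x] Hx; [by left|right].
by apply/in_map/Hi/in_map_iff; exists (S x).
Qed.

Lemma pow_le1 x m : (0 <= x <= 1)%R -> (x ^ m <= 1)%R.
Proof. by move=> Hx; rewrite -(pow1 m); apply: pow_incr; lra. Qed.

(** * Finite sums *)

Lemma rsum_seq_last (a : nat -> R) n :
  rsum a (seq 0 (S n)) = (rsum a (seq 0 n) + a n)%R.
Proof. rewrite seq_S rsum_app /=; ring. Qed.

Lemma rsum_ext {I} (a b : I -> R) l :
  (forall i, In i l -> a i = b i) -> rsum a l = rsum b l.
Proof.
elim: l => //= x l IH H; rewrite H; last by left.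
by rewrite IH // => i Hi; apply: H; right.
Qed.

Lemma rsum_plus {I} (a b : I -> R) l :
  rsum (fun i => (a i + b i)%R) l = (rsum a l + rsum b l)%R.
Proof. elim: l => /= [|x l ->]; ring. Qed.

Lemma rsum_scal {I} k (a : I -> R) l : rsum (fun i => (k * a i)%R) l = (k * rsum a l)%R.
Proof. elim: l => /= [|x l ->]; ring. Qed.

Lemma csum_plus {I} (a b : I -> C) l : csum (fun i => a i + b i) l = csum a l + csum b l.
Proof. elim: l => /= [|x l ->]; ring. Qed.

Lemma csum_scal {I} k (a : I -> C) l : csum (fun i => k * a i) l = k * csum a l.
Proof. elim: l => /= [|x l ->]; ring. Qed.

Lemma csum_seq_S (a : nat -> C) n :
  csum a (seq 0 (S n)) = a 0%nat + csum (fun i => a (S i)) (seq 0 n).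
Proof. by rewrite /= -seq_shift csum_map. Qed.

Lemma csum_seq_last (a : nat -> C) n :
  csum a (seq 0 (S n)) = csum a (seq 0 n) + a n.
Proof. rewrite seq_S csum_app /=; ring. Qed.

Lemma rsum_seq_S (a : nat -> R) n :
  rsum a (seq 0 (S n)) = (a 0%nat + rsum (fun i => a (S i)) (seq 0 n))%R.
Proof. by rewrite /= -seq_shift rsum_map. Qed.

Lemma rsum_swap {I J} (a : I -> J -> R) l m :
  rsum (fun i => rsum (a i) m) l = rsum (fun j => rsum (fun i => a i j) l) m.
Proof.
elim: l => [|i l IH] /=; first by elim: m => //= j m <-; ring.
by rewrite IH -rsum_plus.
Qed.

Lemma csum_swap {I J} (a : I -> J -> C) l m :
  csum (fun i => csum (a i) m) l = csum (fun j => csum (fun i => a i j) l) m.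
Proof.
elim: l => [|i l IH] /=; first by elim: m => //= j m <-; ring.
by rewrite IH -csum_plus.
Qed.

Lemma rsum_minus {I} (a b : I -> R) l :
  rsum (fun i => (a i - b i)%R) l = (rsum a l - rsum b l)%R.
Proof. elim: l => /= [|i l ->]; ring. Qed.

Lemma rsum_zero {I} (a : I -> R) l : (forall i, In i l -> a i = 0%R) -> rsum a l = 0%R.
Proof.
elim: l => //= i l IH H; rewrite H; last by left.
rewrite IH; first ring.
by move=> j Hj; apply: H; right.
Qed.

Lemma csum_RtoC {I} (a : I -> R) l : csum (fun i => RtoC (a i)) l = RtoC (rsum a l).
Proof. by elim: l => //= i l ->; rewrite RtoC_plus. Qed.

Lemma rsum_sum_n (a : nat -> R) n : sum_n a n = rsum a (seq 0 (S n)).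
Proof.
elim: n => [|n IH]; first by rewrite sum_O /=; ring.
by rewrite sum_Sn IH (rsum_seq_last a (S n)).
Qed.

Lemma csum_seq1 (a : nat -> C) n : csum a (seq 1 n) = csum (fun i => a (S i)) (seq 0 n).
Proof. by rewrite -seq_shift csum_map. Qed.

Lemma rsum_seq1 (a : nat -> R) n : rsum a (seq 1 n) = rsum (fun i => a (S i)) (seq 0 n).
Proof. by rewrite -seq_shift rsum_map. Qed.

Lemma rsum_sum_n_m (a : nat -> R) n : sum_n_m a 1 n = rsum a (seq 1 n).
Proof.
elim: n => [|n IH]; first by rewrite sum_n_m_zero.
rewrite sum_n_Sm; last lia.
rewrite IH seq_S rsum_app /plus /=; ring.
Qed.

Lemma csum_sum_n_m (a : nat -> C) n : sum_n_m a 1 n = csum a (seq 1 n).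
Proof.
elim: n => [|n IH]; first by rewrite sum_n_m_zero.
rewrite sum_n_Sm; last lia.
rewrite IH seq_S csum_app /plus /=; ring.
Qed.

Lemma csum_zero {I} (a : I -> C) l : (forall i, In i l -> a i = 0) -> csum a l = 0.
Proof.
elim: l => //= i l IH H; rewrite H; last by left.
rewrite IH; first ring.
by move=> j Hj; apply: H; right.
Qed.

(** * Absolutely convergent power series *)

(** A power series on a closed disc together with a bound [M] of the norm [sum
    |c n| r^n].  This norm is submultiplicative and countably subadditive, so
    that analyticity of sums of series, products and inverses follows from
    estimates alone. *)
Definition W (c : nat -> C) (r M : R) (f : C -> C) : Prop :=
  bsum (fun n => (Cmod (c n) * r ^ n)%R) M /\
  forall h, (Cmod h <= r)%R -> has_sum (fun n => c n * h ^ n) (f h).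

Lemma W_rpos c r M f : W c r M f -> (0 <= M)%R.
Proof. by case=> /bsum_ge0. Qed.

Lemma W_ext c r M f g : (forall h, (Cmod h <= r)%R -> f h = g h) -> W c r M f -> W c r M g.
Proof. move=> E [HM Hf]; split => // h Hh; rewrite -E //; exact: Hf. Qed.

Lemma W_Mle c r M N f : (M <= N)%R -> W c r M f -> W c r N f.
Proof. move=> H [HM Hf]; split => //; exact: bsum_mono H HM. Qed.

Lemma W_coef_ext c d r M f : (forall n, c n = d n) -> W c r M f -> W d r M f.
Proof.
move=> E [HM Hf]; split.
  apply: bsum_le (HM) => n; rewrite E; split; last lra.
  rewrite -(E n); case: HM => H _; exact: H.
move=> h /Hf; apply: has_sum_ext => n; by rewrite E.
Qed.

Lemma W_mono c r r' M f : (0 <= r' <= r)%R -> W c r M f -> W c r' M f.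
Proof.
move=> Hr [HM Hf]; split => [|h Hh]; last by apply: Hf; lra.
apply: bsum_le HM => n; have := Cmod_ge_0 (c n).
have : (0 <= r' ^ n)%R by apply: pow_le; lra.
have : (r' ^ n <= r ^ n)%R by apply: pow_incr; lra.
move=> *; split; nra.
Qed.

Lemma W_bound c r M f h : (Cmod h <= r)%R -> W c r M f -> (Cmod (f h) <= M)%R.
Proof.
move=> Hh [HM Hf]; apply: has_sum_bound HM (Hf h Hh) => n.
rewrite Cmod_mult Cmod_pow; apply: Rmult_le_compat_l; first exact: Cmod_ge_0.
apply: pow_incr; split => //; exact: Cmod_ge_0.
Qed.

Lemma W_coef_bound c r M f n : (0 < r)%R -> W c r M f -> (Cmod (c n) <= M / r ^ n)%R.
Proof.
move=> Hr [HM _]; have := bsum_term _ _ n HM.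
have Hp : (0 < r ^ n)%R by apply: pow_lt.
move=> H; apply: (Rmult_le_reg_r (r ^ n)) => //.
replace (M / r ^ n * r ^ n)%R with M by (field; lra); lra.
Qed.

Lemma W_value0 c r M f : (0 <= r)%R -> W c r M f -> f 0 = c 0%nat.
Proof.
move=> Hr [_ Hf].
have H0 : (Cmod 0 <= r)%R by rewrite Cmod_0.
apply: (has_sum_unique _ _ _ (Hf 0 H0)).
have -> : c 0%nat = c 0%nat * 0 ^ 0 by rewrite /=; ring.
apply: (has_sum_single 0%nat (fun n => c n * 0 ^ n)) => -[] //= n _; ring.
Qed.

Lemma W_const r k : (0 <= r)%R ->
  W (fun n => match n with O => k | _ => 0 end) r (Cmod k) (fun _ => k).
Proof.
move=> Hr; split.
  apply: bsum_nat => [n|n].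
    by apply: Rmult_le_pos; [exact: Cmod_ge_0|apply: pow_le].
  case: n => [|n]; first exact: Cmod_ge_0.
  rewrite /= -seq_shift rsum_map /=.
  have -> : forall l, rsum (fun i => (Cmod 0 * (r * r ^ i))%R) l = 0%R.
    elim=> //= x l ->; rewrite Cmod_0; ring.
  lra.
move=> h _; set a := fun n : nat => _.
have {1}-> : k = a 0%nat by rewrite /a /=; ring.
apply: has_sum_single => -[] // n _; rewrite /a /=; ring.
Qed.

Lemma W_plus c d r M N f g : (0 <= r)%R -> W c r M f -> W d r N g ->
  W (fun n => c n + d n) r (M + N) (fun h => f h + g h).
Proof.
move=> Hr [HM Hf] [HN Hg]; split => [|h Hh].
  apply: bsum_le (bsum_plus _ _ _ _ HM HN) => n.
  have := Cmod_triangle (c n) (d n); have := Cmod_ge_0 (c n + d n).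
  have := pow_le r n Hr => *; split; nra.
apply: has_sum_ext (has_sum_plus _ _ _ _ (Hf h Hh) (Hg h Hh)) => n; ring.
Qed.

Lemma W_scal k c r M f : W c r M f ->
  W (fun n => k * c n) r (Cmod k * M) (fun h => k * f h).
Proof.
move=> [HM Hf]; split => [|h Hh].
  apply: bsum_le (bsum_scal _ _ _ (Cmod_ge_0 k) HM) => n; rewrite Cmod_mult.
  have := proj1 HM n; have := Cmod_ge_0 k => *; split; nra.
apply: has_sum_ext (has_sum_scal k _ _ (Hf h Hh)) => n; ring.
Qed.

Lemma W_shift c r M f : (0 <= r)%R -> W c r M f ->
  W (fun n => match n with O => 0 | S m => c m end) r (r * M) (fun h => h * f h).
Proof.
move=> Hr [HM Hf]; split => [|h Hh].
  set b := fun n : nat => _.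
  replace (r * M)%R with (b 0%nat + r * M)%R by (rewrite /b Cmod_0; ring).
  apply: bsum_unshift; first by rewrite /b Cmod_0; lra.
  apply: bsum_le (bsum_scal r _ _ Hr HM) => n.
  have := proj1 HM n; rewrite /b /= => *; split; nra.
replace (h * f h) with (0 * h ^ 0 + h * f h) by ring.
apply: (has_sum_shift (fun n => match n with O => 0 | S m => c m end * h ^ n)).
apply: has_sum_ext (has_sum_scal h _ _ (Hf h Hh)) => n /=; ring.
Qed.

(** Division by [h]; the value at 0 has to be put in by hand. *)
Lemma W_unshift c r M f (f1 : C -> C) : (0 < r)%R -> W c r M f -> f1 0 = c 1%nat ->
  (forall h, (Cmod h <= r)%R -> f h = c 0%nat + h * f1 h) ->
  W (fun n => c (S n)) r (M / r) f1.
Proof.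
move=> Hr [HM Hf] H0 E; split => [|h Hh].
  have Hi : (0 <= / r)%R by left; apply: Rinv_0_lt_compat.
  rewrite /Rdiv Rmult_comm.
  apply: bsum_le (bsum_scal _ _ _ Hi (bsum_shift _ _ HM)) => n.
  have -> : (/ r * (Cmod (c (S n)) * r ^ S n) = Cmod (c (S n)) * r ^ n)%R.
    rewrite /=; field; lra.
  split; last lra; apply: Rmult_le_pos; [exact: Cmod_ge_0|apply: pow_le; lra].
case: (Ceq_dec h 0) => [->|Hn].
  rewrite H0; set a := fun n : nat => _.
  have {1}-> : c 1%nat = a 0%nat by rewrite /a /=; ring.
  apply: has_sum_single => -[] // n _; rewrite /a /=; ring.
have [u Hu] : exists u, has_sum (fun n => c (S n) * h ^ S n) u.
  apply: (has_sum_exists _ (fun n => (Cmod (c (S n)) * r ^ S n)%R)) (bsum_shift _ _ HM) => n.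
  rewrite Cmod_mult Cmod_pow; apply: Rmult_le_compat_l; first exact: Cmod_ge_0.
  apply: pow_incr; split => //; exact: Cmod_ge_0.
have Eu := has_sum_unique _ _ _ (Hf h Hh) (has_sum_shift (fun n => c n * h ^ n) _ Hu).
have -> : f1 h = / h * u.
  have : h * f1 h = u.
    have -> : h * f1 h = f h - c 0%nat by rewrite E //; ring.
    rewrite Eu /=; ring.
  by move=> <-; field.
apply: has_sum_ext (has_sum_scal (/ h) _ _ Hu) => n /=; by field.
Qed.

(** Weierstrass's theorem on series of analytic functions: the double family
    of all terms is absolutely summable, so that the order of summation can be
    exchanged. *)
Lemma W_sum {I} (c : I -> nat -> C) r (M : I -> R) S f F : (0 < r)%R ->
  (forall i, W (c i) r (M i) (f i)) -> bsum M S ->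
  (forall h, (Cmod h <= r)%R -> has_sum (fun i => f i h) (F h)) ->
  exists d, (forall n, has_sum (fun i => c i n) (d n)) /\ W d r S F.
Proof.
move=> Hr Hc HS HF.
have Hd : forall n, exists s, has_sum (fun i => c i n) s.
  move=> n; have Hp : (0 < / r ^ n)%R by apply: Rinv_0_lt_compat; apply: pow_lt.
  apply: (has_sum_exists _ (fun i => (/ r ^ n * M i)%R) _ _ (bsum_scal _ _ _ (Rlt_le _ _ Hp) HS)).
  move=> i; have := W_coef_bound _ _ _ _ n Hr (Hc i).
  by rewrite /Rdiv Rmult_comm.
pose d n := proj1_sig (constructive_indefinite_description _ (Hd n)).
have Hdn : forall n, has_sum (fun i => c i n) (d n).
  move=> n; exact: proj2_sig (constructive_indefinite_description _ (Hd n)).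
exists d; split => //.
have Hb : bsum (fun p : I * nat => (Cmod (c (fst p) (snd p)) * r ^ snd p)%R) S.
  apply: (bsum_pairs _ M) HS => i /=; exact: (proj1 (Hc i)).
have Hrn : forall n, Cmod (RtoC (r ^ n)) = (r ^ n)%R.
  by move=> n; rewrite Cmod_R Rabs_pos_eq //; apply: pow_le; lra.
split.
  apply: (bsum_le _ (fun n => Cmod (d n * RtoC (r ^ n)))).
    move=> n; rewrite Cmod_mult Hrn; split; last lra.
    apply: Rmult_le_pos; [exact: Cmod_ge_0|apply: pow_le; lra].
  apply: (bsum_rows (fun n i => c i n * RtoC (r ^ n))) => [|n]; last exact: has_sum_scal_r.
  apply: (bsum_le _ (fun p : nat * I => Cmod (c (snd p) (fst p)) * r ^ fst p)%R).
    move=> p; rewrite Cmod_mult Hrn; split; last lra.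
    apply: Rmult_le_pos; [exact: Cmod_ge_0|apply: pow_le; lra].
  by apply: (bsum_inj (fun p : nat * I => (snd p, fst p)) _ _ _ Hb) => -[n i] [n' i'] [-> ->].
move=> h Hh.
have Hp : forall n, (0 <= Cmod h ^ n <= r ^ n)%R.
  move=> n; have H0 := Cmod_ge_0 h; split; first exact: pow_le.
  exact: pow_incr.
have [T HT] := has_sum_exists (fun p : I * nat => c (fst p) (snd p) * h ^ snd p)
  (fun p : I * nat => (Cmod (c (fst p) (snd p)) * r ^ snd p)%R) S
  ltac:(move=> [i n] /=; rewrite Cmod_mult Cmod_pow; apply: Rmult_le_compat_l;
    [exact: Cmod_ge_0|exact: (proj2 (Hp n))]) Hb.
have HT1 := has_sum_pairs _ _ _ HT (fun i => proj2 (Hc i) h Hh).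
have ET := has_sum_unique _ _ _ HT1 (HF h Hh); rewrite -ET.
apply: (has_sum_pairs _ _ _ (has_sum_swap (fun i n => c i n * h ^ n) _ HT)) => n /=.
exact: has_sum_scal_r.
Qed.

Lemma W_powmul k c r M f : (0 <= r)%R -> W c r M f ->
  W (fun n => if Nat.ltb n k then RtoC 0 else c (n - k)%nat) r (r ^ k * M) (fun h => h ^ k * f h).
Proof.
move=> Hr HW; elim: k => [|k IH].
  apply: (W_ext _ _ _ f) => [h _|]; first by rewrite /=; ring.
  rewrite /= Rmult_1_l; apply: W_coef_ext HW => n /=; by rewrite Nat.sub_0_r.
replace (r ^ S k * M)%R with (r * (r ^ k * M))%R by (rewrite /=; ring).
apply: (W_ext _ _ _ (fun h => h * (h ^ k * f h))) => [h _|]; first by rewrite /=; ring.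
apply: W_coef_ext (W_shift _ _ _ _ Hr IH) => -[|n] //.
Qed.

Lemma W_mult c d r M N f g : (0 < r)%R -> W c r M f -> W d r N g ->
  W (fun n => csum (fun i => c i * d (n - i)%nat) (seq 0 (S n))) r (M * N) (fun h => f h * g h).
Proof.
move=> Hr Hf Hg.
have HN := W_rpos _ _ _ _ Hg.
have H1 : forall i, W (fun n => c i * (if Nat.ltb n i then RtoC 0 else d (n - i)%nat)) r
    (N * (Cmod (c i) * r ^ i)) (fun h => c i * (h ^ i * g h)).
  move=> i; replace (N * (Cmod (c i) * r ^ i))%R with (Cmod (c i) * (r ^ i * N))%R by ring.
  apply: (W_scal (c i) (fun n => if Nat.ltb n i then RtoC 0 else d (n - i)%nat)).
  apply: W_powmul => //; lra.
have H2 : forall h, (Cmod h <= r)%R -> has_sum (fun i => c i * (h ^ i * g h)) (f h * g h).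
  move=> h Hh; apply: has_sum_ext (has_sum_scal_r (g h) _ _ (proj2 Hf h Hh)) => i; ring.
have [e [He HW]] := W_sum _ r _ (N * M) _ _ Hr H1 (bsum_scal N _ _ HN (proj1 Hf)) H2.
rewrite Rmult_comm; apply: W_coef_ext HW => n.
apply: (has_sum_unique _ _ _ (He n)).
rewrite (csum_ext _ (fun i => c i * (if Nat.ltb n i then RtoC 0 else d (n - i)%nat))); last first.
  by move=> i /in_seq Hi; case: Nat.ltb_spec => //; lia.
apply: has_sum_fin; first exact: seq_NoDup.
move=> i Hi; case: Nat.ltb_spec => H; first ring.
case: Hi; apply/in_seq; lia.
Qed.

Lemma W_pow c r M f k : (0 < r)%R -> W c r M f ->
  exists d, W d r (M ^ k) (fun h => f h ^ k).
Proof.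
move=> Hr HW; elim: k => [|k [d Hd]].
  exists (fun n => match n with O => RtoC 1 | _ => RtoC 0 end).
  replace (M ^ 0)%R with (Cmod 1) by (rewrite Cmod_1 //); apply: W_const; lra.
eexists; exact: (W_mult _ _ _ _ _ _ _ Hr HW Hd).
Qed.

(** A factor [r' / r] comes out of every term when the constant term is zero.
    *)
Lemma W_small c r M f eps : (0 < r)%R -> (0 < eps)%R -> W c r M f -> c 0%nat = 0 ->
  exists r', (0 < r' <= r)%R /\ W c r' eps f.
Proof.
move=> Hr He HW H0.
have HM := W_rpos _ _ _ _ HW.
set q := Rmin 1 (eps / (M + 1)).
have Hq0 : (0 < q)%R.
  apply: Rmin_pos; first lra; apply: Rdiv_lt_0_compat; lra.
have Hq1 : (q <= 1)%R := Rmin_l _ _.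
have Hq2 : (q * M <= eps)%R.
  have : (q <= eps / (M + 1))%R := Rmin_r _ _.
  move=> H; have : (q * (M + 1) <= eps)%R.
    apply: Rle_trans (_ : (eps / (M + 1) * (M + 1) <= _)%R).
      apply: Rmult_le_compat_r; lra.
    right; field; lra.
  nra.
exists (q * r)%R; split; first nra.
case: (HW) => HB Hf; split; last by move=> h Hh; apply: Hf; nra.
apply: bsum_mono Hq2 _.
apply: bsum_le (bsum_scal q _ _ (Rlt_le _ _ Hq0) HB) => -[|n].
  rewrite H0 Cmod_0; lra.
have H1 : (0 <= q ^ n <= 1)%R.
  split; first by apply: pow_le; lra.
  rewrite -(pow1 n); apply: pow_incr; lra.
rewrite Rpow_mult_distr; set u := (q ^ n)%R in H1.
have := proj1 HB (S n); set v := (Cmod _ * _)%R => Hv.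
have -> : (Cmod (c (S n)) * (q ^ S n * r ^ S n) = q * u * v)%R by rewrite /u /v /=; ring.
have : (0 <= q * v)%R by nra.
move=> *; split; nra.
Qed.

(** Neumann series in [1 - f h / f 0], which is small near 0. *)
Lemma W_inv c r M f : (0 < r)%R -> W c r M f -> c 0%nat <> 0 ->
  exists d r' M', (0 < r' <= r)%R /\ W d r' M' (fun h => / f h) /\
    forall h, (Cmod h <= r')%R -> f h <> 0.
Proof.
move=> Hr HW H0; set k := c 0%nat in H0.
pose g h := 1 - / k * f h.
have HG : W (fun n => (match n with O => 1 | _ => 0 end) + - / k * c n) r
    (Cmod 1 + Cmod (- / k) * M) g.
  apply: (W_ext _ _ _ (fun h => 1 + - / k * f h)) => [h _|]; first by rewrite /g; ring.
  apply: W_plus; [lra|apply: W_const; lra|exact: W_scal].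
have Hg0 : 1 + - / k * c 0%nat = 0 by rewrite -/k; field.
have Hh : (0 < / 2)%R by lra.
case: (W_small _ _ _ _ _ Hr Hh HG Hg0) => r' [Hr' HG'].
have Hlt : forall h, (Cmod h <= r')%R -> (Cmod (g h) < 1)%R.
  move=> h Hh'; have := W_bound _ _ _ _ _ Hh' HG'; lra.
have Hfg : forall h, f h = k * (1 - g h).
  move=> h; rewrite /g; by field.
have Hne : forall h, (Cmod h <= r')%R -> 1 - g h <> 0.
  move=> h /Hlt H E; have : g h = 1.
    by replace (g h) with (1 - (1 - g h)) by ring; rewrite E; ring.
  move=> E1; rewrite E1 Cmod_1 in H; lra.
have Hp : forall i : nat, exists d, W d r' ((/ 2) ^ i) (fun h => g h ^ i).
  move=> i; apply: W_pow HG'; lra.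
pose d i := proj1_sig (constructive_indefinite_description _ (Hp i)).
have Hd : forall i, W (d i) r' ((/ 2) ^ i) (fun h => g h ^ i).
  move=> i; exact: proj2_sig (constructive_indefinite_description _ (Hp i)).
have [e [_ He]] := W_sum d r' _ _ _ (fun h => / (1 - g h)) (proj1 Hr') Hd
  (bsum_geom (/ 2) ltac:(lra)) (fun h Hh' => has_sum_geom _ (Hlt h Hh')).
exists (fun n => / k * e n), r', (Cmod (/ k) * / (1 - / 2))%R; split => //.
split; last first.
  move=> h Hh'; rewrite Hfg; apply: Cmult_neq_0 => //; exact: Hne.
apply: (W_ext _ _ _ (fun h => / k * / (1 - g h))) (W_scal _ _ _ _ _ He) => h Hh'.
rewrite [in RHS]Hfg; field; split => //; exact: Hne.
Qed.

(** If the constant term were nonzero, so would be [f] near 0; otherwise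
    divide by [h] and repeat. *)
Lemma W_isolated c r M f : (0 < r)%R -> W c r M f ->
  (forall eps, (0 < eps)%R -> exists h, (0 < Cmod h < eps)%R /\ f h = 0) ->
  forall n, c n = 0.
Proof.
move=> Hr HW HZ n; elim: n c M f HW HZ => [|n IH] c M f HW HZ.
  apply: NNPP => H0; case: (W_inv _ _ _ _ Hr HW H0) => d [r' [M' [Hr' [_ Hne]]]].
  case: (HZ r' (proj1 Hr')) => h [Hh E]; apply: (Hne h) => //; lra.
have H0 : c 0%nat = 0.
  apply: NNPP => H0; case: (W_inv _ _ _ _ Hr HW H0) => d [r' [M' [Hr' [_ Hne]]]].
  case: (HZ r' (proj1 Hr')) => h [Hh E]; apply: (Hne h) => //; lra.
pose f1 h := match Ceq_dec h 0 with left _ => c 1%nat | right _ => f h / h end.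
have Hf1 : W (fun n => c (S n)) r (M / r) f1.
  apply: (W_unshift _ _ _ _ _ Hr HW) => [|h Hh]; rewrite /f1; case: Ceq_dec => // E.
    rewrite H0 E; have := W_value0 _ _ _ _ (Rlt_le _ _ Hr) HW; rewrite H0 => ->; ring.
  rewrite H0; by field.
apply: (IH _ _ _ Hf1) => eps He; case: (HZ eps He) => h [Hh E].
exists h; split => //; rewrite /f1; case: Ceq_dec => [E0|_].
  move: Hh; rewrite E0 Cmod_0; lra.
rewrite E /Cdiv; ring.
Qed.

Lemma W_unique c d r r' M N f g : (0 < r)%R -> (0 < r')%R -> W c r M f -> W d r' N g ->
  (forall eps, (0 < eps)%R -> exists h, (0 < Cmod h < eps)%R /\ f h = g h) ->
  forall n, c n = d n.
Proof.
move=> Hr Hr' HW HV H n.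
set s := Rmin r r'; have Hs : (0 < s)%R by apply: Rmin_pos.
have Hs1 : (s <= r)%R := Rmin_l _ _; have Hs2 : (s <= r')%R := Rmin_r _ _.
have Hs3 : (0 <= s <= r)%R by lra.
have Hs4 : (0 <= s <= r')%R by lra.
have H1 := W_mono _ _ s _ _ Hs3 HW.
have H2 := W_scal (-1) _ _ _ _ (W_mono _ _ s _ _ Hs4 HV).
have H3 := W_plus _ _ _ _ _ _ _ (Rlt_le _ _ Hs) H1 H2.
have E := W_isolated _ _ _ _ Hs H3 _ n.
have -> : c n = c n + -1 * d n + d n by ring.
rewrite E; first ring.
move=> eps He; case: (H eps He) => h [Hh E']; exists h; split => //; rewrite E'; ring.
Qed.

Lemma W_lipschitz0 c r M f h : (0 < r)%R -> W c r M f -> (Cmod h <= r)%R ->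
  (Cmod (f h - c 0%nat) <= M / r * Cmod h)%R.
Proof.
move=> Hr HW Hh.
pose f1 h := match Ceq_dec h 0 with left _ => c 1%nat | right _ => (f h - c 0%nat) / h end.
have H1 : W (fun n => c (S n)) r (M / r) f1.
  apply: (W_unshift _ _ _ _ _ Hr HW) => [|h' Hh']; rewrite /f1; case: Ceq_dec => // E.
    rewrite E (W_value0 _ _ _ _ (Rlt_le _ _ Hr) HW); ring.
  by field.
have E : f h - c 0%nat = f1 h * h.
  rewrite /f1; case: Ceq_dec => [->|E]; last by field.
  rewrite (W_value0 _ _ _ _ (Rlt_le _ _ Hr) HW); ring.
rewrite E Cmod_mult; apply: Rmult_le_compat_r; first exact: Cmod_ge_0.
exact: (W_bound _ _ _ _ _ Hh H1).
Qed.

Lemma W_is_pseries c r M f h : W c r M f -> (Cmod h <= r)%R ->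
  @is_pseries C_AbsRing C_NormedModule c h (f h).
Proof.
move=> [_ Hf] /Hf /has_sum_is_series; apply: is_series_ext => n.
by rewrite /scal /= /mult /= Cmult_comm.
Qed.

(** Convergence at [r / 2] bounds the terms there, so that a geometric series
    dominates them at [r / 4]. *)
Lemma is_pseries_W c r F : (0 < r)%R ->
  (forall h, (0 < Cmod h < r)%R -> @is_pseries C_AbsRing C_NormedModule c h (F h)) ->
  exists r' M G, (0 < r' < r)%R /\ W c r' M G /\
    forall h, (0 < Cmod h <= r')%R -> G h = F h.
Proof.
move=> Hr HF.
have Hh0 : (0 < Cmod (RtoC (r / 2)) < r)%R by rewrite Cmod_R Rabs_pos_eq; lra.
have [K HK] : exists K, forall n, (Cmod (c n) * (r / 2) ^ n <= K)%R.
  have HS := HF _ Hh0.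
  have := proj1 (filterlim_locally_ball_norm _ _) HS (mkposreal 1 Rlt_0_1).
  case=> N0 HN0; pose N := S N0.
  have HN' : forall n, (N <= n)%nat -> (Cmod (c n) * (r / 2) ^ n <= 2)%R.
    move=> [|n] Hn; first by rewrite /N in Hn; lia.
    have A := HN0 (S n) ltac:(rewrite /N in Hn; lia).
    have B := HN0 n ltac:(rewrite /N in Hn; lia).
    move: A B; rewrite sum_Sn /ball_norm /norm /minus /plus /opp /scal /= /mult /=.
    set u := sum_n _ n; set t := (_ * c (S n))%C; set v := F _ => A B.
    have Et : Cmod t = (Cmod (c (S n)) * (r / 2) ^ S n)%R.
      rewrite /t Cmod_mult Rmult_comm; congr Rmult.
      change (Cmod (RtoC (r / 2) * pow_n (RtoC (r / 2)) n) = ((r / 2) ^ S n)%R).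
      have -> : RtoC (r / 2) * pow_n (RtoC (r / 2)) n = RtoC ((r / 2) ^ S n).
        rewrite RtoC_pow /=; congr Cmult; elim: (n) => //= m ->; by [].
      rewrite Cmod_R Rabs_pos_eq //; apply: pow_le; lra.
    change (r / 2 * (r / 2) ^ n)%R with ((r / 2) ^ S n)%R.
    rewrite -Et.
    have := Cmod_triangle (u + t + - v) (- (u + - v)); rewrite Cmod_opp.
    replace (u + t + - v + - (u + - v)) with t by ring.
    lra.
  have [K HK] : exists K, forall n, (n < N)%nat -> (Cmod (c n) * (r / 2) ^ n <= K)%R.
    elim: (N) => [|m [K HK]]; first by exists 0%R => n; lia.
    exists (Rmax K (Cmod (c m) * (r / 2) ^ m)) => n Hn.
    case: (Nat.eq_dec n m) => [->|Hm]; first exact: Rmax_r.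
    apply: Rle_trans (Rmax_l _ _); apply: HK; lia.
  exists (Rmax K 2) => n; case: (Nat.lt_ge_cases n N) => Hn.
    exact: Rle_trans (HK n Hn) (Rmax_l _ _).
  exact: Rle_trans (HN' n Hn) (Rmax_r _ _).
have HB : bsum (fun n => (Cmod (c n) * (r / 4) ^ n)%R) (K * / (1 - / 2)).
  have HK0 : (0 <= K)%R.
    apply: Rle_trans (HK 0%nat); rewrite /= Rmult_1_r; exact: Cmod_ge_0.
  apply: bsum_le (bsum_scal K _ _ HK0 (bsum_geom (/ 2) ltac:(lra))) => n.
  split; first by apply: Rmult_le_pos; [exact: Cmod_ge_0|apply: pow_le; lra].
  replace (r / 4)%R with (r / 2 * / 2)%R by field.
  rewrite Rpow_mult_distr -Rmult_assoc; apply: Rmult_le_compat_r; last exact: HK.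
  apply: pow_le; lra.
have HG : forall h, exists s, (Cmod h <= r / 4)%R -> has_sum (fun n => c n * h ^ n) s.
  move=> h; case: (Rle_dec (Cmod h) (r / 4)) => Hh; last by exists 0 => /Hh.
  have [s Hs] := has_sum_exists (fun n => c n * h ^ n) (fun n => (Cmod (c n) * (r / 4) ^ n)%R) _
    ltac:(move=> n; rewrite Cmod_mult Cmod_pow; apply: Rmult_le_compat_l;
      [exact: Cmod_ge_0|apply: pow_incr; split => //; exact: Cmod_ge_0]) HB.
  by exists s.
pose G h := proj1_sig (constructive_indefinite_description _ (HG h)).
have HGh : forall h, (Cmod h <= r / 4)%R -> has_sum (fun n => c n * h ^ n) (G h).
  move=> h; exact: proj2_sig (constructive_indefinite_description _ (HG h)).
have HWG : W c (r / 4) (K * / (1 - / 2)) G by split.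
exists (r / 4)%R, (K * / (1 - / 2))%R, G; split; first lra.
split => // h Hh.
have A := W_is_pseries _ _ _ _ h HWG (proj2 Hh).
have Hh' : (0 < Cmod h < r)%R by lra.
have B := HF h Hh'.
exact: (filterlim_locally_unique _ _ _ A B).
Qed.

Lemma W_dilate (k : C) c r M (f : C -> C) : k <> 0 -> W c r M f ->
  W (fun n => c n * k ^ n) (r / Cmod k) M (fun h => f (k * h)).
Proof.
move=> Hk [HB HS]; have Hk' := proj1 (Cmod_gt_0 k) Hk; split.
  apply: bsum_le (HB) => n; rewrite Cmod_mult Cmod_pow Rmult_assoc -Rpow_mult_distr.
  have -> : (Cmod k * (r / Cmod k) = r)%R by field; lra.
  split; last lra.
  have := proj1 HB n; done.
move=> h Hh; have Hkh : (Cmod (k * h) <= r)%R.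
  rewrite Cmod_mult; replace r with (Cmod k * (r / Cmod k))%R by (field; lra).
  apply: Rmult_le_compat_l; lra.
apply: has_sum_ext (HS _ Hkh) => n; rewrite Cpow_mult_l; ring.
Qed.

(** * The exponential function *)

Lemma Cexp_plus a b : Cexp (a + b) = Cexp a * Cexp b.
Proof.
case: a b => [a1 a2] [b1 b2]; rewrite /Cexp /= exp_plus cos_plus sin_plus.
apply: injective_projections => /=; ring.
Qed.

Lemma Cexp_0 : Cexp 0 = 1.
Proof.
by rewrite /Cexp /= exp_0 cos_0 sin_0; apply: injective_projections => /=; ring.
Qed.

Lemma Cmod_Cexp z : Cmod (Cexp z) = exp (Re z).
Proof.
rewrite /Cexp /Cmod /=.
have -> : (exp (Re z) * cos (Im z) * (exp (Re z) * cos (Im z) * 1) +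
  exp (Re z) * sin (Im z) * (exp (Re z) * sin (Im z) * 1))%R
  = Rsqr (exp (Re z)).
  have := sin2_cos2 (Im z); rewrite /Rsqr => E.
  set e := exp _; set c := cos _ in E *; set t := sin _ in E *.
  transitivity (e * e * (t * t + c * c))%R; [ring|rewrite E; ring].
apply: sqrt_Rsqr; left; exact: exp_pos.
Qed.

Lemma Cexp_neq0 z : Cexp z <> 0.
Proof. by apply/Cmod_gt_0; rewrite Cmod_Cexp; exact: exp_pos. Qed.

Lemma Cexp_opp z : Cexp (- z) = / Cexp z.
Proof.
have H : Cexp z * Cexp (- z) = 1.
  rewrite -Cexp_plus -Cexp_0; congr Cexp; ring.
have Hn := Cexp_neq0 z.
replace (Cexp (- z)) with (/ Cexp z * (Cexp z * Cexp (- z))) by (field; done).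
rewrite H; ring.
Qed.

Lemma Cexp_pow z n : Cexp z ^ n = Cexp (INR n * z).
Proof.
elim: n => [|n IH]; first have -> : RtoC (INR 0) * z = 0 by exact: Cmult_0_l.
  by rewrite Cexp_0.
rewrite S_INR RtoC_plus Cpow_S IH -Cexp_plus; congr Cexp; ring.
Qed.

Lemma INR_fact_neq0 n : RtoC (INR (fact n)) <> 0.
Proof. move=> /RtoC_inj; exact: INR_fact_neq_0. Qed.

Lemma bsum_exp x : (0 <= x)%R -> bsum (fun n => (x ^ n / INR (fact n))%R) (exp x).
Proof.
move=> Hx.
have Hp : forall n, (0 <= x ^ n / INR (fact n))%R.
  move=> n; apply: Rmult_le_pos; first exact: pow_le.
  left; apply: Rinv_0_lt_compat; exact: INR_fact_lt_0.
apply: bsum_nat => // n.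
have E : forall n, rsum (fun n => (x ^ n / INR (fact n))%R) (seq 0 (S n))
    = sum_f_R0 (fun i => / INR (fact i) * x ^ i)%R n.
  elim=> [|m IH]; first by rewrite /=; field.
  rewrite rsum_seq_last IH tech5 /Rdiv; ring.
have HS : infinite_sum (fun i => / INR (fact i) * x ^ i)%R (exp x).
  rewrite /exp; by case: (exist_exp x).
case: n => [|n]; first by rewrite /=; left; exact: exp_pos.
rewrite E; apply: sum_incr => // i.
have := Hp i; rewrite /Rdiv; lra.
Qed.

(** The exponential series, under a name of its own until it is shown to agree
    with [Cexp]. *)
Definition Eseries (z : C) : C :=
  epsilon (inhabits (RtoC 0)) (has_sum (fun n => / RtoC (INR (fact n)) * z ^ n)).

Lemma Cmod_exp_term z n :
  Cmod (/ RtoC (INR (fact n)) * z ^ n) = (Cmod z ^ n / INR (fact n))%R.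
Proof.
rewrite Cmod_mult Cmod_pow Cmod_inv; last exact: INR_fact_neq0.
rewrite Cmod_R Rabs_pos_eq; last exact: pos_INR.
rewrite /Rdiv; ring.
Qed.

Lemma Eseries_spec z : has_sum (fun n => / RtoC (INR (fact n)) * z ^ n) (Eseries z).
Proof.
apply: (epsilon_spec (inhabits (RtoC 0))).
apply: (has_sum_exists _ (fun n => (Cmod z ^ n / INR (fact n))%R)) (bsum_exp _ (Cmod_ge_0 z)) => n.
rewrite Cmod_exp_term; exact: Rle_refl.
Qed.

Lemma W_Eseries k r : (0 <= r)%R ->
  W (fun n => / RtoC (INR (fact n)) * k ^ n) r (exp (Cmod k * r)) (fun h => Eseries (k * h)).
Proof.
move=> Hr; split => [|h _].
  have Hk := Cmod_ge_0 k.
  apply: bsum_le (bsum_exp (Cmod k * r) ltac:(nra)) => n.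
  rewrite Cmod_exp_term Rpow_mult_distr.
  have H1 : (0 <= Cmod k ^ n)%R by apply: pow_le.
  have H2 : (0 <= r ^ n)%R by apply: pow_le.
  have H3 := Rinv_0_lt_compat _ (INR_fact_lt_0 n).
  rewrite /Rdiv; split; last lra.
  apply: Rmult_le_pos => //; apply: Rmult_le_pos => //; lra.
apply: has_sum_ext (Eseries_spec (k * h)) => n.
rewrite Cpow_mult_l; ring.
Qed.

Lemma binom_fact a b n :
  csum (fun i => / RtoC (INR (fact i)) * a ^ i * (/ RtoC (INR (fact (n - i))) * b ^ (n - i)))
    (seq 0 (S n)) = / RtoC (INR (fact n)) * (a + b) ^ n.
Proof.
elim: n => [|n IH]; first by rewrite /=; field.
have Hn : RtoC (INR (S n)) <> 0 by move=> /RtoC_inj; apply: not_0_INR.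
suff E : RtoC (INR (S n)) * csum (fun i => / RtoC (INR (fact i)) * a ^ i *
    (/ RtoC (INR (fact (S n - i))) * b ^ (S n - i))) (seq 0 (S (S n))) =
    (a + b) * (/ RtoC (INR (fact n)) * (a + b) ^ n).
  have Hf := INR_fact_neq0 n.
  set t := csum _ _ in E *.
  have -> : t = / RtoC (INR (S n)) * (RtoC (INR (S n)) * t) by field.
  rewrite E fact_simpl mult_INR RtoC_mult Cpow_S; field; by split.
have T : forall i, (i <= S n)%nat ->
  RtoC (INR (S n)) * (/ RtoC (INR (fact i)) * a ^ i * (/ RtoC (INR (fact (S n - i))) * b ^ (S n - i)))
  = RtoC (INR i) * (/ RtoC (INR (fact i)) * a ^ i) * (/ RtoC (INR (fact (S n - i))) * b ^ (S n - i))
   + / RtoC (INR (fact i)) * a ^ i * (RtoC (INR (S n - i)) * (/ RtoC (INR (fact (S n - i))) * b ^ (S n - i))).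
  move=> i Hi; rewrite minus_INR // RtoC_minus; ring.
have D : forall x k, RtoC (INR (S k)) * (/ RtoC (INR (fact (S k))) * x ^ S k)
    = x * (/ RtoC (INR (fact k)) * x ^ k).
  move=> x k; rewrite fact_simpl mult_INR RtoC_mult Cpow_S.
  have Hk : RtoC (INR (S k)) <> 0 by move=> /RtoC_inj; apply: not_0_INR.
  have Hf := INR_fact_neq0 k; field; by split.
rewrite -csum_scal.
etransitivity; first by apply: csum_ext => i Hi; apply: T; move: Hi => /in_seq; lia.
rewrite csum_plus csum_seq_S (csum_seq_last _ (S n)) Nat.sub_diag.
rewrite Cmult_plus_distr_r -IH -!csum_scal.
have -> : RtoC (INR 0) = 0 by [].
set s1 := csum _ _; set s2 := csum _ _; set s3 := csum _ _; set s4 := csum _ _.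
have -> : s1 = s3.
  apply: csum_ext => i _; rewrite D Nat.sub_succ; ring.
have -> : s2 = s4.
  apply: csum_ext => i /in_seq Hi.
  replace (S n - i)%nat with (S (n - i)) by lia; rewrite D; ring.
ring.
Qed.

(** By the binomial theorem the Cauchy product of the two series is the series
    of the sum. *)
Lemma Eseries_plus a b : Eseries (a + b) = Eseries a * Eseries b.
Proof.
have H1 : (0 < 1)%R by lra.
have Ha := W_Eseries a 1 (Rlt_le _ _ H1); have Hb := W_Eseries b 1 (Rlt_le _ _ H1).
have [_ H] := W_mult _ _ _ _ _ _ _ H1 Ha Hb.
have := H 1 ltac:(rewrite Cmod_1; lra); rewrite !Cmult_1_r => H2.
apply: (has_sum_unique _ _ _ (Eseries_spec (a + b))).
apply: has_sum_ext H2 => n; rewrite binom_fact Cpow_1_l; ring.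
Qed.

Lemma infinite_sum_has_sum (a : nat -> R) s S : infinite_sum a s ->
  has_sum (fun n => RtoC (a n)) S -> S = RtoC s.
Proof.
move=> H /has_sum_is_series HS.
apply: (filterlim_locally_unique _ _ _ HS).
apply/filterlim_locally_ball_norm => eps.
case: (H eps (cond_pos eps)) => N HN; exists N => n Hn.
rewrite /ball_norm /norm /minus /plus /opp /=.
have -> : sum_n (fun k => RtoC (a k)) n = RtoC (sum_f_R0 a n).
  elim: (n) => [|m IH]; first by rewrite sum_O.
  by rewrite sum_Sn IH tech5 RtoC_plus.
have := HN n Hn; rewrite /R_dist -RtoC_opp -RtoC_plus Cmod_R; done.
Qed.

Definition parity_fwd (p : nat + nat) : nat :=
  match p with inl k => (2 * k)%nat | inr k => (2 * k + 1)%nat end.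

Definition parity_bwd (n : nat) : nat + nat :=
  if Nat.even n then inl (Nat.div2 n) else inr (Nat.div2 n).

Lemma parity_fwdK p : parity_bwd (parity_fwd p) = p.
Proof.
case: p => k; rewrite /parity_bwd /parity_fwd.
  by rewrite Nat.even_mul Nat.div2_double.
rewrite Nat.even_add Nat.even_mul /=.
have -> : (k + (k + 0) + 1)%nat = S (2 * k) by lia.
by rewrite Nat.div2_succ_double.
Qed.

Lemma parity_bwdK n : parity_fwd (parity_bwd n) = n.
Proof.
rewrite /parity_bwd; case E: (Nat.even n) => /=.
  have := Nat.Even_double n (proj1 (Nat.even_spec n) E); rewrite /Nat.double; lia.
have Ho : Nat.Odd n by apply/Nat.odd_spec; rewrite -Nat.negb_even E.
have := Nat.Odd_double n Ho; rewrite /Nat.double; lia.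
Qed.

Lemma Eseries_real x : Eseries (RtoC x) = RtoC (exp x).
Proof.
apply: (infinite_sum_has_sum (fun i => / INR (fact i) * x ^ i)%R).
  rewrite /exp; by case: (exist_exp x).
apply: has_sum_ext (Eseries_spec x) => n.
rewrite RtoC_mult RtoC_inv ?RtoC_pow //; exact: INR_fact_neq_0.
Qed.

Lemma Ci_pow_even k : Ci ^ (2 * k) = RtoC ((-1) ^ k).
Proof.
rewrite Cpow_mult_r RtoC_pow; congr Cpow.
by rewrite /=; apply: injective_projections => /=; ring.
Qed.

(** The even and the odd terms are the series of cosine and sine. *)
Lemma Eseries_imag y : Eseries (Ci * RtoC y) = (cos y, sin y).
Proof.
have Hb : forall f : nat -> nat, (forall a b, f a = f b -> a = b) ->
    exists s, has_sum (fun k => / RtoC (INR (fact (f k))) * (Ci * y) ^ f k) s.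
  move=> f Hf; apply: (has_sum_exists _ (fun k => (Cmod (Ci * y) ^ f k / INR (fact (f k)))%R)).
    move=> k; rewrite Cmod_exp_term; exact: Rle_refl.
  apply: (bsum_inj f (fun n => (Cmod (Ci * y) ^ n / INR (fact n))%R) _ Hf).
  apply: bsum_exp; exact: Cmod_ge_0.
have [s Hs] := Hb (fun k => (2 * k)%nat) ltac:(move=> a b /=; lia).
have [t Ht] := Hb (fun k => (2 * k + 1)%nat) ltac:(move=> a b /=; lia).
have E : Eseries (Ci * y) = s + t.
  apply: (has_sum_unique _ _ _ (Eseries_spec _)).
  apply: (has_sum_reindex parity_fwd parity_bwd); [exact: parity_fwdK|exact: parity_bwdK|].
  exact: (has_sum_union (fun p => / RtoC (INR (fact (parity_fwd p))) * (Ci * y) ^ parity_fwd p)).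
have Es : s = RtoC (cos y).
  apply: (infinite_sum_has_sum (fun i => cos_n i * (Rsqr y) ^ i)%R).
    rewrite /cos; by case: (exist_cos (Rsqr y)).
  apply: has_sum_ext Hs => k.
  rewrite /cos_n Cpow_mult_l Ci_pow_even -RtoC_pow /Rdiv !RtoC_mult RtoC_inv;
    last exact: INR_fact_neq_0.
  have -> : (y ^ (2 * k))%R = (y² ^ k)%R by rewrite pow_mult Rsqr_pow2.
  ring.
have Et : t = Ci * RtoC (sin y).
  have [u Hu] : exists u, infinite_sum (fun i => sin_n i * (Rsqr y) ^ i)%R u /\ sin y = (y * u)%R.
    rewrite /sin; case: (exist_sin (Rsqr y)) => u Hu; by exists u.
  have [v Hv] : exists v, has_sum (fun i => RtoC (sin_n i * (Rsqr y) ^ i)) v.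
    apply: (has_sum_exists _ (fun k => (Rabs y ^ (2 * k) / INR (fact (2 * k)))%R)); last first.
      apply: (bsum_inj (fun k => (2 * k)%nat) (fun n => (Rabs y ^ n / INR (fact n))%R)).
        move=> a b /=; lia.
      apply: bsum_exp; exact: Rabs_pos.
    move=> i; rewrite Cmod_R /sin_n Rabs_mult /Rdiv Rabs_mult pow_1_abs Rmult_1_l.
    rewrite (Rabs_pos_eq (/ _)); last first.
      left; apply: Rinv_0_lt_compat; exact: INR_fact_lt_0.
    rewrite (Rabs_pos_eq (_ ^ i)); last by apply: pow_le; exact: Rle_0_sqr.
    rewrite pow_mult -Rsqr_pow2 -Rsqr_abs Rmult_comm; apply: Rmult_le_compat_l.
      apply: pow_le; exact: Rle_0_sqr.
    apply: Rinv_le_contravar; first exact: INR_fact_lt_0.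
    apply: le_INR; apply: fact_le; lia.
  rewrite (proj2 Hu) RtoC_mult -(infinite_sum_has_sum _ _ _ (proj1 Hu) Hv).
  apply: (has_sum_unique _ _ _ Ht).
  rewrite Cmult_assoc; apply: has_sum_ext (has_sum_scal (Ci * y) _ _ Hv) => k.
  rewrite /sin_n Cpow_add_r Cpow_mult_l Ci_pow_even -RtoC_pow /Rdiv !RtoC_mult RtoC_inv;
    last exact: INR_fact_neq_0.
  have -> : (y ^ (2 * k))%R = (y² ^ k)%R by rewrite pow_mult Rsqr_pow2.
  rewrite Cpow_1_r; ring.
rewrite E Es Et; apply: injective_projections => /=; ring.
Qed.

Lemma Eseries_Cexp z : Eseries z = Cexp z.
Proof.
have {1}-> : z = RtoC (Re z) + Ci * RtoC (Im z).
  by case: z => x y; apply: injective_projections => /=; ring.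
rewrite Eseries_plus Eseries_real Eseries_imag /Cexp.
apply: injective_projections => /=; ring.
Qed.

Lemma W_Cexp k r : (0 <= r)%R ->
  W (fun n => / RtoC (INR (fact n)) * k ^ n) r (exp (Cmod k * r)) (fun h => Cexp (k * h)).
Proof.
move=> Hr; apply: (W_ext _ _ _ _ _ _ (W_Eseries k r Hr)) => h _; exact: Eseries_Cexp.
Qed.

Lemma Cexp_eq1 z : Cexp z = 1 -> exists k : Z, z = RtoC (IZR k) * (2 * PI * Ci).
Proof.
move=> E; have Er : Re z = 0%R.
  have := Cmod_Cexp z; rewrite E Cmod_1 => H.
  apply: exp_inv; by rewrite exp_0.
have Ec : cos (Im z) = 1%R.
  have := f_equal fst E; rewrite /Cexp /= Er exp_0; lra.
have Es : sin (Im z / 2) = 0%R.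
  have := cos_2a_sin (Im z / 2); replace (2 * (Im z / 2))%R with (Im z) by field.
  rewrite Ec => H.
  by apply: Rsqr_0_uniq; rewrite /Rsqr; lra.
case: (sin_eq_0_0 _ Es) => k Hk; exists k.
rewrite (surjective_pairing z) -/(Re z) -/(Im z) Er.
have -> : Im z = (IZR k * (2 * PI))%R by lra.
apply: injective_projections => /=; ring.
Qed.

(** * Analytic functions *)

Definition analytic_at (a : C) (f : C -> C) : Prop :=
  exists c r M, (0 < r)%R /\ W c r M (fun h => f (a + h)).

Lemma an_ext_near a rho f g : (0 < rho)%R ->
  (forall z, (Cmod (z - a) < rho)%R -> f z = g z) -> analytic_at a f -> analytic_at a g.
Proof.
move=> Hrho E [c [r [M [Hr HW]]]].
set s := Rmin r (rho / 2).
have Hs : (0 < s)%R by apply: Rmin_pos; lra.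
have Hs1 : (s <= r)%R := Rmin_l _ _; have Hs2 : (s <= rho / 2)%R := Rmin_r _ _.
have Hs3 : (0 <= s <= r)%R by lra.
exists c, s, M; split => //; apply: (W_ext _ _ _ _ _ _ (W_mono _ _ _ _ _ Hs3 HW)) => h Hh.
apply: E; replace (a + h - a) with h by ring; lra.
Qed.

Lemma an_ext a f g : (forall z, f z = g z) -> analytic_at a f -> analytic_at a g.
Proof. move=> E; exact: (an_ext_near a 1 f g ltac:(lra) (fun z _ => E z)). Qed.

Lemma an_const a k : analytic_at a (fun _ => k).
Proof.
exists (fun n => match n with O => k | _ => 0 end), 1%R, (Cmod k); split; first lra.
apply: W_const; lra.
Qed.

Lemma an_common a f g : analytic_at a f -> analytic_at a g -> exists c d r M N, (0 < r)%R /\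
  W c r M (fun h => f (a + h)) /\ W d r N (fun h => g (a + h)).
Proof.
move=> [c [r [M [Hr HW]]]] [d [r' [N [Hr' HV]]]].
set s := Rmin r r'.
have Hs : (0 < s)%R by apply: Rmin_pos; lra.
have Hs1 : (s <= r)%R := Rmin_l _ _; have Hs2 : (s <= r')%R := Rmin_r _ _.
have Hs3 : (0 <= s <= r)%R by lra.
have Hs4 : (0 <= s <= r')%R by lra.
exists c, d, s, M, N; split => //; split; [exact: (W_mono _ _ _ _ _ Hs3 HW)|exact: (W_mono _ _ _ _ _ Hs4 HV)].
Qed.

Lemma an_plus a f g : analytic_at a f -> analytic_at a g -> analytic_at a (fun z => f z + g z).
Proof.
move=> Hf Hg; have [c [d [r [M [N [Hr [H1 H2]]]]]]] := an_common _ _ _ Hf Hg.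
eexists _, r, _; split => //.
exact: (W_plus _ _ _ _ _ _ _ (Rlt_le _ _ Hr) H1 H2).
Qed.

Lemma an_mult a f g : analytic_at a f -> analytic_at a g -> analytic_at a (fun z => f z * g z).
Proof.
move=> Hf Hg; have [c [d [r [M [N [Hr [H1 H2]]]]]]] := an_common _ _ _ Hf Hg.
eexists _, r, _; split => //.
exact: (W_mult _ _ _ _ _ _ _ Hr H1 H2).
Qed.

Lemma an_scal a k f : analytic_at a f -> analytic_at a (fun z => k * f z).
Proof. move=> H; exact: an_mult (an_const a k) H. Qed.

Lemma an_opp a f : analytic_at a f -> analytic_at a (fun z => - f z).
Proof. move=> H; apply: an_ext (an_scal a (-1) f H) => z; ring. Qed.

Lemma an_minus a f g : analytic_at a f -> analytic_at a g -> analytic_at a (fun z => f z - g z).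
Proof. move=> Hf Hg; exact: an_plus Hf (an_opp _ _ Hg). Qed.

Lemma an_id a : analytic_at a (fun z => z).
Proof.
apply: (an_ext _ (fun z => a + (z - a))) => [z|]; first ring.
apply: an_plus; first exact: an_const.
have H := W_shift _ _ _ _ Rle_0_1 (W_const 1 1 Rle_0_1).
eexists _, 1%R, _; split; first lra.
apply: W_ext H => h _; ring.
Qed.

Lemma an_pow a f n : analytic_at a f -> analytic_at a (fun z => f z ^ n).
Proof.
move=> H; elim: n => [|n IH]; first exact: an_const.
exact: an_mult H IH.
Qed.

Lemma an_inv a (f : C -> C) : f a <> 0 -> analytic_at a f -> analytic_at a (fun z => / f z).
Proof.
move=> H0 [c [r [M [Hr HW]]]].
have Ec := W_value0 _ _ _ _ (Rlt_le _ _ Hr) HW.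
have Hc : c 0%nat <> 0 by rewrite -Ec Cplus_0_r.
have [d [r' [M' [Hr' [HV _]]]]] := W_inv _ _ _ _ Hr HW Hc.
exists d, r', M'; split => //; lra.
Qed.

Lemma an_Cexp a k : analytic_at a (fun z => Cexp (k * z)).
Proof.
apply: (an_ext _ (fun z => Cexp (k * a) * Cexp (k * (z - a)))).
  move=> z; rewrite -Cexp_plus; congr Cexp; ring.
apply: an_scal; eexists _, 1%R, _; split; first lra.
apply: W_ext (W_Cexp k 1 Rle_0_1) => h _; congr Cexp; ring.
Qed.

Lemma an_shift a b f : analytic_at (a + b) f -> analytic_at a (fun z => f (z + b)).
Proof.
move=> [c [r [M [Hr HW]]]]; exists c, r, M; split => //.
apply: W_ext HW => h _; congr f; ring.
Qed.

Lemma an_csum {I} a (f : I -> C -> C) l : (forall i, In i l -> analytic_at a (f i)) ->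
  analytic_at a (fun z => csum (fun i => f i z) l).
Proof.
elim: l => [|i l IH] H /=; first exact: an_const.
apply: an_plus; first by apply: H; left.
by apply: IH => j Hj; apply: H; right.
Qed.

Lemma an_continuous a f eps : analytic_at a f -> (0 < eps)%R ->
  exists d, (0 < d)%R /\ forall z, (Cmod (z - a) < d)%R -> (Cmod (f z - f a) < eps)%R.
Proof.
move=> [c [r [M [Hr HW]]]] He.
have Ec := W_value0 _ _ _ _ (Rlt_le _ _ Hr) HW.
have HM := W_rpos _ _ _ _ HW.
set d := Rmin r (eps / (M / r + 1)).
have HMr : (0 <= M / r)%R by apply: Rmult_le_pos => //; left; apply: Rinv_0_lt_compat.
have Hd : (0 < d)%R.
  apply: Rmin_pos => //; apply: Rdiv_lt_0_compat; lra.
exists d; split => // z Hz.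
have Hz1 : (Cmod (z - a) <= r)%R by have := Rmin_l r (eps / (M / r + 1)); rewrite -/d; lra.
have := W_lipschitz0 _ _ _ _ _ Hr HW Hz1.
replace (a + (z - a)) with z by ring.
rewrite -Ec Cplus_0_r.
move=> H; apply: Rle_lt_trans H _.
have Hz2 : (Cmod (z - a) < eps / (M / r + 1))%R.
  apply: Rlt_le_trans Hz _; exact: Rmin_r.
apply: Rle_lt_trans (_ : ((M / r + 1) * Cmod (z - a) < _)%R).
  have := Cmod_ge_0 (z - a); nra.
replace eps with ((M / r + 1) * (eps / (M / r + 1)))%R by (field; lra).
apply: Rmult_lt_compat_l; lra.
Qed.

Lemma an_neq0_near a (f : C -> C) : analytic_at a f -> f a <> 0 ->
  exists d, (0 < d)%R /\ forall z, (Cmod (z - a) < d)%R -> f z <> 0.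
Proof.
move=> Hf H0; have Hp := proj1 (Cmod_gt_0 _) H0.
case: (an_continuous a f _ Hf Hp) => d [Hd H]; exists d; split => // z /H.
move=> Hz E; move: Hz; rewrite E; replace (0 - f a) with (- f a) by ring.
rewrite Cmod_opp; lra.
Qed.

Lemma an_eq_near a f g : analytic_at a f -> analytic_at a g ->
  (forall eps, (0 < eps)%R -> exists z, (0 < Cmod (z - a) < eps)%R /\ f z = g z) ->
  exists d, (0 < d)%R /\ forall z, (Cmod (z - a) < d)%R -> f z = g z.
Proof.
move=> Hf Hg HZ; have [c [d [r [M [N [Hr [H1 H2]]]]]]] := an_common _ _ _ Hf Hg.
have E := W_unique _ _ _ _ _ _ _ _ Hr Hr H1 H2 _.
exists r; split => // z Hz.
have E' : forall n, c n = d n.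
  apply: E => eps He; case: (HZ eps He) => z' [Hz' Ez]; exists (z' - a).
  by split => //; replace (a + (z' - a)) with z' by ring.
have A := proj2 H1 (z - a) (Rlt_le _ _ Hz); have B := proj2 H2 (z - a) (Rlt_le _ _ Hz).
replace (a + (z - a)) with z in A, B by ring.
apply: (has_sum_unique _ _ _ A); apply: has_sum_ext B => n; by rewrite E'.
Qed.

(** The quotient is the power series with its coefficients shifted by one. *)
Lemma an_quotient a f : analytic_at a f -> exists f1, analytic_at a f1 /\
  (forall z, f z = f a + (z - a) * f1 z) /\ C_derive f a = f1 a.
Proof.
move=> [c [r [M [Hr HW]]]].
have Ec := W_value0 _ _ _ _ (Rlt_le _ _ Hr) HW.
rewrite Cplus_0_r in Ec.
pose f1 z := match Ceq_dec z a with left _ => c 1%nat | right _ => (f z - f a) / (z - a) end.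
have Hna : forall z, z <> a -> z - a <> 0.
  move=> z Hz E; apply: Hz; replace z with (z - a + a) by ring; rewrite E; ring.
have Hq : forall z, f z = f a + (z - a) * f1 z.
  move=> z; rewrite /f1; case: Ceq_dec => [->|Hz]; first ring.
  field; exact: Hna.
have Hf1 : analytic_at a f1.
  exists (fun n => c (S n)), r, (M / r)%R; split => //.
  apply: (W_unshift _ _ _ _ _ Hr HW) => [|h Hh].
    rewrite /f1; case: Ceq_dec => // H; case: H; ring.
  rewrite -Ec (Hq (a + h)); ring.
exists f1; split => //; split => //.
apply: is_C_lim_unique; apply/filterlim_locally => eps.
have [d [Hd H]] := an_continuous _ _ _ Hf1 (cond_pos eps).
have Hd2 : (0 < d / 2)%R by lra.
exists (mkposreal _ Hd2) => z Hz Hza.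
apply: C_NormedModule_mixin_compat1.
have E : (f z - f a) / (z - a) = f1 z by rewrite {1}Hq; field; exact: Hna.
rewrite E; apply: H.
have := C_NormedModule_mixin_compat2 _ _ _ Hz.
rewrite /minus /plus /opp /= => H2; apply: Rlt_le_trans H2 _.
have : (sqrt 2 <= 2)%R.
  rewrite -{2}(sqrt_square 2); last lra.
  apply: sqrt_le_1_alt; lra.
nra.
Qed.

(** * Meromorphic functions and the identity theorem *)

Lemma an_pole_order_le m a f F : analytic_at a F ->
  (exists rho, (0 < rho)%R /\ forall z, (0 < Cmod (z - a) < rho)%R -> F z = (z - a) ^ m * f z) ->
  pole_order_le m f a.
Proof.
move=> [c [r [M [Hr HW]]]] [rho [Hrho E]].
have Hs : (0 < Rmin r rho)%R by apply: Rmin_pos.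
exists c, (mkposreal _ Hs) => z Hz; rewrite -E; last first.
  split; first by case: Hz.
  apply: Rlt_le_trans (proj2 Hz) _; exact: Rmin_r.
have -> : z = a + (z - a) by ring.
replace (a + (z - a) - a) with (z - a) by ring.
apply: (W_is_pseries _ _ _ (fun h => F (a + h)) _ HW).
left; apply: Rlt_le_trans (proj2 Hz) _; exact: Rmin_l.
Qed.

Lemma pole_order_le_an m a f : pole_order_le m f a -> exists F rho,
  (0 < rho)%R /\ analytic_at a F /\ forall z, (0 < Cmod (z - a) < rho)%R -> F z = (z - a) ^ m * f z.
Proof.
move=> [c [r H]].
case: (is_pseries_W c r (fun h => h ^ m * f (a + h)) (cond_pos r)).
  move=> h Hh; have := H (a + h).
  replace (a + h - a) with h by ring; exact.
move=> r' [M [G [Hr' [HW HG]]]].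
exists (fun z => G (z - a)), r'; split; first lra; split.
  exists c, r', M; split; first lra.
  apply: W_ext HW => h _; congr G; ring.
move=> z Hz; rewrite HG; last lra.
by replace (a + (z - a)) with z by ring.
Qed.

Lemma Cpow_neq0 (z : C) n : z <> 0 -> z ^ n <> 0.
Proof. exact: Cpow_nz. Qed.

Lemma Cmod_pos_neq0 (z : C) : (0 < Cmod z)%R -> z <> 0.
Proof. by move=> /Cmod_gt_0. Qed.

Lemma pole_order_le_plus m a f g :
  pole_order_le m f a -> pole_order_le m g a -> pole_order_le m (fun z => f z + g z) a.
Proof.
move=> /pole_order_le_an [F [r [Hr [HF EF]]]] /pole_order_le_an [G [s [Hs [HG EG]]]].
apply: (an_pole_order_le m a _ _ (an_plus _ _ _ HF HG)).
exists (Rmin r s); split; first exact: Rmin_pos.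
move=> z Hz; rewrite EF; last by have := Rmin_l r s; lra.
rewrite EG; last by have := Rmin_r r s; lra.
ring.
Qed.

Lemma pole_order_le_scal m a k f :
  pole_order_le m f a -> pole_order_le m (fun z => k * f z) a.
Proof.
move=> /pole_order_le_an [F [r [Hr [HF EF]]]].
apply: (an_pole_order_le m a _ _ (an_scal _ k _ HF)).
exists r; split => // z Hz; rewrite EF //; ring.
Qed.

Lemma pole_order_le_mono m n a f : (m <= n)%nat -> pole_order_le m f a -> pole_order_le n f a.
Proof.
move=> Hmn /pole_order_le_an [F [r [Hr [HF EF]]]].
apply: (an_pole_order_le n a _ (fun z => (z - a) ^ (n - m) * F z)).
  apply: an_mult HF; apply: an_pow; apply: an_minus; [exact: an_id|exact: an_const].
exists r; split => // z Hz; rewrite EF // Cmult_assoc -Cpow_add_r.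
by congr (_ ^ _ * _); lia.
Qed.

Lemma pole_order_le_near m a f g rho : (0 < rho)%R ->
  (forall z, (0 < Cmod (z - a) < rho)%R -> f z = g z) ->
  pole_order_le m f a -> pole_order_le m g a.
Proof.
move=> Hrho E /pole_order_le_an [F [r [Hr [HF EF]]]].
apply: (an_pole_order_le m a _ _ HF).
exists (Rmin r rho); split; first exact: Rmin_pos.
move=> z Hz; rewrite EF; last by have := Rmin_l r rho; lra.
rewrite E //; have := Rmin_r r rho; lra.
Qed.

Lemma an_pole0 a f : analytic_at a f -> pole_order_le 0 f a.
Proof.
move=> H; apply: (an_pole_order_le 0 a f f H); exists 1%R; split; first lra.
move=> z _; rewrite /=; ring.
Qed.

Lemma meromorphic_minus_at f g a : (exists m, pole_order_le m f a) ->
  (exists m, pole_order_le m g a) -> exists m, pole_order_le m (fun z => f z - g z) a.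
Proof.
move=> [m Hm] [n Hn]; exists (m + n)%nat.
have H1 := pole_order_le_mono m (m + n) a f ltac:(lia) Hm.
have H2 := pole_order_le_scal _ _ (-1) _ (pole_order_le_mono n (m + n) a g ltac:(lia) Hn).
apply: (pole_order_le_near _ _ _ _ 1 Rlt_0_1 _ (pole_order_le_plus _ _ _ _ H1 H2)).
move=> z _; ring.
Qed.

Definition zero_near (f : C -> C) (a : C) : Prop :=
  exists rho, (0 < rho)%R /\ forall z, (0 < Cmod (z - a) < rho)%R -> f z = 0.

(** Clearing the pole turns [f] into an analytic function with a zero that is
    not isolated. *)
Lemma zeros_cluster m f a : pole_order_le m f a ->
  (forall eps, (0 < eps)%R -> exists z, (0 < Cmod (z - a) < eps)%R /\ f z = 0) ->
  zero_near f a.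
Proof.
move=> /pole_order_le_an [F [r [Hr [HF EF]]]] HZ.
have [eps He|d [Hd H]] := an_eq_near a F (fun _ => 0) HF (an_const a 0).
  have Hm : (0 < Rmin eps r)%R by apply: Rmin_pos.
  case: (HZ _ Hm) => z [Hz Ez]; exists z.
  have H1 := Rmin_l eps r; have H2 := Rmin_r eps r; split; first lra.
  rewrite EF; last lra.
  rewrite Ez; ring.
exists (Rmin d r); split; first exact: Rmin_pos.
move=> z Hz; have H1 := Rmin_l d r; have H2 := Rmin_r d r.
have E := EF z ltac:(lra); rewrite H in E; last lra.
have Hn : (z - a) ^ m <> 0 by apply: Cpow_neq0; apply: Cmod_pos_neq0; lra.
replace (f z) with (/ (z - a) ^ m * ((z - a) ^ m * f z)) by (field; done).
rewrite -E; ring.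
Qed.

Lemma exists_near (p q : C) rho : (0 < rho)%R ->
  exists z, (0 < Cmod (z - p) < rho)%R /\ z <> q.
Proof.
move=> Hr.
have H : forall t, (0 < t < rho)%R -> (0 < Cmod (p + RtoC t - p) < rho)%R.
  move=> t Ht; replace (p + t - p) with (RtoC t) by ring.
  rewrite Cmod_R Rabs_pos_eq; lra.
case: (Ceq_dec (p + RtoC (rho / 2)) q) => E; last first.
  exists (p + RtoC (rho / 2)); split => //; apply: H; lra.
exists (p + RtoC (rho / 3)); split; first by apply: H; lra.
move=> E2; have : RtoC (rho / 2) = RtoC (rho / 3).
  replace (RtoC (rho / 2)) with (p + RtoC (rho / 2) - p) by ring.
  rewrite E -E2; ring.
move=> /RtoC_inj; lra.
Qed.

(** Take the supremum of the parameters up to which [f] vanishes locally.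
    Zeros accumulate there, so [f] vanishes near that point too, hence also a
    little further along the segment. *)
Lemma identity_segment f a b :
  (forall t : R, (0 <= t <= 1)%R -> exists m, pole_order_le m f (a + RtoC t * (b - a))) ->
  zero_near f a -> zero_near f b.
Proof.
move=> Hm Ha; pose p (t : R) := a + RtoC t * (b - a).
pose E (t : R) := (0 <= t <= 1)%R /\ forall s, (0 <= s <= t)%R -> zero_near f (p s).
have Hp0 : p 0%R = a by rewrite /p; ring.
have HE0 : E 0%R.
  split; first lra; move=> s Hs; replace s with 0%R by lra; by rewrite Hp0.
case: (completeness E); first by exists 1%R => t [Ht _]; lra.
  by exists 0%R.
move=> T [HT1 HT2].
have T0 : (0 <= T)%R := HT1 _ HE0.
have T1 : (T <= 1)%R by apply: HT2 => t [Ht _]; lra.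
have Hbelow : forall s, (0 <= s < T)%R -> zero_near f (p s).
  move=> s Hs; apply: NNPP => Hn.
  have : (T <= s)%R; last lra.
  apply: HT2 => t [_ Ht]; apply: Rnot_lt_le => Hst; apply: Hn; apply: Ht; lra.
set L := Cmod (b - a); have HL : (0 <= L)%R := Cmod_ge_0 _.
have Hdist : forall s t, Cmod (p s - p t) = (Rabs (s - t) * L)%R.
  move=> s t; rewrite -Cmod_R -Cmod_mult; congr Cmod; rewrite /p RtoC_minus; ring.
have HTn : zero_near f (p T).
  case: (Rle_lt_or_eq_dec _ _ T0) => [HT|<-]; last by rewrite Hp0.
  have [m Hpm] := Hm T (conj T0 T1).
  apply: (zeros_cluster m) Hpm _ => eps He.
  set d := Rmin (T / 2) (eps / (2 * (L + 1))).
  have Hd : (0 < d)%R by apply: Rmin_pos; [lra|apply: Rdiv_lt_0_compat; lra].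
  have Hd1 : (d <= T / 2)%R := Rmin_l _ _.
  have Hd2 : (d * L <= eps / 2)%R.
    have : (d <= eps / (2 * (L + 1)))%R := Rmin_r _ _.
    move=> Hd2; apply: Rle_trans (_ : (d * (L + 1) <= _)%R); first nra.
    apply: Rle_trans (_ : (eps / (2 * (L + 1)) * (L + 1) <= _)%R).
      apply: Rmult_le_compat_r; lra.
    right; field; lra.
  have [rho [Hrho Hz]] := Hbelow (T - d)%R ltac:(lra).
  have Hmin : (0 < Rmin rho (eps / 2))%R by apply: Rmin_pos; lra.
  have [z [Hz1 Hz2]] := exists_near (p (T - d)%R) (p T) _ Hmin.
  have M1 := Rmin_l rho (eps / 2); have M2 := Rmin_r rho (eps / 2).
  exists z; split; last by apply: Hz; lra.
  split.
    apply/Cmod_gt_0 => E0; apply: Hz2; replace z with (z - p T + p T) by ring.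
    rewrite -/(p T) in E0; rewrite E0; ring.
  have := Cmod_triangle (z - p (T - d)%R) (p (T - d)%R - p T).
  replace (z - p (T - d)%R + (p (T - d)%R - p T)) with (z - p T) by ring.
  rewrite Hdist Rabs_left; last lra.
  rewrite -/(p T); nra.
case: (Rle_lt_or_eq_dec _ _ T1) => [HT|E1]; last first.
  by move: HTn; rewrite E1 /p; replace (a + 1 * (b - a)) with b by ring.
exfalso; have [rho [Hrho Hz]] := HTn.
set e := Rmin ((1 - T) / 2) (rho / (2 * (L + 1))).
have He : (0 < e)%R by apply: Rmin_pos; [lra|apply: Rdiv_lt_0_compat; lra].
have He1 : (e <= (1 - T) / 2)%R := Rmin_l _ _.
have He2 : (e * L <= rho / 2)%R.
  have : (e <= rho / (2 * (L + 1)))%R := Rmin_r _ _.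
  move=> He2; apply: Rle_trans (_ : (e * (L + 1) <= _)%R); first nra.
  apply: Rle_trans (_ : (rho / (2 * (L + 1)) * (L + 1) <= _)%R).
    apply: Rmult_le_compat_r; lra.
  right; field; lra.
have : E (T + e)%R; last by move=> /HT1; lra.
split; first lra.
move=> s Hs; case: (Rlt_le_dec s T) => HsT; first by apply: Hbelow; lra.
have [m Hpm] := Hm s ltac:(lra).
apply: (zeros_cluster m) Hpm _ => eps Heps.
have Hmin : (0 < Rmin eps (rho / 2))%R by apply: Rmin_pos; lra.
have [z [Hz1 Hz2]] := exists_near (p s) (p T) _ Hmin.
have M1 := Rmin_l eps (rho / 2); have M2 := Rmin_r eps (rho / 2).
exists z; split; first by rewrite -/(p s); lra.
apply: Hz; split.
  apply/Cmod_gt_0 => E0; apply: Hz2; replace z with (z - p T + p T) by ring.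
  rewrite E0; ring.
have := Cmod_triangle (z - p s) (p s - p T).
replace (z - p s + (p s - p T)) with (z - p T) by ring.
rewrite Hdist Rabs_pos_eq; last lra.
nra.
Qed.

Lemma zero_near_eq f g a : zero_near (fun z => f z - g z) a ->
  exists r : posreal, forall z, (0 < Cmod (z - a) < r)%R -> f z = g z.
Proof.
move=> [rho [Hr H]]; exists (mkposreal rho Hr) => z Hz.
replace (f z) with (f z - g z + g z) by ring; rewrite H //; ring.
Qed.

Lemma identity_theorem f g a : meromorphic f -> meromorphic g ->
  zero_near (fun z => f z - g z) a -> mero_eq f g.
Proof.
move=> Hf Hg Ha b; apply: zero_near_eq.
apply: identity_segment Ha => t _; exact: meromorphic_minus_at.
Qed.

Lemma an_eq_at a f g : analytic_at a f -> analytic_at a g -> zero_near (fun z => f z - g z) a -> f a = g a.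
Proof.
move=> Hf Hg [rho [Hr H]].
have [eps He|d [Hd E]] := an_eq_near a f g Hf Hg.
  have Hmin : (0 < Rmin eps rho)%R by apply: Rmin_pos.
  have [z [Hz _]] := exists_near a a _ Hmin.
  have M1 := Rmin_l eps rho; have M2 := Rmin_r eps rho.
  exists z; split; first lra.
  replace (f z) with (f z - g z + g z) by ring; rewrite H; [ring|lra].
apply: E; replace (a - a) with (RtoC 0) by ring; by rewrite Cmod_0.
Qed.

Lemma an_eq_everywhere f g a : (forall z, analytic_at z f) -> (forall z, analytic_at z g) ->
  zero_near (fun z => f z - g z) a -> forall z, f z = g z.
Proof.
move=> Hf Hg Ha z; apply: an_eq_at => //.
apply: identity_segment Ha => t _; exists 0%nat; apply: an_pole0; exact: an_minus.
Qed.

Lemma mero_eq_sym f1 f2 : mero_eq f1 f2 -> mero_eq f2 f1.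
Proof. move=> H a; have [r Hr] := H a; exists r => z /Hr ->; done. Qed.

Lemma mero_eq_trans f1 f2 f3 : mero_eq f1 f2 -> mero_eq f2 f3 -> mero_eq f1 f3.
Proof.
move=> H1 H2 a; have [r Hr] := H1 a; have [s Hs] := H2 a.
have Hm : (0 < Rmin r s)%R by apply: Rmin_pos; exact: cond_pos.
exists (mkposreal _ Hm) => z /= Hz; have := Rmin_l r s; have := Rmin_r r s => A B.
rewrite Hr; last lra.
apply: Hs; lra.
Qed.

Lemma pole_order_le_mero_eq m f1 f2 a : mero_eq f1 f2 -> pole_order_le m f1 a -> pole_order_le m f2 a.
Proof. move=> /(_ a) [r Hr]; exact: pole_order_le_near (cond_pos r) Hr. Qed.

Lemma mero_eq_csum {I} (c : I -> C) (f h : I -> C -> C) l : (forall i, mero_eq (f i) (h i)) ->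
  mero_eq (fun x => csum (fun i => c i * f i x) l) (fun x => csum (fun i => c i * h i x) l).
Proof.
move=> H; elim: l => [|i l IH] a /=; first by exists (mkposreal 1 Rlt_0_1).
have [r Hr] := H i a; have [s Hs] := IH a.
have Hm : (0 < Rmin r s)%R by apply: Rmin_pos; exact: cond_pos.
exists (mkposreal _ Hm) => z /= Hz; have H1 := Rmin_l r s; have H2 := Rmin_r r s.
rewrite Hr; last lra.
rewrite Hs //; lra.
Qed.

(** * The nome and the lattice *)

(** The coordinate in which functions of period 1 become Laurent series. *)
Definition qexp (x : C) : C := Cexp (2 * RtoC PI * Ci * x).

Lemma qexp_plus x y : qexp (x + y) = qexp x * qexp y.
Proof. rewrite /qexp -Cexp_plus; congr Cexp; ring. Qed.

Lemma qexp_opp x : qexp (- x) = / qexp x.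
Proof. rewrite /qexp -Cexp_opp; congr Cexp; ring. Qed.

Lemma qexp_neq0 x : qexp x <> 0.
Proof. exact: Cexp_neq0. Qed.

Lemma qexp_0 : qexp 0 = 1.
Proof. rewrite /qexp Cmult_0_r; exact: Cexp_0. Qed.

Lemma Cmod_qexp x : Cmod (qexp x) = exp (- (2 * PI * Im x)).
Proof. rewrite /qexp Cmod_Cexp; congr exp; case: x => a b /=; ring. Qed.

Lemma qexp_nat n x : qexp (RtoC (INR n) * x) = qexp x ^ n.
Proof. rewrite /qexp Cexp_pow; congr Cexp; ring. Qed.

Lemma qexp_Z (n : Z) : qexp (RtoC (IZR n)) = 1.
Proof.
have H1 : qexp 1 = 1.
  rewrite /qexp /Cexp /=.
  have -> : ((2 * PI - 0 * 0) * 0 - (2 * 0 + 0 * PI) * 1 = 0)%R by ring.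
  rewrite !Rmult_0_l !Rmult_0_r !Rmult_1_r !Rminus_0_r !Rplus_0_r ?Rplus_0_l ?Rminus_0_l ?Ropp_0.
  rewrite exp_0 cos_2PI sin_2PI; apply: injective_projections => /=; ring.
have Hn : forall k : nat, qexp (RtoC (INR k)) = 1.
  move=> k; have := qexp_nat k 1; rewrite Cmult_1_r H1 Cpow_1_l; done.
case: (Z_le_gt_dec 0 n) => H.
  rewrite -(Z2Nat.id n H) -INR_IZR_INZ; exact: Hn.
have -> : RtoC (IZR n) = - RtoC (INR (Z.to_nat (- n))).
  rewrite INR_IZR_INZ Z2Nat.id; last lia.
  rewrite opp_IZR RtoC_opp; ring.
rewrite qexp_opp Hn; field; move=> /RtoC_inj; lra.
Qed.

Lemma qexp_eq1 x : qexp x = 1 -> exists k : Z, x = RtoC (IZR k).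
Proof.
move=> /Cexp_eq1 [k Hk]; exists k.
have HPI := PI_RGT_0.
have Hne : 2 * RtoC PI * Ci <> 0.
  move=> E; have := f_equal snd E => /=; lra.
replace x with (/ (2 * RtoC PI * Ci) * (2 * RtoC PI * Ci * x)); last first.
  rewrite Cmult_assoc Cinv_l //; ring.
rewrite Hk; replace (IZR k * (2 * PI * Ci)) with (2 * PI * Ci * IZR k) by ring.
rewrite Cmult_assoc Cinv_l //; ring.
Qed.

Lemma qexp_shift1 x : qexp (x + 1) = qexp x.
Proof. rewrite qexp_plus (qexp_Z 1); ring. Qed.

Lemma an_qexp a b : analytic_at a (fun z => qexp (z + b)).
Proof.
apply: (an_ext _ (fun z => qexp b * Cexp (2 * RtoC PI * Ci * z))).
  move=> z; rewrite qexp_plus /qexp; ring.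
apply: an_scal; exact: an_Cexp.
Qed.

(** The constant that [DeltaZ] turns out to be. *)
Definition D0 : C := - (2 * RtoC PI * Ci).

Lemma D0_neq0 : D0 <> 0.
Proof.
have HPI := PI_RGT_0.
move=> E; have := f_equal snd E; rewrite /D0 /=; lra.
Qed.

Lemma qexp_D0 x : qexp x = Cexp (- (D0 * x)).
Proof. rewrite /qexp /D0; congr Cexp; ring. Qed.

(** A function of period 1 with simple poles at the integers, tending to 1 far
    up and to 0 far down. *)
Definition kap (x : C) : C := / (1 - qexp x).

Lemma kap_neq x : qexp x <> 1 -> 1 - qexp x <> 0.
Proof.
move=> H E; apply: H; replace (qexp x) with (1 - (1 - qexp x)) by ring.
rewrite E; ring.
Qed.

Lemma an_kap a b : qexp (a + b) <> 1 -> analytic_at a (fun z => kap (z + b)).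
Proof.
move=> H; apply: an_inv; first exact: kap_neq.
apply: an_minus; [exact: an_const|exact: an_qexp].
Qed.

(** Near 0 the denominator [1 - qexp h] is [h] times an analytic function with
    value [D0] at 0. *)
Lemma kap_pole : exists v, analytic_at 0 v /\ v 0 = / D0 /\
  exists d, (0 < d)%R /\ forall h, (0 < Cmod h < d)%R -> qexp h <> 1 /\ h * kap h = v h.
Proof.
have Hr : (0 <= 1)%R by lra.
have HW := W_Cexp (2 * RtoC PI * Ci) 1 Hr.
have HC := W_plus _ _ _ _ _ _ _ Hr (W_const 1 1 Hr) (W_scal (-1) _ _ _ _ HW).
have H1 : analytic_at 0 (fun h => 1 - qexp h).
  eexists _, 1%R, _; split; first lra.
  apply: W_ext HC => h _; rewrite /qexp Cplus_0_l; ring.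
have [c [r [M [Hr0 HW0]]]] := H1.
have [u [Hu [Eu Du]]] := an_quotient _ _ H1.
have Eq : forall h, 1 - qexp h = h * u h.
  move=> h; rewrite Eu qexp_0; ring.
have Hu0 : u 0 = D0.
  have [c1 [r1 [M1 [Hr1 HW1]]]] := Hu.
  have E := W_value0 _ _ _ _ (Rlt_le _ _ Hr1) HW1; rewrite Cplus_0_l in E.
  have HS := W_shift _ _ _ _ (Rlt_le _ _ Hr1) HW1.
  have HU := W_unique _ _ _ _ _ _ _ _ Hr1 Rlt_0_1 HS HC _ 1%nat.
  rewrite E; etransitivity; first apply: HU.
    move=> eps He; have [z [Hz _]] := exists_near 0 0 _ He.
    exists z; replace (z - 0) with z in Hz by ring; split => //.
    have := Eq z; rewrite /qexp Cplus_0_l => <-; ring.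
  rewrite /D0 Cpow_1_r; have -> : RtoC (INR (fact 1)) = 1 by [].
  field; move=> /RtoC_inj; lra.
have Hne : u 0 <> 0 by rewrite Hu0; exact: D0_neq0.
exists (fun h => / u h); split; first exact: an_inv; split; first by rewrite Hu0.
have [d [Hd Hd2]] := an_neq0_near _ _ Hu Hne.
exists d; split => // h Hh.
have Hh0 : h <> 0 by apply: Cmod_pos_neq0; lra.
have Huh : u h <> 0 by apply: Hd2; replace (h - 0) with h by ring; lra.
split.
  move=> E; have := Eq h; rewrite E; replace (1 - 1) with (RtoC 0) by ring.
  move=> E0; symmetry in E0; exact: (Cmult_neq_0 _ _ Hh0 Huh E0).
rewrite /kap Eq; field; by split.
Qed.

(** The geometric series in [phi] converges in norm, as the norm of [phi] is
    at most 1/2. *)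
Lemma W_geom c r rho phi : (0 < r)%R -> (rho <= / 2)%R -> W c r rho phi ->
  exists d, W d r (2 * rho) (fun h => phi h / (1 - phi h)).
Proof.
move=> Hr Hrho HW; have H0 := W_rpos _ _ _ _ HW.
have Hp : forall i : nat, exists d, W d r (rho * (/ 2) ^ i) (fun h => phi h * phi h ^ i).
  move=> i; case: (W_pow _ _ _ _ i Hr HW) => d Hd.
  eexists; apply: W_Mle (W_mult _ _ _ _ _ _ _ Hr HW Hd).
  apply: Rmult_le_compat_l => //; apply: pow_incr; lra.
pose d i := proj1_sig (constructive_indefinite_description _ (Hp i)).
have Hd : forall i, W (d i) r (rho * (/ 2) ^ i) (fun h => phi h * phi h ^ i).
  move=> i; exact: proj2_sig (constructive_indefinite_description _ (Hp i)).
have Hlt : forall h, (Cmod h <= r)%R -> (Cmod (phi h) < 1)%R.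
  move=> h Hh; have := W_bound _ _ _ _ _ Hh HW; lra.
have [e [_ He]] := W_sum d r _ _ _ (fun h => phi h / (1 - phi h)) Hr Hd
  (bsum_scal rho _ _ H0 (bsum_geom (/ 2) ltac:(lra)))
  (fun h Hh => has_sum_scal (phi h) _ _ (has_sum_geom _ (Hlt h Hh))).
exists e; apply: W_Mle He; right; field.
Qed.

Definition Zball (N : nat) : list Z :=
  map (fun k => (Z.of_nat k - Z.of_nat N)%Z) (seq 0 (2 * N + 1)).

Lemma Zball_In N n : In n (Zball N) <-> (Z.abs_nat n <= N)%nat.
Proof.
rewrite /Zball in_map_iff; split.
  move=> [k [<- /in_seq Hk]]; lia.
move=> Hn; exists (Z.to_nat (n + Z.of_nat N)); split; first lia.
apply/in_seq; lia.
Qed.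

Lemma Zball_NoDup N : NoDup (Zball N).
Proof.
apply: FinFun.Injective_map_NoDup (seq_NoDup _ _) => x y; lia.
Qed.

(** The tail is a power series by [W_sum]; only finitely many summands, which
    may be singular, have to be taken out. *)
Lemma sum_tail_an (u : Z -> C -> C) S x0 r (M : Z -> R) B N : (0 < r)%R ->
  (forall x, (Cmod (x - x0) <= r)%R -> has_sum (fun n => u n x) (S x)) -> bsum M B ->
  (forall n, (N < Z.abs_nat n)%nat -> exists d, W d r (M n) (fun h => u n (x0 + h))) ->
  analytic_at x0 (fun x => S x - csum (fun n => u n x) (Zball N)).
Proof.
move=> Hr HS HM HT; pose L := Zball N.
have HL : forall n, ~ In n L -> (N < Z.abs_nat n)%nat.
  move=> n Hn; case: (Nat.le_gt_cases (Z.abs_nat n) N) => // H.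
  by case: Hn; apply/Zball_In.
pose t n x := match in_dec Z.eq_dec n L with left _ => RtoC 0 | right _ => u n x end.
pose s n x := match in_dec Z.eq_dec n L with left _ => u n x | right _ => RtoC 0 end.
have Hs : forall x, has_sum (fun n => s n x) (csum (fun n => u n x) L).
  move=> x; rewrite (csum_ext _ (fun n => s n x)); last first.
    by move=> n Hn; rewrite /s; case: in_dec.
  apply: has_sum_fin; first exact: Zball_NoDup.
  by move=> n Hn; rewrite /s; case: in_dec.
have HF : forall h, (Cmod h <= r)%R ->
    has_sum (fun n => t n (x0 + h)) (S (x0 + h) - csum (fun n => u n (x0 + h)) L).
  move=> h Hh; have Hx : (Cmod (x0 + h - x0) <= r)%R by replace (x0 + h - x0) with h by ring.
  apply: has_sum_ext (has_sum_minus _ _ _ _ (HS _ Hx) (Hs (x0 + h))) => n.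
  rewrite /t /s; case: in_dec => _; ring.
have HtW : forall n, exists d, W d r (M n) (fun h => t n (x0 + h)).
  move=> n; rewrite /t; case: in_dec => Hn; last by apply: HT; exact: HL.
  eexists; apply: W_Mle (W_const r 0 (Rlt_le _ _ Hr)); rewrite Cmod_0; exact: (proj1 HM).
pose d n := proj1_sig (constructive_indefinite_description _ (HtW n)).
have Hd : forall n, W (d n) r (M n) (fun h => t n (x0 + h)).
  move=> n; exact: proj2_sig (constructive_indefinite_description _ (HtW n)).
have [e [_ HW]] := W_sum d r M B _ _ Hr Hd HM HF.
by exists e, r, B.
Qed.

Section Lattice.
Variables (tau : C) (htau : (0 < Im tau)%R).

Definition qn : R := exp (- (2 * PI * Im tau)).

Lemma qn_pos : (0 < qn)%R. Proof. exact: exp_pos. Qed.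

Lemma qn_lt1 : (qn < 1)%R.
Proof.
rewrite -exp_0; apply: exp_increasing; have := PI_RGT_0; nra.
Qed.

Lemma Im_addZ x (n : Z) : Im (x + RtoC (IZR n) * tau) = (Im x + IZR n * Im tau)%R.
Proof. case: x => a b; case: tau => c d /=; ring. Qed.

Lemma exp_natmul n x : (exp x ^ n)%R = exp (INR n * x).
Proof.
elim: n => [|n IH]; first by rewrite /= Rmult_0_l exp_0.
rewrite -tech_pow_Rmult IH -exp_plus S_INR; congr exp; ring.
Qed.

Lemma abs_nat_IZR n : INR (Z.abs_nat n) = Rabs (IZR n).
Proof. by rewrite INR_IZR_INZ Zabs2Nat.id_abs abs_IZR. Qed.

Lemma Cmod_qexp_pos x n : (0 <= n)%Z ->
  Cmod (qexp (x + RtoC (IZR n) * tau)) = (Cmod (qexp x) * qn ^ Z.abs_nat n)%R.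
Proof.
move=> Hn; rewrite !Cmod_qexp Im_addZ /qn exp_natmul abs_nat_IZR -exp_plus; congr exp.
rewrite Rabs_pos_eq; first ring.
exact: IZR_le.
Qed.

Lemma Cmod_qexp_neg x n : (n <= 0)%Z ->
  Cmod (qexp (- (x + RtoC (IZR n) * tau))) = (Cmod (qexp (- x)) * qn ^ Z.abs_nat n)%R.
Proof.
move=> Hn; have := Cmod_qexp_pos (- x) (- n) ltac:(lia).
replace (Z.abs_nat (- n)) with (Z.abs_nat n) by lia.
move=> <-; congr (Cmod (qexp _)); rewrite opp_IZR RtoC_opp; ring.
Qed.

Lemma lattice_qexp x : (exists n : Z, qexp (x + RtoC (IZR n) * tau) = 1) -> in_lattice tau x.
Proof.
move=> [n /qexp_eq1 [k Hk]]; exists k, (- n)%Z.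
rewrite -Hk opp_IZR RtoC_opp; ring.
Qed.

Lemma qexp_lattice x : in_lattice tau x -> exists n : Z, qexp (x + RtoC (IZR n) * tau) = 1.
Proof.
move=> [m [n ->]]; exists (- n)%Z; rewrite opp_IZR RtoC_opp.
replace (IZR m + IZR n * tau + - IZR n * tau) with (RtoC (IZR m)) by ring.
exact: qexp_Z.
Qed.

Lemma nlat_qexp x n : ~ in_lattice tau x -> qexp (x + RtoC (IZR n) * tau) <> 1.
Proof. by move=> H E; apply: H; apply: lattice_qexp; exists n. Qed.

Lemma qexp_Im0 x : qexp x = 1 -> Im x = 0%R.
Proof. by move=> /qexp_eq1 [k ->]. Qed.

Lemma qexp_unique x n m : qexp (x + RtoC (IZR n) * tau) = 1 ->
  qexp (x + RtoC (IZR m) * tau) = 1 -> n = m.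
Proof.
move=> /qexp_Im0; rewrite Im_addZ => H1 /qexp_Im0; rewrite Im_addZ => H2.
apply: eq_IZR; nra.
Qed.

Lemma lattice_shift x k : in_lattice tau (x + RtoC (IZR k) * tau) -> in_lattice tau x.
Proof.
move=> [m [n E]]; exists m, (n - k)%Z; rewrite minus_IZR RtoC_minus.
replace x with (x + IZR k * tau - IZR k * tau) by ring; rewrite E; ring.
Qed.

Lemma lattice_shift1 x : in_lattice tau (x + 1) -> in_lattice tau x.
Proof.
move=> [m [n E]]; exists (m - 1)%Z, n; rewrite minus_IZR RtoC_minus.
replace x with (x + 1 - 1) by ring; rewrite E; ring.
Qed.

Lemma strip_not_lattice x : (0 < Im x < Im tau)%R -> ~ in_lattice tau x.
Proof.
move=> Hx [m [n E]].
have Ei : Im x = (IZR n * Im tau)%R.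
  rewrite E; case: (tau) => a b /=; ring.
have H0 : (0 < n)%Z by apply: lt_IZR; nra.
have H1 : (n < 1)%Z by apply: lt_IZR; nra.
lia.
Qed.

Lemma lattice_discrete (a : C) : exists r : posreal,
  forall z, (0 < Cmod (z - a) < r)%R -> ~ in_lattice tau z.
Proof.
set d := Rmin (/ 2) (Im tau / 2).
have Hd : (0 < d)%R by apply: Rmin_pos; lra.
have Hd1 : (d <= / 2)%R := Rmin_l _ _.
have Hd2 : (d <= Im tau / 2)%R := Rmin_r _ _.
have Huniq : forall z z', in_lattice tau z -> in_lattice tau z' ->
    (Cmod (z - a) < d)%R -> (Cmod (z' - a) < d)%R -> z = z'.
  move=> z z' [m [n Ez]] [m' [n' Ez']] Hz Hz'.
  have Hzz : (Cmod (z - z') < 2 * d)%R.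
    have := Cmod_triangle (z - a) (- (z' - a)); rewrite Cmod_opp.
    replace (z - a + - (z' - a)) with (z - z') by ring; lra.
  have HI : (Rabs (Im (z - z')) < 2 * d)%R.
    apply: Rle_lt_trans _ Hzz; apply: Rle_trans (Rmax_Cmod _); exact: Rmax_r.
  have HR : (Rabs (Re (z - z')) < 2 * d)%R.
    apply: Rle_lt_trans _ Hzz; exact: re_le_Cmod.
  have EI : Im (z - z') = (IZR (n - n') * Im tau)%R.
    rewrite Ez Ez' minus_IZR; case: (tau) => x y /=; ring.
  have Hn : n = n'.
    move: HI => /Rabs_def2; rewrite EI => -[HI1 HI2].
    have H0 : (n - n' < 1)%Z by apply: lt_IZR; nra.
    have H1 : (-1 < n - n')%Z by apply: lt_IZR; nra.
    lia.
  have ER : Re (z - z') = IZR (m - m').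
    rewrite Ez Ez' Hn minus_IZR; case: (tau) => x y /=; ring.
  have Hm : m = m'.
    move: HR => /Rabs_def2; rewrite ER => -[HI1 HI2].
    have H0 : (m - m' < 1)%Z by apply: lt_IZR; lra.
    have H1 : (-1 < m - m')%Z by apply: lt_IZR; lra.
    lia.
  by rewrite Ez Ez' Hn Hm.
case: (classic (exists z, in_lattice tau z /\ (0 < Cmod (z - a) < d)%R)) => [[z0 [Hl Hz0]]|Hno].
  exists (mkposreal _ (proj1 Hz0)) => z /= Hz Hlz.
  have E := Huniq z z0 Hlz Hl ltac:(lra) ltac:(lra); rewrite E in Hz; lra.
exists (mkposreal _ Hd) => z /= Hz Hlz; apply: Hno; by exists z.
Qed.

Lemma mero_eq_off_lattice f g : (forall x, ~ in_lattice tau x -> f x = g x) -> mero_eq f g.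
Proof.
move=> H a; have [r Hr] := lattice_discrete a; exists r => z Hz; apply: H; exact: Hr.
Qed.

(** * Lambert series *)

(** Summands of [sum_n c n * kap (x + n tau)], made convergent at [n -> +oo]
    by subtracting the limit 1 of [kap]. *)
Definition lam (n : Z) (x : C) : C :=
  kap (x + RtoC (IZR n) * tau) - (if (0 <=? n)%Z then RtoC 1 else RtoC 0).

(** Growth that the decay of [lam] compensates. *)
Definition weight (c : Z -> C) : Prop := exists rho K : R,
  (0 <= rho)%R /\ (rho * qn < 1)%R /\ forall n, (Cmod (c n) <= K * rho ^ Z.abs_nat n)%R.

Definition Lam (c : Z -> C) (x : C) : C :=
  epsilon (inhabits (RtoC 0)) (has_sum (fun n => c n * lam n x)).

(** For large [n] the geometric series of [kap] in [qexp (x + n tau)] or in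
    its inverse converges on the disc of radius 1 around [x0]. *)
Lemma W_lam x0 : exists K, (0 < K)%R /\ forall n, (K * qn ^ Z.abs_nat n <= 1)%R ->
  exists d, W d 1 (K * qn ^ Z.abs_nat n) (fun h => lam n (x0 + h)).
Proof.
pose E := exp (Cmod (2 * RtoC PI * Ci) * 1).
pose E' := exp (Cmod (- (2 * RtoC PI * Ci)) * 1).
have HE : (0 < E)%R := exp_pos _; have HE' : (0 < E')%R := exp_pos _.
have H1 := Cmod_ge_0 (qexp x0); have H2 := Cmod_ge_0 (qexp (- x0)).
set K := (2 * (Cmod (qexp x0) * E + Cmod (qexp (- x0)) * E' + 1))%R.
have HK : (0 < K)%R by rewrite /K; nra.
exists K; split => // n Hn.
have Hq : (0 <= qn ^ Z.abs_nat n)%R by apply: pow_le; left; exact: qn_pos.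
set b := (qn ^ _)%R in Hn Hq *.
have Hhalf : (K * b / 2 <= / 2)%R by lra.
case: (Z_lt_ge_dec n 0) => Hn0.
  set s := - (x0 + RtoC (IZR n) * tau).
  have HW := W_scal (qexp s) _ _ _ _ (W_Cexp (- (2 * RtoC PI * Ci)) 1 Rle_0_1).
  have Es : Cmod (qexp s) = (Cmod (qexp (- x0)) * b)%R by rewrite /s Cmod_qexp_neg //; lia.
  rewrite -/E' in HW.
  have HS : (Cmod (qexp s) * E' <= K * b / 2)%R.
    rewrite Es /K.
    have A : (0 <= Cmod (qexp x0) * E)%R by nra.
    have -> : (Cmod (qexp (- x0)) * b * E' = (Cmod (qexp (- x0)) * E') * b)%R by ring.
    nra.
  have [d Hd] := W_geom _ _ _ _ Rlt_0_1 Hhalf (W_Mle _ _ _ _ _ HS HW).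
  exists (fun n => -1 * d n).
  have := W_scal (-1) _ _ _ _ Hd.
  have -> : Cmod (-1) = 1%R by rewrite Cmod_R Rabs_left; lra.
  move=> HV; apply: W_Mle (W_ext _ _ _ _ _ _ HV); first lra.
  move=> h Hh /=.
  have Ee : qexp s * Cexp (- (2 * PI * Ci) * h) = / qexp (x0 + h + RtoC (IZR n) * tau).
    have -> : Cexp (- (2 * PI * Ci) * h) = qexp (- h) by rewrite /qexp; congr Cexp; ring.
    rewrite -qexp_plus -qexp_opp /s; congr qexp; ring.
  rewrite /lam (proj2 (Z.leb_gt 0 n)); last lia.
  rewrite /kap Ee.
  have Hlt : (Cmod (qexp s * Cexp (- (2 * PI * Ci) * h)) < 1)%R.
    have := W_bound _ _ _ _ _ Hh (W_Mle _ _ _ _ _ HS HW) => /=; lra.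
  rewrite Ee in Hlt.
  have Hx := qexp_neq0 (x0 + h + RtoC (IZR n) * tau).
  set X := qexp _ in Hlt Hx *.
  have Hx1 : X <> 1.
    move=> EX; move: Hlt; rewrite EX; replace (/ 1) with (RtoC 1) by (field; move=> /RtoC_inj; lra).
    rewrite Cmod_1; lra.
  have Hx2 : 1 - X <> 0.
    move=> E0; apply: Hx1; replace X with (1 - (1 - X)) by ring; rewrite E0; ring.
  have Hx3 : X - 1 <> 0.
    move=> E0; apply: Hx1; replace X with (X - 1 + 1) by ring; rewrite E0; ring.
  field; by auto.
set s := x0 + RtoC (IZR n) * tau.
have HW := W_scal (qexp s) _ _ _ _ (W_Cexp (2 * RtoC PI * Ci) 1 Rle_0_1).
have Es : Cmod (qexp s) = (Cmod (qexp x0) * b)%R by rewrite /s Cmod_qexp_pos //; lia.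
rewrite -/E in HW.
have HS : (Cmod (qexp s) * E <= K * b / 2)%R.
  rewrite Es /K.
  have A : (0 <= Cmod (qexp (- x0)) * E')%R by nra.
  have -> : (Cmod (qexp x0) * b * E = (Cmod (qexp x0) * E) * b)%R by ring.
  nra.
have [d Hd] := W_geom _ _ _ _ Rlt_0_1 Hhalf (W_Mle _ _ _ _ _ HS HW).
exists d; apply: W_Mle (W_ext _ _ _ _ _ _ Hd); first lra.
move=> h Hh /=.
have Ee : qexp s * Cexp (2 * PI * Ci * h) = qexp (x0 + h + RtoC (IZR n) * tau).
  rewrite -/(qexp h) -qexp_plus /s; congr qexp; ring.
rewrite /lam (proj2 (Z.leb_le 0 n)); last lia.
rewrite /kap Ee.
have Hlt : (Cmod (qexp s * Cexp (2 * PI * Ci * h)) < 1)%R.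
  have := W_bound _ _ _ _ _ Hh (W_Mle _ _ _ _ _ HS HW) => /=; lra.
rewrite Ee in Hlt; field => E0.
set X := qexp _ in Hlt E0.
have EX : X = 1 by replace X with (1 - (1 - X)) by ring; rewrite E0; ring.
rewrite EX Cmod_1 in Hlt; lra.
Qed.

Lemma pow_small (K q : R) : (0 < K)%R -> (0 <= q < 1)%R ->
  exists N, forall n, (N <= n)%nat -> (K * q ^ n <= 1)%R.
Proof.
move=> HK Hq; have Hi : (0 < / K)%R by apply: Rinv_0_lt_compat.
have [N HN] := pow_lt_1_zero q ltac:(rewrite Rabs_pos_eq; lra) _ Hi.
exists N => n Hn; have := HN n Hn; have Hp : (0 <= q ^ n)%R by apply: pow_le; lra.
rewrite Rabs_pos_eq // => H.
replace 1%R with (K * / K)%R by (field; lra).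
apply: Rmult_le_compat_l; lra.
Qed.

Lemma lam_tail x0 : exists N K, (0 < K)%R /\ forall n, (N <= Z.abs_nat n)%nat ->
  exists d, W d 1 (K * qn ^ Z.abs_nat n) (fun h => lam n (x0 + h)).
Proof.
have [K [HK HW]] := W_lam x0.
have [N HN] := pow_small K qn HK (conj (Rlt_le _ _ qn_pos) qn_lt1).
by exists N, K; split => // n /HN /HW.
Qed.

Lemma lam_bound x : exists K, (0 <= K)%R /\ forall n, (Cmod (lam n x) <= K * qn ^ Z.abs_nat n)%R.
Proof.
have [N [K [HK H]]] := lam_tail x.
have Hq := qn_pos; have Hq1 := qn_lt1.
set S := rsum (fun n => Cmod (lam n x)) (Zball N).
have HS : forall n, In n (Zball N) -> (Cmod (lam n x) <= S)%R.
  rewrite /S; elim: (Zball N) => //= m l IH n [<-|/IH Hn].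
    have : (0 <= rsum (fun n => Cmod (lam n x)) l)%R.
      elim: (l) => /= [|k l' IH']; first lra.
      have := Cmod_ge_0 (lam k x); lra.
    lra.
  have := Cmod_ge_0 (lam m x); lra.
have HS0 : (0 <= S)%R.
  apply: Rle_trans (HS 0%Z _); first exact: Cmod_ge_0.
  apply/Zball_In => /=; lia.
have HqN : (0 < / qn ^ N)%R by apply: Rinv_0_lt_compat; exact: pow_lt.
exists (S * / qn ^ N + K)%R; split; first nra.
move=> n; have Hp : (0 < qn ^ Z.abs_nat n)%R by apply: pow_lt.
case: (Nat.le_gt_cases N (Z.abs_nat n)) => Hn.
  have [d Hd] := H n Hn.
  have H01 : (Cmod 0 <= 1)%R by rewrite Cmod_0; lra.
  have := W_bound _ _ _ _ 0 H01 Hd => /=; rewrite Cplus_0_r.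
  have : (0 <= S * / qn ^ N)%R by nra.
  nra.
apply: Rle_trans (HS n _) _; first by apply/Zball_In; lia.
have Hle : (1 <= / qn ^ N * qn ^ Z.abs_nat n)%R.
  replace N with ((N - Z.abs_nat n) + Z.abs_nat n)%nat by lia.
  rewrite pow_add Rinv_mult Rmult_assoc Rinv_l; last lra.
  rewrite Rmult_1_r -{1}Rinv_1; apply: Rinv_le_contravar; first exact: pow_lt.
  rewrite -(pow1 (N - Z.abs_nat n)); apply: pow_incr; lra.
nra.
Qed.

Lemma bsum_weight c K : weight c -> (0 <= K)%R ->
  exists M, bsum (fun n => (Cmod (c n) * (K * qn ^ Z.abs_nat n))%R) M.
Proof.
move=> [rho [K' [H0 [H1 H2]]]] HK.
have Hq := qn_pos.
have HK' : (0 <= K')%R by apply: Rle_trans (Cmod_ge_0 (c 0%Z)) _; have := H2 0%Z; rewrite /= Rmult_1_r.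
have HKK : (0 <= K' * K)%R by nra.
have Hrq : (0 <= rho * qn < 1)%R by split; [nra|].
have HG := bsum_scal (K' * K) _ _ HKK (bsum_geomZ (rho * qn) Hrq).
eexists; apply: bsum_le HG => n.
have Hp : (0 <= qn ^ Z.abs_nat n)%R by apply: pow_le; lra.
split; first by apply: Rmult_le_pos; [exact: Cmod_ge_0|nra].
rewrite Rpow_mult_distr; have := H2 n.
have -> : (K' * K * (rho ^ Z.abs_nat n * qn ^ Z.abs_nat n)
  = K' * rho ^ Z.abs_nat n * (K * qn ^ Z.abs_nat n))%R by ring.
move=> H; apply: Rmult_le_compat_r => //; nra.
Qed.

Lemma Lam_spec c x : weight c -> has_sum (fun n => c n * lam n x) (Lam c x).
Proof.
move=> Hc; apply: (epsilon_spec (inhabits (RtoC 0))).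
have [K [HK H]] := lam_bound x.
have [M HM] := bsum_weight c K Hc HK.
apply: has_sum_exists HM => n; rewrite Cmod_mult.
apply: Rmult_le_compat_l; [exact: Cmod_ge_0|exact: H].
Qed.

(** Only the summand [m0] can be singular at [x0]; a tail is analytic because
    of its decay, and the finitely many other summands are analytic. *)
Lemma Lam_local c x0 m0 : weight c ->
  (forall n, n <> m0 -> qexp (x0 + RtoC (IZR n) * tau) <> 1) ->
  analytic_at x0 (fun x => Lam c x - c m0 * kap (x + RtoC (IZR m0) * tau)).
Proof.
move=> Hc Hne.
have [N0 [K [HK HT]]] := lam_tail x0.
set N := max N0 (Z.abs_nat m0).
pose L := Zball N.
have [M HM] := bsum_weight c K Hc (Rlt_le _ _ HK).
have HtW : forall n, (N < Z.abs_nat n)%nat ->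
    exists d, W d 1 (Cmod (c n) * (K * qn ^ Z.abs_nat n)) (fun h => c n * lam n (x0 + h)).
  move=> n Hn; have [d Hd] := HT n ltac:(lia).
  eexists; exact: (W_scal (c n) _ _ _ _ Hd).
pose F x := Lam c x - csum (fun n => c n * lam n x) L.
have HFan : analytic_at x0 F.
  exact: (sum_tail_an _ _ _ _ _ _ _ Rlt_0_1 (fun x _ => Lam_spec c x Hc) HM HtW).
pose u n x := match Z.eq_dec n m0 with
  | left _ => - c m0 * (if (0 <=? m0)%Z then RtoC 1 else RtoC 0)
  | right _ => c n * lam n x end.
apply: (an_ext _ (fun x => F x + csum (fun n => u n x) L)).
  move=> x; rewrite /F.
  have -> : csum (fun n => c n * lam n x) L
     = csum (fun n => u n x) L + csum (fun n => c n * lam n x - u n x) L.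
    rewrite -csum_plus; apply: csum_ext => n _; ring.
  have -> : csum (fun n => c n * lam n x - u n x) L = c m0 * kap (x + IZR m0 * tau).
    have Hz : forall n, n <> m0 -> c n * lam n x - u n x = 0.
      move=> n Hn; rewrite /u; case: Z.eq_dec => // _; ring.
    have H1 := has_sum_single m0 (fun n => c n * lam n x - u n x) Hz.
    have H2 := has_sum_fin (fun n => c n * lam n x - u n x) L (Zball_NoDup N) _.
    rewrite (has_sum_unique _ _ _ (H2 _) H1); last first.
      move=> n Hn; apply: Hz => E; apply: Hn; rewrite E; apply/Zball_In; rewrite /N; lia.
    rewrite /u; case: Z.eq_dec => // _; rewrite /lam; ring.
  ring.
apply: an_plus => //; apply: an_csum => n _; rewrite /u; case: Z.eq_dec => Hn.
  exact: an_const.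
apply: an_scal; apply: an_minus; last exact: an_const.
apply: an_kap; exact: Hne.
Qed.

Lemma Lam_an c x0 : weight c -> ~ in_lattice tau x0 -> analytic_at x0 (Lam c).
Proof.
move=> Hc Hx.
have H1 := Lam_local c x0 0 Hc (fun n _ => nlat_qexp x0 n Hx).
have H2 := an_scal _ (c 0%Z) _ (an_kap x0 (RtoC (IZR 0) * tau) (nlat_qexp x0 0 Hx)).
apply: an_ext (an_plus _ _ _ H1 H2) => z; ring.
Qed.

Lemma Lam_pole c x0 m0 : weight c -> qexp (x0 + RtoC (IZR m0) * tau) = 1 ->
  exists G, analytic_at x0 G /\ G x0 = c m0 * / D0 /\
  exists d, (0 < d)%R /\ forall z, (0 < Cmod (z - x0) < d)%R -> (z - x0) * Lam c z = G z.
Proof.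
move=> Hc E.
have H1 : analytic_at x0 (fun x => Lam c x - c m0 * kap (x + RtoC (IZR m0) * tau)).
  apply: Lam_local => // n Hn En; apply: Hn; exact: qexp_unique En E.
have [v [Hv [Hv0 [d [Hd Hk]]]]] := kap_pole.
have Hv' : analytic_at x0 (fun z => v (z - x0)).
  apply: an_shift; by replace (x0 + - x0) with (RtoC 0) by ring.
exists (fun z => (z - x0) * (Lam c z - c m0 * kap (z + RtoC (IZR m0) * tau)) + c m0 * v (z - x0)).
split.
  apply: an_plus; last exact: an_scal.
  apply: an_mult H1; apply: an_minus; [exact: an_id|exact: an_const].
split; first by replace (x0 - x0) with (RtoC 0) by ring; rewrite Hv0; ring.
exists d; split => // z Hz; have [_ <-] := Hk _ Hz.
have -> : kap (z + RtoC (IZR m0) * tau) = kap (z - x0).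
  rewrite /kap; congr (/ (1 - _)).
  replace (z + RtoC (IZR m0) * tau) with (z - x0 + (x0 + RtoC (IZR m0) * tau)) by ring.
  rewrite qexp_plus E; ring.
ring.
Qed.

Lemma Lam_pole_order c x : weight c -> pole_order_le 1 (Lam c) x.
Proof.
move=> Hc; case: (classic (in_lattice tau x)) => Hx; last first.
  apply: (pole_order_le_mono 0); first lia.
  apply: an_pole0; exact: Lam_an.
have [m0 E] := qexp_lattice x Hx.
have [G [HG [_ [d [Hd H]]]]] := Lam_pole c x m0 Hc E.
apply: (an_pole_order_le 1 x _ _ HG); exists d; split => // z Hz.
rewrite -H // Cpow_1_r; ring.
Qed.

Lemma lam_period n x : lam n (x + 1) = lam n x.
Proof.
rewrite /lam /kap.
replace (x + 1 + RtoC (IZR n) * tau) with (x + RtoC (IZR n) * tau + 1) by ring.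
by rewrite qexp_shift1.
Qed.

Lemma Lam_period c x : Lam c (x + 1) = Lam c x.
Proof.
rewrite /Lam; congr epsilon.
have -> : (fun n => c n * lam n (x + 1)) = (fun n => c n * lam n x); last done.
by apply: FunctionalExtensionality.functional_extensionality => n; rewrite lam_period.
Qed.

End Lattice.

(** * Fourier coefficients *)

Lemma qexp_real t : qexp (RtoC t) = (cos (2 * PI * t), sin (2 * PI * t)).
Proof.
rewrite /qexp /Cexp /=.
match goal with |- (exp ?a * cos ?b, _)%R = _ => replace a with 0%R by ring;
  replace b with (2 * PI * t)%R by ring end.
by rewrite exp_0 !Rmult_1_l.
Qed.

Lemma Cmod_qexp_real t : Cmod (qexp (RtoC t)) = 1%R.
Proof. by rewrite Cmod_qexp /= Rmult_0_r Ropp_0 exp_0. Qed.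

Lemma is_RInt_qexp (k : Z) :
  is_RInt (V := C_R_CompleteNormedModule) (fun t => qexp (RtoC (IZR k * t))) 0 1
    (if Z.eqb k 0 then RtoC 1 else RtoC 0).
Proof.
case: Z.eqb_spec => Hk.
  apply: (is_RInt_ext (fun _ => RtoC 1)).
    move=> t _; by rewrite Hk Rmult_0_l qexp_0.
  have := @is_RInt_const C_R_CompleteNormedModule 0 1 (RtoC 1).
  have -> : @scal _ C_R_CompleteNormedModule (1 - 0)%R (RtoC 1) = RtoC 1; last done.
  rewrite Rminus_0_r; exact: (@scal_one _ C_R_CompleteNormedModule).
have Hk' : IZR k <> 0%R by move=> /eq_IZR.
have HPI := PI_neq0.
apply: (is_RInt_ext (fun t => (cos (2 * PI * (IZR k * t)), sin (2 * PI * (IZR k * t))))).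
  by move=> t _; rewrite qexp_real.
have Es : sin (2 * PI * IZR k) = 0%R.
  have := qexp_Z k; rewrite qexp_real => E; exact: (f_equal snd E).
have Ec : cos (2 * PI * IZR k) = 1%R.
  have := qexp_Z k; rewrite qexp_real => E; exact: (f_equal fst E).
apply: (is_RInt_fct_extend_pair (U := R_NormedModule) (V := R_NormedModule)) => /=.
  have H : is_RInt (fun t => cos (2 * PI * (IZR k * t))) 0 1
     (minus (sin (2 * PI * (IZR k * 1)) / (2 * PI * IZR k))
            (sin (2 * PI * (IZR k * 0)) / (2 * PI * IZR k)))%R.
    apply: (is_RInt_derive (fun t => sin (2 * PI * (IZR k * t)) / (2 * PI * IZR k))%R).
      move=> t _; auto_derive => //; field; by split.
    move=> t _; apply: ex_derive_continuous; by auto_derive.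
  move: H; rewrite /minus /plus /opp /= Rmult_1_r !Rmult_0_r sin_0 Es.
  by have -> : (0 / (2 * PI * IZR k) + - (0 / (2 * PI * IZR k)) = 0)%R by rewrite /Rdiv; ring.
have H : is_RInt (fun t => sin (2 * PI * (IZR k * t))) 0 1
   (minus (- cos (2 * PI * (IZR k * 1)) / (2 * PI * IZR k))
          (- cos (2 * PI * (IZR k * 0)) / (2 * PI * IZR k)))%R.
  apply: (is_RInt_derive (fun t => - cos (2 * PI * (IZR k * t)) / (2 * PI * IZR k))%R).
    move=> t _; auto_derive => //; field; by split.
  move=> t _; apply: ex_derive_continuous; by auto_derive.
move: H; rewrite /minus /plus /opp /= Rmult_1_r !Rmult_0_r cos_0 Ec.
by have -> : (- (1) / (2 * PI * IZR k) + - (- (1) / (2 * PI * IZR k)) = 0)%R by rewrite /Rdiv; ring.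
Qed.

Lemma is_RInt_Cscal (f : R -> C) a b k l :
  is_RInt (V := C_R_CompleteNormedModule) f a b l ->
  is_RInt (V := C_R_CompleteNormedModule) (fun t => k * f t) a b (k * l).
Proof.
move=> H; have H1 := is_RInt_fct_extend_fst (U := R_NormedModule) (V := R_NormedModule) _ _ _ _ H.
have H2 := is_RInt_fct_extend_snd (U := R_NormedModule) (V := R_NormedModule) _ _ _ _ H.
apply: (is_RInt_fct_extend_pair (U := R_NormedModule) (V := R_NormedModule)) => /=.
  exact: (is_RInt_minus _ _ _ _ _ _ (is_RInt_scal _ _ _ (fst k) _ H1) (is_RInt_scal _ _ _ (snd k) _ H2)).
exact: (is_RInt_plus _ _ _ _ _ _ (is_RInt_scal _ _ _ (fst k) _ H2) (is_RInt_scal _ _ _ (snd k) _ H1)).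
Qed.

(** Convergence is uniform, so the integral may be taken term by term, and
    only the constant term contributes. *)
Lemma is_RInt_fourier (c : Z -> C) M (phi : R -> C) : bsum (fun k => Cmod (c k)) M ->
  (forall t, has_sum (fun k => c k * qexp (RtoC (IZR k * t))) (phi t)) ->
  is_RInt (V := C_R_CompleteNormedModule) phi 0 1 (c 0%Z).
Proof.
move=> HM Hphi.
pose f (N : nat) t := csum (fun k => c k * qexp (RtoC (IZR k * t))) (Zball N).
have Hf : forall N, is_RInt (V := C_R_CompleteNormedModule) (f N) 0 1 (c 0%Z).
  move=> N.
  have -> : c 0%Z = csum (fun k => c k * (if Z.eqb k 0 then RtoC 1 else RtoC 0)) (Zball N).
    have Hz : forall k, k <> 0%Z -> c k * (if Z.eqb k 0 then RtoC 1 else RtoC 0) = 0.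
      move=> k Hk; case: Z.eqb_spec => // _; ring.
    have H1 := has_sum_single 0%Z _ Hz.
    have H2 := has_sum_fin (fun k => c k * (if Z.eqb k 0 then RtoC 1 else RtoC 0)) (Zball N) (Zball_NoDup N) _.
    rewrite (has_sum_unique _ _ _ (H2 _) H1) /=; first by ring.
    move=> i Hi; apply: Hz => E; apply: Hi; rewrite E; apply/Zball_In => /=; lia.
  rewrite /f; elim: (Zball N) => [|k l IH] /=.
    have := @is_RInt_const C_R_CompleteNormedModule 0 1 (RtoC 0).
    have -> : @scal _ C_R_CompleteNormedModule (1 - 0)%R (RtoC 0) = RtoC 0; last done.
    rewrite Rminus_0_r; exact: (@scal_one _ C_R_CompleteNormedModule).
  apply: (@is_RInt_plus C_R_CompleteNormedModule) IH.
  apply: is_RInt_Cscal; exact: is_RInt_qexp.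
have HU : filterlim f eventually (@locally (fct_UniformSpace R C_R_CompleteNormedModule) phi).
  apply/filterlim_locally => eps.
  have [s Hs] := has_sum_nonneg _ _ HM.
  have He2 : (0 < eps / 4)%R by have := cond_pos eps; lra.
  case: (Hs _ He2) => l0 Hl0.
  have [N0 HN0] : exists N, incl l0 (Zball N).
    elim: (l0) => [|k l [N HN]]; first by exists 0%nat.
    exists (max N (Z.abs_nat k)) => x [<-|Hx]; apply/Zball_In; first lia.
    have := HN x Hx => /Zball_In; lia.
  exists N0 => N HN t.
  apply: C_NormedModule_mixin_compat1; rewrite /minus /plus /opp /=.
  have Hincl : incl l0 (Zball N).
    move=> x /HN0 /Zball_In Hx; apply/Zball_In; lia.
  case: (Hphi t _ He2) => l1 Hl1.
  case: (join_list l1 (Zball N)) => l [Hn [Hi1 Hi2]].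
  have A := Hl1 l Hn Hi1.
  case: (split_incl _ _ (Zball_NoDup N) Hn Hi2) => l2 [Hn2 Hp].
  have B1 := Hl0 l Hn (fun x Hx => Hi2 x (Hincl x Hx)).
  have B2 := Hl0 (Zball N) (Zball_NoDup N) Hincl.
  have ER : forall m, csum (fun k => RtoC (Cmod (c k))) m = RtoC (rsum (fun k => Cmod (c k)) m).
    elim=> //= x m ->; by rewrite RtoC_plus.
  have B3 : (rsum (fun k => Cmod (c k)) l2 < eps / 2)%R.
    move: B1 B2; rewrite (csum_perm _ _ _ Hp) csum_app !ER.
    set u := rsum _ (Zball N); set v := rsum _ l2 => B1 B2.
    have := Cmod_triangle (u + v - s) (- (u - s)); rewrite Cmod_opp.
    replace (u + v - s + - (u - s)) with (RtoC v) by ring.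
    rewrite Cmod_R; have := Rle_abs v; lra.
  move: A; rewrite (csum_perm _ _ _ Hp) csum_app -/(f N t) => A.
  set w := csum _ l2 in A.
  have Hw : (Cmod w < eps / 2)%R.
    apply: Rle_lt_trans B3; apply: Rle_trans (Cmod_csum _ _) _.
    apply: rsum_le => k _; rewrite Cmod_mult Cmod_qexp_real; lra.
  have := Cmod_triangle (f N t + w - phi t) (- w); rewrite Cmod_opp.
  replace (f N t + w - phi t + - w) with (f N t + - phi t) by ring.
  lra.
have [If [HIf HI]] := @filterlim_RInt nat C_R_CompleteNormedModule f 0 1 eventually _ phi (fun _ => c 0%Z) Hf HU.
suff -> : c 0%Z = If by [].
apply: (filterlim_locally_unique (K := R_AbsRing) (V := C_R_CompleteNormedModule) _ _ _ _ HIf).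
exact: filterlim_const.
Qed.

(** * The theta function *)

Section Theta.
Variables (tau : C) (htau : (0 < Im tau)%R).

Definition nu (n : Z) : C := RtoC (IZR n + / 2)%R.

Definition sg (n : Z) : C := RtoC (powerRZ (-1) n).

Definition tcoef (n : Z) : C := sg n * Cexp (RtoC PI * Ci * tau * nu n ^ 2).

Definition tterm (n : Z) (x : C) : C := tcoef n * qexp (nu n * x).

Lemma sg_add m n : sg (m + n) = sg m * sg n.
Proof. rewrite /sg powerRZ_add; [by rewrite RtoC_mult|lra]. Qed.

Lemma sg_sqr n : sg n * sg n = 1.
Proof.
rewrite /sg -RtoC_mult -powerRZ_mult.
replace (-1 * -1)%R with 1%R by ring.
by rewrite powerRZ_R1.
Qed.

Lemma nu_add n m : nu (n + m) = nu n + RtoC (IZR m).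
Proof. rewrite /nu -RtoC_plus plus_IZR; congr RtoC; ring. Qed.

Definition nuR (n : Z) : R := (IZR n + / 2)%R.

Lemma Cmod_tcoef n : Cmod (tcoef n) = exp (- (PI * Im tau * nuR n ^ 2)).
Proof.
rewrite /tcoef Cmod_mult Cmod_Cexp.
have -> : Cmod (sg n) = 1%R.
  have E := sg_sqr n; have := Cmod_mult (sg n) (sg n); rewrite E Cmod_1 => H.
  have := Cmod_ge_0 (sg n); nra.
rewrite Rmult_1_l; congr exp; rewrite /nu -/(nuR n) -RtoC_pow.
case: (tau) => a b /=; ring.
Qed.

Lemma Cmod_qexp_nu n x : Cmod (qexp (nu n * x)) = exp (- (2 * PI * nuR n * Im x)).
Proof.
rewrite Cmod_qexp; congr exp; rewrite /nu -/(nuR n); case: x => a b /=; ring.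
Qed.

Lemma tcoef_neq0 n : tcoef n <> 0.
Proof. apply: Cmod_pos_neq0; rewrite Cmod_tcoef; exact: exp_pos. Qed.

Lemma exp_mono x y : (x <= y)%R -> (exp x <= exp y)%R.
Proof. move=> [H|->]; [left; exact: exp_increasing|exact: Rle_refl]. Qed.

(** Complete the square: Gaussian decay beats every exponential. *)
Lemma gauss_bound (B : R) : exists K, (0 < K)%R /\ forall n,
  (exp (- (PI * Im tau * nuR n ^ 2) + 2 * PI * B * Rabs (nuR n)) <= K * exp (-1) ^ Z.abs_nat n)%R.
Proof.
have HPI := PI_RGT_0.
set al := (PI * Im tau)%R; have Hal : (0 < al)%R by apply: Rmult_lt_0_compat.
set be := (2 * PI * B)%R.
exists (exp ((be + 1) ^ 2 / (4 * al) + / 2)); split; first exact: exp_pos.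
move=> n; rewrite exp_natmul -exp_plus; apply: exp_mono.
rewrite abs_nat_IZR.
have Habs : (Rabs (IZR n) <= Rabs (nuR n) + / 2)%R.
  replace (IZR n) with (nuR n + - / 2)%R by (rewrite /nuR; ring).
  apply: Rle_trans (Rabs_triang _ _) _; rewrite Rabs_Ropp (Rabs_pos_eq (/ 2)); lra.
have Esq : (nuR n ^ 2 = Rabs (nuR n) ^ 2)%R by rewrite pow2_abs.
rewrite Esq; set v := Rabs (nuR n) in Habs *.
have Hq : (0 <= (2 * al * v - (be + 1)) ^ 2 / (4 * al))%R.
  apply: Rmult_le_pos; first exact: pow2_ge_0.
  left; apply: Rinv_0_lt_compat; lra.
have E : ((2 * al * v - (be + 1)) ^ 2 / (4 * al)
   = al * v ^ 2 - (be + 1) * v + (be + 1) ^ 2 / (4 * al))%R by field; lra.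
lra.
Qed.

Lemma tterm_gauss n x :
  (Cmod (tterm n x) <= exp (- (PI * Im tau * nuR n ^ 2) + 2 * PI * Rabs (Im x) * Rabs (nuR n)))%R.
Proof.
rewrite /tterm Cmod_mult Cmod_tcoef Cmod_qexp_nu -exp_plus; apply: exp_mono.
have := Rle_abs (- (nuR n * Im x)); rewrite Rabs_Ropp Rabs_mult.
have := PI_RGT_0; nra.
Qed.

Lemma exp_m1 : (0 <= exp (-1) < 1)%R.
Proof. split; [left; exact: exp_pos|rewrite -exp_0; apply: exp_increasing; lra]. Qed.

Lemma tterm_bsum x : exists M, bsum (fun n => Cmod (tterm n x)) M.
Proof.
have [K [HK H]] := gauss_bound (Rabs (Im x)).
eexists; apply: bsum_le (bsum_scal K _ _ (Rlt_le _ _ HK) (bsum_geomZ _ exp_m1)) => n.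
split; first exact: Cmod_ge_0.
apply: Rle_trans (tterm_gauss n x) (H n).
Qed.

Lemma theta_spec x : has_sum (fun n => tterm n x) (theta tau x).
Proof.
have [M HM] := tterm_bsum x.
have [s Hs] := has_sum_exists _ _ M (fun n => Rle_refl (Cmod (tterm n x))) HM.
suff -> : theta tau x = s by [].
rewrite /theta -(has_sum_ZSeries _ _ M _ (fun n => Rle_refl _) HM Hs).
congr ZSeries; apply: FunctionalExtensionality.functional_extensionality => n.
rewrite /tterm /tcoef /sg /qexp -/(nu n); congr (_ * Cexp _); ring.
Qed.

Lemma theta_an x0 : analytic_at x0 (theta tau).
Proof.
have [K [HK H]] := gauss_bound (Rabs (Im x0) + 1).
pose N n := exp (Cmod (2 * RtoC PI * Ci * nu n) * 1).
have HN : forall n, N n = exp (2 * PI * Rabs (nuR n)).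
  move=> n; rewrite /N; congr exp; rewrite /nu -/(nuR n) !Cmod_mult Cmod_Ci !Cmod_R.
  have HPI := PI_RGT_0; rewrite (Rabs_pos_eq 2); last lra.
  rewrite (Rabs_pos_eq PI); [ring|lra].
have HW : forall n, W (fun j => tterm n x0 * (/ RtoC (INR (fact j)) * (2 * RtoC PI * Ci * nu n) ^ j)) 1
    (Cmod (tterm n x0) * N n) (fun h => tterm n (x0 + h)).
  move=> n; apply: W_ext (W_scal (tterm n x0) _ _ _ _ (W_Cexp (2 * RtoC PI * Ci * nu n) 1 Rle_0_1)).
  move=> h _; rewrite /tterm Cmult_plus_distr_l qexp_plus {3}/qexp.
  have -> : 2 * PI * Ci * (nu n * h) = 2 * PI * Ci * nu n * h by ring.
  ring.
have HS : bsum (fun n => (Cmod (tterm n x0) * N n)%R) (K * (2 / (1 - exp (-1)))).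
  apply: bsum_le (bsum_scal K _ _ (Rlt_le _ _ HK) (bsum_geomZ _ exp_m1)) => n.
  have HNp : (0 < N n)%R := exp_pos _.
  have H0 := Cmod_ge_0 (tterm n x0).
  split; first nra.
  apply: Rle_trans (H n); rewrite HN.
  replace (- (PI * Im tau * nuR n ^ 2) + 2 * PI * (Rabs (Im x0) + 1) * Rabs (nuR n))%R
   with (- (PI * Im tau * nuR n ^ 2) + 2 * PI * Rabs (Im x0) * Rabs (nuR n) + 2 * PI * Rabs (nuR n))%R by ring.
  rewrite exp_plus; apply: Rmult_le_compat_r; first by left; exact: exp_pos.
  exact: tterm_gauss.
have [d [_ Hd]] := W_sum _ 1 _ _ _ (fun h => theta tau (x0 + h)) Rlt_0_1 HW HS
  (fun h _ => theta_spec (x0 + h)).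
by exists d, 1%R, (K * (2 / (1 - exp (-1))))%R; split => //; lra.
Qed.

Lemma sg_opp n : sg (- n - 1) = - sg n.
Proof.
have E : sg (- n - 1) * sg n = -1.
  rewrite -sg_add; replace (- n - 1 + n)%Z with (-1)%Z by lia.
  rewrite /sg /=; congr RtoC; field.
transitivity (sg (- n - 1) * (sg n * sg n)); first by rewrite sg_sqr; ring.
rewrite Cmult_assoc E; ring.
Qed.

Lemma nu_opp n : nu (- n - 1) = - nu n.
Proof. rewrite /nu -RtoC_opp minus_IZR opp_IZR; congr RtoC; field. Qed.

Lemma tcoef_opp n : tcoef (- n - 1) = - tcoef n.
Proof.
rewrite /tcoef sg_opp nu_opp.
have -> : (- nu n) ^ 2 = nu n ^ 2 by ring.
ring.
Qed.

Lemma tterm_0 n : tterm n 0 = tcoef n.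
Proof. rewrite /tterm Cmult_0_r qexp_0; ring. Qed.

Lemma tcoef_bsum : exists M, bsum (fun n => Cmod (tcoef n)) M.
Proof.
have [M HM] := tterm_bsum 0; exists M; apply: bsum_le HM => n.
rewrite tterm_0; split; [exact: Cmod_ge_0|exact: Rle_refl].
Qed.

(** Theta is odd. *)
Lemma theta_0 : theta tau 0 = 0.
Proof.
have H := theta_spec 0.
have H2 : has_sum (fun n => tterm n 0) (- theta tau 0).
  apply: (has_sum_reindex (fun n => - n - 1)%Z (fun n => - n - 1)%Z); try by move=> n; lia.
  apply: has_sum_ext (has_sum_opp _ _ H) => n; by rewrite !tterm_0 tcoef_opp.
have E := has_sum_unique _ _ _ H H2.
have : 2 * theta tau 0 = 0.
  have -> : 2 * theta tau 0 = theta tau 0 - (- theta tau 0) by ring.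
  rewrite -E; ring.
move=> E2; replace (theta tau 0) with (/ 2 * (2 * theta tau 0)).
  rewrite E2; ring.
field; move=> /RtoC_inj; lra.
Qed.

Definition beta (j : Z) : C :=
  epsilon (inhabits (RtoC 0)) (has_sum (fun i => tcoef (j - Z.of_nat i))).

Lemma beta_spec j : has_sum (fun i => tcoef (j - Z.of_nat i)) (beta j).
Proof.
apply: (epsilon_spec (inhabits (RtoC 0))).
have [M HM] := tcoef_bsum.
apply: (has_sum_exists _ (fun i => Cmod (tcoef (j - Z.of_nat i))) M) => [i|]; first lra.
apply: (bsum_inj (fun i => (j - Z.of_nat i)%Z) (fun n => Cmod (tcoef n))) => // x y; lia.
Qed.

Lemma beta_rec j : beta j = tcoef j + beta (j - 1).
Proof.
apply: (has_sum_unique _ _ _ (beta_spec j)).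
replace (tcoef j) with (tcoef (j - Z.of_nat 0)) by (congr tcoef; lia).
apply: (has_sum_shift (fun i => tcoef (j - Z.of_nat i))).
apply: has_sum_ext (beta_spec (j - 1)) => i; congr tcoef; lia.
Qed.

(** The coefficients of theta add up to [theta tau 0 = 0], so a partial sum
    can also be computed from the other end. *)
Lemma beta_compl j : has_sum (fun i => tcoef (j + 1 + Z.of_nat i)) (- beta j).
Proof.
have [M HM] := tcoef_bsum.
have H0 : has_sum (fun n => tcoef n) 0.
  rewrite -theta_0; apply: has_sum_ext (theta_spec 0) => n; exact: tterm_0.
have H1 := has_sum_Zshift _ (j + 1) _ H0.
have HM1 : bsum (fun n => Cmod (tcoef (n + (j + 1)))) M.
  apply: (bsum_inj (fun n => (n + (j + 1))%Z) (fun n => Cmod (tcoef n))) => // x y; lia.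
have [u [v [Hu [Hv E]]]] := has_sum_Z_halves _ _ _ _ (fun n => Rle_refl _) HM1 H1.
have Ev : v = beta j.
  apply: (has_sum_unique _ _ _ Hv); apply: has_sum_ext (beta_spec j) => i; congr tcoef; lia.
have -> : - beta j = u.
  replace u with (u + v - v) by ring; rewrite -E Ev; ring.
apply: has_sum_ext Hu => i; congr tcoef; lia.
Qed.

Lemma tcoef_decay j k (m : nat) : (nuR j ^ 2 + 2 * INR m <= nuR k ^ 2)%R ->
  (Cmod (tcoef k) <= Cmod (tcoef j) * qn tau ^ m)%R.
Proof.
move=> H; rewrite !Cmod_tcoef /qn exp_natmul -exp_plus; apply: exp_mono.
have := PI_RGT_0 => HPI; have : (0 < PI * Im tau)%R by apply: Rmult_lt_0_compat.
nra.
Qed.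

(** Sum the coefficients from the side on which they decrease. *)
Lemma beta_bound j : (Cmod (beta j) <=
  Cmod (tcoef j) * (if (0 <=? j)%Z then qn tau ^ Z.abs_nat j else 1) * / (1 - qn tau))%R.
Proof.
have Hq := qn_pos tau; have Hq1 := qn_lt1 tau htau.
have HG := bsum_geom (qn tau) ltac:(lra).
have Ht := Cmod_ge_0 (tcoef j).
case: Z.leb_spec => Hj.
  rewrite -Cmod_opp.
  have Hq2 : (0 <= Cmod (tcoef j) * qn tau ^ Z.abs_nat j)%R.
    apply: Rmult_le_pos => //; apply: pow_le; lra.
  apply: (has_sum_bound _ _ _ _ _ (bsum_scal _ _ _ Hq2 HG) (beta_compl j)) => i.
  rewrite Rmult_assoc -pow_add; apply: tcoef_decay.
  rewrite plus_INR abs_nat_IZR Rabs_pos_eq; last exact: IZR_le.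
  rewrite /nuR !plus_IZR -INR_IZR_INZ.
  have := pos_INR i; have := IZR_le _ _ Hj => A B; nra.
rewrite Rmult_1_r.
apply: (has_sum_bound _ _ _ _ _ (bsum_scal _ _ _ Ht HG) (beta_spec j)) => i.
apply: tcoef_decay.
have Hj1 : (IZR j <= -1)%R by apply: IZR_le; lia.
rewrite /nuR minus_IZR -INR_IZR_INZ.
case: i => [|i]; first by rewrite /=; nra.
have := pos_INR i; rewrite S_INR => B; nra.
Qed.

Lemma beta_bound_crude j : (Cmod (beta j) <= Cmod (tcoef j) * / (1 - qn tau))%R.
Proof.
have Hq := qn_pos tau; have Hq1 := qn_lt1 tau htau.
have Ht := Cmod_ge_0 (tcoef j).
apply: Rle_trans (beta_bound j) _; apply: Rmult_le_compat_r.
  left; apply: Rinv_0_lt_compat; lra.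
case: Z.leb_spec => Hj; last lra.
have : (qn tau ^ Z.abs_nat j <= 1)%R.
  rewrite -(pow1 (Z.abs_nat j)); apply: pow_incr; lra.
nra.
Qed.

(** Since theta vanishes at the lattice, [theta * kap] is entire; its Laurent
    coefficients in [qexp u] are the partial sums [beta] of those of theta. *)
Lemma theta_kap u : qexp u <> 1 ->
  has_sum (fun j => beta j * qexp (nu j * u)) (theta tau u * kap u).
Proof.
move=> Hu; have [M HM] := tterm_bsum u.
have Hq := qn_pos tau; have Hq1 := qn_lt1 tau htau.
have Hi : (0 <= / (1 - qn tau))%R by left; apply: Rinv_0_lt_compat; lra.
have [s Hs] : exists s, has_sum (fun j => beta j * qexp (nu j * u)) s.
  apply: (has_sum_exists _ _ _ _ (bsum_scal _ _ _ Hi HM)) => j.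
  cbv beta; rewrite /tterm (Cmod_mult (beta j)) (Cmod_mult (tcoef j)).
  have B := beta_bound_crude j.
  apply: Rle_trans (Rmult_le_compat_r _ _ _ (Cmod_ge_0 (qexp (nu j * u))) B) _; right; ring.
have H1 : has_sum (fun j => tterm j u) (s - qexp u * s).
  have H2 := has_sum_Zshift _ (-1) _ (has_sum_scal (qexp u) _ _ Hs).
  apply: has_sum_ext (has_sum_minus _ _ _ _ Hs H2) => j.
  rewrite /tterm beta_rec.
  replace (j + -1)%Z with (j - 1)%Z by lia.
  have -> : qexp u * (beta (j - 1) * qexp (nu (j - 1) * u)) = beta (j - 1) * qexp (nu j * u).
    have -> : qexp (nu j * u) = qexp u * qexp (nu (j - 1) * u).
      rewrite -qexp_plus; congr qexp; replace (nu j) with (nu ((j - 1) + 1)) by (congr nu; lia).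
      rewrite nu_add; ring.
    ring.
  ring.
have E := has_sum_unique _ _ _ H1 (theta_spec u).
have -> : theta tau u * kap u = s; last done.
rewrite -E /kap; field; exact: kap_neq.
Qed.

(** The factor of quasi-periodicity of theta. *)
Definition qfac (n : Z) (x : C) : C :=
  sg n * qexp (RtoC (IZR n) * x + RtoC (IZR n) ^ 2 * tau / 2).

Lemma tterm_shift n j x :
  tterm (n + j) x = qfac n x * tterm j (x + RtoC (IZR n) * tau).
Proof.
rewrite /tterm /tcoef /qfac Z.add_comm sg_add.
have -> : qexp (nu (j + n) * x) = qexp (RtoC (IZR n) * x) * qexp (nu j * x).
  rewrite -qexp_plus nu_add; congr qexp; ring.
rewrite Cmult_plus_distr_l !qexp_plus.
suff -> : Cexp (PI * Ci * tau * nu (j + n) ^ 2) =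
   qexp (RtoC (IZR n) ^ 2 * tau / 2) * qexp (nu j * (IZR n * tau)) * Cexp (PI * Ci * tau * nu j ^ 2).
  ring.
rewrite /qexp -!Cexp_plus nu_add; congr Cexp; field.
Qed.

Lemma theta_shift n x : theta tau x = qfac n x * theta tau (x + RtoC (IZR n) * tau).
Proof.
apply: (has_sum_unique _ _ _ (has_sum_Zshift _ n _ (theta_spec x))).
apply: has_sum_ext (has_sum_scal (qfac n x) _ _ (theta_spec (x + IZR n * tau))) => j.
by rewrite Z.add_comm tterm_shift.
Qed.

(** Multiply the series of [theta (x + y)] by the series
    [sum_j beta j / tcoef j * qexp (- nu j * y)] and collect the terms whose
    indices differ by [n]: quasi-periodicity turns each such row into
    [qexp (n y) * kap (x + n tau) * theta x]. *)
Lemma kronecker_sum y : (0 < Im y < Im tau)%R -> exists gam, forall x,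
  (forall n, qexp (x + RtoC (IZR n) * tau) <> 1) ->
  has_sum (fun n => qexp (RtoC (IZR n) * y) * kap (x + RtoC (IZR n) * tau) * theta tau x)
    (theta tau (x + y) * gam).
Proof.
move=> Hy; pose b j := beta j / tcoef j * qexp (- (nu j * y)).
have Hq := qn_pos tau; have Hq1 := qn_lt1 tau htau; have HPI := PI_RGT_0.
set Y := exp (2 * PI * Im y).
have HY : (1 < Y)%R by rewrite -exp_0; apply: exp_increasing; nra.
have HqY : (qn tau * Y < 1)%R.
  rewrite /qn /Y -exp_plus -exp_0; apply: exp_increasing; nra.
set rho := Rmax (qn tau * Y) (/ Y).
have Hrho : (0 <= rho < 1)%R.
  split; first by apply: Rle_trans (Rmax_l _ _); nra.
  apply: Rmax_lub_lt => //; rewrite -Rinv_1; apply: Rinv_lt_contravar; lra.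
set H := exp (PI * Im y).
have Hb : forall j, (Cmod (b j) <= (/ (1 - qn tau) * H) * rho ^ Z.abs_nat j)%R.
  move=> j; rewrite /b Cmod_mult Cmod_div; last exact: tcoef_neq0.
  have Ht : (0 < Cmod (tcoef j))%R by apply/Cmod_gt_0; exact: tcoef_neq0.
  have Ee : Cmod (qexp (- (nu j * y))) = (H * exp (2 * PI * Im y * IZR j))%R.
    rewrite qexp_opp Cmod_inv; last exact: qexp_neq0.
    rewrite Cmod_qexp_nu -exp_Ropp /H -exp_plus; congr exp; rewrite /nuR; field.
  have HH : (0 < H)%R := exp_pos _.
  have Hi : (0 < / (1 - qn tau))%R by apply: Rinv_0_lt_compat; lra.
  have HB := beta_bound j.
  have HB2 : (Cmod (beta j) / Cmod (tcoef j) <=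
     (if (0 <=? j)%Z then qn tau ^ Z.abs_nat j else 1) * / (1 - qn tau))%R.
    apply: (Rmult_le_reg_r _ _ _ Ht).
    replace (Cmod (beta j) / Cmod (tcoef j) * Cmod (tcoef j))%R with (Cmod (beta j)) by (field; lra).
    apply: Rle_trans HB _; right; ring.
  have Hpow : ((if (0 <=? j)%Z then qn tau ^ Z.abs_nat j else 1) * exp (2 * PI * Im y * IZR j)
      <= rho ^ Z.abs_nat j)%R.
    case: Z.leb_spec => Hj.
      have -> : (exp (2 * PI * Im y * IZR j) = Y ^ Z.abs_nat j)%R.
        rewrite /Y exp_natmul abs_nat_IZR Rabs_pos_eq; [congr exp; ring|exact: IZR_le].
      rewrite -Rpow_mult_distr; apply: pow_incr; split; [nra|exact: Rmax_l].
    have -> : (exp (2 * PI * Im y * IZR j) = (/ Y) ^ Z.abs_nat j)%R.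
      rewrite /Y -exp_Ropp exp_natmul abs_nat_IZR Rabs_left; [congr exp; ring|exact: IZR_lt].
    rewrite Rmult_1_l; apply: pow_incr; split; [left; apply: Rinv_0_lt_compat; lra|exact: Rmax_r].
  rewrite Ee.
  set X := (if _ then _ else _)%R in HB2 Hpow.
  set Z0 := exp _ in Hpow *.
  have HZ0 : (0 < Z0)%R := exp_pos _.
  apply: Rle_trans (_ : (X * / (1 - qn tau) * (H * Z0) <= _)%R).
    apply: Rmult_le_compat_r => //; nra.
  have -> : (X * / (1 - qn tau) * (H * Z0) = / (1 - qn tau) * H * (X * Z0))%R by ring.
  apply: Rmult_le_compat_l => //; nra.
have HKb : (0 <= / (1 - qn tau) * H)%R.
  apply: Rmult_le_pos; [left; apply: Rinv_0_lt_compat; lra|left; exact: exp_pos].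
have HMb : bsum (fun j => Cmod (b j)) (/ (1 - qn tau) * H * (2 / (1 - rho))).
  apply: bsum_le (bsum_scal _ _ _ HKb (bsum_geomZ _ Hrho)) => j.
  split; [exact: Cmod_ge_0|exact: Hb].
have [gam Hgam] := has_sum_exists _ _ _ (fun j => Rle_refl (Cmod (b j))) HMb.
exists gam => x Hx.
have [M HM] := tterm_bsum (x + y).
have HP := has_sum_prod _ _ _ _ _ _ HM HMb (theta_spec (x + y)) Hgam.
have HR : has_sum (fun p : Z * Z => tterm (fst p + snd p) (x + y) * b (snd p)) (theta tau (x + y) * gam).
  apply: (has_sum_reindex (fun p : Z * Z => (fst p - snd p, snd p)%Z)
    (fun p : Z * Z => (fst p + snd p, snd p)%Z)).
  - move=> [m n] /=; congr pair; lia.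
  - move=> [m n] /=; congr pair; lia.
  apply: has_sum_ext HP => -[m n] /=; by replace (m - n + n)%Z with m by lia.
apply: (has_sum_pairs _ _ _ HR) => n /=.
have Hrow := has_sum_scal (qexp (RtoC (IZR n) * y) * qfac n x) _ _ (theta_kap _ (Hx n)).
have -> : qexp (IZR n * y) * kap (x + IZR n * tau) * theta tau x =
  qexp (IZR n * y) * qfac n x * (theta tau (x + IZR n * tau) * kap (x + IZR n * tau)).
  rewrite {1}(theta_shift n x); ring.
apply: has_sum_ext Hrow => j.
rewrite tterm_shift /b /tterm.
have Ht := tcoef_neq0 j.
have -> : qfac n (x + y) = qexp (IZR n * y) * qfac n x.
  rewrite /qfac; have -> : qexp (IZR n * y) * (sg n * qexp (IZR n * x + IZR n ^ 2 * tau / 2))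
    = sg n * (qexp (IZR n * y) * qexp (IZR n * x + IZR n ^ 2 * tau / 2)) by ring.
  rewrite -qexp_plus; congr (_ * qexp _); ring.
have -> : qexp (nu j * (x + y + IZR n * tau)) = qexp (nu j * (x + IZR n * tau)) * qexp (nu j * y).
  rewrite -qexp_plus; congr qexp; ring.
rewrite qexp_opp; field; split => //; exact: qexp_neq0.
Qed.

End Theta.

(** * The Eisenstein-Kronecker function *)

Section Kronecker.
Variables (tau : C) (htau : (0 < Im tau)%R).

Definition wexp (y : C) (n : Z) : C := qexp (RtoC (IZR n) * y).

Definition wpol (j : nat) (n : Z) : C := / RtoC (INR (fact j)) * (- RtoC (IZR n) * D0) ^ j.

Lemma Cmod_D0 : Cmod D0 = (2 * PI)%R.
Proof.
have HPI := PI_RGT_0.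
rewrite /D0 Cmod_opp !Cmod_mult Cmod_Ci !Cmod_R !Rabs_pos_eq; lra.
Qed.

Lemma weight_wexp y : (Rabs (Im y) < Im tau)%R -> weight tau (wexp y).
Proof.
move=> Hy; have HPI := PI_RGT_0.
exists (exp (2 * PI * Rabs (Im y))), 1%R; split; first by left; exact: exp_pos.
split.
  rewrite /qn -exp_plus -exp_0; apply: exp_increasing; nra.
move=> n; rewrite /wexp Cmod_qexp exp_natmul Rmult_1_l; apply: exp_mono.
rewrite abs_nat_IZR.
have -> : Im (RtoC (IZR n) * y) = (IZR n * Im y)%R by case: y {Hy} => a b /=; ring.
have := Rle_abs (- (IZR n * Im y)); rewrite Rabs_Ropp Rabs_mult; nra.
Qed.

Lemma weight_wpol j : weight tau (wpol j).
Proof.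
have HPI := PI_RGT_0; have Hs : (0 < PI * Im tau)%R by apply: Rmult_lt_0_compat.
set s := (PI * Im tau)%R in Hs.
exists (exp s), ((2 * PI / s) ^ j)%R; split; first by left; exact: exp_pos.
split.
  rewrite /qn -exp_plus -exp_0; apply: exp_increasing; rewrite /s; nra.
move=> n; rewrite /wpol Cmod_exp_term Cmod_mult Cmod_opp Cmod_R Cmod_D0.
rewrite exp_natmul abs_nat_IZR.
have Hp := Rabs_pos (IZR n).
have := bsum_term _ _ j (bsum_exp (Rabs (IZR n) * s) ltac:(nra)).
move=> H; apply: Rle_trans (_ : ((2 * PI / s) ^ j * ((Rabs (IZR n) * s) ^ j / INR (fact j)) <= _)%R).
  right; have -> : (Rabs (IZR n) * (2 * PI) = 2 * PI / s * (Rabs (IZR n) * s))%R by field; lra.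
  rewrite (Rpow_mult_distr (2 * PI / s)) /Rdiv; ring.
apply: Rmult_le_compat_l => //; apply: pow_le.
apply: Rmult_le_pos; [lra|left; exact: Rinv_0_lt_compat].
Qed.

(** The double series of the Eisenstein-Kronecker function, which converges
    for [|Im y| < Im tau] and [x] off the lattice. *)
Definition Lfun (x y : C) : C := D0 * (kap y + Lam tau (wexp y) x).

Definition theta'0 : C := C_derive (theta tau) 0.

(** The limits subtracted in [lam] add up to the geometric series of [kap y].
    *)
Lemma Lfun_theta y : (0 < Im y < Im tau)%R -> exists gam, forall x,
  ~ in_lattice tau x -> theta tau x * Lfun x y = D0 * gam * theta tau (x + y).
Proof.
move=> Hy; have [gam Hg] := kronecker_sum tau htau y Hy; exists gam => x Hx.
have H1 := Hg x (fun n => nlat_qexp tau x n Hx).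
have Hw : (Cmod (qexp y) < 1)%R.
  rewrite Cmod_qexp -exp_0; apply: exp_increasing; have := PI_RGT_0; nra.
have H2 := Lam_spec tau htau (wexp y) x (weight_wexp y ltac:(rewrite Rabs_pos_eq; lra)).
have H3 : has_sum (fun n => wexp y n * (if (0 <=? n)%Z then RtoC 1 else RtoC 0)) (kap y + 0).
  apply: has_sum_Z.
    apply: has_sum_ext (has_sum_geom _ Hw) => k.
    rewrite (proj2 (Z.leb_le 0 (Z.of_nat k))); last lia.
    rewrite /wexp -INR_IZR_INZ qexp_nat; ring.
  apply: has_sum_ext has_sum_zero => k.
  rewrite (proj2 (Z.leb_gt 0 _)); last lia.
  ring.
have H4 := has_sum_scal_r (theta tau x) _ _ (has_sum_plus _ _ _ _ H2 H3).
have E : (Lam tau (wexp y) x + (kap y + 0)) * theta tau x = theta tau (x + y) * gam.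
  apply: has_sum_unique _ H1; apply: has_sum_ext H4 => n; rewrite /lam /wexp; ring.
rewrite /Lfun.
replace (theta tau x * (D0 * (kap y + Lam tau (wexp y) x)))
  with (D0 * ((Lam tau (wexp y) x + (kap y + 0)) * theta tau x)) by ring.
rewrite E; ring.
Qed.

(** Only the summand [n = 0] is singular at 0, with residue [/ D0]. *)
Lemma Lfun_residue y : (Rabs (Im y) < Im tau)%R -> exists G, analytic_at 0 G /\ G 0 = 1 /\
  exists d, (0 < d)%R /\ forall x, (0 < Cmod x < d)%R -> x * Lfun x y = G x.
Proof.
move=> Hy.
have E0 : qexp (0 + RtoC (IZR 0) * tau) = 1.
  rewrite -qexp_0; congr qexp; ring.
have [G [HG [G0 [d [Hd H]]]]] := Lam_pole tau htau _ 0 0%Z (weight_wexp y Hy) E0.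
exists (fun x => D0 * (x * kap y + G x)); split.
  apply: an_scal; apply: an_plus => //; apply: an_mult; [exact: an_id|exact: an_const].
split.
  have Ew : wexp y 0 = 1 by rewrite /wexp Cmult_0_l qexp_0.
  rewrite G0 Ew; field; exact: D0_neq0.
exists d; split => // x Hx; rewrite -H; last by replace (x - 0) with x by ring.
rewrite /Lfun; ring.
Qed.

(** The constant in [Lfun_theta] is found by comparing both sides at [x = 0],
    where the pole of [Lfun] cancels the zero of theta. *)
Lemma kronecker_strip x y : ~ in_lattice tau x -> (0 < Im y < Im tau)%R ->
  theta tau y * (theta tau x * Lfun x y) = theta'0 * theta tau (x + y).
Proof.
move=> Hx Hy; have [gam Hg] := Lfun_theta y Hy.
have [G [HG [G0 [d [Hd HL]]]]] := Lfun_residue y ltac:(rewrite Rabs_pos_eq; lra).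
have [t1 [Ht1 [Et1 Dt1]]] := an_quotient _ _ (theta_an tau htau 0).
have E1 : t1 0 * G 0 = D0 * gam * theta tau (0 + y).
  apply: (an_eq_at 0 (fun z => t1 z * G z) (fun z => D0 * gam * theta tau (z + y))).
  - exact: an_mult.
  - apply: an_scal; apply: an_shift; exact: theta_an.
  have [r Hr] := lattice_discrete tau htau 0.
  exists (Rmin d r); split; first by apply: Rmin_pos => //; exact: cond_pos.
  move=> z Hz; have M1 := Rmin_l d r; have M2 := Rmin_r d r.
  have Hz' : (0 < Cmod z < d)%R by replace z with (z - 0) by ring; lra.
  rewrite -HL // -Hg; last by apply: Hr; lra.
  rewrite (Et1 z) theta_0 //; ring.
rewrite Cplus_0_l G0 Cmult_1_r in E1.
rewrite Hg // /theta'0 Dt1 E1; ring.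
Qed.

(** Otherwise its Fourier coefficients, which are not zero, would vanish. *)
Lemma theta_nonzero : exists x, theta tau x <> 0.
Proof.
apply: NNPP => Hno.
have H0 : forall x, theta tau x = 0.
  move=> x; apply: NNPP => Hx; apply: Hno; by exists x.
have [M HM] := tcoef_bsum tau htau.
have H1 : is_RInt (V := C_R_CompleteNormedModule) (fun _ => RtoC 0) 0 1 (tcoef tau 0).
  apply: (is_RInt_fourier _ M) => // t.
  have H := theta_spec tau htau (RtoC t); rewrite H0 in H.
  have := has_sum_scal (qexp (- (t / 2))) _ _ H; rewrite Cmult_0_r.
  apply: has_sum_ext => n; rewrite /tterm.
  replace (qexp (IZR n * t)%R) with (qexp (- (t / 2)) * qexp (nu n * t)); first ring.
  rewrite -qexp_plus; congr qexp; rewrite /nu RtoC_plus RtoC_mult RtoC_inv; last lra.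
  field.
have H2 : is_RInt (V := C_R_CompleteNormedModule) (fun _ => RtoC 0) 0 1 (RtoC 0).
  apply: (is_RInt_fourier (fun _ => 0) 0).
    apply: (bsum_le _ (fun _ => 0%R)); first by move=> _; rewrite Cmod_0; lra.
    split => [_|l _]; first lra.
    have -> : rsum (fun _ : Z => 0%R) l = 0%R by elim: l => //= z l ->; ring.
    lra.
  move=> t; apply: has_sum_ext has_sum_zero => n; ring.
apply: (tcoef_neq0 tau 0).
by rewrite -(is_RInt_unique _ _ _ _ H1) (is_RInt_unique _ _ _ _ H2).
Qed.

Lemma theta_not_zero_near a : ~ zero_near (theta tau) a.
Proof.
move=> Ha; have [x Hx] := theta_nonzero; apply: Hx.
apply: (an_eq_everywhere (theta tau) (fun _ => 0) a) => [z|z|].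
- exact: theta_an.
- exact: an_const.
have [r [Hr H]] := Ha; exists r; split => // z Hz; rewrite H //; ring.
Qed.

Definition ymid : C := (0%R, (Im tau / 2)%R).

Lemma ymid_near z : (Cmod (z - ymid) < Im tau / 2)%R -> (0 < Im z < Im tau)%R.
Proof.
move=> Hz.
have : (Rabs (Im (z - ymid)) < Im tau / 2)%R.
  apply: Rle_lt_trans Hz; apply: Rle_trans (Rmax_Cmod _); exact: Rmax_r.
move=> /Rabs_def2; rewrite /ymid; case: z {Hz} => a b /=; lra.
Qed.

(** Otherwise [kronecker_strip] would force theta to vanish near 0, since
    [Lfun] has a pole there. *)
Lemma theta'0_neq0 : theta'0 <> 0.
Proof.
move=> E0.
have [y [Hy Hty]] : exists y, (0 < Im y < Im tau)%R /\ theta tau y <> 0.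
  apply: NNPP => Hno; apply: (theta_not_zero_near ymid).
  exists (Im tau / 2)%R; split; first lra.
  move=> z [_ /ymid_near Hz]; apply: NNPP => Ht; apply: Hno; by exists z.
have [G [HG [G0 [d [Hd HL]]]]] := Lfun_residue y ltac:(rewrite Rabs_pos_eq; lra).
have HGn : G 0 <> 0 by rewrite G0; move=> /RtoC_inj; lra.
have [d2 [Hd2 HG2]] := an_neq0_near _ _ HG HGn.
have [r Hr] := lattice_discrete tau htau 0.
apply: (theta_not_zero_near 0).
exists (Rmin (Rmin d d2) r); split.
  apply: Rmin_pos; [exact: Rmin_pos|exact: cond_pos].
move=> z Hz; have M1 := Rmin_l (Rmin d d2) r; have M2 := Rmin_r (Rmin d d2) r.
have M3 := Rmin_l d d2; have M4 := Rmin_r d d2.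
have K := kronecker_strip z y (Hr z ltac:(lra)) Hy; rewrite E0 Cmult_0_l in K.
have Hzd : (0 < Cmod z < d)%R by replace z with (z - 0) by ring; lra.
have HGz : G z <> 0 by apply: HG2; lra.
have HLz : Lfun z y <> 0 by move=> E; apply: HGz; rewrite -HL // E; ring.
apply: NNPP => Htz; exact: (Cmult_neq_0 _ _ Hty (Cmult_neq_0 _ _ Htz HLz)).
Qed.

(** A zero [x] off the lattice would make [theta tau (x + y)] vanish for every
    [y] in the strip. *)
Lemma theta_neq0 x : ~ in_lattice tau x -> theta tau x <> 0.
Proof.
move=> Hx Ex; apply: (theta_not_zero_near (x + ymid)).
exists (Im tau / 2)%R; split; first lra.
move=> z [_ Hz].
have Hy : (0 < Im (z - x) < Im tau)%R.
  apply: ymid_near; by replace (z - x - ymid) with (z - (x + ymid)) by ring.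
have K := kronecker_strip x (z - x) Hx Hy.
rewrite Ex Cmult_0_l Cmult_0_r in K.
replace (x + (z - x)) with z in K by ring.
apply: NNPP => Hz0; exact: (Cmult_neq_0 _ _ theta'0_neq0 Hz0 (eq_sym K)).
Qed.

(** * The expansion in the second argument *)

(** Bernoulli numbers over factorials with the convention [B_1 = 1/2], whose
    generating function is [b(t) = t / (1 - exp (- t))]. *)
Definition bcoef (n : nat) : R := (bernoulli n / INR (fact n) + (if Nat.eqb n 1 then 1 else 0))%R.

(** This is [(exp t - 1) * sum_n B_n t^n / n! = t], coefficient by
    coefficient. *)
Lemma bernoulli_egf n :
  rsum (fun i => bernoulli i / INR (fact i) * / INR (fact (S n - i)))%R (seq 0 (S n))
  = (if Nat.eqb n 0 then 1 else 0)%R.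
Proof.
case: n => [|n]; first by rewrite /= /bernoulli /=; field.
have H := bernoulli_rec (S n) ltac:(lia).
have E : forall m, rsum (fun i => bernoulli i / INR (fact i) * / INR (fact (S (S n) - i)))%R (seq 0 (S m))
   = (/ INR (fact (S (S n))) * sum_f_R0 (fun k => Binomial.C (S n + 1) k * bernoulli k) m)%R.
  have Hf := INR_fact_neq_0.
  have E1 : forall k, (bernoulli k / INR (fact k) * / INR (fact (S (S n) - k)) =
    / INR (fact (S (S n))) * (Binomial.C (S n + 1) k * bernoulli k))%R.
    move=> k; rewrite /Binomial.C; replace (S n + 1)%nat with (S (S n)) by lia.
    have F1 := Hf k; have F2 := Hf (S (S n) - k)%nat; have F3 := Hf (S (S n)).
    field; by repeat split.
  elim=> [|m IH]; first by rewrite rsum_seq_last E1; exact: Rplus_0_l.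
  by rewrite rsum_seq_last IH tech5 Rmult_plus_distr_l -E1.
rewrite E H; by rewrite Rmult_0_r.
Qed.

(** This is [(exp t - 1) * b(t) = t exp t], coefficient by coefficient. *)
Lemma bcoef_egf n :
  rsum (fun i => bcoef i * / INR (fact (S n - i)))%R (seq 0 (S n)) = (/ INR (fact n))%R.
Proof.
have -> : rsum (fun i => bcoef i * / INR (fact (S n - i)))%R (seq 0 (S n))
  = (rsum (fun i => bernoulli i / INR (fact i) * / INR (fact (S n - i))) (seq 0 (S n))
    + rsum (fun i => (if Nat.eqb i 1 then 1 else 0) * / INR (fact (S n - i))) (seq 0 (S n)))%R.
  rewrite -rsum_plus; apply: rsum_ext => i _; rewrite /bcoef; ring.
rewrite bernoulli_egf; case: n => [|n]; first by rewrite /=; field.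
have Hz : forall l, (forall i, In i l -> (2 <= i)%nat) ->
    rsum (fun i => (if Nat.eqb i 1 then 1 else 0) * / INR (fact (S (S n) - i)))%R l = 0%R.
  elim=> //= i l IH Hl; rewrite IH; last by move=> k Hk; apply: Hl; right.
  case: Nat.eqb_spec => Hi; last ring.
  have := Hl i (or_introl eq_refl); lia.
rewrite /seq -/seq; simpl rsum; rewrite Hz; last by move=> i /in_seq; lia.
simpl Nat.eqb; change (fact n + n * fact n)%nat with (fact (S n)); cbv iota; ring.
Qed.

Lemma W_kap_coef : exists r M v, (0 < r)%R /\
  W (fun n => D0 ^ n * RtoC (bcoef n)) r M v /\
  forall y, (0 < Cmod y <= r)%R -> v y = D0 * (y * kap y).
Proof.
have [v0 [Hv0 [_ [d [Hd Hk]]]]] := kap_pole.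
have [c [r0 [M [Hr0 HW0]]]] := an_scal 0 D0 _ Hv0.
set r := Rmin r0 (d / 2).
have Hr : (0 < r)%R by apply: Rmin_pos; lra.
have Hr1 : (r <= r0)%R := Rmin_l _ _; have Hr2 : (r <= d / 2)%R := Rmin_r _ _.
have Hr3 : (0 <= r <= r0)%R by lra.
have HW := W_mono _ _ _ _ _ Hr3 HW0.
pose v h := D0 * v0 (0 + h).
have Hv : forall y, (0 < Cmod y <= r)%R -> v y = D0 * (y * kap y).
  move=> y Hy; rewrite /v Cplus_0_l (proj2 (Hk y ltac:(lra))) //.
suff Ec : forall n, c n = D0 ^ n * RtoC (bcoef n).
  exists r, M, v; split => //; split => //; exact: W_coef_ext Ec HW.
have HE := W_Cexp D0 r (Rlt_le _ _ Hr).
(* the relation (exp (D0 y) - 1) v = D0 y exp (D0 y), coefficientwise *)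
have H1 := W_mult _ _ _ _ _ _ _ Hr HW (W_plus _ _ _ _ _ _ _ (Rlt_le _ _ Hr) HE
  (W_const r (-1) (Rlt_le _ _ Hr))).
have H2 := W_scal D0 _ _ _ _ (W_shift _ _ _ _ (Rlt_le _ _ Hr) HE).
have E := W_unique _ _ _ _ _ _ _ _ Hr Hr H1 H2 _.
have Rec : forall n, csum (fun i => c i * (/ RtoC (INR (fact (S n - i))) * D0 ^ (S n - i))) (seq 0 (S n))
    = D0 * (/ RtoC (INR (fact n)) * D0 ^ n).
  move=> n; have := E _ (S n); rewrite csum_seq_last Nat.sub_diag => <-; last first.
    move=> eps He.
    have Hm : (0 < Rmin eps r)%R by apply: Rmin_pos.
    have [z [Hz _]] := exists_near 0 0 _ Hm; exists z.
    replace (z - 0) with z in Hz by ring.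
    have M1 := Rmin_l eps r; have M2 := Rmin_r eps r; split; first lra.
    have Hzr : (0 < Cmod z <= r)%R by lra.
    rewrite -/(v z) (Hv z Hzr) /kap qexp_D0 Cexp_opp.
    have [Hne _] := Hk z ltac:(lra); rewrite qexp_D0 Cexp_opp in Hne.
    have HX := Cexp_neq0 (D0 * z); set X := Cexp _ in Hne HX *.
    have HX1 : X - 1 <> 0.
      move=> E0; apply: Hne; have -> : X = 1 by replace X with (X - 1 + 1) by ring; rewrite E0; ring.
      by field; move=> /RtoC_inj; lra.
    field; split => //.
  have -> : c (S n) * (/ INR (fact 0) * D0 ^ 0 + -1) = 0.
    have -> : RtoC (INR (fact 0)) = 1 by []. 
    rewrite /=; field; move=> /RtoC_inj; lra.
  rewrite Cplus_0_r; apply: csum_ext => i /in_seq Hi.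
  replace (S n - i)%nat with (S (n - i)) by lia; ring.
elim/Wf_nat.lt_wf_ind => n IH.
have := Rec n; rewrite csum_seq_last.
rewrite (csum_ext _ (fun i => D0 ^ (S n) * RtoC (bcoef i * / INR (fact (S n - i))))); last first.
  move=> i /in_seq Hi; rewrite IH; last lia.
  rewrite RtoC_mult RtoC_inv; last exact: INR_fact_neq_0.
  replace (S n) with (i + (S n - i))%nat at 3 by lia.
  rewrite Cpow_add_r; ring.
rewrite csum_scal.
have -> : forall l, csum (fun i => RtoC (bcoef i * / INR (fact (S n - i)))) l
    = RtoC (rsum (fun i => bcoef i * / INR (fact (S n - i)))%R l).
  by elim=> //= i l ->; rewrite RtoC_plus.
have := bcoef_egf n; rewrite rsum_seq_last.
replace (S n - n)%nat with 1%nat by lia.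
set s := rsum _ _ => Es.
have -> : (s = / INR (fact n) - bcoef n)%R.
  rewrite -Es /=; field.
rewrite RtoC_minus RtoC_inv; last exact: INR_fact_neq_0.
have -> : RtoC (INR (fact 1)) = 1 by [].
rewrite Cpow_S Cpow_1_r => H.
have HD := D0_neq0; have Hf := INR_fact_neq0 n.
have : c n * D0 = D0 * D0 ^ n * bcoef n.
  replace (c n * D0) with (c n * (/ 1 * D0)).
    replace (c n * (/ 1 * D0)) with (D0 * D0 ^ n * (/ INR (fact n) - bcoef n) +
      c n * (/ 1 * D0) - D0 * D0 ^ n * (/ INR (fact n) - bcoef n)) by ring.
    rewrite H; field; done.
  field; move=> /RtoC_inj; lra.
move=> H3; replace (c n) with (/ D0 * (c n * D0)) by (field; done).
rewrite H3; field; done.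
Qed.

(** The Lambert series that [g tau n] equals off the lattice.  On the lattice,
    where the values of [g tau n] carry no information, it is a definite
    function of period 1. *)
Definition ghat (n : nat) (x : C) : C :=
  D0 ^ n * RtoC (bcoef n) + match n with O => 0 | S j => D0 * Lam tau (wpol j) x end.

(** Expand each [qexp (n y)] in powers of [y] and sum over [n] first; the
    summand [kap y] contributes the Bernoulli numbers. *)
Lemma Lfun_expansion x : exists r M Y, (0 < r < Im tau)%R /\
  W (fun n => ghat n x) r M Y /\ forall y, (0 < Cmod y <= r)%R -> Y y = y * Lfun x y.
Proof.
have [r0 [M0 [v [Hr0 [HW0 Hv]]]]] := W_kap_coef.
have HPI := PI_RGT_0; have Hq := qn_pos tau.
set r := Rmin r0 (Im tau / 2).
have Hr : (0 < r)%R by apply: Rmin_pos; lra.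
have Hr1 : (r <= r0)%R := Rmin_l _ _; have Hr2 : (r <= Im tau / 2)%R := Rmin_r _ _.
have Hr3 : (0 <= r <= r0)%R by lra.
have HW1 := W_mono _ _ _ _ _ Hr3 HW0.
have [K [HK Hlam]] := lam_bound tau htau x.
set rho := exp (2 * PI * r).
have Hrho : (0 < rho)%R := exp_pos _.
have Hrq : (0 <= rho * qn tau < 1)%R.
  split; first nra; rewrite /rho /qn -exp_plus -exp_0; apply: exp_increasing; nra.
have HWn : forall n, W (fun j => lam tau n x * (/ RtoC (INR (fact j)) * (- RtoC (IZR n) * D0) ^ j)) r
    (K * (rho * qn tau) ^ Z.abs_nat n) (fun y => lam tau n x * qexp (RtoC (IZR n) * y)).
  move=> n; apply: (W_ext _ _ _ (fun y => lam tau n x * Cexp ((- RtoC (IZR n) * D0) * y))).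
    move=> y _; rewrite qexp_D0; congr (_ * Cexp _); ring.
  apply: W_Mle (W_scal _ _ _ _ _ (W_Cexp (- RtoC (IZR n) * D0) r (Rlt_le _ _ Hr))).
  rewrite Cmod_mult Cmod_opp Cmod_R Cmod_D0 Rpow_mult_distr.
  have -> : exp (Rabs (IZR n) * (2 * PI) * r) = (rho ^ Z.abs_nat n)%R.
    rewrite /rho exp_natmul abs_nat_IZR; congr exp; ring.
  have Hp : (0 <= rho ^ Z.abs_nat n)%R by apply: pow_le; lra.
  have := Hlam n; nra.
have HIm : forall y, (Cmod y <= r)%R -> (Rabs (Im y) < Im tau)%R.
  move=> y Hy; apply: Rle_lt_trans (_ : (Cmod y < _)%R); last lra.
  apply: Rle_trans (Rmax_Cmod _); exact: Rmax_r.
have [e [He HW2]] := W_sum _ r _ _ _ (fun y => Lam tau (wexp y) x) Hr HWn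
  (bsum_scal K _ _ HK (bsum_geomZ _ Hrq))
  (fun y Hy => has_sum_ext _ _ _ (fun n => Cmult_comm _ _) (Lam_spec tau htau _ x (weight_wexp y (HIm y Hy)))).
have Ee : forall j, e j = Lam tau (wpol j) x.
  move=> j; apply: (has_sum_unique _ _ _ (He j)).
  apply: has_sum_ext (Lam_spec tau htau _ x (weight_wpol j)) => n; exact: Cmult_comm.
have HW3 := W_plus _ _ _ _ _ _ _ (Rlt_le _ _ Hr) HW1
  (W_scal D0 _ _ _ _ (W_shift _ _ _ _ (Rlt_le _ _ Hr) HW2)).
eexists r, _, _; split; first lra; split.
  apply: W_coef_ext HW3 => -[|j]; rewrite /ghat; first ring.
  by rewrite Ee.
move=> y Hy; cbv beta; rewrite Hv; last lra.
rewrite /Lfun; ring.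
Qed.

(** After multiplication by [y] both sides of [kronecker_strip] are analytic
    at [y = 0], and they agree at points of the strip close to 0. *)
Lemma EK_Lfun x : ~ in_lattice tau x -> exists r, (0 < r)%R /\
  forall y, (0 < Cmod y < r)%R -> EK tau x y = Lfun x y.
Proof.
move=> Hx; have [r [M [Y [Hr [HW HY]]]]] := Lfun_expansion x.
have HYa : analytic_at 0 Y.
  exists (fun n => ghat n x), r, M; split; first lra.
  apply: W_ext HW => h _; by rewrite Cplus_0_l.
have [eps He|d [Hd E]] := an_eq_near 0 (fun y => theta tau y * (theta tau x * Y y))
  (fun y => theta'0 * (y * theta tau (y + x)))
  (an_mult _ _ _ (theta_an tau htau 0) (an_scal _ _ _ HYa))
  (an_scal _ _ _ (an_mult _ _ _ (an_id 0) (an_shift _ _ _ (theta_an tau htau (0 + x))))).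
  have Hm : (0 < Rmin eps r)%R by apply: Rmin_pos; lra.
  have M1 := Rmin_l eps r; have M2 := Rmin_r eps r.
  set t := (Rmin eps r / 2)%R.
  have Ht : (0 < t)%R by rewrite /t; lra.
  have Hc : Cmod (Ci * t) = t.
    rewrite Cmod_mult Cmod_Ci Cmod_R Rabs_pos_eq; lra.
  exists (Ci * t); replace (Ci * t - 0) with (Ci * t) by ring; rewrite Hc; split; first by rewrite /t; lra.
  rewrite HY; last by rewrite Hc /t; lra.
  have Hy : (0 < Im (Ci * t) < Im tau)%R.
    have -> : Im (Ci * t) = t by rewrite /=; ring.
    rewrite /t; lra.
  have K := kronecker_strip x _ Hx Hy.
  have -> : theta tau (Ci * t) * (theta tau x * (Ci * t * Lfun x (Ci * t)))
    = Ci * t * (theta tau (Ci * t) * (theta tau x * Lfun x (Ci * t))) by ring.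
  rewrite K Cplus_comm; ring.
have [r1 Hr1] := lattice_discrete tau htau 0.
set s := Rmin (Rmin d r) r1.
have M1 := Rmin_l (Rmin d r) r1; have M2 := Rmin_r (Rmin d r) r1.
have M3 := Rmin_l d r; have M4 := Rmin_r d r.
exists s; split.
  apply: Rmin_pos; [apply: Rmin_pos; lra|exact: cond_pos].
rewrite -/s in M1 M2 => y Hy.
have Hy0 : y <> 0 by apply: Cmod_pos_neq0; lra.
have Ey : Cmod (y - 0) = Cmod y by congr Cmod; ring.
have := E y ltac:(lra); rewrite HY; last lra.
have Hty : theta tau y <> 0 by apply: theta_neq0; apply: Hr1; lra.
have Htx := theta_neq0 x Hx.
move=> E1; rewrite /EK -/theta'0 (Cplus_comm x y).
have -> : theta'0 * theta tau (y + x) = / y * (theta'0 * (y * theta tau (y + x))) by field.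
rewrite -E1; field; by repeat split.
Qed.

Lemma g_ghat n x : ~ in_lattice tau x -> g tau n x = ghat n x.
Proof.
move=> Hx; have [r [M [Y [Hr [HW HY]]]]] := Lfun_expansion x.
have [r1 [Hr1 HEK]] := EK_Lfun x Hx.
set s := Rmin r r1.
have Hs : (0 < s)%R by apply: Rmin_pos; lra.
have M1 := Rmin_l r r1; have M2 := Rmin_r r r1; rewrite -/s in M1 M2.
have Hexp : is_EK_expansion tau x (fun n => ghat n x).
  exists (mkposreal s Hs) => y /= Hy; exists (Y y); split.
    apply: (W_is_pseries _ _ _ _ _ HW); lra.
  rewrite HEK; last lra.
  rewrite HY; last lra.
  have Hy0 : y <> 0 by apply: Cmod_pos_neq0; lra.
  by field.
have := epsilon_spec (inhabits (fun _ : nat => RtoC 0)) (is_EK_expansion tau x) (ex_intro _ _ Hexp).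
rewrite /g; set a := epsilon _ _ => -[r2 Ha].
set s2 := Rmin s r2.
have Hs2 : (0 < s2)%R by apply: Rmin_pos => //; exact: cond_pos.
have N1 := Rmin_l s r2; have N2 := Rmin_r s r2; rewrite -/s2 in N1 N2.
have [r3 [M3 [G [Hr3 [HW3 HG]]]]] : exists r' M G, (0 < r' < s2)%R /\ W a r' M G /\
    forall h, (0 < Cmod h <= r')%R -> G h = Y h.
  apply: is_pseries_W => // h Hh.
  have [t [Ht Et]] := Ha h ltac:(lra).
  suff -> : Y h = t by [].
  rewrite HY; last lra.
  rewrite -HEK; last lra.
  rewrite Et; field; apply: Cmod_pos_neq0; lra.
apply: (W_unique _ _ _ _ _ _ _ _ _ _ HW3 HW); try lra.
move=> eps He.
have Hm : (0 < Rmin eps r3)%R by apply: Rmin_pos; lra.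
have [z [Hz _]] := exists_near 0 0 _ Hm; exists z.
replace (z - 0) with z in Hz by ring.
have K1 := Rmin_l eps r3; have K2 := Rmin_r eps r3; split; first lra.
apply: HG; lra.
Qed.

Lemma g_0 x : ~ in_lattice tau x -> g tau 0 x = 1.
Proof.
move=> /g_ghat ->; rewrite /ghat.
have -> : bcoef 0 = 1%R by rewrite /bcoef /bernoulli /=; field.
have -> : D0 ^ 0 = 1 by [].
ring.
Qed.

(** * Periodicity and poles of the coefficients *)

Lemma ghat_pole n x : pole_order_le 1 (ghat n) x.
Proof.
rewrite /ghat; case: n => [|j].
  apply: (pole_order_le_mono 0); first lia.
  apply: an_pole0; exact: an_const.
apply: pole_order_le_plus.
  apply: (pole_order_le_mono 0); first lia.
  apply: an_pole0; exact: an_const.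
apply: pole_order_le_scal; apply: Lam_pole_order => //; exact: weight_wpol.
Qed.

Lemma ghat_an n x : ~ in_lattice tau x -> analytic_at x (ghat n).
Proof.
move=> Hx; rewrite /ghat; apply: an_plus; first exact: an_const.
case: n => [|j]; first exact: an_const.
apply: an_scal; apply: Lam_an => //; exact: weight_wpol.
Qed.

Lemma ghat_period n x : ghat n (x + 1) = ghat n x.
Proof. rewrite /ghat; case: n => // j; by rewrite Lam_period. Qed.

(** The shift moves the index, and the subtracted limit changes for [n = -1]
    only. *)
Lemma lam_shift n x : lam tau n (x + tau) =
  lam tau (n + 1) x + (if (n =? -1)%Z then RtoC 1 else RtoC 0).
Proof.
rewrite /lam.
replace (x + tau + RtoC (IZR n) * tau) with (x + RtoC (IZR (n + 1)) * tau); last first.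
  rewrite plus_IZR RtoC_plus; ring.
case: (Z.leb_spec 0 n) => H1; case: (Z.leb_spec 0 (n + 1)) => H2;
  case: (Z.eqb_spec n (-1)) => H3; try lia; ring.
Qed.

Lemma Lfun_shift x y : (Rabs (Im y) < Im tau)%R -> qexp y <> 1 ->
  Lfun (x + tau) y = Cexp (D0 * y) * Lfun x y.
Proof.
move=> Hy Hy1; have Hw := weight_wexp y Hy.
have H1 := Lam_spec tau htau _ x Hw.
have H2 := has_sum_scal (/ qexp y) _ _ (has_sum_Zshift _ 1 _ H1).
have H3 : has_sum (fun n => if (n =? -1)%Z then / qexp y else RtoC 0) (/ qexp y).
  apply: (has_sum_single (-1)%Z (fun n => if (n =? -1)%Z then / qexp y else RtoC 0)) => i Hi.
  by case: Z.eqb_spec.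
have H4 := has_sum_plus _ _ _ _ H2 H3.
have Hx := qexp_neq0 y.
have -> : Cexp (D0 * y) = / qexp y by rewrite qexp_D0 Cexp_opp; field; exact: Cexp_neq0.
have E : Lam tau (wexp y) (x + tau) = / qexp y * Lam tau (wexp y) x + / qexp y.
  apply: (has_sum_unique _ _ _ (Lam_spec tau htau _ (x + tau) Hw)).
  apply: has_sum_ext H4 => n; rewrite lam_shift /wexp.
  have -> : qexp (IZR (n + 1) * y) = qexp y * qexp (IZR n * y).
    rewrite -qexp_plus plus_IZR RtoC_plus; congr qexp; ring.
  case: Z.eqb_spec => Hn; last by field.
  have -> : qexp (IZR n * y) = / qexp y.
    rewrite Hn -qexp_opp; congr qexp; ring.
  by field.
rewrite /Lfun E /kap; field; split => //; exact: kap_neq.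
Qed.

(** Compare coefficients of [y] in [Lfun (x + tau) y = exp (D0 y) Lfun x y].
    *)
Lemma ghat_shift n x : ghat n (x + tau) =
  csum (fun i => / RtoC (INR (fact i)) * D0 ^ i * ghat (n - i) x) (seq 0 (S n)).
Proof.
have [r [M [Y [Hr [HW HY]]]]] := Lfun_expansion x.
have [r' [M' [Y' [Hr' [HW' HY']]]]] := Lfun_expansion (x + tau).
have [v0 [_ [_ [d [Hd Hk]]]]] := kap_pole.
have Hr0 : (0 < r)%R by lra.
have HP := W_mult _ _ _ _ _ _ _ Hr0 (W_Cexp D0 r (Rlt_le _ _ Hr0)) HW.
apply: (W_unique _ _ _ _ _ _ _ _ _ Hr0 HW' HP); first lra.
move=> eps He; set s := Rmin (Rmin eps d) (Rmin r r').
have M1 := Rmin_l (Rmin eps d) (Rmin r r'); have M2 := Rmin_r (Rmin eps d) (Rmin r r').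
have M3 := Rmin_l eps d; have M4 := Rmin_r eps d; have M5 := Rmin_l r r'; have M6 := Rmin_r r r'.
rewrite -/s in M1 M2.
have Hs : (0 < s)%R by apply: Rmin_pos; apply: Rmin_pos; lra.
have [z [Hz _]] := exists_near 0 0 _ Hs; exists z.
replace (z - 0) with z in Hz by ring.
split; first lra.
rewrite HY; last lra.
rewrite HY'; last lra.
have [Hz1 _] := Hk z ltac:(lra).
rewrite Lfun_shift //; first ring.
apply: Rle_lt_trans (_ : (Cmod z < _)%R); last lra.
apply: Rle_trans (Rmax_Cmod _); exact: Rmax_r.
Qed.

Lemma DeltaE (f : C -> C) x : Defs.Delta tau f x = f (x + tau) - f x.
Proof. by []. Qed.

Lemma iter_Delta_ext k (f f' : C -> C) : (forall x, ~ in_lattice tau x -> f x = f' x) ->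
  forall x, ~ in_lattice tau x -> Nat.iter k (Defs.Delta tau) f x = Nat.iter k (Defs.Delta tau) f' x.
Proof.
elim: k f f' => [|k IH] f f' H x Hx; first exact: H.
rewrite !Nat.iter_succ.
rewrite !DeltaE (IH f f' H x Hx) (IH f f' H (x + tau)) // => Hl; apply: Hx.
apply: (lattice_shift tau x 1); by replace (x + RtoC (IZR 1) * tau) with (x + tau) by ring.
Qed.

Lemma iter_Delta_csum {I} k (a : I -> C) (f : I -> C -> C) l x :
  Nat.iter k (Defs.Delta tau) (fun x => csum (fun i => a i * f i x) l) x
  = csum (fun i => a i * Nat.iter k (Defs.Delta tau) (f i) x) l.
Proof.
elim: k x => [|k IH] x //; rewrite Nat.iter_succ DeltaE !IH.
transitivity (csum (fun i => a i * Nat.iter k (Defs.Delta tau) (f i) (x + tau) +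
    -1 * (a i * Nat.iter k (Defs.Delta tau) (f i) x)) l).
  rewrite csum_plus csum_scal; ring.
apply: csum_ext => i _; rewrite Nat.iter_succ DeltaE; ring.
Qed.

(** By [ghat_shift] a difference of [ghat n] is a combination of the [ghat k]
    with [k < n]. *)
Lemma ghat_SK n : forall k x, (n < k)%nat -> ~ in_lattice tau x ->
  Nat.iter k (Defs.Delta tau) (ghat n) x = 0.
Proof.
elim/Wf_nat.lt_wf_ind: n => n IH -[|k] x Hk Hx; first lia.
rewrite Nat.iter_succ_r.
rewrite (iter_Delta_ext k _ (fun x => csum (fun i => (/ RtoC (INR (fact (S i))) * D0 ^ (S i)) *
   ghat (n - S i) x) (seq 0 n))) //; last first.
  move=> z Hz; rewrite DeltaE ghat_shift csum_seq_S Nat.sub_0_r.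
  have -> : RtoC (INR (fact 0)) = 1 by [].
  rewrite /=; field; move=> /RtoC_inj; lra.
rewrite iter_Delta_csum (csum_ext _ (fun _ => 0)).
  by elim: (seq 0 n) => //= i l ->; ring.
move=> i /in_seq Hi; rewrite IH; [ring|lia|lia|done].
Qed.

Lemma g_mero_ghat n : mero_eq (g tau n) (ghat n).
Proof. apply: (mero_eq_off_lattice tau htau) => x; exact: g_ghat. Qed.

Lemma g_pole n x : pole_order_le 1 (g tau n) x.
Proof.
apply: pole_order_le_mero_eq (ghat_pole n x); apply: mero_eq_sym; exact: g_mero_ghat.
Qed.

Lemma g_SK n : SK_ tau (n + 1) (g tau n).
Proof.
split; first by move=> a; exists 1%nat; exact: g_pole.
split.
  apply: (mero_eq_off_lattice tau htau) => x Hx.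
  rewrite !g_ghat ?ghat_period // => Hl; apply: Hx; exact: (lattice_shift1 tau).
split.
  move=> a Ha; apply: pole_order_le_mero_eq (an_pole0 _ _ (ghat_an n a Ha)).
  apply: mero_eq_sym; exact: g_mero_ghat.
apply: (mero_eq_off_lattice tau htau) => x Hx.
rewrite (iter_Delta_ext _ _ (ghat n)) //; last by move=> z; exact: g_ghat.
apply: ghat_SK => //; lia.
Qed.

Lemma g_V n : V tau (g tau n).
Proof. split; [by exists (n + 1)%nat; exact: g_SK|exact: g_pole]. Qed.

End Kronecker.

(** * Partial fractions of the cotangent *)

Lemma an_affine a k b f : analytic_at (k * a + b) f -> analytic_at a (fun z => f (k * z + b)).
Proof.
move=> [c [r [M [Hr HW]]]].
have Hk := Cmod_ge_0 k.
set s := (r / (Cmod k + 1))%R.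
have Hs : (0 < s)%R by apply: Rdiv_lt_0_compat; lra.
have Hks : (Cmod k * s <= r)%R.
  have -> : r = ((Cmod k + 1) * s)%R by rewrite /s; field; lra.
  nra.
exists (fun n => c n * k ^ n), s, M; split => //; case: HW => HB HS; split.
  apply: bsum_le HB => n.
  rewrite Cmod_mult Cmod_pow Rmult_assoc -Rpow_mult_distr.
  have H1 := Cmod_ge_0 (c n).
  have H2 : (0 <= (Cmod k * s) ^ n)%R by apply: pow_le; nra.
  have H3 : ((Cmod k * s) ^ n <= r ^ n)%R by apply: pow_incr; nra.
  split; nra.
move=> h Hh; have Hkh : (Cmod (k * h) <= r)%R.
  rewrite Cmod_mult; apply: Rle_trans Hks; exact: Rmult_le_compat_l.
replace (k * (a + h) + b) with (k * a + b + k * h) by ring.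
apply: has_sum_ext (HS _ Hkh) => n; rewrite Cpow_mult_l; ring.
Qed.

(** This is [pi cot (pi x)]. *)
Definition cotp (x : C) : C := D0 * kap x - D0 / 2.

(** Summand of the partial fraction expansion, regularized so as to be
    absolutely summable in [m]. *)
Definition pf (m : Z) (x : C) : C :=
  / (x - RtoC (IZR m)) + (if Z.eqb m 0 then RtoC 0 else / RtoC (IZR m)).

(** A weight comparable with [1 / m^2] and finite at [m = 0]. *)
Definition sqw (m : Z) : R := (/ (INR (Z.abs_nat m) + 1) ^ 2)%R.

Lemma sqw_bsum : bsum sqw (2 + 2).
Proof.
have H : bsum (fun n => / (INR n + 1) ^ 2)%R 2.
  apply: bsum_nat => n.
    left; apply: Rinv_0_lt_compat; apply: pow_lt; have := pos_INR n; lra.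
  have E : (rsum (fun n => / (INR n + 1) ^ 2) (seq 0 n) <= 2 - / (INR n + / 2))%R.
    elim: n => [|n IH]; first by rewrite /=; lra.
    rewrite rsum_seq_last S_INR; have Hn := pos_INR n.
    suff : (/ (INR n + 1) ^ 2 <= / (INR n + / 2) - / (INR n + 1 + / 2))%R by lra.
    replace (/ (INR n + / 2) - / (INR n + 1 + / 2))%R with
      (/ ((INR n + 1) ^ 2 - / 4))%R by (field; split; [nra|nra]).
    apply: Rinv_le_contravar; nra.
  apply: Rle_trans E _.
  have : (0 < / (INR n + / 2))%R by apply: Rinv_0_lt_compat; have := pos_INR n; lra.
  lra.
apply: bsum_Z.
  apply: bsum_le H => n; rewrite /sqw Zabs2Nat.id; split; last lra.
  left; apply: Rinv_0_lt_compat; apply: pow_lt; have := pos_INR n; lra.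
apply: bsum_le H => n; rewrite /sqw.
have Hn := pos_INR n.
have -> : INR (Z.abs_nat (- Z.of_nat n - 1)) = (INR n + 1)%R.
  rewrite -S_INR; congr INR; lia.
split; first by left; apply: Rinv_0_lt_compat; apply: pow_lt; lra.
apply: Rinv_le_contravar; first by apply: pow_lt; lra.
apply: pow_incr; lra.
Qed.

Lemma sqw_pos m : (0 < sqw m)%R.
Proof.
apply: Rinv_0_lt_compat; apply: pow_lt; have := pos_INR (Z.abs_nat m); lra.
Qed.

Lemma Cmod_IZR m : Cmod (RtoC (IZR m)) = INR (Z.abs_nat m).
Proof. by rewrite Cmod_R abs_nat_IZR. Qed.

Lemma dist_lower (x : C) m : (INR (Z.abs_nat m) - Cmod x <= Cmod (x - RtoC (IZR m)))%R.
Proof.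
rewrite -Cmod_IZR; have := Cmod_triangle (- (x - RtoC (IZR m))) x.
rewrite Cmod_opp; replace (- (x - RtoC (IZR m)) + x) with (RtoC (IZR m)) by ring.
lra.
Qed.

Lemma W_pf_tail x0 : exists K N, (0 <= K)%R /\ forall m, (N < Z.abs_nat m)%nat ->
  exists d, W d 1 (K * sqw m) (fun h => pf m (x0 + h)).
Proof.
have HX := Cmod_ge_0 x0.
have [N HN] : exists N, (2 * Cmod x0 + 3 < INR N)%R.
  have [N HN] := INR_unbounded (2 * Cmod x0 + 3); by exists N.
exists (16 * (Cmod x0 + 1))%R, N; split; first lra.
move=> m Hm; set a := INR (Z.abs_nat m).
have Ha : (2 * Cmod x0 + 3 < a)%R by apply: Rlt_trans HN _; apply: lt_INR.
have Hm0 : RtoC (IZR m) <> 0.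
  apply: Cmod_pos_neq0; rewrite Cmod_IZR -/a; lra.
set p := x0 - RtoC (IZR m).
have Hp : (a / 2 + 1 <= Cmod p)%R by have := dist_lower x0 m; rewrite -/a -/p; lra.
have Hp0 : p <> 0 by apply: Cmod_pos_neq0; lra.
have Hid := W_scal (- / p) _ _ _ _ (W_shift _ _ _ _ Rle_0_1 (W_const 1 1 Rle_0_1)).
have Hn : (Cmod (- / p) * (1 * Cmod 1) <= / 2)%R.
  rewrite Cmod_opp Cmod_inv // Cmod_1 !Rmult_1_r.
  apply: Rinv_le_contravar; lra.
have Hid2 := W_Mle _ _ _ _ _ Hn Hid.
have [d Hd] := W_geom _ _ _ _ Rlt_0_1 (Rle_refl _) Hid2.
have H1 := W_plus _ _ _ _ _ _ _ Rle_0_1 (W_const 1 1 Rle_0_1) Hd.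
have Hx : W (fun n => (match n with O => x0 | _ => 0 end) + (match n with O => 0 | S k => match k with O => 1 | _ => 0 end end)) 1
    (Cmod x0 + 1 * Cmod 1) (fun h => x0 + h * 1).
  apply: W_plus; [lra|apply: W_const; lra|apply: W_shift; [lra|apply: W_const; lra]].
have H2 := W_scal (/ (p * RtoC (IZR m))) _ _ _ _ (W_mult _ _ _ _ _ _ _ Rlt_0_1 Hx H1).
eexists; apply: W_Mle (W_ext _ _ _ _ _ _ H2).
  have Hmod : (Cmod (/ (p * RtoC (IZR m))) <= 8 * sqw m)%R.
    rewrite Cmod_inv; last by apply: Cmult_neq_0.
    rewrite Cmod_mult Cmod_IZR -/a /sqw -/a.
    have -> : (8 * / (a + 1) ^ 2 = / ((a + 1) ^ 2 / 8))%R by field; lra.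
    apply: Rinv_le_contravar; nra.
  rewrite Cmod_1.
  have -> : ((Cmod x0 + 1 * 1) * (1 + 2 * / 2) = 2 * (Cmod x0 + 1))%R by field.
  have := sqw_pos m; have := Cmod_ge_0 (/ (p * RtoC (IZR m))); nra.
move=> h Hh; rewrite /pf.
have -> : Z.eqb m 0 = false by apply/Z.eqb_neq => E; move: Hm0; rewrite E.
have Hph : p + h <> 0.
  move=> E; have : Cmod p = Cmod h.
    rewrite -(Cmod_opp h); congr Cmod; replace p with (p + h - h) by ring; rewrite E; ring.
  lra.
have Hne : 1 - - / p * (h * 1) <> 0.
  move=> E; apply: Hph; replace (p + h) with (p * (1 - - / p * (h * 1))) by (field; done).
  rewrite E; ring.
have Epx : x0 + h - IZR m = p + h by rewrite /p; ring.
rewrite Epx.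
have Ex : x0 = p + RtoC (IZR m) by rewrite /p; ring.
have Hne2 : p + h <> 0 by []. 
have E2 : 1 + - / p * (h * 1) / (1 - - / p * (h * 1)) = p / (p + h).
  field; split => //; by replace (p + h * 1) with (p + h) by ring.
rewrite E2 {1}Ex; field; by repeat split.
Qed.

Lemma an_pf m x0 : x0 <> RtoC (IZR m) -> analytic_at x0 (pf m).
Proof.
move=> Hx; apply: an_plus; last exact: an_const.
apply: an_inv; last by apply: an_minus; [exact: an_id|exact: an_const].
move=> E; apply: Hx; replace x0 with (x0 - IZR m + IZR m) by ring; rewrite E; ring.
Qed.

Lemma pf_bound x : exists K, (0 <= K)%R /\ forall m, (Cmod (pf m x) <= K * sqw m)%R.
Proof.
have [K [N [HK HW]]] := W_pf_tail x.
have [K2 [HK2 H2]] : exists K2, (0 <= K2)%R /\ forall m, In m (Zball N) -> (Cmod (pf m x) <= K2 * sqw m)%R.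
  elim: (Zball N) => [|m l [K2 [HK2 IH]]]; first by exists 0%R; split => //; lra.
  have Hs := sqw_pos m; have Hp := Cmod_ge_0 (pf m x).
  have Hi : (0 < / sqw m)%R by apply: Rinv_0_lt_compat.
  exists (K2 + Cmod (pf m x) * / sqw m)%R; split; first nra.
  move=> k [<-|Hk].
    have -> : ((K2 + Cmod (pf m x) * / sqw m) * sqw m = K2 * sqw m + Cmod (pf m x))%R.
      field; lra.
    nra.
  have Hpi : (0 <= Cmod (pf m x) * / sqw m)%R by nra.
  have := IH k Hk; have := sqw_pos k; nra.
exists (K + K2)%R; split; first lra.
move=> m; have Hs := sqw_pos m; case: (Nat.le_gt_cases (Z.abs_nat m) N) => Hm.
  have := H2 m (proj2 (Zball_In N m) Hm); nra.
have [d Hd] := HW m Hm.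
have H01 : (Cmod 0 <= 1)%R by rewrite Cmod_0; lra.
have := W_bound _ _ _ _ 0 H01 Hd; rewrite /= Cplus_0_r; nra.
Qed.

Definition pfs (x : C) : C := epsilon (inhabits (RtoC 0)) (has_sum (fun m => pf m x)).

Lemma pfs_spec x : has_sum (fun m => pf m x) (pfs x).
Proof.
apply: (epsilon_spec (inhabits (RtoC 0))).
have [K [HK H]] := pf_bound x.
exact: has_sum_exists H (bsum_scal _ _ _ HK sqw_bsum).
Qed.

Lemma pfs_tail_an x0 N0 : exists N, (N0 <= N)%nat /\
  analytic_at x0 (fun x => pfs x - csum (fun m => pf m x) (Zball N)).
Proof.
have [K [N [HK HW]]] := W_pf_tail x0; exists (max N0 N); split; first lia.
apply: (sum_tail_an _ _ _ _ _ _ _ Rlt_0_1 (fun x _ => pfs_spec x) (bsum_scal _ _ _ HK sqw_bsum)).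
move=> n Hn; apply: HW; lia.
Qed.

Lemma qexp_neq1_Z x m : qexp x <> 1 -> x <> RtoC (IZR m).
Proof. by move=> H E; apply: H; rewrite E qexp_Z. Qed.

Lemma pfs_an x0 : qexp x0 <> 1 -> analytic_at x0 pfs.
Proof.
move=> Hx; have [N [_ HN]] := pfs_tail_an x0 0.
apply: (an_ext _ (fun x => pfs x - csum (fun m => pf m x) (Zball N) + csum (fun m => pf m x) (Zball N))).
  move=> z; ring.
apply: an_plus => //; apply: an_csum => m _; apply: an_pf; exact: qexp_neq1_Z.
Qed.

Lemma pfs_an_int k : analytic_at (RtoC (IZR k)) (fun x => pfs x - / (x - RtoC (IZR k))).
Proof.
have [N [Hk0 HN]] := pfs_tail_an (RtoC (IZR k)) (Z.abs_nat k).
have Hk := proj2 (Zball_In N k) Hk0.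
pose u m x := match Z.eq_dec m k with
  | left _ => (if Z.eqb m 0 then RtoC 0 else / RtoC (IZR m)) | right _ => pf m x end.
apply: (an_ext _ (fun x => pfs x - csum (fun m => pf m x) (Zball N) + csum (fun m => u m x) (Zball N))).
  move=> x.
  have -> : csum (fun m => pf m x) (Zball N) = csum (fun m => u m x) (Zball N) + / (x - RtoC (IZR k)).
    have Hz : forall m, m <> k -> pf m x - u m x = 0.
      move=> m Hm; rewrite /u; case: Z.eq_dec => // _; ring.
    have H1 := has_sum_single k (fun m => pf m x - u m x) Hz.
    have H2 := has_sum_fin (fun m => pf m x - u m x) (Zball N) (Zball_NoDup N)
      (fun m Hm => Hz m (fun E => Hm (eq_ind_r (fun z => In z (Zball N)) Hk E))).
    have E := has_sum_unique _ _ _ H1 H2.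
    have E2 : pf k x - u k x = / (x - RtoC (IZR k)).
      rewrite /u /pf; case: Z.eq_dec => // _; ring.
    rewrite -E2 E -csum_plus; apply: csum_ext => m _; ring.
  ring.
apply: an_plus => //; apply: an_csum => m _; rewrite /u; case: Z.eq_dec => Hm.
  exact: an_const.
apply: an_pf => E; apply: Hm; symmetry; apply: eq_IZR; exact: RtoC_inj.
Qed.

Lemma kap_shiftZ x k : kap (x + RtoC (IZR k)) = kap x.
Proof. by rewrite /kap qexp_plus qexp_Z Cmult_1_r. Qed.

Lemma an_cotp x0 : qexp x0 <> 1 -> analytic_at x0 cotp.
Proof.
move=> Hx; apply: an_minus; last exact: an_const.
apply: an_scal; apply: (an_ext _ (fun z => kap (z + 0))); first by move=> z; rewrite Cplus_0_r.
apply: an_kap; by rewrite Cplus_0_r.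
Qed.

Lemma qexp_neq1_near x0 : qexp x0 <> 1 -> exists d, (0 < d)%R /\
  forall z, (Cmod (z - x0) < d)%R -> qexp z <> 1.
Proof.
move=> Hx.
have Ha : analytic_at x0 (fun z => 1 - qexp (z + 0)) by apply: an_minus; [exact: an_const|exact: an_qexp].
have H0 : 1 - qexp (x0 + 0) <> 0 by rewrite Cplus_0_r; exact: kap_neq.
have [d [Hd H]] := an_neq0_near _ _ Ha H0; exists d; split => // z /H.
rewrite Cplus_0_r => Hz E; apply: Hz; rewrite E; ring.
Qed.

Definition fcot (x : C) : C := cotp x - pfs x.

Lemma fcot_reg x0 : exists A d, (0 < d)%R /\ analytic_at x0 A /\
  forall z, (0 < Cmod (z - x0) < d)%R -> qexp z <> 1 /\ A z = fcot z.
Proof.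
case: (classic (qexp x0 = 1)) => [E|Hx]; last first.
  have [d [Hd H]] := qexp_neq1_near x0 Hx; exists fcot, d; split => //; split.
    by apply: an_minus; [exact: an_cotp|exact: pfs_an].
  by move=> z Hz; split => //; apply: H; lra.
have [k Hk] := qexp_eq1 x0 E; subst x0.
have [v [Hv [Hv0 [d [Hd Hkap]]]]] := kap_pole.
have [v1 [Hv1 [Ev1 _]]] := an_quotient _ _ (an_scal _ D0 _ Hv).
have Hv1' : analytic_at (RtoC (IZR k)) (fun z => v1 (z - RtoC (IZR k))).
  apply: an_shift; by replace (RtoC (IZR k) + - RtoC (IZR k)) with (RtoC 0) by ring.
exists (fun z => v1 (z - RtoC (IZR k)) - D0 / 2 - (pfs z - / (z - RtoC (IZR k)))), d.
split => //; split.
  apply: an_minus; last exact: pfs_an_int.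
  by apply: an_minus => //; exact: an_const.
move=> z Hz; set h := z - RtoC (IZR k) in Hz *.
have Hh0 : h <> 0 by apply: Cmod_pos_neq0; lra.
have Ez : z = h + RtoC (IZR k) by rewrite /h; ring.
have [Hne Hkh] := Hkap h Hz.
split; first by rewrite Ez qexp_plus qexp_Z Cmult_1_r.
have Ek : kap z = kap h by rewrite Ez kap_shiftZ.
have E1 := Ev1 h; rewrite Hv0 -Hkh in E1.
have E2 : v1 h = D0 * kap h - / h.
  have -> : v1 h = / h * (h * v1 h) by field.
  have -> : h * v1 h = D0 * (h * kap h) - 1.
    rewrite E1; field; exact: D0_neq0.
  by field.
rewrite /fcot /cotp Ek E2; ring.
Qed.

(** The entire extension of [fcot], whose poles at the integers cancel. *)
Definition Hcot (x : C) : C := epsilon (inhabits (RtoC 0)) (fun v => exists A d,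
  (0 < d)%R /\ analytic_at x A /\ A x = v /\ forall z, (0 < Cmod (z - x) < d)%R -> A z = fcot z).

Lemma Hcot_spec x A d : (0 < d)%R -> analytic_at x A ->
  (forall z, (0 < Cmod (z - x) < d)%R -> A z = fcot z) -> Hcot x = A x.
Proof.
move=> Hd HA E.
have [B [d2 [Hd2 [HB [EBx EB]]]]] := epsilon_spec (inhabits (RtoC 0)) (fun v => exists A d,
  (0 < d)%R /\ analytic_at x A /\ A x = v /\ forall z, (0 < Cmod (z - x) < d)%R -> A z = fcot z)
  (ex_intro _ (A x) (ex_intro _ A (ex_intro _ d (conj Hd (conj HA (conj eq_refl E)))))).
rewrite /Hcot -EBx; symmetry; apply: an_eq_at => //.
exists (Rmin d d2); split; first exact: Rmin_pos.
move=> z Hz; have M1 := Rmin_l d d2; have M2 := Rmin_r d d2.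
rewrite E; last lra.
rewrite EB; last lra.
ring.
Qed.

Lemma Hcot_off x : qexp x <> 1 -> Hcot x = fcot x.
Proof.
move=> Hx; apply: (Hcot_spec x fcot 1) => //; first lra.
by apply: an_minus; [exact: an_cotp|exact: pfs_an].
Qed.

Lemma Hcot_an x : analytic_at x Hcot.
Proof.
have [A [d [Hd [HA E]]]] := fcot_reg x.
apply: (an_ext_near x d A) => // z Hz; symmetry.
case: (Ceq_dec z x) => [->|Hn].
  by apply: (Hcot_spec x A d) => // y Hy; case: (E y Hy).
have Hz' : (0 < Cmod (z - x) < d)%R.
  split => //; apply/Cmod_gt_0 => E0; apply: Hn.
  replace z with (z - x + x) by ring; rewrite E0; ring.
have [H1 ->] := E z Hz'; exact: Hcot_off.
Qed.

Lemma has_sum_evenodd (a : Z -> C) s t : has_sum (fun m => a (2 * m)%Z) s ->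
  has_sum (fun m => a (2 * m - 1)%Z) t -> has_sum a (s + t).
Proof.
move=> Hs Ht.
pose f (p : Z + Z) := match p with inl m => (2 * m)%Z | inr m => (2 * m - 1)%Z end.
pose h n := match Z.even n with true => @inl Z Z (n / 2)%Z | false => @inr Z Z ((n + 1) / 2)%Z end.
apply: (has_sum_reindex f h).
- case=> m; rewrite /h /f.
    have -> : Z.even (2 * m) = true by rewrite Z.even_mul.
    by rewrite Z.mul_comm Z.div_mul.
  have -> : Z.even (2 * m - 1) = false by rewrite Z.even_sub Z.even_mul.
  by replace (2 * m - 1 + 1)%Z with (m * 2)%Z by lia; rewrite Z.div_mul.
- move=> n; rewrite /h; case E: (Z.even n); rewrite /f.
    have := proj1 (Z.even_spec n) E; case=> k ->.
    by rewrite (Z.mul_comm 2 k) Z.div_mul // Z.mul_comm.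
  have : Z.odd n = true by rewrite -Z.negb_even E.
  move=> /Z.odd_spec [k ->].
  replace (2 * k + 1 + 1)%Z with ((k + 1) * 2)%Z by lia; rewrite Z.div_mul //; lia.
exact: (has_sum_union (fun p => a (f p))).
Qed.

Lemma RtoC2_neq0 : RtoC 2 <> 0.
Proof. move=> /RtoC_inj; lra. Qed.

Lemma qexp_half x : qexp (/ 2 * x) * qexp (/ 2 * x) = qexp x.
Proof. rewrite -qexp_plus; congr qexp; field; exact: RtoC2_neq0. Qed.

Lemma qexp_12 : qexp (/ 2) = -1.
Proof.
rewrite -RtoC_inv; last lra.
rewrite qexp_real; replace (2 * PI * / 2)%R with PI by field.
by rewrite cos_PI sin_PI.
Qed.

Lemma qexp_half1 x : qexp (/ 2 * x + / 2) = - qexp (/ 2 * x).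
Proof. rewrite qexp_plus qexp_12; ring. Qed.

Lemma qexp_half_neq1 x : qexp x <> 1 -> qexp (/ 2 * x) <> 1 /\ qexp (/ 2 * x + / 2) <> 1.
Proof.
move=> Hx; split => E; apply: Hx; rewrite -qexp_half.
  rewrite E; ring.
rewrite qexp_half1 in E.
replace (qexp (/ 2 * x) * qexp (/ 2 * x)) with (- qexp (/ 2 * x) * - qexp (/ 2 * x)) by ring.
rewrite E; ring.
Qed.

Lemma Csub_neq0 (a b : C) : a <> b -> a - b <> 0.
Proof.
move=> H E; apply: H; replace a with (a - b + b) by ring; rewrite E; ring.
Qed.

Lemma cotp_double x : qexp x <> 1 ->
  2 * cotp x = cotp (/ 2 * x) + cotp (/ 2 * x + / 2).
Proof.
move=> Hx; have [H1 H2] := qexp_half_neq1 x Hx.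
rewrite /cotp /kap -(qexp_half x) qexp_half1.
have N1 := kap_neq _ Hx; have N2 := kap_neq _ H1; have N3 := kap_neq _ H2.
rewrite -qexp_half in N1; rewrite qexp_half1 in N3.
move: N1 N2 N3; set u := qexp _ => N1 N2 N3.
have -> : 1 - - u = 1 + u by ring.
have N3' : 1 + u <> 0 by move=> E; apply: N3; rewrite -E; ring.
have -> : 1 - u * u = (1 - u) * (1 + u) by ring.
field; repeat split => //; exact: RtoC2_neq0.
Qed.

(** Split the sum into even and odd [m]; the regularizing terms contribute
    only a constant. *)
Lemma pfs_double : exists kp, forall x, qexp x <> 1 ->
  2 * pfs x = pfs (/ 2 * x) + pfs (/ 2 * x + / 2) + kp.
Proof.
pose kd m := 2 * (if Z.eqb (2 * m - 1) 0 then RtoC 0 else / RtoC (IZR (2 * m - 1)))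
  - (if Z.eqb m 0 then RtoC 0 else / RtoC (IZR m)).
have HH : forall x, qexp x <> 1 -> exists kp, has_sum kd kp /\
    2 * pfs x = pfs (/ 2 * x) + pfs (/ 2 * x + / 2) + kp.
  move=> x Hx.
  have [K [HK HB]] := pf_bound x.
  have HM := bsum_scal _ _ _ HK sqw_bsum.
  have HM2 := bsum_inj (fun m => (2 * m - 1)%Z) _ _ ltac:(cbv beta; move=> a b; lia) HM.
  have [v Hv] := has_sum_exists (fun m => pf (2 * m - 1) x) _ _ (fun m => HB (2 * m - 1)%Z) HM2.
  have Hv2 := has_sum_scal 2 _ _ Hv.
  have H2 := RtoC2_neq0.
  have [N1 N2] := qexp_half_neq1 x Hx.
  have S1 := pfs_spec (/ 2 * x); have S2 := pfs_spec (/ 2 * x + / 2).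
  have Hev : has_sum (fun m => 2 * pf (2 * m) x) (pfs (/ 2 * x)).
    apply: has_sum_ext S1 => m; rewrite /pf mult_IZR RtoC_mult.
    have D1 := Csub_neq0 _ _ (qexp_neq1_Z _ m N1).
    have D2 : x - 2 * IZR m <> 0.
      move=> E; apply: D1; have -> : / 2 * x - IZR m = / 2 * (x - 2 * IZR m) by field.
      rewrite E; ring.
    have -> : / 2 * x - IZR m = / 2 * (x - 2 * IZR m) by field.
    case: (Z.eqb_spec m 0) => Hm.
      subst m; change (IZR (2 * 0)) with 0%R.
      have D3 : x <> 0 by move=> E0; apply: D2; rewrite E0; ring.
      have -> : x - 2 * RtoC 0 = x by ring.
      rewrite /=; field; by auto.
    have -> : Z.eqb (2 * m) 0 = false by apply/Z.eqb_neq; lia.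
    have D3 : RtoC (IZR m) <> 0 by move=> /RtoC_inj E; apply: Hm; exact: eq_IZR E.
    by field.
  have E := has_sum_unique _ _ _ (has_sum_scal 2 _ _ (pfs_spec x)) (has_sum_evenodd _ _ _ Hev Hv2).
  exists (2 * v - pfs (/ 2 * x + / 2)); split; last by rewrite E; ring.
  apply: has_sum_ext (has_sum_minus _ _ _ _ Hv2 S2) => m.
  have D1 := Csub_neq0 _ _ (qexp_neq1_Z _ m N2).
  have D2 := Csub_neq0 _ _ (qexp_neq1_Z _ (2 * m - 1) Hx).
  rewrite /pf /kd.
  have -> : / (/ 2 * x + / 2 - IZR m) = 2 * / (x - IZR (2 * m - 1)).
    have E3 : / 2 * x + / 2 - IZR m = / 2 * (x - IZR (2 * m - 1)).
      rewrite minus_IZR mult_IZR RtoC_minus RtoC_mult; field.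
    rewrite E3; by field.
  ring.
have Hi : qexp Ci <> 1.
  move=> /qexp_Im0 /=; lra.
have [kp [Hkp _]] := HH Ci Hi; exists kp => x /HH [kp' [Hkp' E]].
by rewrite (has_sum_unique _ _ _ Hkp Hkp').
Qed.

Lemma Hcot_double : exists kp, forall x, 2 * Hcot x = Hcot (/ 2 * x) + Hcot (/ 2 * x + / 2) + kp.
Proof.
have [kp Hkp] := pfs_double; exists (- kp).
apply: (an_eq_everywhere _ _ Ci) => [z|z|].
- apply: an_scal; exact: Hcot_an.
- apply: an_plus; last exact: an_const.
  apply: an_plus; last by apply: an_affine; exact: Hcot_an.
  apply: (an_ext _ (fun w => Hcot (/ 2 * w + 0))); first by move=> w; rewrite Cplus_0_r.
  apply: an_affine; exact: Hcot_an.
exists 1%R; split; first lra.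
move=> z [_ Hz].
have Hz1 : qexp z <> 1.
  move=> /qexp_Im0 E; have : (Rabs (Im (z - Ci)) < 1)%R.
    apply: Rle_lt_trans Hz; apply: Rle_trans (Rmax_Cmod _); exact: Rmax_r.
  have -> : Im (z - Ci) = (Im z - 1)%R by case: (z) => a b /=; ring.
  rewrite E Rabs_left; lra.
have [H1 H2] := qexp_half_neq1 z Hz1.
rewrite !Hcot_off // /fcot.
have A := cotp_double z Hz1; have B := Hkp z Hz1.
replace (2 * (cotp z - pfs z)) with (2 * cotp z - 2 * pfs z) by ring.
rewrite A B; ring.
Qed.

(** Herglotz's trick: at a maximum both halves are maximal as well. *)
Lemma herglotz_max phi kp : (forall t, (0 <= t <= 1)%R -> continuity_pt phi t) ->
  (forall t, (0 <= t <= 1)%R -> (2 * phi t = phi (t / 2) + phi ((t + 1) / 2) + kp)%R) ->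
  (0 <= kp)%R /\ ((kp <= 0)%R -> forall t, (0 <= t <= 1)%R -> (phi t <= phi 0)%R).
Proof.
move=> Hc Hd.
have [t0 [Hmax Ht0]] := continuity_ab_maj phi 0 1 Rle_0_1 Hc.
have Hk : (0 <= kp)%R.
  have := Hd t0 Ht0; have := Hmax (t0 / 2)%R ltac:(lra); have := Hmax ((t0 + 1) / 2)%R ltac:(lra).
  lra.
split => // Hk2 t Ht.
have Hit : forall n, phi (t0 / 2 ^ n)%R = phi t0 /\ (0 <= t0 / 2 ^ n <= 1)%R.
  elim=> [|n [IH1 IH2]]; first by rewrite /= Rdiv_1_r.
  have E : (t0 / 2 ^ S n = t0 / 2 ^ n / 2)%R.
    rewrite /=; field; apply: pow_nonzero; lra.
  rewrite E; split; last lra.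
  have := Hd _ IH2; have := Hmax (t0 / 2 ^ n / 2)%R ltac:(lra).
  have := Hmax ((t0 / 2 ^ n + 1) / 2)%R ltac:(lra); lra.
suff -> : phi 0%R = phi t0 by exact: Hmax.
apply: NNPP => Hne.
have He : (0 < Rabs (phi t0 - phi 0))%R by apply: Rabs_pos_lt; lra.
have [al [Hal H]] := Hc 0%R ltac:(lra) _ He.
have [n Hn] : exists n, (t0 / 2 ^ n < al)%R.
  have [n Hn] := pow_lt_1_zero (/ 2) ltac:(rewrite Rabs_pos_eq; lra) al Hal.
  exists n; have := Hn n (Nat.le_refl n).
  have Hp : (0 < (/ 2) ^ n)%R by apply: pow_lt; lra.
  rewrite Rabs_pos_eq; last lra.
  rewrite /Rdiv -pow_inv; nra.
have [E1 E2] := Hit n.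
case: (Req_dec (t0 / 2 ^ n) 0) => E0; first by apply: Hne; rewrite -E0 E1.
have := H (t0 / 2 ^ n)%R; rewrite /D_x /no_cond /dist /= /R_dist E1.
move=> H1; have := H1 _; rewrite Rminus_0_r Rabs_pos_eq; last lra.
move=> H2; have := H2 (conj (conj I (fun E => E0 (eq_sym E))) Hn); lra.
Qed.

(** Apply [herglotz_max] to [phi] and to its negative. *)
Lemma herglotz phi kp : (forall t, (0 <= t <= 1)%R -> continuity_pt phi t) ->
  (forall t, (0 <= t <= 1)%R -> (2 * phi t = phi (t / 2) + phi ((t + 1) / 2) + kp)%R) ->
  forall t, (0 <= t <= 1)%R -> phi t = phi 0%R.
Proof.
move=> Hc Hd t Ht.
have [H1 H2] := herglotz_max phi kp Hc Hd.
have [H3 H4] := herglotz_max (fun t => - phi t)%R (- kp)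
  (fun t Ht => continuity_pt_opp _ _ (Hc t Ht)) ltac:(move=> s /Hd; lra).
have A := H2 ltac:(lra) t Ht; have B := H4 ltac:(lra) t Ht; lra.
Qed.

Lemma continuity_pt_of_an (f : C -> C) (L : C -> R) (t : R) :
  (forall z w, (Rabs (L z - L w) <= Cmod (z - w))%R) -> analytic_at (RtoC t) f ->
  continuity_pt (fun t => L (f (RtoC t))) t.
Proof.
move=> HL Hf eps He; have [d [Hd H]] := an_continuous _ _ _ Hf He.
exists d; split => // s [_ Hs]; rewrite /dist /= /R_dist in Hs *.
apply: Rle_lt_trans (HL _ _) _; apply: H.
by rewrite -RtoC_minus Cmod_R.
Qed.

(** On [0, 1] apply [herglotz] to the real and to the imaginary part; the
    identity theorem does the rest. *)
Lemma Hcot_const x : Hcot x = Hcot 0.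
Proof.
have [kp Hkp] := Hcot_double.
have Hpart : forall L : C -> R, (forall z w, L (z + w) = (L z + L w)%R) ->
   (forall z w, (Rabs (L z - L w) <= Cmod (z - w))%R) ->
   forall t, (0 <= t <= 1)%R -> L (Hcot (RtoC t)) = L (Hcot 0).
  move=> L Hadd Hlip t Ht.
  apply: (herglotz (fun t => L (Hcot (RtoC t))) (L kp)) Ht => s Hs.
    apply: (continuity_pt_of_an _ _ _ Hlip); exact: Hcot_an.
  have := Hkp (RtoC s).
  have -> : 2 * Hcot s = Hcot s + Hcot s by ring.
  have -> : / 2 * RtoC s = RtoC (s / 2).
    rewrite /Rdiv RtoC_mult RtoC_inv; [ring|lra].
  have -> : RtoC (s / 2) + / 2 = RtoC ((s + 1) / 2).
    rewrite -RtoC_inv; last lra.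
    rewrite -RtoC_plus; congr RtoC; field.
  move=> /(f_equal L); rewrite !Hadd; lra.
have H01 : forall t, (0 <= t <= 1)%R -> Hcot (RtoC t) = Hcot 0.
  move=> t Ht; rewrite (surjective_pairing (Hcot t)) (surjective_pairing (Hcot 0)).
  congr pair.
    apply: (Hpart fst) => // z w; rewrite -/(Re z) -/(Re w).
    have -> : (Re z - Re w)%R = Re (z - w) by []. exact: re_le_Cmod.
  apply: (Hpart snd) => // z w; rewrite -/(Im z) -/(Im w).
  have -> : (Im z - Im w)%R = Im (z - w) by [].
  apply: Rle_trans (Rmax_Cmod _); exact: Rmax_r.
have [eps He|d [Hd E]] := an_eq_near 0 Hcot (fun _ => Hcot 0) (Hcot_an 0) (an_const _ _).
  have Hm : (0 < Rmin eps 1)%R by apply: Rmin_pos; lra.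
  have M1 := Rmin_l eps 1; have M2 := Rmin_r eps 1.
  exists (RtoC (Rmin eps 1 / 2)); rewrite H01; last lra.
  split => //; replace (RtoC (Rmin eps 1 / 2) - 0) with (RtoC (Rmin eps 1 / 2)) by ring.
  rewrite Cmod_R Rabs_pos_eq; lra.
apply: (an_eq_everywhere Hcot (fun _ => Hcot 0) 0 Hcot_an (fun z => an_const _ _)).
exists d; split => // z Hz; rewrite E; [ring|lra].
Qed.

Lemma kap_opp x : qexp x <> 1 -> kap (- x) = 1 - kap x.
Proof.
move=> Hx; rewrite /kap qexp_opp.
have H0 := qexp_neq0 x; have H1 := kap_neq _ Hx.
have H2 : qexp x - 1 <> 0 by apply: Csub_neq0.
field; by auto.
Qed.

Lemma pfs_opp x : pfs (- x) = - pfs x.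
Proof.
apply: (has_sum_unique _ _ _ (pfs_spec (- x))).
apply: has_sum_ext (has_sum_Zopp _ _ (has_sum_opp _ _ (pfs_spec x))) => m.
rewrite /pf opp_IZR RtoC_opp.
have Ei : forall z : C, / (- z) = - / z.
  move=> z; case: (Ceq_dec z 0) => [->|Hz]; last by field.
  have -> : - RtoC 0 = 0 by ring.
  have -> : / RtoC 0 = 0.
    by apply: injective_projections; rewrite /= /Rdiv ?Ropp_0 Rmult_0_l.
  ring.
replace (- x - IZR m) with (- (x - - IZR m)) by ring; rewrite (Ei (x - - IZR m)).
case: (Z.eqb_spec m 0) => Hm.
  rewrite Hm; change (Z.eqb (- 0) 0) with true; cbv iota. ring.
have -> : Z.eqb (- m) 0 = false by apply/Z.eqb_neq; lia.
rewrite Ei; ring.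
Qed.

(** The difference of the two sides is constant and odd. *)
Theorem cotangent_partial_fractions x : qexp x <> 1 -> pfs x = cotp x.
Proof.
have Hi : qexp Ci <> 1 by move=> /qexp_Im0 /=; lra.
have Hi2 : qexp (- Ci) <> 1 by move=> /qexp_Im0 /=; lra.
have E : Hcot Ci = - Hcot Ci.
  rewrite {1}(Hcot_const Ci) -(Hcot_const (- Ci)) !Hcot_off //.
  rewrite /fcot pfs_opp /cotp kap_opp //; field; exact: RtoC2_neq0.
have E0 : Hcot 0 = 0.
  rewrite -(Hcot_const Ci); replace (Hcot Ci) with (/ 2 * (Hcot Ci - - Hcot Ci)).
    rewrite -E; ring.
  field; exact: RtoC2_neq0.
move=> Hx; have := Hcot_off x Hx; rewrite Hcot_const E0 /fcot => E1.
replace (pfs x) with (cotp x - (cotp x - pfs x)) by ring; rewrite -E1; ring.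
Qed.

(** * The Weierstrass zeta function *)

Lemma inv_sq_bound u delta : (0 < delta)%R ->
  (forall m, (delta <= Cmod (u - RtoC (IZR m)))%R) ->
  exists K, (0 <= K)%R /\ forall m, (Cmod (/ (u - RtoC (IZR m)) ^ 2) <= K * sqw m)%R.
Proof.
move=> Hd H; set K1 := (1 + (Cmod u + 1) / delta)%R.
have Hu := Cmod_ge_0 u.
have HK1 : (0 < K1)%R.
  have : (0 < (Cmod u + 1) / delta)%R by apply: Rdiv_lt_0_compat; lra.
  rewrite /K1; lra.
exists (K1 ^ 2)%R; split; first by apply: pow2_ge_0.
move=> m; have Hm := H m; have Hl := dist_lower u m.
set p := u - RtoC (IZR m) in Hm Hl *.
have Hp : p <> 0 by apply: Cmod_pos_neq0; lra.
rewrite Cmod_inv; last by apply: Cpow_neq0.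
rewrite Cmod_pow /sqw.
set a := INR _ in Hl *; have Ha : (0 <= a)%R := pos_INR _.
have HK : (a + 1 <= K1 * Cmod p)%R.
  have : ((Cmod u + 1) <= (Cmod u + 1) / delta * Cmod p)%R.
    have -> : ((Cmod u + 1) / delta * Cmod p = (Cmod u + 1) * (Cmod p / delta))%R by field; lra.
    have : (1 <= Cmod p / delta)%R.
      apply: (Rmult_le_reg_r delta) => //.
      have -> : (Cmod p / delta * delta = Cmod p)%R by field; lra.
      lra.
    nra.
  rewrite /K1; lra.
have H2 : ((a + 1) ^ 2 <= K1 ^ 2 * Cmod p ^ 2)%R.
  rewrite -Rpow_mult_distr; apply: pow_incr; lra.
have Hp2 : (0 < Cmod p ^ 2)%R by apply: pow_lt; lra.
have Ha2 : (0 < (a + 1) ^ 2)%R by apply: pow_lt; lra.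
apply: (Rmult_le_reg_r (Cmod p ^ 2)) => //; rewrite Rinv_l; last lra.
apply: (Rmult_le_reg_r ((a + 1) ^ 2)) => //.
have -> : (K1 ^ 2 * / (a + 1) ^ 2 * Cmod p ^ 2 * (a + 1) ^ 2 = K1 ^ 2 * Cmod p ^ 2)%R by field; lra.
lra.
Qed.

(** [sum_m (u - m)^-2] is minus the derivative of the cotangent at [u], read
    off as the linear coefficient of the power series. *)
Lemma cotp_coef1 u E c r M : Im u <> 0%R -> (0 < r)%R ->
  has_sum (fun m => / (u - RtoC (IZR m)) ^ 2) E ->
  W c r M (fun h => cotp (u + h)) -> c 1%nat = - E.
Proof.
move=> Hu Hr HE HW.
set delta := Rabs (Im u).
have Hd : (0 < delta)%R by apply: Rabs_pos_lt.
have HIm : forall (v : C) m, (Rabs (Im v) <= Cmod (v - RtoC (IZR m)))%R.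
  move=> v m; apply: Rle_trans (Rmax_Cmod _).
  have -> : Im v = snd (v - RtoC (IZR m)) by case: v => a b /=; ring.
  exact: Rmax_r.
have [K [HK HB]] := inv_sq_bound u delta Hd (HIm u).
have [K2 [HK2 HB2]] := pf_bound u.
set s := (delta / 2)%R; have Hs : (0 < s)%R by rewrite /s; lra.
pose psi m := / (u - RtoC (IZR m)).
have Hp : forall m, u - RtoC (IZR m) <> 0.
  move=> m; apply: Cmod_pos_neq0; have := HIm u m; rewrite -/delta; lra.
have Hpsi : forall m, (Cmod (- psi m) * (s * Cmod 1) <= / 2)%R.
  move=> m; rewrite Cmod_opp Cmod_1 /psi Cmod_inv //.
  have H1 := HIm u m; rewrite -/delta in H1.
  apply: (Rmult_le_reg_l (Cmod (u - RtoC (IZR m)))); first lra.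
  rewrite -Rmult_assoc Rinv_r; last lra.
  rewrite /s; lra.
have HWm : forall m, exists d, d 1%nat = - (psi m) ^ 2 /\
    W d s (K2 * sqw m + K * sqw m * (s * 2)) (fun h => pf m (u + h)).
  move=> m; have H1 := W_scal (- psi m) _ _ _ _ (W_shift _ _ _ _ (Rlt_le _ _ Hs) (W_const s 1 (Rlt_le _ _ Hs))).
  have H2 := W_Mle _ _ _ _ _ (Hpsi m) H1.
  have [e He] := W_geom _ _ _ _ Hs (Rle_refl _) H2.
  have H3 := W_plus _ _ _ _ _ _ _ (Rlt_le _ _ Hs) (W_const s 1 (Rlt_le _ _ Hs)) He.
  have He0 : e 0%nat = 0.
    rewrite -(W_value0 _ _ _ _ (Rlt_le _ _ Hs) He); rewrite /Cdiv; ring.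
  have H4 := W_scal (- (psi m) ^ 2) _ _ _ _ (W_shift _ _ _ _ (Rlt_le _ _ Hs) H3).
  have H5 := W_plus _ _ _ _ _ _ _ (Rlt_le _ _ Hs) (W_const s (pf m u) (Rlt_le _ _ Hs)) H4.
  eexists; split; last first.
    apply: W_Mle (W_ext _ _ _ _ _ _ H5).
      rewrite Cmod_1 Cmod_opp.
      have := HB2 m; have := HB m.
      have -> : / (u - IZR m) ^ 2 = psi m ^ 2 by rewrite /psi Cpow_inv.
      have -> : (1 + 2 * / 2 = 2)%R by field.
      move=> A B; apply: Rplus_le_compat => //; apply: Rmult_le_compat_r => //; lra.
    move=> h Hh; rewrite /pf /psi.
    have Hph : u - RtoC (IZR m) + h <> 0.
      move=> E0; have := HIm (u + h) m; replace (u + h - IZR m) with (u - IZR m + h) by ring.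
      rewrite E0 Cmod_0.
      have Hh2 : (Rabs (Im h) <= s)%R.
        apply: Rle_trans Hh; apply: Rle_trans (Rmax_Cmod _); exact: Rmax_r.
      have -> : Im (u + h) = (Im u + Im h)%R by [].
      have := Rabs_triang_inv (Im u) (- Im h); rewrite Rabs_Ropp -/delta.
      replace (Im u - - Im h)%R with (Im u + Im h)%R by ring.
      rewrite /s in Hh2; lra.
    have Hpm := Hp m.
    replace (u + h - IZR m) with (u - IZR m + h) by ring.
    set p := u - IZR m in Hph Hpm *.
    have Hq : 1 - - / p * (h * 1) <> 0.
      move=> E0; apply: Hph; replace (p + h) with (p * (1 - - / p * (h * 1))) by (field; done).
      rewrite E0; ring.
    have -> : 1 + - / p * (h * 1) / (1 - - / p * (h * 1)) = p / (p + h).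
      field; split => //; by replace (p + h * 1) with (p + h) by ring.
    set w := (if _ then _ else _); field; by split.
  rewrite /= He0; ring.
pose d m := proj1_sig (constructive_indefinite_description _ (HWm m)).
have Hdm : forall m, d m 1%nat = - (psi m) ^ 2 /\
    W (d m) s (K2 * sqw m + K * sqw m * (s * 2)) (fun h => pf m (u + h)).
  move=> m; exact: proj2_sig (constructive_indefinite_description _ (HWm m)).
have HS : bsum (fun m => (K2 * sqw m + K * sqw m * (s * 2))%R) ((K2 + K * (s * 2)) * (2 + 2)).
  apply: bsum_le (bsum_scal (K2 + K * (s * 2)) _ _ _ sqw_bsum); last by nra.
  move=> m; have := sqw_pos m => Hw.
  have : (0 <= K * (s * 2))%R by nra.
  split; nra.
have Hex : forall h, (Cmod h <= s)%R -> qexp (u + h) <> 1.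
  move=> h Hh /qexp_Im0; have -> : Im (u + h) = (Im u + Im h)%R by [].
  have Hh2 : (Rabs (Im h) <= s)%R.
    apply: Rle_trans Hh; apply: Rle_trans (Rmax_Cmod _); exact: Rmax_r.
  move=> E0; have E1 : Im u = (- Im h)%R by lra.
  move: Hh2; rewrite -(Rabs_Ropp (Im h)) -E1 -/delta /s; lra.
have HP : forall h, (Cmod h <= s)%R -> has_sum (fun m => pf m (u + h)) (cotp (u + h)).
  move=> h Hh; rewrite -cotangent_partial_fractions; [exact: pfs_spec|exact: Hex].
have [e [He HWe]] := W_sum d s _ _ _ _ Hs (fun m => proj2 (Hdm m)) HS HP.
have -> : c 1%nat = e 1%nat.
  apply: (W_unique _ _ _ _ _ _ _ _ Hr Hs HW HWe) => eps Heps.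
  have [z [Hz _]] := exists_near 0 0 _ Heps; exists z.
  by replace (z - 0) with z in Hz by ring.
apply: (has_sum_unique _ _ _ (He 1%nat)).
apply: has_sum_ext (has_sum_opp _ _ HE) => m.
by rewrite (proj1 (Hdm m)) /psi Cpow_inv.
Qed.

Lemma const_value_eq f c : mero_eq f (fun _ => c) -> const_value f = c.
Proof.
move=> H; have := epsilon_spec (inhabits (RtoC 0)) (fun c => mero_eq f (fun _ => c)) (ex_intro _ c H).
rewrite -/(const_value f) => H2.
have [r Hr] := H 0; have [s Hs] := H2 0.
have Hm : (0 < Rmin r s)%R by apply: Rmin_pos; exact: cond_pos.
have [z [Hz _]] := exists_near 0 0 _ Hm.
have M1 := Rmin_l r s; have M2 := Rmin_r r s.
rewrite -(Hr z); last lra.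
rewrite (Hs z) //; lra.
Qed.

Lemma RtoC_IZR_neq0 m : m <> 0%Z -> RtoC (IZR m) <> 0.
Proof. move=> H /RtoC_inj E; apply: H; exact: eq_IZR E. Qed.

Section Zeta.
Variables (tau : C) (htau : (0 < Im tau)%R).

Definition esq (n m : Z) : C :=
  if (Z.eqb m 0 && Z.eqb n 0)%bool then RtoC 0 else / (RtoC (IZR m) + RtoC (IZR n) * tau) ^ 2.

(** Row sums of [/ w ^ 2] over the lattice, the coefficients of [x] in the
    rows of the zeta series. *)
Definition Esum (n : Z) : C := epsilon (inhabits (RtoC 0)) (has_sum (esq n)).

Lemma Im_ntau (n : Z) : Im (RtoC (IZR n) * tau) = (IZR n * Im tau)%R.
Proof. case: tau => a b /=; ring. Qed.

Lemma esq_bound n : exists K, (0 <= K)%R /\ forall m, (Cmod (esq n m) <= K * sqw m)%R.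
Proof.
case: (Z.eq_dec n 0) => Hn.
  exists 4%R; split; first lra; move=> m; rewrite /esq Hn.
  have Hs := sqw_pos m.
  rewrite Z.eqb_refl Bool.andb_true_r.
  case: Z.eqb_spec => Hm; first by rewrite Cmod_0; lra.
  have -> : RtoC (IZR m) + 0 * tau = RtoC (IZR m) by ring.
  rewrite Cmod_inv; last by apply: Cpow_neq0; exact: RtoC_IZR_neq0.
  rewrite Cmod_pow Cmod_IZR /sqw.
  have Ha : (1 <= INR (Z.abs_nat m))%R by apply: (le_INR 1); lia.
  set a := INR _ in Ha *.
  have -> : (4 * / (a + 1) ^ 2 = / ((a + 1) ^ 2 / 4))%R by field; lra.
  apply: Rinv_le_contravar; nra.
set u := RtoC (IZR (- n)) * tau.
have Hd : (0 < Rabs (Im u))%R.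
  apply: Rabs_pos_lt; rewrite /u Im_ntau.
  have : IZR (- n) <> 0%R by move=> E; have := eq_IZR _ _ E; lia.
  nra.
have [|K [HK HB]] := inv_sq_bound u _ Hd.
  move=> m; apply: Rle_trans (Rmax_Cmod _).
  have -> : Im u = snd (u - RtoC (IZR m)) by case: (u) => a b /=; ring.
  exact: Rmax_r.
exists K; split => // m; apply: Rle_trans (HB m); right; congr Cmod.
rewrite /esq; have -> : Z.eqb n 0 = false by apply/Z.eqb_neq.
rewrite Bool.andb_false_r; congr Cinv; rewrite /u opp_IZR RtoC_opp; ring.
Qed.

Lemma Esum_spec n : has_sum (esq n) (Esum n).
Proof.
apply: (epsilon_spec (inhabits (RtoC 0))).
have [K [HK H]] := esq_bound n.
exact: has_sum_exists H (bsum_scal _ _ _ HK sqw_bsum).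
Qed.

Lemma decay_extend (u : Z -> R) N K : (0 <= K)%R -> (forall n, (0 <= u n)%R) ->
  (forall n, (N < Z.abs_nat n)%nat -> (u n <= K * qn tau ^ Z.abs_nat n)%R) ->
  exists K', (0 <= K')%R /\ forall n, (u n <= K' * qn tau ^ Z.abs_nat n)%R.
Proof.
move=> HK Hu H; have Hq := qn_pos tau.
have [K2 [HK2 H2]] : exists K2, (0 <= K2)%R /\
    forall n, In n (Zball N) -> (u n <= K2 * qn tau ^ Z.abs_nat n)%R.
  elim: (Zball N) => [|m l [K2 [HK2 IH]]]; first by exists 0%R; split => //; lra.
  have Hm : (0 < qn tau ^ Z.abs_nat m)%R by apply: pow_lt.
  have Hi := Rinv_0_lt_compat _ Hm.
  have Hum := Hu m; have Hpi : (0 <= u m * / qn tau ^ Z.abs_nat m)%R by nra.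
  exists (K2 + u m * / qn tau ^ Z.abs_nat m)%R; split; first lra.
  move=> k [<-|Hk].
    have -> : ((K2 + u m * / qn tau ^ Z.abs_nat m) * qn tau ^ Z.abs_nat m
       = K2 * qn tau ^ Z.abs_nat m + u m)%R by field; lra.
    nra.
  have Hk2 : (0 < qn tau ^ Z.abs_nat k)%R by apply: pow_lt.
  have := IH k Hk; nra.
exists (K + K2)%R; split; first lra.
move=> m; have Hm : (0 < qn tau ^ Z.abs_nat m)%R by apply: pow_lt.
case: (Nat.le_gt_cases (Z.abs_nat m) N) => Hn.
  have := H2 m (proj2 (Zball_In N m) Hn); nra.
have := H m Hn; nra.
Qed.

(** Up to a constant factor [Esum n] is a Taylor coefficient at 0 of [lam (-
    n)], whose norm decays. *)
Lemma Esum_decay : exists K, (0 <= K)%R /\ forall n, (Cmod (Esum n) <= K * qn tau ^ Z.abs_nat n)%R.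
Proof.
have [N [K [HK H]]] := lam_tail tau htau 0.
have HD := Cmod_ge_0 D0.
apply: (decay_extend (fun n => Cmod (Esum n)) N (Cmod D0 * K)); [nra|by move=> n; exact: Cmod_ge_0|].
move=> n Hn; have [d Hd] := H (- n)%Z ltac:(lia).
replace (Z.abs_nat (- n)) with (Z.abs_nat n) in Hd by lia.
set u := RtoC (IZR (- n)) * tau.
have HE : has_sum (fun m => / (u - RtoC (IZR m)) ^ 2) (Esum n).
  apply: has_sum_ext (Esum_spec n) => m; rewrite /esq.
  have -> : Z.eqb n 0 = false by apply/Z.eqb_neq; lia.
  rewrite Bool.andb_false_r; congr Cinv; rewrite /u opp_IZR RtoC_opp; ring.
have H1 := W_plus _ _ _ _ _ _ _ Rle_0_1 (W_scal D0 _ _ _ _ Hd)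
  (W_const 1 (D0 * (if (0 <=? - n)%Z then RtoC 1 else RtoC 0) - D0 / 2) Rle_0_1).
have HW : W (fun k => D0 * d k + match k with O => D0 * (if (0 <=? - n)%Z then RtoC 1 else RtoC 0) - D0 / 2 | _ => 0 end)
   1 (Cmod D0 * (K * qn tau ^ Z.abs_nat n) + Cmod (D0 * (if (0 <=? - n)%Z then RtoC 1 else RtoC 0) - D0 / 2)) (fun h => cotp (u + h)).
  apply: (W_ext _ _ _ _ _ _ H1) => h _; rewrite /lam /cotp.
  replace (0 + h + IZR (- n) * tau) with (u + h) by (rewrite /u; ring).
  ring.
have Hu : Im u <> 0%R.
  rewrite /u Im_ntau; have : IZR (- n) <> 0%R by move=> E; have := eq_IZR _ _ E; lia.
  nra.
have := cotp_coef1 u _ _ _ _ Hu Rlt_0_1 HE HW; rewrite Cplus_0_r => E.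
have -> : Cmod (Esum n) = (Cmod D0 * Cmod (d 1%nat))%R by rewrite -Cmod_mult E Cmod_opp.
have := W_coef_bound _ _ _ _ 1 Rlt_0_1 Hd; rewrite pow1 Rdiv_1_r; nra.
Qed.

Definition zterm (x : C) (n m : Z) : C :=
  if (Z.eqb m 0 && Z.eqb n 0)%bool then RtoC 0
  else let w := RtoC (IZR m) + RtoC (IZR n) * tau in / (x - w) + / w + x / w ^ 2.

(** The sum of [zterm x n] over [m], in closed form by the partial fractions
    of the cotangent. *)
Definition zrow (x : C) (n : Z) : C :=
  (if Z.eqb n 0 then cotp x - / x
   else cotp (x + RtoC (IZR (- n)) * tau) - cotp (0 + RtoC (IZR (- n)) * tau)) + x * Esum n.

Lemma ntau_neq1 n : n <> 0%Z -> qexp (0 + RtoC (IZR n) * tau) <> 1.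
Proof.
move=> Hn /qexp_Im0; rewrite Cplus_0_l Im_ntau => E.
have : IZR n <> 0%R by move=> E0; exact: Hn (eq_IZR _ _ E0).
nra.
Qed.

Lemma Cinv_opp (z : C) : / (- z) = - / z.
Proof.
case: (Ceq_dec z 0) => [->|Hz]; last by field.
have -> : - RtoC 0 = 0 by ring.
have -> : / RtoC 0 = 0.
  by apply: injective_projections; rewrite /= /Rdiv ?Ropp_0 Rmult_0_l.
ring.
Qed.

Lemma zterm_pf x n m : zterm x n m =
  (if Z.eqb n 0 then pf m x - (if Z.eqb m 0 then / x else RtoC 0)
   else pf m (x + RtoC (IZR (- n)) * tau) - pf m (0 + RtoC (IZR (- n)) * tau)) + x * esq n m.
Proof.
rewrite /zterm /esq /pf opp_IZR RtoC_opp.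
case: (Z.eqb_spec n 0) => Hn; case: (Z.eqb_spec m 0) => Hm; simpl andb; cbv iota.
- rewrite Hm; replace (x - 0) with x by ring; ring.
- rewrite Hn; replace (RtoC (IZR m) + 0 * tau) with (RtoC (IZR m)) by ring.
  rewrite /Cdiv; ring.
- rewrite Hm; replace (0 + - IZR n * tau - 0) with (- (0 + IZR n * tau)) by ring.
  rewrite Cinv_opp; replace (x + - IZR n * tau - 0) with (x - (0 + IZR n * tau)) by ring.
  rewrite /Cdiv; ring.
replace (0 + - IZR n * tau - IZR m) with (- (IZR m + IZR n * tau)) by ring.
rewrite Cinv_opp; replace (x + - IZR n * tau - IZR m) with (x - (IZR m + IZR n * tau)) by ring.
rewrite /Cdiv; ring.
Qed.

Lemma zterm_row x n : ~ in_lattice tau x -> ZSeries (zterm x n) = zrow x n.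
Proof.
move=> Hx.
have HE := has_sum_scal x _ _ (Esum_spec n).
have [K3 [HK3 B3]] := esq_bound n.
have Hx0 := Cmod_ge_0 x.
have [K [HK [B HS]]] : exists K, (0 <= K)%R /\ (forall m, (Cmod (zterm x n m) <= K * sqw m)%R) /\
    has_sum (zterm x n) (zrow x n).
  have Hbd : forall m a b c, (Cmod a <= b * sqw m)%R -> (0 <= b)%R -> (Cmod c <= K3 * sqw m)%R ->
     (Cmod (a + x * c) <= (b + Cmod x * K3) * sqw m)%R.
    move=> m a b c Ha Hb Hc; apply: Rle_trans (Cmod_triangle _ _) _; rewrite Cmod_mult.
    have := sqw_pos m; have := Cmod_ge_0 c; nra.
  case: (Z.eq_dec n 0) => Hn.
    have [K1 [HK1 B1]] := pf_bound x.
    have Hix := Cmod_ge_0 (/ x).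
    have Hex : qexp x <> 1.
      have := nlat_qexp tau x 0 Hx; by replace (x + RtoC (IZR 0) * tau) with x by ring.
    exists (K1 + Cmod (/ x) + Cmod x * K3)%R; split; first nra; split.
      move=> m; rewrite zterm_pf Hn Z.eqb_refl; apply: Hbd => //; last by rewrite -Hn.
        apply: Rle_trans (Cmod_triangle _ _) _; rewrite Cmod_opp.
        have -> : ((K1 + Cmod (/ x)) * sqw m = K1 * sqw m + Cmod (/ x) * sqw m)%R by ring.
        apply: Rplus_le_compat => //; have := sqw_pos m; case: Z.eqb_spec => Hm Hs.
          by rewrite Hm /sqw /= Rplus_0_l !Rmult_1_l Rinv_1 Rmult_1_r; lra.
        rewrite Cmod_0; nra.
      lra.
    apply: (has_sum_ext (fun m => pf m x - (if Z.eqb m 0 then / x else RtoC 0) + x * esq n m)).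
      by move=> m; rewrite zterm_pf Hn Z.eqb_refl.
    rewrite /zrow (proj2 (Z.eqb_eq n 0) Hn); apply: has_sum_plus => //; apply: has_sum_minus.
      rewrite -cotangent_partial_fractions //; exact: pfs_spec.
    by apply: (has_sum_single 0%Z (fun m => if Z.eqb m 0 then / x else RtoC 0)) => m Hm; case: Z.eqb_spec.
  have En : Z.eqb n 0 = false by apply/Z.eqb_neq.
  have [K1 [HK1 B1]] := pf_bound (x + RtoC (IZR (- n)) * tau).
  have [K2 [HK2 B2]] := pf_bound (0 + RtoC (IZR (- n)) * tau).
  exists (K1 + K2 + Cmod x * K3)%R; split; first nra; split.
    move=> m; rewrite zterm_pf En; apply: Hbd => //; last lra.
    apply: Rle_trans (Cmod_triangle _ _) _; rewrite Cmod_opp.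
    have := B1 m; have := B2 m; lra.
  apply: (has_sum_ext (fun m => pf m (x + RtoC (IZR (- n)) * tau) -
      pf m (0 + RtoC (IZR (- n)) * tau) + x * esq n m)).
    by move=> m; rewrite zterm_pf En.
  rewrite /zrow En; apply: has_sum_plus => //; apply: has_sum_minus.
    rewrite -cotangent_partial_fractions; [exact: pfs_spec|exact: nlat_qexp].
  rewrite -cotangent_partial_fractions; [exact: pfs_spec|apply: ntau_neq1; lia].
exact: has_sum_ZSeries B (bsum_scal _ _ _ HK sqw_bsum) HS.
Qed.

Lemma bernoulli_1 : bernoulli 1 = (- / 2)%R.
Proof. rewrite /bernoulli /= /Binomial.C /=; field. Qed.

Lemma lam_opp n : n <> 0%Z -> lam tau (- n) 0 = - lam tau n 0.
Proof.
move=> Hn; rewrite /lam.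
have -> : 0 + RtoC (IZR (- n)) * tau = - (0 + RtoC (IZR n) * tau).
  rewrite opp_IZR RtoC_opp; ring.
rewrite kap_opp; last exact: ntau_neq1.
case: (Z.leb_spec 0 n) => H1; case: (Z.leb_spec 0 (- n)) => H2; try lia; ring.
Qed.

(** Add up the closed forms of the rows: the values of [lam] at 0 cancel in
    pairs, those at [x] form [ghat tau 1], and the [x * Esum n] form a linear
    term. *)
Lemma zeta_ghat : exists e, forall x, ~ in_lattice tau x -> zeta tau x = ghat tau 1 x + e * x.
Proof.
have [KE [HKE BE]] := Esum_decay.
have Hq := qn_pos tau; have Hq1 := qn_lt1 tau htau.
have HG := bsum_geomZ (qn tau) ltac:(lra).
have [Etot HEt] := has_sum_exists _ _ _ BE (bsum_scal _ _ _ HKE HG).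
exists Etot => x Hx.
have [Kx [HKx Bx]] := lam_bound tau htau x.
have [K0 [HK0 B0]] := lam_bound tau htau 0.
pose lz n := if Z.eqb n 0 then RtoC 0 else lam tau (- n) 0.
have Hrow : forall n, zrow x n = D0 * lam tau (- n) x - D0 * lz n + x * Esum n +
    (if Z.eqb n 0 then D0 / 2 - / x else RtoC 0).
  move=> n; rewrite /zrow /lz /lam /cotp.
  case: Z.eqb_spec => Hn; last ring.
  rewrite Hn /=; have -> : x + 0 * tau = x by ring.
  have Hx0 : x <> 0.
    move=> E; apply: Hx; exists 0%Z, 0%Z; rewrite E; ring.
  have H2 := RtoC2_neq0; field; by auto.
have Hlz : forall n, (Cmod (lz n) <= K0 * qn tau ^ Z.abs_nat n)%R.
  move=> n; rewrite /lz; case: Z.eqb_spec => Hn.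
    rewrite Cmod_0; apply: Rmult_le_pos => //; apply: pow_le; lra.
  have := B0 (- n)%Z; by replace (Z.abs_nat (- n)) with (Z.abs_nat n) by lia.
have [lzs Hlzs] := has_sum_exists _ _ _ Hlz (bsum_scal _ _ _ HK0 HG).
have Elzs : lzs = 0.
  have H2 : has_sum lz (- lzs).
    apply: has_sum_ext (has_sum_Zopp _ _ (has_sum_opp _ _ Hlzs)) => n; rewrite /lz.
    case: (Z.eqb_spec n 0) => Hn.
      rewrite Hn; change (Z.eqb (- 0) 0) with true; cbv iota; ring.
    have -> : Z.eqb (- n) 0 = false by apply/Z.eqb_neq; lia.
    rewrite -lam_opp; last lia.
    by rewrite Z.opp_involutive.
  have E := has_sum_unique _ _ _ Hlzs H2.
  replace lzs with (/ 2 * (lzs - - lzs)) by (field; exact: RtoC2_neq0).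
  rewrite -E; ring.
have HL := Lam_spec tau htau (wpol 0) x (weight_wpol tau htau 0).
have HL2 : has_sum (fun n => D0 * lam tau (- n) x) (D0 * Lam tau (wpol 0) x).
  apply: has_sum_scal; apply: has_sum_ext (has_sum_Zopp _ _ HL) => n.
  rewrite /wpol; have -> : RtoC (INR (fact 0)) = 1 by [].
  have H1 : RtoC 1 <> 0 by move=> /RtoC_inj; lra.
  rewrite /=; field; done.
have H0 : has_sum (fun n => if Z.eqb n 0 then D0 / 2 - / x else RtoC 0) (D0 / 2 - / x).
  by apply: (has_sum_single 0%Z (fun n => if Z.eqb n 0 then D0 / 2 - / x else RtoC 0)) => m Hm; case: Z.eqb_spec.
have HS := has_sum_plus _ _ _ _ (has_sum_plus _ _ _ _ (has_sum_minus _ _ _ _ HL2 (has_sum_scal D0 _ _ Hlzs))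
  (has_sum_scal x _ _ HEt)) H0.
have HS2 : has_sum (zrow x) (D0 * Lam tau (wpol 0) x - D0 * lzs + x * Etot + (D0 / 2 - / x)).
  by apply: has_sum_ext HS => n; rewrite Hrow.
set K := (Cmod D0 * Kx + Cmod D0 * K0 + Cmod x * KE + Cmod (D0 / 2 - / x))%R.
have HD := Cmod_ge_0 D0; have HX := Cmod_ge_0 x; have HY := Cmod_ge_0 (D0 / 2 - / x).
have HB : forall n, (Cmod (zrow x n) <= K * qn tau ^ Z.abs_nat n)%R.
  move=> n; rewrite Hrow.
  have Hp : (0 < qn tau ^ Z.abs_nat n)%R by apply: pow_lt.
  have A1 := Bx (- n)%Z; replace (Z.abs_nat (- n)) with (Z.abs_nat n) in A1 by lia.
  have A2 := Hlz n; have A3 := BE n.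
  have A4 : (Cmod (if Z.eqb n 0 then D0 / 2 - / x else RtoC 0)%C <= Cmod (D0 / 2 - / x) * qn tau ^ Z.abs_nat n)%R.
    case: Z.eqb_spec => Hn; first by rewrite Hn /= Rmult_1_r; lra.
    rewrite Cmod_0; nra.
  have T1 := Cmod_triangle (D0 * lam tau (- n) x - D0 * lz n + x * Esum n) (if Z.eqb n 0 then D0 / 2 - / x else RtoC 0).
  have T2 := Cmod_triangle (D0 * lam tau (- n) x - D0 * lz n) (x * Esum n).
  have T3 := Cmod_triangle (D0 * lam tau (- n) x) (- (D0 * lz n)).
  rewrite Cmod_opp !Cmod_mult in T3; rewrite Cmod_mult in T2.
  have M1 := Rmult_le_compat_l _ _ _ HD A1.
  have M2 := Rmult_le_compat_l _ _ _ HD A2.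
  have M3 := Rmult_le_compat_l _ _ _ HX A3.
  have -> : (K * qn tau ^ Z.abs_nat n = Cmod D0 * (Kx * qn tau ^ Z.abs_nat n) +
     Cmod D0 * (K0 * qn tau ^ Z.abs_nat n) + Cmod x * (KE * qn tau ^ Z.abs_nat n) +
     Cmod (D0 / 2 - / x) * qn tau ^ Z.abs_nat n)%R by rewrite /K; ring.
  rewrite /Cminus in T1 T2 T3 A4 *; lra.
have HK : (0 <= K)%R by rewrite /K; nra.
have EZ := has_sum_ZSeries _ _ _ _ HB (bsum_scal _ _ _ HK HG) HS2.
rewrite /zeta.
have -> : ZSeries (fun n => ZSeries (fun m => if (Z.eqb m 0 && Z.eqb n 0)%bool then RtoC 0
    else let w := RtoC (IZR m) + RtoC (IZR n) * tau in / (x - w) + / w + x / w ^ 2)) = ZSeries (zrow x).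
  congr ZSeries; apply: FunctionalExtensionality.functional_extensionality => n.
  exact: zterm_row.
rewrite EZ Elzs /ghat /bcoef bernoulli_1.
have -> : ((- / 2 / INR (fact 1) + (if Nat.eqb 1 1 then 1 else 0))%R = / 2)%R.
  rewrite /=; field.
rewrite RtoC_inv; last lra.
rewrite Cpow_1_r /Cdiv; ring.
Qed.

(** As [ghat tau 1] has period 1, the linear term is the one that [Zfun]
    removes. *)
Lemma Zfun_ghat x : ~ in_lattice tau x -> Zfun tau x = ghat tau 1 x.
Proof.
have [e He] := zeta_ghat.
have -> : Zfun tau x = zeta tau x - e2 tau * x by [].
have -> : e2 tau = e.
  apply: const_value_eq; apply: (mero_eq_off_lattice tau htau) => z Hz.
  have Hz1 : ~ in_lattice tau (z + 1) by move=> H; apply: Hz; exact: lattice_shift1 H.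
  rewrite !He // ghat_period; ring.
move=> Hx; rewrite He //; ring.
Qed.

Lemma DeltaZ_D0 : DeltaZ tau = D0.
Proof.
apply: const_value_eq; apply: (mero_eq_off_lattice tau htau) => z Hz.
have Hz1 : ~ in_lattice tau (z + tau).
  move=> H; apply: Hz; apply: (lattice_shift tau z 1).
  by replace (z + RtoC (IZR 1) * tau) with (z + tau) by ring.
rewrite DeltaE !Zfun_ghat // ghat_shift //.
have E : ghat tau 0 z = 1.
  rewrite -g_ghat //; exact: g_0.
simpl seq; simpl csum; rewrite E; simpl INR.
field; move=> /RtoC_inj; lra.
Qed.

End Zeta.

(** * Stirling numbers *)

Notation s1 n k := (IZR (stirling1 n k)) (only parsing).
Notation s2 n k := (INR (stirling2 n k)) (only parsing).
Notation delta i j := (if Nat.eqb i j then 1%R else 0%R) (only parsing).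

Lemma stirling1_0 n : s1 (S n) 0%nat = (- INR n * s1 n 0%nat)%R.
Proof. by rewrite [stirling1 (S n) 0]/= mult_IZR opp_IZR -INR_IZR_INZ. Qed.

Lemma stirling1_S n k : s1 (S n) (S k) = (s1 n k - INR n * s1 n (S k))%R.
Proof.
have -> : stirling1 (S n) (S k) = (stirling1 n k - Z.of_nat n * stirling1 n (S k))%Z by [].
by rewrite minus_IZR mult_IZR -INR_IZR_INZ.
Qed.

Lemma stirling2_S n k : s2 (S n) (S k) = (s2 n k + INR (S k) * s2 n (S k))%R.
Proof.
have -> : stirling2 (S n) (S k) = (stirling2 n k + S k * stirling2 n (S k))%nat by [].
by rewrite plus_INR mult_INR.
Qed.

Lemma stirling1_n0 n : (1 <= n)%nat -> s1 n 0%nat = 0%R.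
Proof.
case: n => [|n] H; first lia.
elim: n {H} => [|n IH]; first by rewrite stirling1_0 /=; ring.
rewrite stirling1_0 IH; ring.
Qed.

(** The form in which the recurrence enters inductions on [n]. *)
Lemma stirling1_sum n (L : nat -> R) :
  rsum (fun k => s1 (S n) k * L k)%R (seq 0 (S (S n))) =
  (rsum (fun k => s1 n k * L (S k))%R (seq 0 (S n))
   - INR n * rsum (fun k => s1 n k * L k)%R (seq 0 (S n)))%R.
Proof.
rewrite rsum_seq_S stirling1_0.
rewrite (rsum_ext _ (fun k => s1 n k * L (S k) + - INR n * (s1 n (S k) * L (S k)))%R); last first.
  move=> k _; rewrite stirling1_S; ring.
rewrite rsum_plus rsum_scal.
have E : rsum (fun k => s1 n k * L k)%R (seq 0 (S (S n))) = rsum (fun k => s1 n k * L k)%R (seq 0 (S n)).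
  rewrite rsum_seq_last stirling1_big; [ring|lia].
rewrite rsum_seq_S in E; rewrite -E; ring.
Qed.

Lemma stirling2_sum n (L : nat -> R) :
  rsum (fun k => s2 (S n) k * L k)%R (seq 0 (S (S n))) =
  (rsum (fun k => s2 n k * L (S k))%R (seq 0 (S n))
   + rsum (fun k => s2 n k * (INR k * L k))%R (seq 0 (S n)))%R.
Proof.
rewrite rsum_seq_S.
rewrite (rsum_ext _ (fun k => s2 n k * L (S k) + s2 n (S k) * (INR (S k) * L (S k)))%R); last first.
  move=> k _; rewrite stirling2_S; ring.
rewrite rsum_plus.
have E : rsum (fun k => s2 n k * (INR k * L k))%R (seq 0 (S (S n))) = rsum (fun k => s2 n k * (INR k * L k))%R (seq 0 (S n)).
  rewrite rsum_seq_last stirling2_big; [rewrite /=; ring|lia].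
rewrite rsum_seq_S in E; rewrite -E; have -> : stirling2 (S n) 0 = 0%nat by [].
rewrite /=; ring.
Qed.

Lemma stirling12 n j : rsum (fun k => s1 n k * s2 k j)%R (seq 0 (S n)) = delta n j.
Proof.
elim: n j => [|n IH] j; first by rewrite /=; case: j => [|j] /=; ring.
rewrite (stirling1_sum n (fun k => s2 k j)) IH.
case: j => [|j].
  rewrite rsum_zero; last by move=> k _; rewrite /=; ring.
  case: n {IH} => [|n] /=; ring.
rewrite (rsum_ext _ (fun k => s1 n k * s2 k j + INR (S j) * (s1 n k * s2 k (S j)))%R); last first.
  move=> k _; rewrite stirling2_S; ring.
rewrite rsum_plus rsum_scal !IH.
change (Nat.eqb (S n) (S j)) with (Nat.eqb n j).
case: (Nat.eqb_spec n (S j)) => [->|H]; last ring.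
case: Nat.eqb_spec => H; [lia|ring].
Qed.

Lemma stirling21 n j : rsum (fun k => s2 n k * s1 k j)%R (seq 0 (S n)) = delta n j.
Proof.
elim: n j => [|n IH] j; first by rewrite /=; case: j => [|j] /=; ring.
rewrite (stirling2_sum n (fun k => s1 k j)).
case: j => [|j].
  rewrite -rsum_plus rsum_zero //= => k _; rewrite stirling1_0; ring.
change (Nat.eqb (S n) (S j)) with (Nat.eqb n j); rewrite -IH -rsum_plus.
apply: rsum_ext => k _; rewrite stirling1_S; ring.
Qed.

Lemma alternating_binomial k : rsum (fun t => (-1) ^ t * Binomial.C k t)%R (seq 0 (S k)) = delta k 0%nat.
Proof.
have H := binomial (-1) 1 k.
replace (-1 + 1)%R with 0%R in H by ring.
have E : rsum (fun t => (-1) ^ t * Binomial.C k t)%R (seq 0 (S k)) = (0 ^ k)%R.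
  rewrite H.
  have G : forall m, rsum (fun t => (-1) ^ t * Binomial.C k t)%R (seq 0 (S m)) =
     sum_f_R0 (fun i => Binomial.C k i * (-1) ^ i * 1 ^ (k - i))%R m.
    elim=> [|m IH].
      rewrite /= pow1; ring.
    rewrite rsum_seq_last IH tech5 pow1; ring.
  exact: G.
rewrite E; case: k {H E} => [|k] //=; ring.
Qed.

(** The alternating sum of the explicit formula, with [n] and [k] replaced by
    their successors so that [n - 1] and [k - 1] do not occur. *)
Definition expl (n k : nat) : R :=
  rsum (fun t => (-1) ^ t * INR (S k - t) ^ n * Binomial.C k t)%R (seq 0 (S k)).

(** The alternating sum satisfies the recurrence of the Stirling numbers. *)
Lemma stirling2_explicit n k : (INR (fact k) * s2 (S n) (S k))%R = expl n k.
Proof.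
elim: n k => [|n IH] k.
  rewrite stirling2_S.
  have -> : expl 0 k = delta k 0%nat.
    rewrite -alternating_binomial; apply: rsum_ext => t _; rewrite /=; ring.
  case: k => [|k] /=; ring.
rewrite stirling2_S.
have Hs : expl (S n) k = (INR (S k) * expl n k -
   rsum (fun t => INR t * ((-1) ^ t * INR (S k - t) ^ n * Binomial.C k t)) (seq 0 (S k)))%R.
  rewrite /expl -rsum_scal /Rminus.
  rewrite -(Rmult_1_l (rsum (fun t => INR t * _)%R _)) Ropp_mult_distr_l -rsum_scal -rsum_plus.
  apply: rsum_ext => t /in_seq Ht.
  rewrite -tech_pow_Rmult {1}minus_INR; last lia.
  ring.
rewrite Hs rsum_seq_S.
have -> : INR 0 = 0%R by [].
case: k {Hs} => [|k].
  rewrite -IH; have -> : stirling2 (S n) 0 = 0%nat by [].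
  simpl (rsum _ (seq 0 0)); simpl INR. ring.
have -> : rsum (fun i => INR (S i) * ((-1) ^ S i * INR (S (S k) - S i) ^ n * Binomial.C (S k) (S i)))%R (seq 0 (S k))
   = (- INR (S k) * expl n k)%R.
  rewrite /expl -rsum_scal; apply: rsum_ext => i /in_seq Hi.
  have -> : (INR (S i) * ((-1) ^ S i * INR (S (S k) - S i) ^ n * Binomial.C (S k) (S i)) =
     - (-1) ^ i * INR (S k - i) ^ n * (INR (S i) * Binomial.C (S k) (S i)))%R.
    rewrite Nat.sub_succ; simpl ((-1) ^ S i)%R; ring.
  have -> : (INR (S i) * Binomial.C (S k) (S i) = INR (S k) * Binomial.C k i)%R.
    rewrite /Binomial.C Nat.sub_succ !fact_simpl !mult_INR.
    have F1 := INR_fact_neq_0 i; have F2 := INR_fact_neq_0 (k - i).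
    have F3 : INR (S i) <> 0%R by apply: not_0_INR.
    field; by repeat split.
  ring.
rewrite -!IH fact_simpl mult_INR; ring.
Qed.

(** * Generating functions *)

Definition pcoef (n k : nat) : R :=
  ((-1) ^ (k - 1) * (INR (fact (k - 1)) / INR (fact (n - 1))) * INR (stirling2 n k))%R.

(** Terms with [k > n] vanish, so that polynomials of different degrees can be
    summed over a common range. *)
Lemma poly_p_seq n N x : (n <= N)%nat ->
  poly_p n x = csum (fun k => RtoC (pcoef n k) * x ^ k) (seq 1 N).
Proof.
move=> Hn; rewrite /poly_p csum_sum_n_m.
replace N with (n + (N - n))%nat by lia.
rewrite seq_app csum_app.
rewrite (csum_ext (fun k => RtoC (pcoef n k) * x ^ k) (fun _ => 0) (seq (1 + n) (N - n))).
  have -> : forall l, csum (fun _ : nat => 0) l = 0 by elim=> //= i l ->; ring.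
  by rewrite Cplus_0_r.
move=> k /in_seq Hk; rewrite /pcoef stirling2_big; last lia.
rewrite Rmult_0_r; ring.
Qed.

Lemma W_csum {I} (c : I -> nat -> C) r (f : I -> C -> C) l : (0 < r)%R ->
  (forall i, exists M, W (c i) r M (f i)) ->
  exists M, W (fun n => csum (fun i => c i n) l) r M (fun h => csum (fun i => f i h) l).
Proof.
move=> Hr H; elim: l => [|i l [M HM]] /=.
  exists (Cmod 0); apply: W_coef_ext (W_const r 0 (Rlt_le _ _ Hr)) => -[|n] //.
have [N HN] := H i; eexists; exact: (W_plus _ _ _ _ _ _ _ (Rlt_le _ _ Hr) HN HM).
Qed.

(** Expand [(Cexp y - 1) ^ k] by the binomial theorem and each power of the
    exponential as a series. *)
Lemma W_exp_pow k r : (0 < r)%R -> exists M,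
  W (fun n => / RtoC (INR (fact n)) * RtoC (expl n k)) r M
    (fun y => (Cexp y - 1) ^ k * Cexp y).
Proof.
move=> Hr.
pose c (t n : nat) := RtoC ((-1) ^ t * Binomial.C k t) * (/ RtoC (INR (fact n)) * RtoC (INR (S k - t)) ^ n).
pose f (t : nat) y := RtoC ((-1) ^ t * Binomial.C k t) * Cexp (RtoC (INR (S k - t)) * y).
have [t|M HM] := W_csum c r f (seq 0 (S k)) Hr.
  eexists; apply: W_scal; apply: W_Cexp; lra.
exists M; apply: (W_ext _ _ _ _ _ _ (W_coef_ext _ _ _ _ _ _ HM)).
  move=> y _; rewrite /f.
  have Hb := binom_fact (-1) (Cexp y) k.
  have -> : (Cexp y - 1) ^ k = RtoC (INR (fact k)) * (/ RtoC (INR (fact k)) * (-1 + Cexp y) ^ k).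
    replace (-1 + Cexp y) with (Cexp y - 1) by ring; field; exact: INR_fact_neq0.
  rewrite -Hb Cmult_comm -!csum_scal; apply: csum_ext => t /in_seq Ht.
  have -> : Cexp (RtoC (INR (S k - t)) * y) = Cexp y ^ (k - t) * Cexp y.
    rewrite Cexp_pow -Cexp_plus; congr Cexp; replace (S k - t)%nat with (S (k - t)) by lia.
    rewrite S_INR RtoC_plus; ring.
  rewrite /Binomial.C /Rdiv !RtoC_mult RtoC_inv; last first.
    apply: Rmult_integral_contrapositive; split; exact: INR_fact_neq_0.
  rewrite RtoC_mult RtoC_pow.
  have F1 := INR_fact_neq0 t; have F2 := INR_fact_neq0 (k - t).
  field; by split.
move=> n; rewrite /c /expl -csum_RtoC -csum_scal; apply: csum_ext => t _.
rewrite !RtoC_mult !RtoC_pow; ring.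
Qed.

(** Expand [1 / (1 + x (exp y - 1))] as a geometric series in [x (exp y - 1)],
    which is small near [y = 0]. *)
Lemma poly_gf x : exists r M, (0 < r)%R /\
  W (fun n => poly_p (S n) x) r M (fun y => x * Cexp y / (1 - x + x * Cexp y)).
Proof.
have Hx := Cmod_ge_0 x.
have HE := W_Cexp 1 1 Rle_0_1.
have HE1 := W_plus _ _ _ _ _ _ _ Rle_0_1 HE (W_const 1 (-1) Rle_0_1).
set eps := (/ (2 * (Cmod x + 1)))%R.
have Heps : (0 < eps)%R by apply: Rinv_0_lt_compat; lra.
have [|r [Hr HW]] := W_small _ _ _ _ eps Rlt_0_1 Heps HE1.
  have -> : RtoC (INR (fact 0)) = 1 by [].
  have H1 : RtoC 1 <> 0 by move=> /RtoC_inj; lra.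
  rewrite /=; field; done.
have Hr0 := proj1 Hr.
set E := exp (Cmod 1 * 1); have HEp : (0 < E)%R := exp_pos _.
have Hr1 : (0 <= r <= 1)%R by lra.
have HEr := W_mono _ _ r _ _ Hr1 HE.
have Hxe : (Cmod x * eps <= / 2)%R.
  rewrite /eps; have -> : (/ 2 = (Cmod x + 1) * / (2 * (Cmod x + 1)))%R by field; lra.
  apply: Rmult_le_compat_r; [exact: Rlt_le|lra].
pose f k y := ((-1) ^ k * x ^ S k) * ((Cexp y - 1) ^ k * Cexp y).
pose c k n := ((-1) ^ k * x ^ S k) * (/ RtoC (INR (fact n)) * RtoC (expl n k)).
have Hf : forall k, W (c k) r (Cmod x * E * (/ 2) ^ k) (f k).
  move=> k; have [d Hd] := W_pow _ _ _ _ k Hr0 HW.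
  have H1 := W_mult _ _ _ _ _ _ _ Hr0 Hd HEr.
  have H2 := W_scal ((-1) ^ k * x ^ S k) _ _ _ _ H1.
  have [M HM] := W_exp_pow k r Hr0.
  have H3 := W_scal ((-1) ^ k * x ^ S k) _ _ _ _ HM.
  have Efun : forall h, (-1) ^ k * x ^ S k * ((Cexp (1 * h) + -1) ^ k * Cexp (1 * h)) = f k h.
    move=> h; rewrite /f Cmult_1_l; congr (_ * (_ ^ _ * _)); ring.
  apply: W_Mle (W_coef_ext _ _ _ _ _ _ (W_ext _ _ _ _ _ _ H2)).
  - rewrite -/E Cmod_mult !Cmod_pow Cmod_R Rabs_left; last lra.
    have -> : (- (-1))%R = 1%R by ring.
    rewrite pow1 Rmult_1_l.
    have -> : (Cmod x ^ S k * (eps ^ k * E) = Cmod x * E * (Cmod x * eps) ^ k)%R.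
      rewrite Rpow_mult_distr /=; ring.
    apply: Rmult_le_compat_l; first nra.
    apply: pow_incr; split => //; nra.
  - move=> n; apply: (W_unique _ _ _ _ _ _ _ _ Hr0 Hr0 H2 H3) => e He.
    have [z [Hz _]] := exists_near 0 0 _ He; exists z.
    replace (z - 0) with z in Hz by ring; split => //; exact: Efun.
  - move=> h _; exact: Efun.
have Hsmall : forall h, (Cmod h <= r)%R -> (Cmod (- x * (Cexp h - 1)) < 1)%R.
  move=> h Hh; rewrite Cmod_mult Cmod_opp.
  have := W_bound _ _ _ _ _ Hh HW; rewrite Cmult_1_l.
  replace (Cexp h + -1) with (Cexp h - 1) by ring; nra.
have HF : forall h, (Cmod h <= r)%R -> has_sum (fun k => f k h) (x * Cexp h / (1 - x + x * Cexp h)).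
  move=> h Hh; have := has_sum_scal (x * Cexp h) _ _ (has_sum_geom _ (Hsmall h Hh)).
  replace (1 - - x * (Cexp h - 1)) with (1 - x + x * Cexp h) by ring.
  apply: has_sum_ext => k; rewrite /f.
  replace (- x * (Cexp h - 1)) with (-1 * x * (Cexp h - 1)) by ring.
  rewrite !Cpow_mult_l Cpow_S; ring.
have HEx : (0 <= Cmod x * E)%R by nra.
have [d [Hd HWd]] := W_sum c r _ _ f _ Hr0 Hf (bsum_scal _ _ _ HEx (bsum_geom (/ 2) ltac:(lra))) HF.
exists r; eexists; split => //; apply: W_coef_ext HWd => n.
apply: (has_sum_unique _ _ _ (Hd n)).
rewrite (poly_p_seq (S n) (S n)) // csum_seq1.
rewrite (csum_ext _ (fun k => c k n)).
  apply: has_sum_fin; first exact: seq_NoDup.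
  move=> k Hk; rewrite /c -stirling2_explicit stirling2_big.
    rewrite Rmult_0_r; ring.
  case: (Nat.le_gt_cases k n) => H; last lia.
  case: Hk; apply/in_seq; lia.
move=> k _; rewrite /c /pcoef -stirling2_explicit !Nat.sub_succ !Nat.sub_0_r.
rewrite /Rdiv !RtoC_mult RtoC_inv ?RtoC_pow; last exact: INR_fact_neq_0.
ring.
Qed.

(** * The transition coefficients *)

(** Real numbers, which carry the transition coefficients once the powers of
    [DeltaZ tau] are split off. *)
Definition rcoef_c (n k : nat) : R :=
  match k, n with
  | O, O => 1
  | O, S _ => / 2 ^ n + (-1) ^ (n + 1) / INR (fact n)
        * sum_n_m (fun m => s1 (n + 1) m / INR m) 1 (n + 1)
  | S _, _ => (-1) ^ (n - 1) * (INR (fact (k - 1)) / INR (fact (n - 1)) * s1 n k)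
  end%R.

Definition rcoef_C (n k : nat) : R :=
  match k with
  | O => (2 - 2 ^ n) * (bernoulli n / INR (fact n))
  | S _ => pcoef n k
  end%R.

Lemma coef_cE D n k : (k <= n)%nat -> coef_c D n k = D ^ (n - k) * RtoC (rcoef_c n k).
Proof.
case: k => [|k] Hk; last first.
  rewrite /coef_c /rcoef_c (RtoC_mult ((-1) ^ (n - 1))); ring.
case: n Hk => [|n] _; first by rewrite /=; ring.
by rewrite /coef_c /rcoef_c Nat.sub_0_r.
Qed.

Lemma coef_CE D n k : coef_C D n k = D ^ (n - k) * RtoC (rcoef_C n k).
Proof.
case: k => [|k]; last first.
  rewrite /coef_C /rcoef_C /pcoef Rmult_assoc (RtoC_mult ((-1) ^ (S k - 1))); ring.
rewrite /coef_C /rcoef_C Nat.sub_0_r.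
have E : (2 * powerRZ 2 (Z.of_nat n - 1) = 2 ^ n)%R.
  have -> : (2 ^ n = powerRZ 2 (Z.of_nat n - 1 + 1))%R.
    by replace (Z.of_nat n - 1 + 1)%Z with (Z.of_nat n) by lia; rewrite pow_powerRZ.
  rewrite powerRZ_add; last lra.
  rewrite powerRZ_1; ring.
have -> : (2 * bernoulli n * (1 - powerRZ 2 (Z.of_nat n - 1)) = (2 - 2 ^ n) * bernoulli n)%R.
  rewrite -E; ring.
rewrite /Rdiv !RtoC_mult RtoC_inv; last exact: INR_fact_neq_0.
rewrite /Cdiv; ring.
Qed.

(** This is [(1 - exp (- t)) * b(t) = t], coefficient by coefficient. *)
Lemma bcoef_neg n :
  rsum (fun i => bcoef i * ((-1) ^ (n - i) / INR (fact (S n - i))))%R (seq 0 (S n)) = delta n 0%nat.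
Proof.
have [r [M [v [Hr [HW Hv]]]]] := W_kap_coef.
have HE := W_Cexp (- D0) r (Rlt_le _ _ Hr).
have H1 := W_mult _ _ _ _ _ _ _ Hr HW (W_plus _ _ _ _ _ _ _ (Rlt_le _ _ Hr) (W_const r 1 (Rlt_le _ _ Hr))
  (W_scal (-1) _ _ _ _ HE)).
have H2 := W_scal D0 _ _ _ _ (W_shift _ _ _ _ (Rlt_le _ _ Hr) (W_const r 1 (Rlt_le _ _ Hr))).
have HD := D0_neq0.
have [v0 [_ [_ [d [Hd Hk]]]]] := kap_pole.
have E := W_unique _ _ _ _ _ _ _ _ Hr Hr H1 H2 _ (S n).
have E1 : csum (fun i => D0 ^ i * RtoC (bcoef i) * (-1 * (/ RtoC (INR (fact (S n - i))) * (- D0) ^ (S n - i))))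
   (seq 0 (S n)) = D0 * (match n with O => 1 | _ => 0 end).
  rewrite -E; last first.
    move=> eps He; have Hm : (0 < Rmin eps (Rmin r d))%R by apply: Rmin_pos => //; apply: Rmin_pos.
    have [z [Hz _]] := exists_near 0 0 _ Hm; exists z.
    replace (z - 0) with z in Hz by ring.
    have M1 := Rmin_l eps (Rmin r d); have M2 := Rmin_r eps (Rmin r d).
    have M3 := Rmin_l r d; have M4 := Rmin_r r d; split; first lra.
    rewrite Hv; last lra.
    have [Hne _] := Hk z ltac:(lra).
    replace (- D0 * z) with (- (D0 * z)) by ring; rewrite -qexp_D0 /kap.
    replace (1 + -1 * qexp z) with (1 - qexp z) by ring.
    field; exact: kap_neq.
  rewrite (csum_seq_last _ (S n)) Nat.sub_diag.
  have -> : 1 + -1 * (/ RtoC (INR (fact 0)) * (- D0) ^ 0) = 0.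
    have -> : RtoC (INR (fact 0)) = 1 by [].
    have H10 : RtoC 1 <> 0 by move=> /RtoC_inj; lra.
    rewrite /=; field; done.
  rewrite Cmult_0_r Cplus_0_r; apply: csum_ext => i /in_seq Hi.
  replace (S n - i)%nat with (S (n - i)) by lia; ring.
have E2 : csum (fun i => D0 ^ i * RtoC (bcoef i) * (-1 * (/ RtoC (INR (fact (S n - i))) * (- D0) ^ (S n - i))))
   (seq 0 (S n)) = D0 ^ (S n) * RtoC (rsum (fun i => bcoef i * ((-1) ^ (n - i) / INR (fact (S n - i))))%R (seq 0 (S n))).
  rewrite -csum_RtoC -csum_scal; apply: csum_ext => i /in_seq Hi.
  replace (- D0) with (-1 * D0) by ring.
  have -> : D0 ^ S n = D0 ^ i * D0 ^ (S n - i) by rewrite -Cpow_add_r; congr (_ ^ _); lia.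
  rewrite Cpow_mult_l /Rdiv !RtoC_mult RtoC_inv; last exact: INR_fact_neq_0.
  have -> : (-1) ^ (S n - i) = -1 * RtoC ((-1) ^ (n - i)).
    rewrite RtoC_pow -Cpow_S; congr (_ ^ _); lia.
  ring.
rewrite E2 in E1; apply: RtoC_inj.
have HDn : D0 ^ S n <> 0 by apply: Cpow_neq0.
set s := RtoC (rsum _ _) in E1 *.
have -> : s = / (D0 ^ S n) * (D0 ^ S n * s) by field.
rewrite E1; case: n {E E1 E2 HDn s H1 H2} => [|n] /=.
  have H10 : RtoC 1 <> 0 by move=> /RtoC_inj; lra.
  field; done.
ring.
Qed.

(** Binomial coefficients that vanish for [n < k], so that Pascal's rule holds
    without side conditions. *)
Fixpoint bin (n k : nat) : nat :=
  match n, k with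
  | _, O => 1
  | O, S _ => 0
  | S m, S j => bin m j + bin m k
  end.

Lemma bin_fact n k : (k <= n)%nat -> (INR (bin n k) = INR (fact n) / (INR (fact k) * INR (fact (n - k))))%R.
Proof.
elim: n k => [|n IH] [|k] Hk; try lia.
- by rewrite /=; field.
- have -> : bin (S n) 0 = 1%nat by [].
  have -> : fact 0 = 1%nat by [].
  rewrite Nat.sub_0_r; have F := INR_fact_neq_0 (S n); set a := INR (fact (S n)) in F *.
  simpl INR; by field.
have F := INR_fact_neq_0.
have -> : bin (S n) (S k) = (bin n k + bin n (S k))%nat by [].
rewrite plus_INR (IH k); last lia.
case: (Nat.eq_dec k n) => [->|Hkn].
  have Hz : forall a b, (a < b)%nat -> bin a b = 0%nat.
    elim=> [|a IHa] [|b] Hab; try lia; first by [].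
    by rewrite /= !IHa; lia.
  rewrite (Hz n (S n)); last lia.
  rewrite !Nat.sub_diag; have F1 := F n; have F2 := F (S n).
  rewrite /=; field; by repeat split.
rewrite IH; last lia.
replace (S n - S k)%nat with (S (n - S k)) by lia.
replace (n - k)%nat with (S (n - S k)) by lia.
rewrite !fact_simpl !mult_INR.
have E : INR (S n) = (INR (S k) + INR (S (n - S k)))%R.
  rewrite -plus_INR; congr INR; lia.
rewrite E.
have F1 := F n; have F2 := F k; have F3 := F (n - S k)%nat.
have G1 : INR (S k) <> 0%R by apply: not_0_INR.
have G2 : INR (S (n - S k)) <> 0%R by apply: not_0_INR.
field; by repeat split.
Qed.

Lemma bin_big n k : (n < k)%nat -> bin n k = 0%nat.
Proof.
elim: n k => [|n IH] [|k] Hk; try lia; first by [].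
by rewrite /= !IH; lia.
Qed.

(** Coefficients of [falling (x - 1) n = falling x (n + 1) / x]. *)
Lemma stirling1_bin n i : rsum (fun k => s1 n k * (INR (bin k i) * (-1) ^ (k + i)))%R (seq 0 (S n))
  = s1 (S n) (S i).
Proof.
elim: n i => [|n IH] i.
  rewrite stirling1_S /=; case: i => [|i] /=; ring.
rewrite stirling1_sum IH (stirling1_S (S n)).
case: i => [|i].
  rewrite (rsum_ext _ (fun k => -1 * (s1 n k * (INR (bin k 0) * (-1) ^ (k + 0))))%R); last first.
    move=> k _; have -> : bin (S k) 0 = 1%nat by []. 
    have -> : bin k 0 = 1%nat by case: k.
    rewrite /=; ring.
  rewrite rsum_scal IH (stirling1_n0 (S n)); last lia.
  rewrite S_INR; ring.
rewrite (rsum_ext _ (fun k => s1 n k * (INR (bin k i) * (-1) ^ (k + i)) +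
   -1 * (s1 n k * (INR (bin k (S i)) * (-1) ^ (k + S i))))%R); last first.
  move=> k _; have -> : bin (S k) (S i) = (bin k i + bin k (S i))%nat by [].
  rewrite plus_INR; replace (S k + S i)%nat with (S (S (k + i))) by lia.
  replace (k + S i)%nat with (S (k + i)) by lia; rewrite /=; ring.
rewrite rsum_plus rsum_scal !IH S_INR; ring.
Qed.

(** Both sides are the integral of [(1 - x)^k] over [0, 1]. *)
Lemma bin_harmonic k :
  rsum (fun i => INR (bin k i) * (-1) ^ i / INR (S i))%R (seq 0 (S k)) = (/ INR (S k))%R.
Proof.
have H := alternating_binomial (S k).
rewrite rsum_seq_S in H; simpl (Nat.eqb (S k) 0) in H.
have E : rsum (fun i => (-1) ^ S i * Binomial.C (S k) (S i))%R (seq 0 (S k)) =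
   (- INR (S k) * rsum (fun i => INR (bin k i) * (-1) ^ i / INR (S i)) (seq 0 (S k)))%R.
  rewrite -rsum_scal; apply: rsum_ext => i /in_seq Hi.
  rewrite bin_fact; last lia.
  rewrite /Binomial.C Nat.sub_succ !fact_simpl !mult_INR.
  have F1 := INR_fact_neq_0 i; have F2 := INR_fact_neq_0 (k - i).
  have G1 : INR (S i) <> 0%R by apply: not_0_INR.
  simpl ((-1) ^ S i)%R; field; by repeat split.
rewrite E in H.
have E0 : Binomial.C (S k) 0 = 1%R.
  rewrite /Binomial.C Nat.sub_0_r; have F := INR_fact_neq_0 (S k); have -> : fact 0 = 1%nat by [].
  set a := INR (fact (S k)) in F *; simpl INR; by field.
rewrite E0 in H; set s := rsum _ _ in H *.
have G : INR (S k) <> 0%R by apply: not_0_INR.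
apply: (Rmult_eq_reg_l (INR (S k))) => //; rewrite Rinv_r //.
simpl ((-1) ^ 0)%R in H; lra.
Qed.

(** Both sides are the integral of [falling x (n + 1) / x] over [0, 1],
    expanded in powers of [x] and of [x - 1]. *)
Lemma stirling1_harmonic n :
  rsum (fun m => s1 (S n) m / INR m)%R (seq 1 (S n)) =
  rsum (fun k => s1 n k * ((-1) ^ k / INR (S k)))%R (seq 0 (S n)).
Proof.
rewrite rsum_seq1.
rewrite (rsum_ext _ (fun i => rsum (fun k => s1 n k * (INR (bin k i) * (-1) ^ (k + i)) / INR (S i)) (seq 0 (S n)))%R); last first.
  move=> i _; rewrite -stirling1_bin /Rdiv Rmult_comm -rsum_scal; apply: rsum_ext => k _; ring.
rewrite rsum_swap; apply: rsum_ext => k /in_seq Hk.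
have E : rsum (fun i => INR (bin k i) * (-1) ^ i / INR (S i))%R (seq 0 (S n)) =
   rsum (fun i => INR (bin k i) * (-1) ^ i / INR (S i))%R (seq 0 (S k)).
  replace (S n) with (S k + (n - k))%nat by lia.
  rewrite seq_app rsum_app (rsum_zero _ (seq (0 + S k) (n - k))); first ring.
  move=> i /in_seq Hi; rewrite bin_big; last lia.
  rewrite /= /Rdiv; ring.
have := bin_harmonic k; rewrite -E => H.
rewrite /Rdiv -H -Rmult_assoc -rsum_scal; apply: rsum_ext => i _.
rewrite pow_add /Rdiv; ring.
Qed.

Lemma bcoef_0 : bcoef 0 = 1%R.
Proof. rewrite /bcoef /bernoulli /=; field. Qed.

(** By [stirling1_bin], [n s(n, j + 1) = s(n, j) - s(n + 1, j + 1)] is a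
    combination of the [s(n, k)] with [k > j]; for each [k] the sum over [j]
    is then the recurrence [bcoef_neg]. *)
Lemma stirling1_bernoulli n : (1 <= n)%nat ->
  (INR n * rsum (fun j => s1 n (S j) * (INR (fact j) * bcoef (S j))) (seq 0 n))%R =
  (- rsum (fun k => s1 n k * ((-1) ^ k / INR (S k))) (seq 0 (S n)))%R.
Proof.
move=> Hn.
have Hs : forall j, (j < n)%nat -> (INR n * s1 n (S j))%R =
   rsum (fun k => if Nat.ltb j k then s1 n k * (INR (bin k j) * - (-1) ^ (k + j)) else 0)%R (seq 0 (S n)).
  move=> j Hj.
  have -> : (INR n * s1 n (S j) = s1 n j - s1 (S n) (S j))%R by rewrite stirling1_S; ring.
  rewrite -stirling1_bin.
  have Ej : s1 n j = rsum (fun k => if Nat.eqb k j then s1 n k else 0%R) (seq 0 (S n)).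
    replace (S n) with (j + (1 + (n - j)))%nat by lia.
    rewrite !seq_app !rsum_app.
    rewrite (rsum_zero _ (seq 0 j)); last by move=> k /in_seq Hk; case: Nat.eqb_spec => //; lia.
    rewrite (rsum_zero _ (seq (0 + j + 1) (n - j))); last by move=> k /in_seq Hk; case: Nat.eqb_spec => //; lia.
    rewrite /= Nat.eqb_refl; ring.
  rewrite {1}Ej -rsum_minus; apply: rsum_ext => k /in_seq Hk.
  case: Nat.eqb_spec => Hkj; case: Nat.ltb_spec => H; try lia.
  - have -> : INR (bin k j) = 1%R.
      rewrite bin_fact ?Hkj // Nat.sub_diag; have F := INR_fact_neq_0 j.
      have -> : fact 0 = 1%nat by []. simpl (INR 1); by field.
    have -> : ((-1) ^ (k + j) = 1)%R.
      rewrite Hkj; replace (j + j)%nat with (2 * j)%nat by lia; exact: pow_1_even.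
    ring.
  - ring.
  - rewrite bin_big; [rewrite /=; ring|lia].
rewrite -rsum_scal.
rewrite (rsum_ext _ (fun j => rsum (fun k => if Nat.ltb j k then
   s1 n k * (INR (fact k) * - (-1) ^ (k + j) / INR (fact (k - j)) * bcoef (S j)) else 0) (seq 0 (S n)))%R); last first.
  move=> j /in_seq Hj; rewrite -Rmult_assoc Hs; last lia.
  rewrite Rmult_comm -rsum_scal; apply: rsum_ext => k _.
  case: Nat.ltb_spec => H; last ring.
  rewrite bin_fact; last lia.
  have F1 := INR_fact_neq_0 j; have F2 := INR_fact_neq_0 (k - j).
  field; by split.
rewrite rsum_swap.
transitivity (rsum (fun k => -1 * (s1 n k * ((-1) ^ k / INR (S k))))%R (seq 0 (S n))); last by rewrite rsum_scal; ring.
apply: rsum_ext => k /in_seq Hk.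
case: k Hk => [|k] Hk.
  rewrite (stirling1_n0 n Hn) rsum_zero; first ring.
  by move=> j _; case: Nat.ltb_spec => //; lia.
have -> : seq 0 n = seq 0 (S k) ++ seq (0 + S k) (n - S k).
  rewrite -seq_app; congr seq; lia.
rewrite rsum_app (rsum_zero _ (seq (0 + S k) (n - S k))); last first.
  move=> j /in_seq Hj; case: Nat.ltb_spec => //; lia.
have H := bcoef_neg (S k); rewrite rsum_seq_S in H; simpl (Nat.eqb (S k) 0) in H.
have E : rsum (fun j => if Nat.ltb j (S k) then s1 n (S k) * (INR (fact (S k)) * - (-1) ^ (S k + j) / INR (fact (S k - j)) * bcoef (S j)) else 0)%R (seq 0 (S k))
  = (s1 n (S k) * INR (fact (S k)) * rsum (fun i => bcoef (S i) * ((-1) ^ (S k - S i) / INR (fact (S (S k) - S i)))) (seq 0 (S k)))%R.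
  rewrite -rsum_scal; apply: rsum_ext => j /in_seq Hj.
  case: Nat.ltb_spec => H1; last lia.
  rewrite !Nat.sub_succ.
  have -> : ((-1) ^ (S k + j) = - (-1) ^ (k - j))%R.
    replace (S k + j)%nat with (S ((k - j) + 2 * j)) by lia.
    rewrite -tech_pow_Rmult pow_add pow_1_even; ring.
  rewrite /Rdiv; ring.
rewrite E.
have -> : rsum (fun i => bcoef (S i) * ((-1) ^ (S k - S i) / INR (fact (S (S k) - S i))))%R (seq 0 (S k))
   = (- ((-1) ^ (S k) / INR (fact (S (S k)))))%R.
  move: H; rewrite bcoef_0 !Nat.sub_0_r; set X := rsum _ _; lra.
rewrite (fact_simpl (S k)) mult_INR.
have F := INR_fact_neq_0 (S k); have G : INR (S (S k)) <> 0%R by apply: not_0_INR.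
field; by split.
Qed.

(** The instance of [fourier_coef_pow] at frequency 0: the right-hand side is
    [bcoef 1 ^ n]. *)
Lemma rcoef_c_bcoef n : (1 <= n)%nat ->
  rsum (fun k => rcoef_c n k * bcoef k)%R (seq 0 (S n)) = (/ 2 ^ n)%R.
Proof.
move=> Hn; rewrite rsum_seq_S bcoef_0.
have H := stirling1_bernoulli n Hn.
rewrite -stirling1_harmonic in H.
set X := rsum _ (seq 1 (S n)) in H.
have E : rsum (fun i => rcoef_c n (S i) * bcoef (S i))%R (seq 0 n) =
   ((-1) ^ (n - 1) / INR (fact (n - 1)) * rsum (fun j => s1 n (S j) * (INR (fact j) * bcoef (S j))) (seq 0 n))%R.
  rewrite -rsum_scal; apply: rsum_ext => i _; rewrite /rcoef_c.
  replace (S i - 1)%nat with i by lia; rewrite /Rdiv; ring.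
rewrite E; set Y := rsum _ _ in H *.
clear E; destruct n as [|n]; first lia.
rewrite /rcoef_c rsum_sum_n_m.
replace (S n + 1)%nat with (S (S n)) by lia; rewrite -/X.
replace (S n - 1)%nat with n by lia.
rewrite fact_simpl mult_INR.
have F := INR_fact_neq_0 n; have G : INR (S n) <> 0%R by apply: not_0_INR.
have -> : X = (- (INR (S n) * Y))%R by lra.
have -> : ((-1) ^ S (S n) = (-1) ^ n)%R by rewrite /=; ring.
have G2 : (2 ^ S n)%R <> 0%R by apply: pow_nonzero; lra.
field; by repeat split.
Qed.

(** The factorials telescope and [stirling12] remains. *)
Lemma rcoef_c_poly n (u : C) : (1 <= n)%nat ->
  csum (fun k => RtoC (rcoef_c n k) * poly_p k u) (seq 1 n) = u ^ n.
Proof.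
move=> Hn.
etransitivity.
  apply: csum_ext => k /in_seq Hk; rewrite (poly_p_seq k n); last lia.
  rewrite -csum_scal; reflexivity.
rewrite csum_swap.
have Hj : forall j, In j (seq 1 n) ->
  csum (fun k => RtoC (rcoef_c n k) * (RtoC (pcoef k j) * u ^ j)) (seq 1 n) =
  RtoC ((-1) ^ (n - 1) / INR (fact (n - 1)) * ((-1) ^ (j - 1) * INR (fact (j - 1))) * delta n j) * u ^ j.
  move=> j /in_seq Hj; rewrite -(stirling12 n j) rsum_seq_S.
  have -> : stirling2 0 j = 0%nat by case: j Hj => // H; lia.
  rewrite Rmult_0_r Rplus_0_l.
  have -> : rsum (fun k => s1 n (S k) * s2 (S k) j)%R (seq 0 n) = rsum (fun k => s1 n k * s2 k j)%R (seq 1 n) by rewrite rsum_seq1.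
  rewrite -rsum_scal -csum_RtoC Cmult_comm -csum_scal.
  apply: csum_ext => -[|k] /in_seq Hk; first lia.
  rewrite /rcoef_c /pcoef; replace (S k - 1)%nat with k by lia.
  have F := INR_fact_neq_0 k.
  set a := INR (fact (n - 1)); set b := ((-1) ^ (j - 1))%R; set c := INR (fact (j - 1)).
  have -> : RtoC ((-1) ^ (n - 1) * (INR (fact k) / a * s1 n (S k))) * (RtoC (b * (c / INR (fact k)) * s2 (S k) j) * u ^ j)
    = RtoC ((-1) ^ (n - 1) * (INR (fact k) / a * s1 n (S k)) * (b * (c / INR (fact k)) * s2 (S k) j)) * u ^ j.
    rewrite (RtoC_mult (_ * (_ * _))); ring.
  rewrite Cmult_comm; congr (_ * RtoC _); rewrite /Rdiv; field; split => //; exact: INR_fact_neq_0.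
rewrite (csum_ext _ _ _ Hj).
have -> : seq 1 n = seq 1 (n - 1) ++ [n].
  replace n with (S (n - 1)) at 1 by lia; rewrite seq_S; congr (_ ++ [_]); lia.
rewrite csum_app csum_zero.
  rewrite /= Nat.eqb_refl Rmult_1_r.
  have F := INR_fact_neq_0 (n - 1).
  have -> : ((-1) ^ (n - 1) / INR (fact (n - 1)) * ((-1) ^ (n - 1) * INR (fact (n - 1))) = 1)%R.
    have -> : ((-1) ^ (n - 1) / INR (fact (n - 1)) * ((-1) ^ (n - 1) * INR (fact (n - 1))) = (-1) ^ (n - 1) * (-1) ^ (n - 1))%R by field.
    rewrite -pow_add; replace (n - 1 + (n - 1))%nat with (2 * (n - 1))%nat by lia.
    exact: pow_1_even.
  ring.
move=> j /in_seq Hj2; case: Nat.eqb_spec => H; [lia|rewrite Rmult_0_r; ring].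
Qed.

Lemma poly_p_half n : (1 <= n)%nat ->
  poly_p n (RtoC (/ 2)) = RtoC (rsum (fun k => pcoef n k * (/ 2) ^ k)%R (seq 1 n)).
Proof.
move=> Hn; rewrite (poly_p_seq n n) // -csum_RtoC; apply: csum_ext => k _.
by rewrite RtoC_mult RtoC_pow.
Qed.

(** At [x = 1/2] the generating function of the [poly_p] is [exp t / (1 + exp
    t)], and [b(t) = b(2t) - t exp t / (1 + exp t)]. *)
Lemma rcoef_C_half n : (1 <= n)%nat ->
  bcoef n = (rcoef_C n 0 + rsum (fun k => pcoef n k * (/ 2) ^ k) (seq 1 n))%R.
Proof.
move=> Hn.
have [r [M [v [Hr [HW Hv]]]]] := W_kap_coef.
have [r2 [M2 [Hr2 HP]]] := poly_gf (RtoC (/ 2)).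
have HD := D0_neq0; have HDm := proj1 (Cmod_gt_0 _) HD.
have H2 := RtoC2_neq0; have H2m := proj1 (Cmod_gt_0 _) H2.
have E2m : Cmod 2 = 2%R by rewrite Cmod_R Rabs_pos_eq; lra.
have HV2 := W_dilate 2 _ _ _ _ H2 HW.
have HPD := W_dilate D0 _ _ _ _ HD HP.
set s := Rmin (r / Cmod 2) (r2 / Cmod D0).
have Hr2' : (0 < r2 / Cmod D0)%R by apply: Rdiv_lt_0_compat.
have Hs : (0 < s)%R by apply: Rmin_pos => //; apply: Rdiv_lt_0_compat.
have Hs1 : (s <= r / Cmod 2)%R := Rmin_l _ _; have Hs2 : (s <= r2 / Cmod D0)%R := Rmin_r _ _.
have Hs3 : (0 <= s <= r)%R by rewrite E2m in Hs1; lra.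
have Hs4 : (0 <= s <= r / Cmod 2)%R by lra.
have Hs5 : (0 <= s <= r2 / Cmod D0)%R by lra.
have Hs0 := Rlt_le _ _ Hs.
have K1 := W_plus _ _ _ _ _ _ _ Hs0 (W_mono _ _ _ _ _ Hs3 HW) (W_plus _ _ _ _ _ _ _ Hs0 (W_scal (-1) _ _ _ _ (W_mono _ _ _ _ _ Hs4 HV2))
  (W_scal D0 _ _ _ _ (W_shift _ _ _ _ Hs0 (W_mono _ _ _ _ _ Hs5 HPD)))).
have K0 := W_const s 0 Hs0.
have [v0 [_ [_ [d [Hd Hk]]]]] := kap_pole.
have E := W_unique _ _ _ _ _ _ _ _ Hs Hs K1 K0 _ n.
have {E} : D0 ^ n * RtoC (bcoef n) + (-1 * (D0 ^ n * RtoC (bcoef n) * 2 ^ n) + D0 ^ n * poly_p n (RtoC (/ 2))) = 0.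
  case: n Hn E => [|n] Hn E; first lia.
  rewrite Cpow_S; rewrite Cpow_S in E.
  have -> : D0 * D0 ^ n * poly_p (S n) (RtoC (/ 2)) = D0 * (poly_p (S n) (RtoC (/ 2)) * D0 ^ n) by ring.
  apply: E => eps He.
  have Hm : (0 < Rmin eps (Rmin s (d / 2)))%R by apply: Rmin_pos => //; apply: Rmin_pos => //; lra.
  have [z [Hz _]] := exists_near 0 0 _ Hm; exists z.
  replace (z - 0) with z in Hz by ring.
  have M1 := Rmin_l eps (Rmin s (d / 2)); have M3 := Rmin_r eps (Rmin s (d / 2)).
  have M4 := Rmin_l s (d / 2); have M5 := Rmin_r s (d / 2); split; first lra.
  have Hz2 : Cmod (2 * z) = (2 * Cmod z)%R by rewrite Cmod_mult E2m.
  rewrite E2m in Hs1.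
  rewrite Hv; last lra.
  rewrite Hv; last by rewrite Hz2; lra.
  have [N1 _] := Hk z ltac:(lra).
  have [N2 _] := Hk (2 * z) ltac:(rewrite Hz2; lra).
  rewrite /kap; have -> : qexp (2 * z) = qexp z * qexp z by rewrite -qexp_plus; congr qexp; ring.
  have N2' : qexp z * qexp z <> 1 by rewrite -qexp_plus; replace (z + z) with (2 * z) by ring.
  have -> : Cexp (D0 * z) = / qexp z.
    rewrite qexp_D0 Cexp_opp; field; exact: Cexp_neq0.
  have N0 := qexp_neq0 z; move: N1 N2' N0; set X := qexp z => N1 N2' N0.
  have N3 : 1 - X <> 0 by apply: Csub_neq0 => EX; apply: N1; rewrite -EX.
  have N4 : 1 + X <> 0.
    move=> EX; apply: N2'; have -> : X = -1 by replace X with (1 + X - 1) by ring; rewrite EX; ring.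
    rewrite -RtoC_mult; congr RtoC; ring.
  rewrite RtoC_inv; last lra.
  have N5 : X + 1 <> 0 by rewrite Cplus_comm.
  have -> : 1 - X * X = (1 - X) * (1 + X) by ring.
  have -> : 1 - / RtoC 2 + / 2 * / X = (X + 1) / (2 * X) by field.
  field; by auto.
have HDn : D0 ^ n <> 0 by apply: Cpow_neq0.
rewrite poly_p_half //; set P := rsum _ _ => E.
have E1 : RtoC (bcoef n + (-1 * (bcoef n * 2 ^ n) + P)) = 0.
  rewrite RtoC_plus (RtoC_plus (-1 * _)) (RtoC_mult (-1)) (RtoC_mult (bcoef n)) RtoC_pow.
  set t := (X in X = _).
  have -> : t = / D0 ^ n * (D0 ^ n * t) by field.
  have -> : D0 ^ n * t = 0 by rewrite -[RHS]E /t; ring.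
  ring.
have E3 := RtoC_inj _ _ E1.
have -> : rcoef_C n 0 = ((2 - 2 ^ n) * bcoef n)%R.
  rewrite /rcoef_C /bcoef; case: Nat.eqb_spec => Hn1; last by ring.
  rewrite Hn1 /=; ring.
lra.
Qed.

(** For positive [j] this is [stirling21]; for [j = 0] eliminate the constants
    by [rcoef_c_bcoef] and [rcoef_C_half]. *)
Lemma rcoef_C_rcoef_c n j : rsum (fun k => rcoef_C n k * rcoef_c k j)%R (seq 0 (S n)) = delta n j.
Proof.
have HS : forall i, rsum (fun k => rcoef_C n k * rcoef_c k (S i))%R (seq 0 (S n)) = delta n (S i).
  move=> i; case: n => [|n]; first by rewrite /rcoef_c /= ; ring.
  rewrite (rsum_ext _ (fun k => INR (fact i) / INR (fact n) * (s2 (S n) k * s1 k (S i)))%R).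
    rewrite rsum_scal stirling21; case: Nat.eqb_spec => [[->]|H]; last ring.
    have F := INR_fact_neq_0 i; by field.
  move=> [|k] _; first by rewrite /rcoef_c /=; ring.
  rewrite /rcoef_C /rcoef_c /pcoef.
  replace (S k - 1)%nat with k by lia; replace (S i - 1)%nat with i by lia.
  replace (S n - 1)%nat with n by lia.
  have F1 := INR_fact_neq_0 k; have F2 := INR_fact_neq_0 n.
  have E : ((-1) ^ k * (-1) ^ k = 1)%R.
    rewrite -pow_add; replace (k + k)%nat with (2 * k)%nat by lia; exact: pow_1_even.
  have -> : ((-1) ^ k * (INR (fact k) / INR (fact n)) * s2 (S n) (S k) * ((-1) ^ k * (INR (fact i) / INR (fact k) * s1 (S k) (S i))) =
    ((-1) ^ k * (-1) ^ k) * (INR (fact i) / INR (fact n) * (s2 (S n) (S k) * s1 (S k) (S i))))%R by field.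
  rewrite E; ring.
case: j => [|j]; last exact: HS.
case: n HS => [|n] HS; first by rewrite /rcoef_c /rcoef_C /bernoulli /=; field.
change (Nat.eqb (S n) 0) with false; cbv iota.
rewrite rsum_seq_S; have -> : rcoef_c 0 0 = 1%R by [].
rewrite (rsum_ext _ (fun k => rcoef_C (S n) (S k) * (/ 2) ^ (S k) -
   rsum (fun i => rcoef_C (S n) (S k) * rcoef_c (S k) (S i) * bcoef (S i)) (seq 0 (S n)))%R); last first.
  move=> k /in_seq Hk.
  have H := rcoef_c_bcoef (S k) ltac:(lia).
  rewrite rsum_seq_S bcoef_0 in H.
  have E : rsum (fun i => rcoef_C (S n) (S k) * rcoef_c (S k) (S i) * bcoef (S i))%R (seq 0 (S n)) =
    (rcoef_C (S n) (S k) * rsum (fun i => rcoef_c (S k) (S i) * bcoef (S i)) (seq 0 (S k)))%R.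
    rewrite -rsum_scal.
    have -> : seq 0 (S n) = seq 0 (S k + (n - k)) by congr seq; lia.
    rewrite seq_app rsum_app (rsum_zero _ (seq (0 + S k) (n - k))); last first.
      move=> i /in_seq Hi; have -> : rcoef_c (S k) (S i) = 0%R by rewrite /rcoef_c stirling1_big; [ring|lia].
        ring.
    rewrite Rplus_0_r; apply: rsum_ext => i _; ring.
  rewrite E pow_inv; set Y := rsum _ _ in H *.
  have -> : rcoef_c (S k) 0 = (/ 2 ^ S k - Y)%R by lra.
  ring.
rewrite rsum_minus rsum_swap.
rewrite (rsum_ext (fun j => rsum (fun i => rcoef_C (S n) (S i) * rcoef_c (S i) (S j) * bcoef (S j)) (seq 0 (S n)))%R
  (fun j => bcoef (S j) * delta n j)%R); last first.
  move=> j _; have H := HS j; rewrite rsum_seq_S in H.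
  have E0 : rcoef_c 0 (S j) = 0%R by rewrite /rcoef_c /=; ring.
  rewrite E0 Rmult_0_r Rplus_0_l in H; change (Nat.eqb (S n) (S j)) with (Nat.eqb n j) in H.
  rewrite -H -rsum_scal; apply: rsum_ext => i _; ring.
rewrite (rsum_seq_last (fun j => bcoef (S j) * delta n j)%R) Nat.eqb_refl (rsum_zero (fun j => bcoef (S j) * delta n j)%R); last first.
  move=> i /in_seq Hi; case: Nat.eqb_spec => H; [lia|ring].
have H := rcoef_C_half (S n) ltac:(lia); rewrite rsum_seq1 in H.
rewrite H; rewrite /rcoef_C; ring.
Qed.

Lemma exp_radius q : (0 <= q < 1)%R -> exists r, (0 < r)%R /\ (0 <= exp r * q < 1)%R.
Proof.
move=> Hq; set r := ((1 - q) / 2)%R; exists r; split; first by rewrite /r; lra.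
have He := exp_pos r.
split; first nra.
have H := exp_ineq1_le (- r); rewrite exp_Ropp in H.
have H2 : (exp r * (1 - r) <= 1)%R.
  apply: Rle_trans (_ : _ <= exp r * / exp r)%R _; last by right; field; lra.
  apply: Rmult_le_compat_l; lra.
have Hqr : (q < 1 - r)%R by rewrite /r; lra.
have := Rmult_lt_compat_l _ _ _ He Hqr; lra.
Qed.

Lemma W_geom_exp Q s : (Cmod Q < 1)%R -> Cmod s = 1%R -> exists r M d, (0 < r)%R /\
  (forall j, has_sum (fun n => Q ^ n * (/ RtoC (INR (fact j)) * (RtoC (INR n) * s) ^ j)) (d j)) /\
  W d r M (fun y => / (1 - Q * Cexp (s * y))) /\
  forall y, (Cmod y <= r)%R -> (Cmod (Q * Cexp (s * y)) < 1)%R.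
Proof.
move=> HQ Hs; have HQ0 := Cmod_ge_0 Q.
have [r [Hr Hrq]] := exp_radius (Cmod Q) (conj HQ0 HQ).
have Hsmall : forall y, (Cmod y <= r)%R -> (Cmod (Q * Cexp (s * y)) < 1)%R.
  move=> y Hy; rewrite Cmod_mult Cmod_Cexp.
  have : (exp (Re (s * y)) <= exp r)%R.
    apply: exp_mono; apply: Rle_trans (Rle_abs _) _; apply: Rle_trans (re_le_Cmod _) _.
    rewrite Cmod_mult Hs; lra.
  nra.
have HWn : forall n, W (fun j => Q ^ n * (/ RtoC (INR (fact j)) * (RtoC (INR n) * s) ^ j)) r
    ((exp r * Cmod Q) ^ n) (fun y => (Q * Cexp (s * y)) ^ n).
  move=> n; apply: (W_ext _ _ _ (fun y => Q ^ n * Cexp (RtoC (INR n) * s * y))).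
    move=> y _; rewrite Cpow_mult_l Cexp_pow; congr (_ * Cexp _); ring.
  apply: W_Mle (W_scal _ _ _ _ _ (W_Cexp (RtoC (INR n) * s) r (Rlt_le _ _ Hr))).
  rewrite Cmod_pow Cmod_mult Hs Rmult_1_r Cmod_R Rabs_pos_eq; last exact: pos_INR.
  rewrite Rpow_mult_distr exp_natmul; right; ring.
have [d [Hd HW]] := W_sum _ r _ _ _ (fun y => / (1 - Q * Cexp (s * y))) Hr HWn (bsum_geom _ Hrq)
  (fun y Hy => has_sum_geom _ (Hsmall y Hy)).
by exists r, (/ (1 - exp r * Cmod Q))%R, d.
Qed.

(** Both sides are the coefficient of [y^j] in [1 / (1 - Q exp (- y))], which
    is the generating function in [poly_gf] at [x = 1 / (1 - Q)]. *)
Lemma poly_geom_pos Q j : (Cmod Q < 1)%R ->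
  has_sum (fun n => Q ^ n * (/ RtoC (INR (fact j)) * (- RtoC (INR n)) ^ j)) (poly_p (S j) (/ (1 - Q))).
Proof.
move=> HQ.
have Hm1 : Cmod (-1) = 1%R by rewrite Cmod_R Rabs_left; lra.
have [r [M [d [Hr [Hd [HW Hsm]]]]]] := W_geom_exp Q (-1) HQ Hm1.
have HQ1 : 1 - Q <> 0.
  apply: Csub_neq0 => E; rewrite -E Cmod_1 in HQ; lra.
have [r2 [M2 [Hr2 HP]]] := poly_gf (/ (1 - Q)).
have -> : poly_p (S j) (/ (1 - Q)) = d j.
  apply: (W_unique _ _ _ _ _ _ _ _ Hr2 Hr HP HW) => eps He.
  have Hm : (0 < Rmin eps r)%R by apply: Rmin_pos.
  have [z [Hz _]] := exists_near 0 0 _ Hm; exists z; replace (z - 0) with z in Hz by ring.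
  have M3 := Rmin_l eps r; have M4 := Rmin_r eps r; split; first lra.
  have Hs := Hsm z ltac:(lra).
  replace (-1 * z) with (- z) in Hs |- * by ring; rewrite Cexp_opp in Hs *.
  have N0 := Cexp_neq0 z; move: Hs N0; set X := Cexp z => Hs N0.
  have N1 : X - Q <> 0.
    apply: Csub_neq0 => E; move: Hs; rewrite -E Cinv_r // Cmod_1; lra.
  have -> : 1 - Q * / X = (X - Q) / X by field.
  have -> : 1 - / (1 - Q) + / (1 - Q) * X = (X - Q) / (1 - Q) by field.
  field; by auto.
apply: has_sum_ext (Hd j) => n; congr (_ * (_ * _ ^ _)); ring.
Qed.

(** The generating function of [poly_geom_pos] with [Q = 1 / P], now expanded
    in powers of [P exp y]. *)
Lemma poly_geom_neg (P : C) j : P <> 0 -> (Cmod P < 1)%R ->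
  has_sum (fun n => - (P ^ S n * (/ RtoC (INR (fact j)) * RtoC (INR (S n)) ^ j))) (poly_p (S j) (/ (1 - / P))).
Proof.
move=> HP0 HP.
have [r [M [d [Hr [Hd [HW Hsm]]]]]] := W_geom_exp P 1 HP Cmod_1.
have HP1 : 1 - P <> 0.
  apply: Csub_neq0 => E; rewrite -E Cmod_1 in HP; lra.
have HP2 : P - 1 <> 0.
  apply: Csub_neq0 => E; rewrite E Cmod_1 in HP; lra.
have [r2 [M2 [Hr2 HPg]]] := poly_gf (/ (1 - / P)).
have Hr0 := Rlt_le _ _ Hr.
have HV := W_plus _ _ _ _ _ _ _ Hr0 (W_const r 1 Hr0) (W_scal (-1) _ _ _ _ HW).
have E : poly_p (S j) (/ (1 - / P)) = (match j with O => 1 | _ => 0 end) + -1 * d j.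
  apply: (W_unique _ _ _ _ _ _ _ _ Hr2 Hr HPg HV) => eps He.
  have Hm : (0 < Rmin eps r)%R by apply: Rmin_pos.
  have [z [Hz _]] := exists_near 0 0 _ Hm; exists z; replace (z - 0) with z in Hz by ring.
  have M3 := Rmin_l eps r; have M4 := Rmin_r eps r; split; first lra.
  have Hs := Hsm z ltac:(lra); rewrite Cmult_1_l in Hs *.
  have N0 := Cexp_neq0 z; move: Hs N0; set X := Cexp z => Hs N0.
  have N1 : 1 - P * X <> 0.
    apply: Csub_neq0 => E; rewrite -E Cmod_1 in Hs; lra.
  have N2 : P * X - 1 <> 0.
    apply: Csub_neq0 => E; rewrite E Cmod_1 in Hs; lra.
  have -> : / (1 - / P) = P / (P - 1).
    by field.
  have E1 : 1 - P / (P - 1) + P / (P - 1) * X = (P * X - 1) / (P - 1) by field.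
  rewrite E1; clear E1.
  field; by auto.
rewrite E.
have -> : (match j with O => RtoC 1 | _ => 0 end) + -1 * d j =
  - (d j - P ^ 0 * (/ RtoC (INR (fact j)) * (RtoC (INR 0) * 1) ^ j)).
  case: (j) => [|i]; [change (fact 0) with 1%nat; change (INR 1) with 1%R|change (INR 0) with 0%R];
  rewrite ?Cpow_S; field; try exact: INR_fact_neq0.
have H1 := has_sum_opp _ _ (has_sum_unshift _ _ (Hd j)).
apply: has_sum_ext H1 => n; by rewrite Cmult_1_r.
Qed.

(** * Fourier expansions *)

(** Expand every [1 / (1 - A T^N)] geometrically and sum over [N] first. *)
Lemma has_sum_lambert (w d : nat -> C) (A T s : C) M :
  bsum (fun N => (Cmod (w N) * Cmod T ^ N)%R) M -> (Cmod A < 1)%R -> (Cmod T < 1)%R ->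
  (forall m, has_sum (fun N => w N * (T ^ S m) ^ N) (d m)) ->
  has_sum (fun N => w N * (/ (1 - A * T ^ N) - 1)) s ->
  (exists B, bsum (fun m => Cmod (d m * A ^ S m)) B) /\ has_sum (fun m => d m * A ^ S m) s.
Proof.
move=> HM HA HT Hd Hs.
have HA0 := Cmod_ge_0 A; have HT0 := Cmod_ge_0 T.
have HG := bsum_shift _ _ (bsum_geom _ (conj HA0 HA)).
have HTp : forall N m, (Cmod ((T ^ S m) ^ N) <= Cmod T ^ N)%R.
  move=> N m; rewrite !Cmod_pow; apply: pow_incr; split; first exact: pow_le.
  rewrite -tech_pow_Rmult; have := pow_le1 (Cmod T) m ltac:(lra); nra.
have HdB : forall m, (Cmod (d m) <= M)%R.
  move=> m; apply: (has_sum_bound _ _ _ _ _ HM (Hd m)) => N.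
  rewrite Cmod_mult; apply: Rmult_le_compat_l; [exact: Cmod_ge_0|exact: HTp].
have HM0 := bsum_ge0 _ _ HM.
split.
  exists (M * / (1 - Cmod A))%R; apply: bsum_le (bsum_scal M _ _ HM0 HG) => m.
  split; first exact: Cmod_ge_0.
  rewrite Cmod_mult Cmod_pow; apply: Rmult_le_compat_r => //; exact: pow_le.
pose a (p : nat * nat) := w (fst p) * ((T ^ S (snd p)) ^ fst p * A ^ S (snd p)).
have Hab : forall p, (Cmod (a p) <= Cmod (w (fst p)) * Cmod T ^ fst p * Cmod A ^ S (snd p))%R.
  move=> [N m]; rewrite /a /fst /snd (Cmod_mult (w N)) (Cmod_mult ((T ^ S m) ^ N)) (Cmod_pow A) Rmult_assoc.
  apply: Rmult_le_compat_l; first exact: Cmod_ge_0.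
  apply: Rmult_le_compat_r; [exact: pow_le|exact: HTp].
have [S1 HS] := has_sum_exists _ _ _ Hab (bsum_prod _ _ _ _ HM HG).
have Hrow : forall N, has_sum (fun m => a (N, m)) (w N * (/ (1 - A * T ^ N) - 1)).
  move=> N.
  have HQ : (Cmod (A * T ^ N) < 1)%R.
    rewrite Cmod_mult Cmod_pow.
    have := pow_le1 (Cmod T) N ltac:(lra); have := pow_le _ N HT0; nra.
  have H1 := has_sum_scal (w N) _ _ (has_sum_unshift _ _ (has_sum_geom _ HQ)).
  apply: has_sum_ext H1 => m.
  rewrite /a /fst /snd Cpow_mult_l -!Cpow_mult_r Nat.mul_comm; ring.
rewrite (has_sum_unique _ _ _ Hs (has_sum_pairs _ _ _ HS Hrow)).
have HS2 := has_sum_swap (fun N m => a (N, m)) _ (has_sum_ext _ _ _ (fun p => match p with (i, j) => eq_refl end) HS).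
apply: (has_sum_pairs _ _ _ HS2) => m.
apply: has_sum_ext (has_sum_scal_r (A ^ S m) _ _ (Hd m)) => N; rewrite /a /=; ring.
Qed.

Definition fourier_abs (F : Z -> C) (x : C) : Prop :=
  exists B, bsum (fun m => Cmod (F m * qexp (RtoC (IZR m) * x))) B.

Definition fourier_sum (F : Z -> C) (x s : C) : Prop :=
  fourier_abs F x /\ has_sum (fun m => F m * qexp (RtoC (IZR m) * x)) s.

Section Fourier.
Variables (tau : C) (htau : (0 < Im tau)%R).

Definition um (m : Z) : C := / (1 - qexp (RtoC (IZR m) * tau)).

(** The Fourier coefficients of [g tau n] in the strip [0 < Im x < Im tau]. *)
Definition fourier_coef (n : nat) (m : Z) : C :=
  D0 ^ n * (if Z.eqb m 0 then RtoC (bcoef n) else poly_p n (um m)).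

Lemma Cmod_qexp_tau : Cmod (qexp tau) = qn tau.
Proof. by rewrite Cmod_qexp. Qed.

Lemma qexp_natS k z : qexp (RtoC (IZR (Z.of_nat k)) * z) = qexp z ^ k.
Proof. rewrite -INR_IZR_INZ; exact: qexp_nat. Qed.

Lemma qexp_negS k z : qexp (RtoC (IZR (- Z.of_nat k - 1)) * z) = qexp (- z) ^ S k.
Proof.
rewrite -qexp_nat; congr qexp.
have -> : (- Z.of_nat k - 1 = - Z.of_nat (S k))%Z by lia.
rewrite opp_IZR -INR_IZR_INZ RtoC_opp; ring.
Qed.

(** Rows [n >= 0] and rows [n < 0] of the lattice are treated by
    [has_sum_lambert] separately; summation over the rows is [poly_geom_pos]
    and [poly_geom_neg]. *)
Lemma Lam_fourier j x : (0 < Im x < Im tau)%R ->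
  fourier_sum (fun m => if Z.eqb m 0 then RtoC 0 else D0 ^ j * poly_p (S j) (um m)) x (Lam tau (wpol j) x).
Proof.
move=> Hx; have Hq := qn_pos tau; have Hq1 := qn_lt1 tau htau; have HPI := PI_RGT_0.
have HA1 : (Cmod (qexp x) < 1)%R.
  rewrite Cmod_qexp -exp_0; apply: exp_increasing; nra.
have HA2 : (Cmod (qexp (tau - x)) < 1)%R.
  rewrite Cmod_qexp -exp_0; apply: exp_increasing.
  have -> : Im (tau - x) = (Im tau - Im x)%R by [].
  nra.
have HT : (Cmod (qexp tau) < 1)%R by rewrite Cmod_qexp_tau.
have [M1 HM1] := bsum_weight tau (wpol j) 1 (weight_wpol tau htau j) Rle_0_1.
have Hq' : (0 <= / qn tau)%R by left; apply: Rinv_0_lt_compat.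
have [M2 HM2] := bsum_weight tau (wpol j) (/ qn tau) (weight_wpol tau htau j) Hq'.
have HL := Lam_spec tau htau (wpol j) x (weight_wpol tau htau j).
have [K [HK HKb]] := lam_bound tau htau x.
have [M3 HM3] := bsum_weight tau (wpol j) K (weight_wpol tau htau j) HK.
have Hb3 : forall n, (Cmod (wpol j n * lam tau n x) <= Cmod (wpol j n) * (K * qn tau ^ Z.abs_nat n))%R.
  move=> n; rewrite Cmod_mult; apply: Rmult_le_compat_l; [exact: Cmod_ge_0|exact: HKb].
have [u [v [Hu [Hv ->]]]] := has_sum_Z_halves _ _ _ _ Hb3 HM3 HL.
(* nonnegative lattice rows give the positive frequencies *)
have P1 : bsum (fun N => (Cmod (wpol j (Z.of_nat N)) * Cmod (qexp tau) ^ N)%R) M1.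
  have := bsum_inj Z.of_nat _ _ Nat2Z.inj HM1; apply: bsum_le => N.
  rewrite Cmod_qexp_tau Zabs2Nat.id Rmult_1_l; split; last lra.
  apply: Rmult_le_pos; [exact: Cmod_ge_0|apply: pow_le; lra].
have P2 : forall m, has_sum (fun N => wpol j (Z.of_nat N) * (qexp tau ^ S m) ^ N)
    (D0 ^ j * poly_p (S j) (um (Z.of_nat (S m)))).
  move=> m.
  have HQ : (Cmod (qexp tau ^ S m) < 1)%R.
    rewrite Cmod_pow Cmod_qexp_tau; apply: Rle_lt_trans (Hq1).
    rewrite -tech_pow_Rmult; have := pow_le1 (qn tau) m ltac:(lra); nra.
  have := poly_geom_pos _ j HQ; rewrite /um qexp_natS => /(has_sum_scal (D0 ^ j)).
  apply: has_sum_ext => N; rewrite /wpol -INR_IZR_INZ Cpow_mult_l; ring.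
have P3 : has_sum (fun N => wpol j (Z.of_nat N) * (/ (1 - qexp x * qexp tau ^ N) - 1)) u.
  apply: has_sum_ext Hu => N; rewrite /lam (proj2 (Z.leb_le 0 (Z.of_nat N))); last lia.
  by rewrite /kap qexp_plus qexp_natS.
have [[B1 HB1] HF1] := has_sum_lambert _ _ _ _ _ _ P1 HA1 HT P2 P3.
(* negative lattice rows give the negative frequencies *)
have N1 : bsum (fun N => (Cmod (- wpol j (- Z.of_nat N - 1)) * Cmod (qexp tau) ^ N)%R) M2.
  have := bsum_inj (fun N => (- Z.of_nat N - 1)%Z) _ _ _ HM2.
  move=> /(_ ltac:(move=> a b; lia)); apply: bsum_le => N.
  rewrite Cmod_qexp_tau Cmod_opp.
  have -> : Z.abs_nat (- Z.of_nat N - 1) = S N by lia.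
  rewrite -tech_pow_Rmult.
  have -> : (/ qn tau * (qn tau * qn tau ^ N) = qn tau ^ N)%R by field; lra.
  split; last lra.
  apply: Rmult_le_pos; [exact: Cmod_ge_0|apply: pow_le; lra].
have N2 : forall m, has_sum (fun N => - wpol j (- Z.of_nat N - 1) * (qexp tau ^ S m) ^ N)
    (/ (qexp tau ^ S m) * (D0 ^ j * poly_p (S j) (um (- Z.of_nat m - 1)))).
  move=> m.
  have HQ : (Cmod (qexp tau ^ S m) < 1)%R.
    rewrite Cmod_pow Cmod_qexp_tau; apply: Rle_lt_trans (Hq1).
    rewrite -tech_pow_Rmult; have := pow_le1 (qn tau) m ltac:(lra); nra.
  have HP0 : qexp tau ^ S m <> 0 by apply: Cpow_neq0; exact: qexp_neq0.
  have := poly_geom_neg _ j HP0 HQ; rewrite /um qexp_negS qexp_opp.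
  have -> : (/ qexp tau) ^ S m = / (qexp tau ^ S m) by rewrite Cpow_inv //; exact: qexp_neq0.
  move: HP0 {HQ}; set P := qexp tau ^ S m => HP0.
  move=> /(has_sum_scal (D0 ^ j)) /(has_sum_scal (/ P)).
  apply: has_sum_ext => N; rewrite /wpol.
  have -> : (- Z.of_nat N - 1 = - Z.of_nat (S N))%Z by lia.
  rewrite opp_IZR -INR_IZR_INZ RtoC_opp Cpow_mult_l; have -> : - - RtoC (INR (S N)) = RtoC (INR (S N)) by ring.
  rewrite Cpow_S; field.
  split => //; exact: INR_fact_neq0.
have N3 : has_sum (fun N => - wpol j (- Z.of_nat N - 1) * (/ (1 - qexp (tau - x) * qexp tau ^ N) - 1)) v.
  apply: has_sum_ext Hv => N; rewrite /lam (proj2 (Z.leb_gt 0 (- Z.of_nat N - 1))); last lia.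
  rewrite /kap.
  have -> : qexp (x + RtoC (IZR (- Z.of_nat N - 1)) * tau) = / (qexp (tau - x) * qexp tau ^ N).
    rewrite -qexp_natS -qexp_plus -qexp_opp; congr qexp.
    rewrite minus_IZR opp_IZR RtoC_minus RtoC_opp; ring.
  have H1 : qexp (tau - x) * qexp tau ^ N <> 0 by apply: Cmult_neq_0; [exact: qexp_neq0|apply: Cpow_neq0; exact: qexp_neq0].
  have H2 : (Cmod (qexp (tau - x) * qexp tau ^ N) < 1)%R.
    rewrite Cmod_mult Cmod_pow Cmod_qexp_tau.
    have := pow_le1 (qn tau) N ltac:(lra).
    have := pow_le (qn tau) N ltac:(lra); have := Cmod_ge_0 (qexp (tau - x)); nra.
  move: H1 H2; set P := qexp (tau - x) * qexp tau ^ N => H1 H2.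
  have H3 : 1 - P <> 0.
    apply: Csub_neq0 => E; rewrite -E Cmod_1 in H2; lra.
  have H4 : P - 1 <> 0.
    apply: Csub_neq0 => E; rewrite E Cmod_1 in H2; lra.
  field; by auto.
have [[B2 HB2] HF2] := has_sum_lambert _ _ _ _ _ _ N1 HA2 HT N2 N3.
have Eneg : forall k, / (qexp tau ^ S k) * (D0 ^ j * poly_p (S j) (um (- Z.of_nat k - 1))) * qexp (tau - x) ^ S k =
   (if Z.eqb (- Z.of_nat k - 1) 0 then RtoC 0 else D0 ^ j * poly_p (S j) (um (- Z.of_nat k - 1))) *
   qexp (RtoC (IZR (- Z.of_nat k - 1)) * x).
  move=> k; have -> : (- Z.of_nat k - 1 =? 0)%Z = false by apply/Z.eqb_neq; lia.
  rewrite qexp_negS /Cminus qexp_plus Cpow_mult_l; field; apply: Cpow_neq0; exact: qexp_neq0.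
have Epos : forall k, D0 ^ j * poly_p (S j) (um (Z.of_nat (S k))) * qexp x ^ S k =
   (if Z.eqb (Z.of_nat (S k)) 0 then RtoC 0 else D0 ^ j * poly_p (S j) (um (Z.of_nat (S k)))) *
   qexp (RtoC (IZR (Z.of_nat (S k))) * x).
  move=> k; by rewrite qexp_natS.
split.
  eexists; apply: bsum_Z.
    apply: bsum_unshift; first exact: Cmod_ge_0.
    apply: bsum_le HB1 => k; rewrite Epos; split; [exact: Cmod_ge_0|lra].
  apply: bsum_le HB2 => k; rewrite Eneg; split; [exact: Cmod_ge_0|lra].
apply: has_sum_Z; last by apply: has_sum_ext HF2.
replace u with (0 * qexp (RtoC (IZR (Z.of_nat 0)) * x) + u) by ring.
apply: (has_sum_shift (fun k => (if Z.eqb (Z.of_nat k) 0 then RtoC 0 else D0 ^ j * poly_p (S j) (um (Z.of_nat k))) *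
   qexp (RtoC (IZR (Z.of_nat k)) * x))).
by apply: has_sum_ext HF1.
Qed.

Lemma fourier_sum_ext F G x s : (forall m, F m = G m) -> fourier_sum F x s -> fourier_sum G x s.
Proof.
move=> E [[B HB] H]; split; last by apply: has_sum_ext H => m; rewrite E.
exists B; apply: bsum_le HB => m; rewrite E; split; [exact: Cmod_ge_0|lra].
Qed.

Lemma fourier_sum_plus F G x s t : fourier_sum F x s -> fourier_sum G x t -> fourier_sum (fun m => F m + G m) x (s + t).
Proof.
move=> [[B HB] H] [[B' HB'] H']; split.
  exists (B + B')%R; apply: bsum_le (bsum_plus _ _ _ _ HB HB') => m.
  rewrite Cmult_plus_distr_r; split; [exact: Cmod_ge_0|exact: Cmod_triangle].
apply: has_sum_ext (has_sum_plus _ _ _ _ H H') => m; ring.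
Qed.

Lemma fourier_sum_scal k F x s : fourier_sum F x s -> fourier_sum (fun m => k * F m) x (k * s).
Proof.
move=> [[B HB] H]; split.
  exists (Cmod k * B)%R; apply: bsum_le (bsum_scal _ _ _ (Cmod_ge_0 k) HB) => m.
  rewrite -Cmult_assoc Cmod_mult; split; last lra.
  apply: Rmult_le_pos; exact: Cmod_ge_0.
apply: has_sum_ext (has_sum_scal k _ _ H) => m; ring.
Qed.

Lemma fourier_sum_const (k : C) x : fourier_sum (fun m => if Z.eqb m 0 then k else RtoC 0) x k.
Proof.
have H : forall m, m <> 0%Z -> (if Z.eqb m 0 then k else RtoC 0) * qexp (RtoC (IZR m) * x) = 0.
  move=> m /Z.eqb_neq ->; ring.
split.
  exists (Cmod k + 0)%R; apply: bsum_Z.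
    have -> : Cmod k = (Cmod ((if (Z.of_nat 0 =? 0)%Z then k else RtoC 0) * qexp (RtoC (IZR (Z.of_nat 0)) * x)) + 0)%R.
      rewrite /= Cmult_0_l qexp_0 Cmult_1_r; lra.
    apply: (bsum_unshift (fun n => Cmod ((if (Z.of_nat n =? 0)%Z then k else RtoC 0) * qexp (RtoC (IZR (Z.of_nat n)) * x)))); first exact: Cmod_ge_0.
    split => [i|l _]; first exact: Cmod_ge_0.
    rewrite rsum_zero; first lra.
    move=> i _; cbv beta; have -> := H (Z.of_nat (S i)) ltac:(lia); exact: Cmod_0.
  split => [i|l _]; first exact: Cmod_ge_0.
  rewrite rsum_zero; first lra.
  move=> i _; cbv beta; have -> := H (- Z.of_nat i - 1)%Z ltac:(lia); exact: Cmod_0.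
have := has_sum_single 0%Z _ H; by rewrite /= Cmult_0_l qexp_0 Cmult_1_r.
Qed.

Lemma poly_p_0 (u : C) : poly_p 0 u = 0.
Proof. by rewrite /poly_p sum_n_m_zero; last lia. Qed.

Lemma poly_p_1 (u : C) : poly_p 1 u = u.
Proof.
rewrite (poly_p_seq 1 1) // /pcoef /=.
have -> : RtoC (1 * (1 / 1) * 1) = 1 by congr RtoC; field.
ring.
Qed.

Lemma ghat_fourier n x : (0 < Im x < Im tau)%R -> fourier_sum (fourier_coef n) x (ghat tau n x).
Proof.
move=> Hx; rewrite /ghat.
have HC := fourier_sum_const (D0 ^ n * RtoC (bcoef n)) x.
case: n HC => [|j] HC.
  rewrite Cplus_0_r; apply: fourier_sum_ext HC => m; rewrite /fourier_coef; case: Z.eqb => //.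
  rewrite poly_p_0; ring.
apply: fourier_sum_ext (fourier_sum_plus _ _ _ _ _ HC (fourier_sum_scal D0 _ _ _ (Lam_fourier j x Hx))) => m.
rewrite /fourier_coef; case: Z.eqb; rewrite Cpow_S; ring.
Qed.

Lemma fourier_coef1_bound : exists K, (0 <= K)%R /\ forall k : nat,
  (Cmod (fourier_coef 1 (Z.of_nat k)) <= K)%R /\ (Cmod (fourier_coef 1 (- Z.of_nat k - 1)) <= K * qn tau ^ S k)%R.
Proof.
have Hq := qn_pos tau; have Hq1 := qn_lt1 tau htau.
have Hp := pow_le1 (qn tau) _ ltac:(lra).
have Hi : (0 <= / (1 - qn tau))%R by left; apply: Rinv_0_lt_compat; lra.
have HK : (0 <= Cmod D0 * / (1 - qn tau))%R by apply: Rmult_le_pos => //; exact: Cmod_ge_0.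
have Hd : forall k, (Cmod (/ (1 - qexp tau ^ S k)) <= / (1 - qn tau))%R /\ 1 - qexp tau ^ S k <> 0.
  move=> k; have H1 : (Cmod (qexp tau ^ S k) <= qn tau)%R.
    rewrite Cmod_pow Cmod_qexp_tau -tech_pow_Rmult; have := Hp k; nra.
  have H2 : 1 - qexp tau ^ S k <> 0.
    apply: Csub_neq0 => E; rewrite -E Cmod_1 in H1; lra.
  split => //; rewrite Cmod_inv //; apply: Rinv_le_contravar; first lra.
  have := Cmod_triangle (1 - qexp tau ^ S k) (qexp tau ^ S k).
  replace (1 - qexp tau ^ S k + qexp tau ^ S k) with (RtoC 1) by ring.
  rewrite Cmod_1; lra.
exists (Cmod (D0 * RtoC (bcoef 1)) + Cmod D0 * / (1 - qn tau))%R; split.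
  have := Cmod_ge_0 (D0 * RtoC (bcoef 1)); lra.
have H0 := Cmod_ge_0 (D0 * RtoC (bcoef 1)).
move=> k; split.
  case: k => [|k]; first by rewrite /fourier_coef /= Cmult_1_r; lra.
  rewrite /fourier_coef (proj2 (Z.eqb_neq _ _)); last lia.
  rewrite poly_p_1 Cpow_1_r /um qexp_natS Cmod_mult.
  have := Rmult_le_compat_l _ _ _ (Cmod_ge_0 D0) (proj1 (Hd k)); lra.
rewrite /fourier_coef (proj2 (Z.eqb_neq _ _)); last lia.
rewrite poly_p_1 Cpow_1_r /um qexp_negS qexp_opp.
have -> : (/ qexp tau) ^ S k = / (qexp tau ^ S k) by rewrite Cpow_inv //; exact: qexp_neq0.
have [H1 H2] := Hd k.
have H3 : qexp tau ^ S k <> 0 by apply: Cpow_neq0; exact: qexp_neq0.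
have HqS : (0 <= qn tau ^ S k)%R by apply: pow_le; lra.
have H4 : Cmod (qexp tau ^ S k) = (qn tau ^ S k)%R by rewrite Cmod_pow Cmod_qexp_tau.
move: H1 H2 H3 H4 HqS; set P := qexp tau ^ S k; set Q := (qn tau ^ S k)%R => H1 H2 H3 H4 HqS.
have -> : / (1 - / P) = - P * / (1 - P).
  field; split; [|split] => // E; apply: H2.
  - replace (1 - P) with (- (P - 1)) by ring; rewrite E; ring.
rewrite !Cmod_mult Cmod_opp H4.
have := Rmult_le_compat_l _ _ _ (Rmult_le_pos _ _ (Cmod_ge_0 D0) HqS) H1.
have := Rmult_le_pos _ _ H0 HqS; rewrite Cmod_mult; lra.
Qed.

End Fourier.

(** * Convolution powers *)

(** On the line [Im z = Im x / 2] both factors are Fourier series in the real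
    part of [z]; the integral picks the zero mode of their product. *)
Lemma conv_fourier h F G f g x : (0 < Im x < 2 * h)%R ->
  (forall z, (0 < Im z < h)%R -> fourier_sum F z (f z)) ->
  (forall z, (0 < Im z < h)%R -> fourier_sum G z (g z)) ->
  fourier_sum (fun m => F m * G m) x (conv_integral f g x).
Proof.
move=> Hx HF HG; pose z0 : C := (0, Im x / 2)%R.
have Hz0 : (0 < Im z0 < h)%R by rewrite /z0 /=; lra.
have Hxz0 : (0 < Im (x - z0) < h)%R by case: x Hx @z0 Hz0 => a b /=; lra.
have [[B HB] _] := HF _ Hxz0; have [[B' HB'] _] := HG _ Hz0.
pose a0 (p : Z * Z) := F (fst p) * qexp (RtoC (IZR (fst p)) * (x - z0)) *
  (G (snd p) * qexp (RtoC (IZR (snd p)) * z0)).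
have H0 : bsum (fun p => Cmod (a0 p)) (B * B').
  apply: bsum_le (bsum_prod _ _ _ _ HB HB') => p; rewrite /a0 Cmod_mult.
  split; last lra; apply: Rmult_le_pos; exact: Cmod_ge_0.
pose a1 (k p : Z) := a0 (p, p + k)%Z.
have H1 : bsum (fun p => Cmod (a1 (fst p) (snd p))) (B * B').
  apply: (bsum_inj (fun p : Z * Z => (snd p, snd p + fst p)%Z) _ _ _ H0).
  move=> [u v] [u' v'] /= [-> E]; congr pair; lia.
have Hrow : forall k, exists s, has_sum (a1 k) s.
  move=> k; apply: (has_sum_exists _ _ _ (fun p => Rle_refl _)).
  apply: (bsum_inj (fun p => (k, p)) _ _ _ H1) => u v; by case.
have [c Hc] := choice_fun _ Hrow.
have HcB := bsum_rows _ _ _ H1 Hc.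
have E0 : forall p, F p * G p * qexp (RtoC (IZR p) * x) = a1 0%Z p.
  move=> p; rewrite /a1 /a0 /fst /snd Z.add_0_r.
  replace (RtoC (IZR p) * x) with (RtoC (IZR p) * (x - z0) + RtoC (IZR p) * z0) by ring.
  rewrite qexp_plus; ring.
split.
  exists (B * B')%R; apply: bsum_le (bsum_inj (fun p => (0%Z, p)) _ _ _ H1).
    move=> p; rewrite E0; split; [exact: Cmod_ge_0|exact: Rle_refl].
  move=> u v; by case.
have -> : conv_integral f g x = c 0%Z; last first.
  apply: has_sum_ext (Hc 0%Z) => p; by rewrite E0.
apply: (is_RInt_unique (V := C_R_CompleteNormedModule)); apply: (is_RInt_fourier _ _ _ HcB) => t.
set z : C := (t, Im x / 2)%R.
have Hz : (0 < Im z < h)%R by rewrite /z /=; lra.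
have Hxz : (0 < Im (x - z) < h)%R by case: x Hx @z {z0 Hz0 Hxz0 HB HB' a0 H0 a1 H1 Hrow Hc E0} Hz => a b /=; lra.
have [[B1 HB1] HF1] := HF _ Hxz; have [[B2 HB2] HG1] := HG _ Hz.
have HP := has_sum_prod _ _ _ _ _ _ HB1 HB2 HF1 HG1.
have HP2 : has_sum (fun p : Z * Z => a1 (fst p) (snd p) * qexp (RtoC (IZR (fst p) * t))) (f (x - z) * g z).
  apply: (has_sum_reindex (fun p : Z * Z => (snd p - fst p, fst p)%Z) (fun p : Z * Z => (snd p, snd p + fst p)%Z)).
  - move=> [u v] /=; congr pair; lia.
  - move=> [u v] /=; congr pair; lia.
  apply: has_sum_ext HP => -[p q]; rewrite /a1 /a0 /fst /snd.
  have -> : (p + (q - p) = q)%Z by lia.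
  have Ez : z = z0 + RtoC t.
    by apply: injective_projections => /=; ring.
  have -> : RtoC (IZR p) * (x - z) = RtoC (IZR p) * (x - z0) + - (RtoC (IZR p) * RtoC t) by rewrite Ez; ring.
  have -> : RtoC (IZR q) * z = RtoC (IZR q) * z0 + RtoC (IZR q) * RtoC t by rewrite Ez; ring.
  rewrite minus_IZR; have -> : RtoC ((IZR q - IZR p) * t) = RtoC (IZR q) * RtoC t + - (RtoC (IZR p) * RtoC t).
    rewrite RtoC_mult RtoC_minus; ring.
  rewrite !qexp_plus; ring.
apply: (has_sum_pairs _ _ _ HP2) => k.
exact: (has_sum_scal_r (qexp (RtoC (IZR k * t))) _ _ (Hc k)).
Qed.

(** On a disc of radius [r] the term of frequency [m] changes by a factor of
    at most [exp (2 pi |m| r)], which the decay absorbs when [r] is small. *)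
Lemma fourier_an F S K rho x0 : (0 <= K)%R -> (0 <= rho)%R ->
  (forall k : nat, (Cmod (F (Z.of_nat k)) <= K)%R /\ (Cmod (F (- Z.of_nat k - 1)%Z) <= K * rho ^ Datatypes.S k)%R) ->
  (Cmod (qexp x0) < 1)%R -> (rho * Cmod (qexp (- x0)) < 1)%R ->
  (exists d, (0 < d)%R /\ forall x, (Cmod (x - x0) < d)%R -> fourier_abs F x -> fourier_sum F x (S x)) ->
  fourier_abs F x0 /\ analytic_at x0 S.
Proof.
move=> HK Hrho HF H1 H2 [d [Hd HS]].
have Hx := Cmod_ge_0 (qexp x0); have Hx' := Cmod_ge_0 (qexp (- x0)).
have H2' : (0 <= rho * Cmod (qexp (- x0)))%R by apply: Rmult_le_pos.
set qm := Rmax (Cmod (qexp x0)) (rho * Cmod (qexp (- x0))).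
have Hq1 : (Cmod (qexp x0) <= qm)%R := Rmax_l _ _.
have Hq2 : (rho * Cmod (qexp (- x0)) <= qm)%R := Rmax_r _ _.
have Hqm : (0 <= qm < 1)%R by split; [lra|apply: Rmax_lub_lt].
have [r0 [Hr0 Hr1]] := exp_radius qm Hqm.
set w := 2 * RtoC PI * Ci.
have HPI := PI_RGT_0.
have Hw : Cmod w = (2 * PI)%R by rewrite /w !Cmod_mult Cmod_Ci !Cmod_R !Rabs_pos_eq; lra.
set r := Rmin (r0 / (2 * PI)) (d / 2).
have Hr : (0 < r)%R by apply: Rmin_pos; [apply: Rdiv_lt_0_compat; lra|lra].
have Hrr : (2 * PI * r <= r0)%R.
  have := Rmin_l (r0 / (2 * PI)) (d / 2); rewrite -/r => H.
  have -> : r0 = (2 * PI * (r0 / (2 * PI)))%R by field; lra.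
  apply: Rmult_le_compat_l; lra.
have Hrd := Rmin_r (r0 / (2 * PI)) (d / 2); rewrite -/r in Hrd.
pose M (m : Z) := (Cmod (F m * qexp (RtoC (IZR m) * x0)) * exp (INR (Z.abs_nat m) * r0))%R.
have HW : forall m, exists c, W c r (M m) (fun h => F m * qexp (RtoC (IZR m) * (x0 + h))).
  move=> m; eexists.
  apply: (W_ext _ _ _ (fun h => F m * qexp (RtoC (IZR m) * x0) * Cexp (RtoC (IZR m) * w * h))).
    move=> h _; rewrite Cmult_plus_distr_l qexp_plus {3}/qexp -Cmult_assoc; congr (_ * (_ * Cexp _)).
    rewrite /w; ring.
  apply: W_Mle (W_scal _ _ _ _ _ (W_Cexp (RtoC (IZR m) * w) r (Rlt_le _ _ Hr))).
  apply: Rmult_le_compat_l; first exact: Cmod_ge_0.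
  apply: exp_mono; rewrite Cmod_mult Hw Cmod_R abs_nat_IZR Rmult_assoc.
  apply: Rmult_le_compat_l; [exact: Rabs_pos|lra].
have HG := bsum_geom _ Hr1.
have HMp : forall m, (0 <= M m)%R.
  move=> m; apply: Rmult_le_pos; [exact: Cmod_ge_0|left; exact: exp_pos].
have HMs : exists B, bsum M B.
  eexists; apply: bsum_Z.
    apply: bsum_le (bsum_scal K _ _ HK HG) => k; split; first exact: HMp.
    rewrite /M Zabs2Nat.id qexp_natS -exp_natmul Cmod_mult Cmod_pow Rpow_mult_distr.
    rewrite Rmult_assoc (Rmult_comm (exp r0 ^ k)).
    apply: Rmult_le_compat; [exact: Cmod_ge_0| |by case: (HF k)|].
      apply: Rmult_le_pos; apply: pow_le; [exact: Cmod_ge_0|left; exact: exp_pos].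
    apply: Rmult_le_compat_r; first by apply: pow_le; left; exact: exp_pos.
    by apply: pow_incr.
  apply: bsum_le (bsum_scal K _ _ HK (bsum_shift _ _ HG)) => k; split; first exact: HMp.
  rewrite /M; have -> : Z.abs_nat (- Z.of_nat k - 1) = Datatypes.S k by lia.
  rewrite qexp_negS -exp_natmul Cmod_mult Cmod_pow Rpow_mult_distr.
  have [_ HFk] := HF k.
  have He : (0 <= exp r0 ^ Datatypes.S k)%R by apply: pow_le; left; exact: exp_pos.
  have Hp : (0 <= Cmod (qexp (- x0)) ^ Datatypes.S k)%R by apply: pow_le.
  have E1 := Rmult_le_compat_r _ _ _ Hp HFk.
  have E2 : (K * rho ^ Datatypes.S k * Cmod (qexp (- x0)) ^ Datatypes.S k <= K * qm ^ Datatypes.S k)%R.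
    rewrite Rmult_assoc -Rpow_mult_distr; apply: Rmult_le_compat_l => //.
    by apply: pow_incr.
  have E3 := Rmult_le_compat_r _ _ _ He (Rle_trans _ _ _ E1 E2); lra.
have [B HB] := HMs.
have HFa : forall h, (Cmod h <= r)%R -> fourier_abs F (x0 + h).
  move=> h Hh; exists B; apply: bsum_le HB => m; split; first exact: Cmod_ge_0.
  have [c Hc] := HW m; exact: (W_bound _ _ _ _ _ Hh Hc).
split.
  have := HFa 0; rewrite Cmod_0 Cplus_0_r; apply; lra.
have [c Hc] := choice_fun _ HW.
have HSum : forall h, (Cmod h <= r)%R -> has_sum (fun m => F m * qexp (RtoC (IZR m) * (x0 + h))) (S (x0 + h)).
  move=> h Hh; have [] // := HS (x0 + h) _ (HFa h Hh).
  replace (x0 + h - x0) with h by ring; lra.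
have [d' [_ HWS]] := W_sum _ _ _ _ _ _ Hr Hc HB HSum.
by exists d', r, B.
Qed.

Section Convolution.
Variables (tau : C) (htau : (0 < Im tau)%R).

(** At frequency 0 this is [rcoef_c_bcoef], elsewhere [rcoef_c_poly].  Since
    convolution multiplies Fourier coefficients, it is the first transition
    formula on the level of coefficients. *)
Lemma fourier_coef_pow n m : (1 <= n)%nat ->
  csum (fun k => coef_c D0 n k * fourier_coef tau k m) (seq 0 (S n)) = fourier_coef tau 1 m ^ n.
Proof.
move=> Hn.
rewrite (csum_ext _ (fun k => D0 ^ n * (RtoC (rcoef_c n k) * (if Z.eqb m 0 then RtoC (bcoef k) else poly_p k (um tau m))))); last first.
  move=> k /in_seq Hk; rewrite coef_cE; last lia.
  rewrite /fourier_coef; have -> : D0 ^ n = D0 ^ (n - k) * D0 ^ k by rewrite -Cpow_add_r; congr Cpow; lia.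
  ring.
rewrite csum_scal /fourier_coef Cpow_1_r Cpow_mult_l; congr (_ * _).
case: Z.eqb.
  have -> : bcoef 1 = (/ 2)%R.
    rewrite /bcoef bernoulli_1 /=; field.
  rewrite -RtoC_pow pow_inv -(rcoef_c_bcoef n Hn) -csum_RtoC.
  by apply: csum_ext => k _; rewrite RtoC_mult.
rewrite poly_p_1 -(rcoef_c_poly n _ Hn) /= poly_p_0; ring.
Qed.

Lemma fourier_sum_csum {I} (F : I -> Z -> C) (s : I -> C) x l : (forall i, fourier_sum (F i) x (s i)) ->
  fourier_sum (fun m => csum (fun i => F i m) l) x (csum s l).
Proof.
move=> H; elim: l => [|i l IH] /=; last exact: fourier_sum_plus.
apply: fourier_sum_ext (fourier_sum_const 0 x) => m; by case: Z.eqb.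
Qed.

Definition conv_pow_value (n : nat) (x : C) : C :=
  csum (fun k => coef_c D0 n k * ghat tau k x) (seq 0 (S n)).

Lemma conv_pow_value_fourier n x : (1 <= n)%nat -> (0 < Im x < Im tau)%R ->
  fourier_sum (fun m => fourier_coef tau 1 m ^ n) x (conv_pow_value n x).
Proof.
move=> Hn Hx; apply: fourier_sum_ext (fourier_sum_csum _ _ x (seq 0 (S n))
  (fun k => fourier_sum_scal (coef_c D0 n k) _ _ _ (ghat_fourier tau htau k x Hx))) => m.
exact: fourier_coef_pow.
Qed.

Lemma conv_pow_value_pole n x : pole_order_le 1 (conv_pow_value n) x.
Proof.
rewrite /conv_pow_value; elim: (seq 0 (S n)) => /= [|k l IH].
  apply: (pole_order_le_mono 0); [lia|apply: an_pole0; exact: an_const].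
apply: pole_order_le_plus IH; apply: pole_order_le_scal; exact: ghat_pole.
Qed.

Lemma conv_pow_value_period n x : conv_pow_value n (x + 1) = conv_pow_value n x.
Proof. by apply: csum_ext => k _; rewrite ghat_period. Qed.

Lemma conv_pow_value_an n x : ~ in_lattice tau x -> analytic_at x (conv_pow_value n).
Proof.
move=> Hx; apply: an_csum => k _; apply: an_scal; exact: ghat_an.
Qed.

Lemma Im_near x z : (Rabs (Im z - Im x) <= Cmod (z - x))%R.
Proof. exact: Rle_trans (Rmax_r _ _) (Rmax_Cmod (z - x)). Qed.

Definition mid : C := (0, Im tau / 2)%R.

Lemma near_mid z : (Cmod (z - mid) < Im tau / 2)%R -> (0 < Im z < Im tau)%R.
Proof.
have := Im_near mid z; rewrite /mid /=; set t := (Im z - _)%R => H1 H2.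
have : (Rabs t < Im tau / 2)%R by lra.
move=> /Rabs_def2; rewrite /t; lra.
Qed.

Lemma zero_near_mid f1 f2 : (forall x, (0 < Im x < Im tau)%R -> f1 x = f2 x) ->
  zero_near (fun z => f1 z - f2 z) mid.
Proof.
move=> H; exists (Im tau / 2)%R; split; first lra.
move=> z Hz; rewrite H; [ring|apply: near_mid; lra].
Qed.

(** The integral is analytic in the strip where it is defined and agrees with
    [k] on its lower half, so gluing the two gives the continuation. *)
Lemma conv_continuation f1 f2 k F G K : meromorphic k -> (forall x, k (x + 1) = k x) ->
  (forall x, ~ in_lattice tau x -> analytic_at x k) ->
  (forall x, (0 < Im x < Im tau)%R -> fourier_sum F x (f1 x)) ->
  (forall x, (0 < Im x < Im tau)%R -> fourier_sum G x (f2 x)) ->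
  (forall x, (0 < Im x < Im tau)%R -> fourier_sum (fun m => F m * G m) x (k x)) ->
  (0 <= K)%R ->
  (forall j : nat, (Cmod (F (Z.of_nat j) * G (Z.of_nat j)) <= K)%R /\
    (Cmod (F (- Z.of_nat j - 1)%Z * G (- Z.of_nat j - 1)%Z) <= K * (qn tau ^ 2) ^ S j)%R) ->
  mero_eq (conv tau f1 f2) k /\
  forall x, (0 < Im x < Im tau)%R -> fourier_sum (fun m => F m * G m) x (conv tau f1 f2 x).
Proof.
move=> Hk Hper Hkan HF HG HFG HK Hb.
pose I := conv_integral f1 f2.
have HPI := PI_RGT_0.
have HI : forall x, (0 < Im x < 2 * Im tau)%R -> fourier_sum (fun m => F m * G m) x (I x).
  move=> x Hx; exact: conv_fourier Hx HF HG.
have HIk : forall x, (0 < Im x < Im tau)%R -> I x = k x.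
  move=> x Hx; apply: has_sum_unique (proj2 (HFG x Hx)); apply: (proj2 (HI x _)); lra.
have HIan : forall x, (0 < Im x < 2 * Im tau)%R -> analytic_at x I.
  move=> x Hx; apply: (proj2 (fourier_an _ _ K (qn tau ^ 2) x HK _ Hb _ _ _)).
  - apply: pow_le; left; exact: qn_pos.
  - rewrite Cmod_qexp -exp_0; apply: exp_increasing; nra.
  - rewrite Cmod_qexp; have -> : Im (- x) = (- Im x)%R by [].
    have -> : (qn tau ^ 2 = qn tau * qn tau)%R by ring.
    rewrite /qn -!exp_plus -exp_0; apply: exp_increasing; nra.
  exists (Rmin (Im x) (2 * Im tau - Im x)); split; first by apply: Rmin_pos; lra.
  move=> z Hz _; apply: HI; have H1 := Im_near x z.
  have H2 := Rmin_l (Im x) (2 * Im tau - Im x); have H3 := Rmin_r (Im x) (2 * Im tau - Im x).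
  have : (Rabs (Im z - Im x) < Rmin (Im x) (2 * Im tau - Im x))%R by lra.
  move=> /Rabs_def2; lra.
have HZ := zero_near_mid _ _ HIk.
have HIeq : forall x, (0 < Im x < 2 * Im tau)%R -> ~ in_lattice tau x -> I x = k x.
  move=> x Hx Hxl; apply: an_eq_at; [exact: HIan|exact: Hkan|].
  apply: identity_segment HZ => t Ht; apply: meromorphic_minus_at; last exact: Hk.
  exists 0%nat; apply: an_pole0; apply: HIan.
  have -> : Im (mid + RtoC t * (x - mid)) = (Im tau / 2 + t * (Im x - Im tau / 2))%R.
    case: x {Hx Hxl} => a b; rewrite /mid /=; ring.
  nra.
pose h x := match excluded_middle_informative (0 < Im x < 2 * Im tau)%R with
  | left _ => I x | right _ => k x end.
have Hhk : forall x, ~ in_lattice tau x -> h x = k x.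
  move=> x Hx; rewrite /h; case: excluded_middle_informative => // H; exact: HIeq.
have Hhm := mero_eq_off_lattice tau htau _ _ Hhk.
have Hh : is_conv tau f1 f2 h.
  split; last split.
  - move=> a; have [m Hm] := Hk a; exists m.
    exact: pole_order_le_mero_eq (mero_eq_sym _ _ Hhm) Hm.
  - apply: (mero_eq_off_lattice tau htau) => x Hx.
    rewrite !Hhk //; move=> H; apply: Hx; exact: lattice_shift1.
  - move=> x Hx; rewrite /h; by case: excluded_middle_informative.
have [Hc1 [Hc2 Hc3]] : is_conv tau f1 f2 (conv tau f1 f2).
  apply: (epsilon_spec (inhabits (fun _ => RtoC 0))); by exists h.
split.
  apply: (identity_theorem _ _ mid) => //; apply: zero_near_mid => x Hx.
  rewrite Hc3; [exact: HIk|lra].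
move=> x Hx; rewrite Hc3; [apply: HI|]; lra.
Qed.

(** The exponent is at least 2, which makes the series converge up to [Im x =
    2 Im tau]. *)
Lemma fourier_coef_pow_bound n : exists K, (0 <= K)%R /\ forall j : nat,
  (Cmod (fourier_coef tau 1 (Z.of_nat j) * fourier_coef tau 1 (Z.of_nat j) ^ S n) <= K)%R /\
  (Cmod (fourier_coef tau 1 (- Z.of_nat j - 1) * fourier_coef tau 1 (- Z.of_nat j - 1) ^ S n) <= K * (qn tau ^ 2) ^ S j)%R.
Proof.
have [K [HK HB]] := fourier_coef1_bound tau htau.
exists (K ^ S (S n))%R; split; first exact: pow_le.
have Hq := qn_pos tau; have Hq1 := qn_lt1 tau htau.
move=> j; have [H1 H2] := HB j.
rewrite -!Cpow_S !Cmod_pow; split; first by apply: pow_incr; split; [exact: Cmod_ge_0|].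
apply: Rle_trans (pow_incr _ _ _ (conj (Cmod_ge_0 _) H2)) _.
rewrite Rpow_mult_distr; apply: Rmult_le_compat_l; first exact: pow_le.
rewrite -!pow_mult; have -> : (S j * S (S n) = 2 * S j + S j * n)%nat by lia.
rewrite pow_add -{2}(Rmult_1_r (qn tau ^ (2 * S j))).
apply: Rmult_le_compat_l; [apply: pow_le; lra|apply: pow_le1; lra].
Qed.

(** The Fourier series is part of the induction: the next convolution
    integrates the function itself, for which equality up to isolated points
    would not be enough. *)
Lemma conv_pow_spec n :
  mero_eq (conv_pow tau (Zfun tau) (S n)) (conv_pow_value (S n)) /\
  forall x, (0 < Im x < Im tau)%R -> fourier_sum (fun m => fourier_coef tau 1 m ^ S n) x (conv_pow tau (Zfun tau) (S n) x).
Proof.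
have HZ : forall x, (0 < Im x < Im tau)%R -> fourier_sum (fourier_coef tau 1) x (Zfun tau x).
  move=> x Hx; rewrite (Zfun_ghat tau htau); last exact: strip_not_lattice.
  exact: ghat_fourier.
elim: n => [|n [_ IH]].
  split; last first.
    move=> x Hx; apply: fourier_sum_ext (HZ x Hx) => m; by rewrite Cpow_1_r.
  apply: (mero_eq_trans _ (ghat tau 1)).
    apply: (mero_eq_off_lattice tau htau) => x Hx; exact: Zfun_ghat.
  apply: (identity_theorem _ _ mid).
  - move=> a; exists 1%nat; exact: ghat_pole.
  - move=> a; exists 1%nat; exact: conv_pow_value_pole.
  apply: zero_near_mid => x Hx.
  apply: has_sum_unique (proj2 (ghat_fourier tau htau 1 x Hx)) _.
  apply: has_sum_ext (proj2 (conv_pow_value_fourier 1 x (le_n 1) Hx)) => m; by rewrite Cpow_1_r.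
have [K [HK HB]] := fourier_coef_pow_bound n.
apply: (conv_continuation _ _ (conv_pow_value (S (S n))) (fourier_coef tau 1) (fun m => fourier_coef tau 1 m ^ S n) K) => //.
- move=> a; exists 1%nat; exact: conv_pow_value_pole.
- exact: conv_pow_value_period.
- exact: conv_pow_value_an.
- move=> x Hx; have Hn : (1 <= S (S n))%nat by lia.
  exact: conv_pow_value_fourier Hn Hx.
Qed.

End Convolution.

(** * The two transition formulas *)

Lemma rcoef_c_big n k : (n < k)%nat -> rcoef_c n k = 0%R.
Proof.
case: k => [|k] Hk; first lia.
rewrite /rcoef_c stirling1_big //; ring.
Qed.

Section Inversion.
Variables (tau : C) (htau : (0 < Im tau)%R).

Lemma ghat_0 x : ghat tau 0 x = 1.
Proof. rewrite /ghat bcoef_0; change (D0 ^ 0) with (RtoC 1); ring. Qed.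

Lemma conv_pow_conv_pow_value n : mero_eq (conv_pow tau (Zfun tau) n) (conv_pow_value tau n).
Proof.
case: n => [|n]; last by case: (conv_pow_spec tau htau n).
move=> a; exists (mkposreal 1 Rlt_0_1) => z _.
rewrite /conv_pow_value /= ghat_0; ring.
Qed.

Lemma conv_pow_value_inverse n x : csum (fun k => coef_C D0 n k * conv_pow_value tau k x) (seq 0 (S n)) = ghat tau n x.
Proof.
etransitivity.
  apply: csum_ext => k /in_seq Hk.
  have -> : coef_C D0 n k * conv_pow_value tau k x =
    csum (fun j => D0 ^ (n - j) * ghat tau j x * RtoC (rcoef_C n k * rcoef_c k j)) (seq 0 (S n)).
    have -> : seq 0 (S n) = seq 0 (S k + (n - k)) by congr seq; lia.
    rewrite seq_app csum_app (csum_zero _ (seq (0 + S k) (n - k))); last first.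
      move=> j /in_seq Hj; rewrite rcoef_c_big; last lia.
      rewrite Rmult_0_r; ring.
    rewrite Cplus_0_r /conv_pow_value -csum_scal; apply: csum_ext => j /in_seq Hj.
    rewrite coef_CE coef_cE; last lia.
    have -> : D0 ^ (n - j) = D0 ^ (n - k) * D0 ^ (k - j) by rewrite -Cpow_add_r; congr Cpow; lia.
    rewrite RtoC_mult; ring.
  reflexivity.
rewrite csum_swap (csum_ext _ (fun j => D0 ^ (n - j) * ghat tau j x * RtoC (delta n j))); last first.
  by move=> j _; rewrite csum_scal csum_RtoC rcoef_C_rcoef_c.
rewrite csum_seq_last csum_zero.
  rewrite Nat.eqb_refl Nat.sub_diag; change (D0 ^ 0) with (RtoC 1); ring.
move=> j /in_seq Hj; case: Nat.eqb_spec => H; [lia|ring].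
Qed.

End Inversion.

Theorem theorem6 (tau : C) (htau : (0 < Im tau)%R) :
  (forall n : nat, V tau (g tau n) /\ SK_ tau (n + 1) (g tau n)) /\
  (forall n : nat, (1 <= n)%nat ->
     mero_eq (conv_pow tau (Zfun tau) n)
       (fun x => sum_n (fun k => coef_c (DeltaZ tau) n k * g tau k x) n)) /\
  (forall n : nat,
     mero_eq (g tau n)
       (fun x => sum_n (fun k =>
          coef_C (DeltaZ tau) n k * conv_pow tau (Zfun tau) k x) n)) /\
  (forall n k : nat, (1 <= k <= n)%nat ->
     coef_C (DeltaZ tau) n k =
       RtoC ((-1) ^ (k - 1) / INR (fact (n - 1)))%R * DeltaZ tau ^ (n - k)
       * RtoC (sum_n (fun t => (-1) ^ t * INR (k - t) ^ (n - 1)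
                               * Binomial.C (k - 1) t) (k - 1))%R) /\
  (forall (n : nat) (x : C), (1 <= n)%nat ->
     poly_p n x = sum_n_m (fun k => coef_C 1 n k * x ^ k) 1 n) /\
  (forall x : C, exists r : posreal, forall y : C, (Cmod y < r)%R ->
     @is_pseries C_AbsRing C_NormedModule
       (fun n => poly_p (S n) x) y
       (x * Cexp y / (1 - x + x * Cexp y))).
Proof.
rewrite (DeltaZ_D0 tau htau).
split; last split; last split; last split; last split.
- move=> n; split; [exact: g_V|exact: g_SK].
- move=> n Hn; apply: (mero_eq_trans _ (conv_pow_value tau n)); first exact: conv_pow_conv_pow_value.
  apply: (mero_eq_off_lattice tau htau) => x Hx.
  rewrite -csum_seq; apply: csum_ext => k _; by rewrite (g_ghat tau htau).
- move=> n; apply: (mero_eq_trans _ (ghat tau n)); first exact: g_mero_ghat.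
  apply: mero_eq_sym; apply: (mero_eq_trans _ (fun x => csum (fun k => coef_C D0 n k * conv_pow_value tau k x) (seq 0 (S n)))).
    move=> a; have [r Hr] := mero_eq_csum (coef_C D0 n) _ _ (seq 0 (S n)) (conv_pow_conv_pow_value tau htau) a.
    exists r => z /Hr; by rewrite csum_seq.
  move=> a; exists (mkposreal 1 Rlt_0_1) => z _; exact: conv_pow_value_inverse.
- move=> [|n] [|k] Hnk; try lia.
  replace (S n - 1)%nat with n by lia; replace (S k - 1)%nat with k by lia.
  rewrite rsum_sum_n -/(expl n k) -stirling2_explicit /coef_C.
  replace (S n - 1)%nat with n by lia; replace (S k - 1)%nat with k by lia.
  have E : ((-1) ^ k * (INR (fact k) / INR (fact n) * s2 (S n) (S k)) =
    (-1) ^ k / INR (fact n) * (INR (fact k) * s2 (S n) (S k)))%R.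
    rewrite /Rdiv; ring.
  rewrite -Cmult_assoc (Cmult_comm (D0 ^ _)) Cmult_assoc -RtoC_mult E RtoC_mult; ring.
- move=> n x Hn; apply: sum_n_m_ext_loc => -[|k] Hk; first lia.
  rewrite /coef_C Cpow_1_l Cmult_1_r -RtoC_mult; congr (RtoC _ * _); ring.
- move=> x; have [r [M [Hr HW]]] := poly_gf x.
  exists (mkposreal r Hr) => y /= Hy; apply: (W_is_pseries _ _ _ _ _ HW); lra.
Qed.
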